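(* Let $(f,E,B)$ be a solution on $[0,T]$ of the relativistic Vlasov--Maxwell system in the half space $\Omega=\{x\in\mathbb R^3:x_3>0\}$ with the perfect conductor boundary condition and initial electromagnetic data $E_0,B_0$, as specified in the context. Then for every $i\in\{1,2,3\}$, $t\in(0,T]$ and $x\in\Omega$, $$ \begin{aligned} E_i(t,x)=\;&\frac{1}{4\pi t^2}\int_{\partial B(x;t)\cap\{y_3>0\}}\Big(t\,\partial_tE_{0i}(y)+E_{0i}(y)+\nabla E_{0i}(y)\cdot(y-x)\Big)\,dS_y\\ &+\frac{1}{4\pi t^2}\int_{\partial B(x;t)\cap\{y_3<0\}}\iota_i\Big(-t\,\partial_tE_{0i}(\bar y)-E_{0i}(\bar y)-\nabla E_{0i}(\bar y)\cdot(\bar y-\bar x)\Big)\,dS_y\\ &+\int_{B(x;t)\cap\{y_3>0\}}\int_{\mathbb R^3}\frac{(|\hat v|^2-1)(\hat v_i+\omega_i)}{|y-x|^2(1+\hat v\cdot\omega)^2}\,f(t-|y-x|,y,v)\,dv\,dy\\ &-\int_{B(x;t)\cap\{y_3<0\}}\int_{\mathbb R^3}\iota_i\frac{(|\hat v|^2-1)(\hat v_i+\bar\omega_i)}{|y-x|^2(1+\hat v\cdot\bar\omega)^2}\,f(t-|y-x|,\bar y,v)\,dv\,dy\\ &-\int_{B(x;t)\cap\{y_3>0\}}\int_{\mathbb R^3}a^E_i(v,\omega)\cdot\big[(E+\hat v\times B-g\mathbf e_3)f\big](t-|y-x|,y,v)\,dv\,\frac{dy}{|y-x|}\\ &+\int_{B(x;t)\cap\{y_3<0\}}\int_{\mathbb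 R^3}\iota_i\,a^E_i(v,\bar\omega)\cdot\big[(E+\hat v\times B-g\mathbf e_3)f\big](t-|y-x|,\bar y,v)\,dv\,\frac{dy}{|y-x|}\\ &+\int_{B(x;t)\cap\{y_3=0\}}\int_{\mathbb R^3}\Big(\delta_{i3}-\frac{(\omega_i+\hat v_i)\hat v_3}{1+\hat v\cdot\omega}\Big)f(t-|y-x|,y_\parallel,0,v)\,dv\,\frac{dy_\parallel}{|y-x|}\\ &-\int_{B(x;t)\cap\{y_3=0\}}\int_{\mathbb R^3}\iota_i\Big(\delta_{i3}-\frac{\bar\omega_i\hat v_3+\hat v_i\hat v_3}{1+\hat v\cdot\bar\omega}\Big)f(t-|y-x|,y_\parallel,0,v)\,dv\,\frac{dy_\parallel}{|y-x|}\\ &-\int_{\partial B(x;t)\cap\{y_3>0\}}\int_{\mathbb R^3}\sum_{j=1}^3\omega_j\Big(\delta_{ij}-\frac{(\omega_i+\hat v_i)\hat v_j}{1+\hat v\cdot\omega}\Big)f(0,y,v)\,dv\,\frac{dS_y}{|y-x|}\\ &+\int_{\partial B(x;t)\cap\{y_3<0\}}\int_{\mathbb R^3}\iota_i\sum_{j=1}^3\bar\omega_j\Big(\delta_{ij}-\frac{\bar\omega_i\hat v_j+\hat v_i\hat v_j}{1+\hat v\cdot\bar\omega}\Big)f(0,\bar y,v)\,dv\,\frac{dS_y}{|y-x|}\\ &-\delta_{i3}\int_{B(x;t)\cap\{y_3=0\}}\int_{\mathbb R^3}\frac{2f(t-|y-x|,y_\parallel,0,v)}{|y-x|}\,dv\,dy_\parallel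 . \end{aligned} $$
   Context: Setting. $\Omega=\{x=(x_1,x_2,x_3)\in\mathbb R^3:x_3>0\}$, $\partial\Omega=\{x_3=0\}$, $T>0$, $g\in\mathbb R$ is a constant, $\mathbf e_3=(0,0,1)$. There is a single species, with mass, charge and speed of light normalized to $1$. For $v\in\mathbb R^3$, $\hat v=v/\sqrt{1+|v|^2}$. The unknowns are $f=f(t,x,v)$ (particle density) on $[0,T]\times\overline\Omega\times\mathbb R^3$ and $E=(E_1,E_2,E_3)$, $B=(B_1,B_2,B_3)$ on $[0,T]\times\overline\Omega$. Put $$\rho(t,x)=\int_{\mathbb R^3}f(t,x,v)\,dv,\qquad J(t,x)=\int_{\mathbb R^3}\hat v\,f(t,x,v)\,dv .$$ ''$(f,E,B)$ is a solution'' means that in $\Omega$ $$\partial_tf+\hat v\cdot\nabla_xf+(E+\hat v\times B-g\mathbf e_3)\cdot\nabla_vf=0,$$ $$\nabla_x\cdot E=4\pi\rho,\quad \nabla_x\times E=-\partial_tB,\quad \nabla_x\cdot B=0,\quad \nabla_x\times B=4\pi J+\partial_tE,$$ together with the perfect conductor boundary condition on $\partial\Omega$: $$E_1=E_2=0,\quad B_3=0,\quad \partial_3E_3=4\pi\rho,\quad \partial_3B_1=4\pi J_2,\quad \partial_3B_2=-4\pi J_1 .$$ Initial data: $E|_{t=0}=E_0$, $B|_{t=0}=B_0$, and the notation $\partial_tE_0:=\nabla_x\times B_0-4\pi J|_{t=0}$, $\partial_tB_0:=-\nabla_x\times E_0$ (these are the values of $\partial_tE,\partial_tB$ at $t=0$);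 $E_{0i},\partial_tE_{0i}$ denote $i$-th components. Regularity: $E,B$ are $C^2$ on $[0,T]\times\overline\Omega$; $f$ is $C^1$ on $[0,T]\times\overline\Omega\times\mathbb R^3$ and, for every $N$ and every compact $K\subset\overline\Omega$, $\sup_{t\in[0,T],x\in K,v\in\mathbb R^3}(1+|v|)^N\big(|f|+|\partial_tf|+|\nabla_xf|+|\nabla_vf|\big)<\infty$. Notation. $B(x;t)=\{y\in\mathbb R^3:|x-y|<t\}$, $\partial B(x;t)=\{y\in\mathbb R^3:|x-y|=t\}$, $dS_y$ is surface measure; $x_\parallel=(x_1,x_2)$, $\bar x=(x_1,x_2,-x_3)$ for $x\in\mathbb R^3$; on $\{y_3=0\}$ points are written $y=(y_\parallel,0)$. $\omega=\omega(x,y)=\frac{y-x}{|y-x|}$ and $\bar\omega=(\omega_1,\omega_2,-\omega_3)$. $\iota_1=\iota_2=1$, $\iota_3=-1$. $\delta_{ij}$ is the Kronecker delta. For a unit vector $\omega$ (treated as independent of $v$), $$a^E_i(v,\omega):=\nabla_v\Big(\frac{\omega_i+\hat v_i}{1+\hat v\cdot\omega}\Big)=\frac{(\mathbf e_i-\hat v_i\hat v)(1+\hat v\cdot\omega)-(\omega_i+\hat v_i)(\omega-(\omega\cdot\hat v)\hat v)}{\sqrt{1+|v|^2}\,(1+\hat v\cdot\omega)^2}\in\mathbb R^3,$$ with $\mathbf e_i$ the $i$-th standard basis vector. The notation $[(E+\hat v\times B-g\mathbf e_3)f](s,z,v)$ means $(E(s,z)+\hat v\times B(s,z)-g\mathbf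 e_3)f(s,z,v)$. $\nabla E_{0i}(\bar y)$ is the gradient of $E_{0i}$ evaluated at $\bar y$. *)

(* Defs.v *)
From HB Require Import structures.
From mathcomp Require Export all_boot all_order all_algebra.
From mathcomp Require Export all_classical all_reals all_analysis.

Set Implicit Arguments.
Unset Strict Implicit.
Unset Printing Implicit Defensive.

Import Order.TTheory GRing.Theory Num.Theory.
Import numFieldNormedType.Exports.
Local Open Scope classical_set_scope.
Local Open Scope ring_scope.

(* Vectors of R^3 are row vectors 'rV[R]_3; the component u_i is [u 0 i].  The
   coordinates 1, 2, 3 are i1, i2, i3. *)
Definition i1 : 'I_3 := @Ordinal 3 0 isT.
Definition i2 : 'I_3 := @Ordinal 3 1 isT.
Definition i3 : 'I_3 := @Ordinal 3 2 isT.

Section VlasovMaxwell.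
Variable R : realType.
Notation vec := 'rV[R]_3.

Definition vec3 (a b c : R) : vec := \row_(k < 3) [:: a; b; c]`_k.

Definition basis (j : 'I_3) : vec := delta_mx 0 j.

Definition dot (u w : vec) : R := \sum_(k < 3) u 0 k * w 0 k.

(* Euclidean norm: the library's norm `|u| on 'rV[R]_3 is the sup norm. *)
Definition enorm (u : vec) : R := Num.sqrt (dot u u).

Definition cross (u w : vec) : vec :=
  vec3 (u 0 i2 * w 0 i3 - u 0 i3 * w 0 i2)
       (u 0 i3 * w 0 i1 - u 0 i1 * w 0 i3)
       (u 0 i1 * w 0 i2 - u 0 i2 * w 0 i1).

Definition delta (i j : 'I_3) : R := (i == j)%:R.

Definition iota_sign (i : 'I_3) : R := if i == i3 then -1 else 1.

Definition bar (x : vec) : vec := vec3 (x 0 i1) (x 0 i2) (- x 0 i3).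

Definition omega (x y : vec) : vec := (enorm (y - x))^-1 *: (y - x).

Definition vhat (v : vec) : vec := (Num.sqrt (1 + enorm v ^+ 2))^-1 *: v.

Definition Omega : set vec := [set x | 0 < x 0 i3].
Definition Omega_bar : set vec := [set x | 0 <= x 0 i3].
Definition bdOmega : set vec := [set x | x 0 i3 = 0].

Definition eball (x : vec) (t : R) : set vec := [set y | enorm (x - y) < t].
Definition upper : set vec := [set y | 0 < y 0 i3].
Definition lower : set vec := [set y | y 0 i3 < 0].

Definition leb2 :
    {measure set (measurableTypeR R * measurableTypeR R) -> \bar R} :=
  (@lebesgue_measure R \x @lebesgue_measure R)%E.
Definition leb3 :
    {measure set (measurableTypeR R * measurableTypeR R * measurableTypeR R) ->
      \bar R} :=
  (leb2 \x @lebesgue_measure R)%E.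

Definition int_space (D : set vec) (h : vec -> R) : R :=
  \int[leb3]_(p in [set p | D (vec3 p.1.1 p.1.2 p.2)])
    h (vec3 p.1.1 p.1.2 p.2).

(* Integral over the part of D in {y_3 = 0}, with respect to dy_1 dy_2. *)
Definition int_plane (D : set vec) (h : vec -> R) : R :=
  \int[leb2]_(p in [set p | D (vec3 p.1 p.2 0)]) h (vec3 p.1 p.2 0).

Definition sphere_param (x : vec) (t : R) (q : R * R) : vec :=
  x + t *: vec3 (sin q.1 * cos q.2) (sin q.1 * sin q.2) (cos q.1).

(* Surface integral over the part of the sphere {y : |x - y| = t} in D, in the
   spherical coordinates q = (theta, phi) of [0, pi] x [0, 2 pi], where
   dS = t^2 sin theta dtheta dphi. *)
Definition int_sphere (x : vec) (t : R) (D : set vec) (h : vec -> R) : R :=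
  \int[leb2]_(q in (`[0, pi] `*` `[0, 2 * pi]) `&`
                   [set q | D (sphere_param x t q)])
    (h (sphere_param x t q) * (t ^+ 2 * sin q.1)).

(* Directional derivative of F at a along e within the set D, i.e. the
   derivative of the library with increments h such that a + h e is in D.  At an
   interior point of D this is 'D_e F a; at a boundary point it is one-sided
   when e is transverse to the boundary. *)
Section Within.
Variables (V : normedModType R) (D : set V) (F : V -> R) (a e : V).

Definition derivable_within : Prop :=
  cvg ((fun h : R => h^-1 *: ((F \o shift a) (h *: e) - F a))
         @ within [set h | D (h *: e + a)] 0^').

Definition derive_within : R :=
  lim ((fun h : R => h^-1 *: ((F \o shift a) (h *: e) - F a))
         @ within [set h | D (h *: e + a)] 0^').
End Within.

Section Derivatives.
Variable T : R.

Definition dt (u : R -> R) (t : R) : R := derive_within `[0, T] u t 1.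
Definition dt_exists (u : R -> R) (t : R) : Prop :=
  derivable_within `[0, T] u t 1.
End Derivatives.

Definition dx (j : 'I_3) (u : vec -> R) (x : vec) : R :=
  derive_within Omega_bar u x (basis j).
Definition dx_exists (j : 'I_3) (u : vec -> R) (x : vec) : Prop :=
  derivable_within Omega_bar u x (basis j).

Definition gradx (u : vec -> R) (x : vec) : vec := \row_j dx j u x.

Definition divx (F : vec -> vec) (x : vec) : R :=
  \sum_(j < 3) dx j (fun z => F z 0 j) x.

Definition curlx (F : vec -> vec) (x : vec) : vec :=
  let d j k := dx j (fun z => F z 0 k) x in
  vec3 (d i2 i3 - d i3 i2) (d i3 i1 - d i1 i3) (d i1 i2 - d i2 i1).

Definition gradv (u : vec -> R) (v : vec) : vec := \row_j 'D_(basis j) u v.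

(* C^k up to the boundary on [0, T] x Omega_bar: the iterated partial
   derivatives, one-sided at boundary points, exist and are jointly continuous
   on the closed set. *)
Fixpoint Ck_field (T : R) (k : nat) (u : R -> vec -> R) : Prop :=
  {within `[0, T] `*` Omega_bar, continuous (fun p : R * vec => u p.1 p.2)} /\
  (if k is k'.+1 then
    [/\ forall t x, t \in `[0, T] -> Omega_bar x ->
          dt_exists T (u ^~ x) t /\ forall j, dx_exists j (u t) x,
        Ck_field T k' (fun t x => dt T (u ^~ x) t)
      & forall j, Ck_field T k' (fun t x => dx j (u t) x)]
   else True).

Definition continuous_density (T : R) (u : R -> vec -> vec -> R) : Prop :=
  {within `[0, T] `*` Omega_bar `*` setT,
    continuous (fun p : R * vec * vec => u p.1.1 p.1.2 p.2)}.

Section Density.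
Variables (T : R) (f : R -> vec -> vec -> R).

Definition dtf t x v := dt T (fun s => f s x v) t.
Definition gradxf t x v : vec := gradx (fun z => f t z v) x.
Definition gradvf t x v : vec := gradv (f t x) v.

Definition C1_density : Prop :=
  [/\ continuous_density T f,
      forall t x v, t \in `[0, T] -> Omega_bar x ->
        [/\ dt_exists T (fun s => f s x v) t,
            forall j, dx_exists j (fun z => f t z v) x
          & forall j, derivable (f t x) v (basis j)],
      continuous_density T dtf,
      forall j, continuous_density T (fun t x v => gradxf t x v 0 j)
    & forall j, continuous_density T (fun t x v => gradvf t x v 0 j)].

Definition decay_density : Prop :=
  forall (N : nat) (K : set vec), compact K -> K `<=` Omega_bar ->
    exists C : R, forall t x v, t \in `[0, T] -> K x ->
      (1 + enorm v) ^+ N *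
        (`|f t x v| + `|dtf t x v| + enorm (gradxf t x v)
         + enorm (gradvf t x v)) <= C.
End Density.

Definition rho (f : R -> vec -> vec -> R) (t : R) (x : vec) : R :=
  int_space setT (fun v => f t x v).

Definition current (f : R -> vec -> vec -> R) (t : R) (x : vec) : vec :=
  \row_k int_space setT (fun v => vhat v 0 k * f t x v).

Definition force (g : R) (E B : R -> vec -> vec) (t : R) (x v : vec) : vec :=
  E t x + cross (vhat v) (B t x) - g *: basis i3.

Definition dt_field (T : R) (F : R -> vec -> vec) (t : R) (x : vec) : vec :=
  \row_k dt T (fun s => F s x 0 k) t.

Record RVM_solution (T g : R) (f : R -> vec -> vec -> R)
    (E B : R -> vec -> vec) (E0 B0 : vec -> vec) : Prop := {
  RVM_E_C2 : forall k, Ck_field T 2 (fun t x => E t x 0 k);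
  RVM_B_C2 : forall k, Ck_field T 2 (fun t x => B t x 0 k);
  RVM_f_C1 : C1_density T f;
  RVM_f_decay : decay_density T f;
  RVM_vlasov : forall t x v, t \in `[0, T] -> Omega x ->
    dtf T f t x v + dot (vhat v) (gradxf f t x v)
      + dot (force g E B t x v) (gradvf f t x v) = 0;
  RVM_gauss : forall t x, t \in `[0, T] -> Omega x ->
    divx (E t) x = 4 * pi * rho f t x;
  RVM_faraday : forall t x, t \in `[0, T] -> Omega x ->
    curlx (E t) x = - dt_field T B t x;
  RVM_gaussB : forall t x, t \in `[0, T] -> Omega x ->
    divx (B t) x = 0;
  RVM_ampere : forall t x, t \in `[0, T] -> Omega x ->
    curlx (B t) x = (4 * pi) *: current f t x + dt_field T E t x;
  RVM_bd_values : forall t x, t \in `[0, T] -> bdOmega x ->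
    [/\ E t x 0 i1 = 0, E t x 0 i2 = 0 & B t x 0 i3 = 0];
  RVM_bd_derivatives : forall t x, t \in `[0, T] -> bdOmega x ->
    [/\ dx i3 (fun z => E t z 0 i3) x = 4 * pi * rho f t x,
        dx i3 (fun z => B t z 0 i1) x = 4 * pi * current f t x 0 i2
      & dx i3 (fun z => B t z 0 i2) x = - (4 * pi * current f t x 0 i1)];
  RVM_initE : forall x, Omega_bar x -> E 0 x = E0 x;
  RVM_initB : forall x, Omega_bar x -> B 0 x = B0 x
}.

Definition dtE0 (f : R -> vec -> vec -> R) (B0 : vec -> vec) (y : vec) : vec :=
  curlx B0 y - (4 * pi) *: current f 0 y.

Definition aE (i : 'I_3) (v w : vec) : vec :=
  gradv (fun u => (w 0 i + vhat u 0 i) / (1 + dot (vhat u) w)) v.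

End VlasovMaxwell.

(* Main.v *)
From HB Require Import structures.
Require Import Defs.
From mathcomp Require Import all_boot all_order all_algebra.
From mathcomp Require Import all_classical all_reals all_analysis.
From mathcomp Require Import measurable_realfun ring lra.

Set Implicit Arguments.
Unset Strict Implicit.
Unset Printing Implicit Defensive.

Import Order.TTheory GRing.Theory Num.Theory.
Import numFieldNormedType.Exports.
Local Open Scope classical_set_scope.
Local Open Scope ring_scope.
Local Notation basis := Defs.basis.

(* Every component E_i solves an inhomogeneous wave equation with source
   4 pi (d_i rho + d_t J_i).  Fix a centre c off the boundary and look at E_i on
   the backward light cone s = t - |y - c|, as a function of y.  The divergence
   theorem on the half ball {|y - c| < t, y_3 > 0} is applied to the retarded
   vector field [flux], whose divergence, by the wave equation, contains only the
   sources.  In [flux] the term with kernel [kap] has been added on purpose: along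
   the cone, d_i and d_t of the density f split into derivatives tangential to the
   cone and the transport derivative d_t + vhat . grad_x (Glassey-Strauss), and the
   tangential part is exactly the divergence of that term.  The transport
   derivative is turned into an acceleration term by the Vlasov equation and an
   integration by parts in v.

   For c = x the singularity at the centre produces E_i(t, x); for c = bar x the
   centre lies outside the half space and produces nothing.  Subtracting iota_i
   times the second identity from the first, the traces of E_i, d_t E_i and d_3 E_i
   on the plane cancel by the conductor conditions, except that for i = 3 twice
   d_3 E_3 = 4 pi rho survives, which is the last term of the formula. *)

(** All the geometry is carried by one-dimensional tools. Spherical coordinates come from
    substitutions on the line and Tonelli, and the boundary of the half ball is never treated as a
    surface: a cutoff in |y - c|^2 turns the flux into a compactly supported field on the half
    space, where Fubini and the fundamental theorem of calculus suffice, and the sphere terms come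
    back as limits of thin shells.

    The fields are not reflected across the plane, since an odd or even extension of E_i would in
    general lose regularity there; the identity about bar x is applied on the same half space, where
    the solution is given.

    The first three terms of [flux] are Kirchhoff's field for the scalar wave equation; taking its
    divergence uses two derivatives of E. The density has only one derivative, so its kernel term is
    differentiated once, under the velocity integral. Every such integral is dominated by a multiple
    of (1 + |v|^2)^-3, while the kernels grow at most like (1 + |v|^2)^2; this is why the exponent 5
    = 2 + 3 recurs in the decay estimates. *)

Lemma near_natSinv_le (R : realType) (e : R) : 0 < e ->
  \forall n \near \oo, n.+1%:R^-1 <= e.
Proof.
by move=> e0; apply: filterS (near_infty_natSinv_lt (PosNum e0)) => n /ltW.
Qed.

(** * Coordinates and measurability *)

Section Caratheodory.
Context {R : realType} d (T : measurableType d).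

Lemma cvg_floor_grid (x : R) :
  (fun n : nat => (Num.floor (n.+1%:R * x))%:~R / n.+1%:R : R) @ \oo --> x.
Proof.
apply/cvgrPdist_le => e e0; near=> n.
have n0 : (0 : R) < n.+1%:R by rewrite ltr0n.
have /andP[h1 h2] := floor_itv (n.+1%:R * x).
rewrite ger0_norm; last by rewrite subr_ge0 ler_pdivrMr// [leRHS]mulrC.
have h3 : n.+1%:R^-1 <= e.
  by near: n; exact: near_natSinv_le.
rewrite lerBlDr -lerBlDl; apply: le_trans (_ : x - n.+1%:R^-1 <= _).
  by rewrite lerB.
rewrite ler_pdivlMr// mulrBl mulVf ?gt_eqF// lerBlDr mulrC.
by move: h2; rewrite intrD => /ltW.
Unshelve. all: end_near. Qed.

(* Approximates the first variable by the grid of mesh 1/(n+1). *)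
Lemma measurable_fun_caratheodory (h : R -> T -> R) :
  (forall t, continuous (h ^~ t)) -> (forall x, measurable_fun setT (h x)) ->
  measurable_fun setT (fun p : measurableTypeR R * T => h p.1 p.2).
Proof.
move=> ch mh.
pose fl n (x : R) := Num.floor (n.+1%:R * x).
pose hn n (p : measurableTypeR R * T) := h ((fl n p.1)%:~R / n.+1%:R) p.2.
apply: (@measurable_realfun.measurable_fun_cvg _ _ _ _ hn) => [n|p _]; last first.
  apply: (cvg_comp _ (h^~ p.2)); first exact: cvg_floor_grid.
  exact: ch.
move=> _ A mA; rewrite setTI.
(* On each cell of the grid the first argument is frozen at k/(n+1), so the preimage is a countable
   union of products of a cell with a preimage under one measurable slice. *)
rewrite (_ : hn n @^-1` A = \bigcup_(k in [set: int])
   ((fl n @^-1` [set k] : set (measurableTypeR R)) `*` (h (k%:~R / n.+1%:R) @^-1` A))).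
  apply: countable_bigcupT_measurable => [|k]; first exact: countableP.
  apply: measurableX; last by rewrite -[X in measurable X]setTI; exact: mh.
  rewrite (_ : _ @^-1` _ = `[k%:~R / n.+1%:R, (k + 1)%:~R / n.+1%:R[%classic) //.
  apply/seteqP; split=> x /=; rewrite in_itv/= ler_pdivrMr// ltr_pdivlMr// mulrC.
    by move=> <-; exact: floor_itv.
  by move=> /floor_def.
apply/seteqP; split=> [p Ap|p [k _ [/= <- //]]].
by exists (fl n p.1).
Qed.
End Caratheodory.

Section Coordinates.
Context {R : realType}.
Notation vec := 'rV[R]_3.
Notation mR := (measurableTypeR R).

Lemma ord3E (P : 'I_3 -> Prop) : P i1 -> P i2 -> P i3 -> forall k, P k.
Proof.
move=> h1 h2 h3 [[|[|[|//]]] lt].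
- by rewrite (_ : Ordinal lt = i1)//; exact/val_inj.
- by rewrite (_ : Ordinal lt = i2)//; exact/val_inj.
- by rewrite (_ : Ordinal lt = i3)//; exact/val_inj.
Qed.

Lemma big3E (V : nmodType) (F : 'I_3 -> V) :
  \sum_(k < 3) F k = F i1 + F i2 + F i3.
Proof.
rewrite !big_ord_recl big_ord0 addr0 addrA.
by congr (_ + _ + _); congr F; exact/val_inj.
Qed.

Lemma vec3_1 (a b c : R) : vec3 a b c 0 i1 = a. Proof. by rewrite mxE. Qed.
Lemma vec3_2 (a b c : R) : vec3 a b c 0 i2 = b. Proof. by rewrite mxE. Qed.
Lemma vec3_3 (a b c : R) : vec3 a b c 0 i3 = c. Proof. by rewrite mxE. Qed.
Definition vec3E := (vec3_1, vec3_2, vec3_3).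

Lemma vec_eqP (u w : vec) :
  u 0 i1 = w 0 i1 -> u 0 i2 = w 0 i2 -> u 0 i3 = w 0 i3 -> u = w.
Proof. by move=> h1 h2 h3; apply/rowP; exact: ord3E. Qed.

Lemma vec3_eta (u : vec) : vec3 (u 0 i1) (u 0 i2) (u 0 i3) = u.
Proof. by apply: vec_eqP; rewrite vec3E. Qed.

Lemma basisE (j k : 'I_3) : basis R j 0 k = (k == j)%:R.
Proof. by rewrite /basis mxE eqxx. Qed.

Lemma dotE (u w : vec) :
  dot u w = u 0 i1 * w 0 i1 + u 0 i2 * w 0 i2 + u 0 i3 * w 0 i3.
Proof. by rewrite /dot big3E. Qed.

Lemma enorm_ge0 (u : vec) : 0 <= enorm u. Proof. exact: sqrtr_ge0. Qed.

Lemma enorm_sqr (u : vec) : enorm u ^+ 2 = u 0 i1 ^+ 2 + u 0 i2 ^+ 2 + u 0 i3 ^+ 2.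
Proof.
rewrite /enorm sqr_sqrtr dotE; last by rewrite -!expr2 !addr_ge0 ?sqr_ge0.
by rewrite -!expr2.
Qed.

Lemma enorm_eq0 (u : vec) : (enorm u == 0) = (u == 0).
Proof.
apply/eqP/eqP => [u0|->]; last first.
  by rewrite /enorm dotE !mxE !mul0r !addr0 sqrtr0.
have := enorm_sqr u; rewrite u0 expr0n/= => /esym/eqP.
rewrite !paddr_eq0 ?addr_ge0 ?sqr_ge0// !sqrf_eq0 => /andP[/andP[/eqP ? /eqP ?] /eqP ?].
by apply: vec_eqP; rewrite mxE.
Qed.

Lemma enorm_gt0 (u : vec) : (0 < enorm u) = (u != 0).
Proof. by rewrite lt_neqAle enorm_ge0 andbT eq_sym enorm_eq0. Qed.

Lemma le_coord_enorm (u : vec) k : `|u 0 k| <= enorm u.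
Proof.
rewrite -(@ler_pXn2r _ 2) ?nnegrE ?enorm_ge0// enorm_sqr real_normK ?num_real//.
have := sqr_ge0 (u 0 i1); have := sqr_ge0 (u 0 i2); have := sqr_ge0 (u 0 i3).
by move: k; apply: ord3E; lra.
Qed.

(** Lagrange's identity: the difference of the two squares is the sum of the squared 2 x 2
    minors. *)
Lemma CauchySchwarz3 (u w : vec) : `|dot u w| <= enorm u * enorm w.
Proof.
rewrite -(@ler_pXn2r _ 2) ?nnegrE ?mulr_ge0 ?enorm_ge0//.
rewrite exprMn !enorm_sqr real_normK ?num_real// dotE -subr_ge0.
set a := u 0 i1; set b := u 0 i2; set c := u 0 i3.
set a' := w 0 i1; set b' := w 0 i2; set c' := w 0 i3.
rewrite (_ : _ - _ = (a * b' - b * a') ^+ 2 + (a * c' - c * a') ^+ 2 + (b * c' - c * b') ^+ 2); last by ring.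
by rewrite !addr_ge0 ?sqr_ge0.
Qed.

Section TopSpace.
Context {X : topologicalType}.

Lemma continuous_vec (x : X) (g : X -> vec) :
  (forall k, {for x, continuous (fun y => g y 0 k)}) -> {for x, continuous g}.
Proof.
move=> cg; apply/cvg_ballP => e e0.
have : \forall y \near x, forall k : 'I_3, ball (g x 0 k) e (g y 0 k).
  by apply: filter_forall => k; have /cvg_ballP := cg k; exact.
by apply: filterS => y gy; split=> // i j; rewrite ord1; exact: gy.
Qed.

Lemma continuous_vec3 (x : X) (a b c : X -> R) :
  {for x, continuous a} -> {for x, continuous b} -> {for x, continuous c} ->
  {for x, continuous (fun y => vec3 (a y) (b y) (c y))}.
Proof.
by move=> ha hb hc; apply: continuous_vec; apply: ord3E;
  under [X in {for _, continuous X}]eq_fun do rewrite vec3E.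
Qed.
End TopSpace.

Lemma continuous_coord (k : 'I_3) : continuous (fun u : vec => u 0 k).
Proof. by move=> u; exact: coord_continuous. Qed.

Lemma continuous_enorm : continuous (@enorm R).
Proof.
move=> u; apply: (@continuous_comp _ _ _ (fun u : vec => dot u u) (@Num.sqrt R)); last exact: sqrt_continuous.
rewrite (_ : (fun u => dot u u) = (fun u : vec => u 0 i1 * u 0 i1 + u 0 i2 * u 0 i2 + u 0 i3 * u 0 i3)); last first.
  by apply/funext => w; rewrite dotE.
by apply: continuousD; [apply: continuousD|]; apply: continuousM; exact: continuous_coord.
Qed.

Lemma continuous_line1 (b c : R) : continuous (fun a => vec3 a b c).
Proof. by move=> a; apply: continuous_vec3 => //; exact: cst_continuous. Qed.
Lemma continuous_line2 (a c : R) : continuous (fun b => vec3 a b c).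
Proof. by move=> b; apply: continuous_vec3 => //; exact: cst_continuous. Qed.
Lemma continuous_line3 (a b : R) : continuous (fun c => vec3 a b c).
Proof. by move=> c; apply: continuous_vec3 => //; exact: cst_continuous. Qed.

(** Carathéodory's criterion, applied one coordinate at a time, only asks for continuity along the
    axes; no comparison of the product sigma-algebra with the Borel sets of row vectors is made. *)
Lemma measurable_vec3_plane (c : R) (h : vec -> R) :
  (forall b c, continuous (fun a => h (vec3 a b c))) ->
  (forall a c, continuous (fun b => h (vec3 a b c))) ->
  measurable_fun setT (fun p : mR * mR => h (vec3 p.1 p.2 c)).
Proof.
move=> h1 h2.
apply: (@measurable_fun_caratheodory _ _ mR (fun a b => h (vec3 a b c))) => //.
by move=> a; apply: continuous_measurable_fun; exact: h2.
Qed.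

Lemma measurable_vec3 (h : vec -> R) :
  (forall b c, continuous (fun a => h (vec3 a b c))) ->
  (forall a c, continuous (fun b => h (vec3 a b c))) ->
  (forall a b, continuous (fun c => h (vec3 a b c))) ->
  measurable_fun setT (fun p : mR * mR * mR => h (vec3 p.1.1 p.1.2 p.2)).
Proof.
move=> h1 h2 h3.
(* [measurable_fun_caratheodory] wants the continuous variable as first factor, so the third
   coordinate is moved to the front. *)
pose sw (p : mR * mR * mR) : mR * (mR * mR) := (p.2, p.1).
apply: (@measurableT_comp _ _ _ _ _ _ (fun p : mR * (mR * mR) => h (vec3 p.2.1 p.2.2 p.1)) _ sw); last first.
  by apply: measurable_fun_pair.
apply: (@measurable_fun_caratheodory _ _ (mR * mR)%type
   (fun c p => h (vec3 p.1 p.2 c))) => [p|c]; first exact: h3.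
exact: measurable_vec3_plane.
Qed.

Lemma measurable_vec3_cont (h : vec -> R) : continuous h ->
  measurable_fun setT (fun p : mR * mR * mR => h (vec3 p.1.1 p.1.2 p.2)).
Proof.
move=> ch; apply: measurable_vec3 => a b z; apply: continuous_comp; try exact: ch.
- exact: continuous_line1.
- exact: continuous_line2.
- exact: continuous_line3.
Qed.

Lemma measurable_vec3_comp (h : vec -> R) (d : measure_display)
    (T : measurableType d) (a b c : T -> R) : continuous h ->
  measurable_fun setT a -> measurable_fun setT b -> measurable_fun setT c ->
  measurable_fun setT (fun p => h (vec3 (a p) (b p) (c p))).
Proof.
move=> /measurable_vec3_cont mh ma mb mc.
apply: (measurableT_comp mh (g := fun p : T => ((a p, b p), c p) : mR * mR * mR)).
by apply: measurable_fun_pair => //; exact: measurable_fun_pair.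
Qed.

Lemma measurable_vec3_plane_cont (c : R) (h : vec -> R) : continuous h ->
  measurable_fun setT (fun p : mR * mR => h (vec3 p.1 p.2 c)).
Proof.
move=> ch; apply: measurable_vec3_plane => a b z; apply: continuous_comp; try exact: ch.
- exact: continuous_line1.
- exact: continuous_line2.
Qed.

End Coordinates.

(** * Tonelli and Fubini on R^2 and R^3 *)

Section SigmaFinite.
Context {R : realType}.
Notation mR := (measurableTypeR R).

Definition sleb1 : {sigma_finite_measure set mR -> \bar R} := @lebesgue_measure R.

(** Attached below as an instance, this lets [leb2] serve as a factor in Tonelli's and Fubini's
    theorems for [leb3]. The squares of an increasing exhaustion of the line exhaust the plane. *)
Lemma leb2_sigma_finite : sigma_finite setT (@leb2 R).
Proof.
have /sigma_finiteP[F [TF ndF Foo]] :=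
  sigma_finiteT (@lebesgue_measure R : {sigma_finite_measure set mR -> \bar R}).
exists (fun n => F n `*` F n).
  rewrite -setXTT TF predeqE => -[x y]; split.
    move=> [/= [n _ Fnx] [k _ Gky]]; exists (maxn n k) => //; split.
    - by move: x Fnx; exact/subsetPset/ndF/leq_maxl.
    - by move: y Gky; exact/subsetPset/ndF/leq_maxr.
  by move=> [n _ []/= ? ?]; split; exists n.
move=> k; have [? ?] := Foo k.
split; first exact: measurableX.
have -> : (leb2 R (F k `*` F k) = lebesgue_measure (F k) * lebesgue_measure (F k))%E.
  exact: (@product_measure1E _ _ _ _ _ sleb1 sleb1).
by rewrite lte_mul_pinfty// ge0_fin_numE.
Qed.

Let leb2_fun : set (mR * mR)%type -> \bar R := (sleb1 \x sleb1)%E.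

HB.instance Definition _ := Measure.on leb2_fun.
HB.instance Definition _ := Measure_isSigmaFinite.Build _ _ _ leb2_fun
  leb2_sigma_finite.

Definition sleb2 : {sigma_finite_measure set (mR * mR)%type -> \bar R} := leb2_fun.

Local Open Scope ereal_scope.
Notation mu := (@lebesgue_measure R).

Section Tonelli.
Variable f : (mR * mR * mR)%type -> \bar R.
Hypotheses (mf : measurable_fun setT f) (f0 : forall p, 0 <= f p).

Lemma tonelli_leb3 : \int[@leb3 R]_p f p = \int[mu]_c \int[@leb2 R]_q f (q, c).
Proof. exact: (@fubini_tonelli2 _ _ _ _ R sleb2 sleb1 f mf f0). Qed.

Lemma tonelli_leb3_line : \int[@leb3 R]_p f p = \int[@leb2 R]_q \int[mu]_c f (q, c).
Proof. exact: (@fubini_tonelli1 _ _ _ _ R sleb2 sleb1 f mf f0). Qed.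

Lemma measurable_tonelli_leb3 :
  measurable_fun (setT : set mR) (fun c => \int[@leb2 R]_q f (q, c)).
Proof. exact: (@measurable_fun_fubini_tonelli_G _ _ _ _ R sleb2 f mf f0). Qed.

End Tonelli.

Section Tonelli2.
Variable f : (mR * mR)%type -> \bar R.
Hypotheses (mf : measurable_fun setT f) (f0 : forall p, 0 <= f p).

Lemma tonelli_leb2 : \int[@leb2 R]_p f p = \int[mu]_b \int[mu]_a f (a, b).
Proof. exact: (@fubini_tonelli2 _ _ _ _ R sleb1 sleb1 f mf f0). Qed.

Lemma measurable_tonelli_leb2 :
  measurable_fun (setT : set mR) (fun b => \int[mu]_a f (a, b)).
Proof. exact: (@measurable_fun_fubini_tonelli_G _ _ _ _ R sleb1 f mf f0). Qed.

End Tonelli2.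

Section Fubini.
Variable f : (mR * mR * mR)%type -> \bar R.
Hypothesis intf : (@leb3 R).-integrable setT f.

Lemma fubini_leb3 : \int[@leb3 R]_p f p = \int[mu]_c \int[@leb2 R]_q f (q, c).
Proof. exact/esym/(@integral21_prod_meas1 _ _ _ _ R sleb2 sleb1 f intf). Qed.

Lemma fubini_leb3_line : \int[@leb3 R]_p f p = \int[@leb2 R]_q \int[mu]_c f (q, c).
Proof. exact/esym/(@integral12_prod_meas1 _ _ _ _ R sleb2 sleb1 f intf). Qed.

End Fubini.

Section Fubini2.
Variable f : (mR * mR)%type -> \bar R.
Hypothesis intf : (@leb2 R).-integrable setT f.

Lemma fubini_leb2 : \int[@leb2 R]_p f p = \int[mu]_b \int[mu]_a f (a, b).
Proof. exact/esym/(@integral21_prod_meas1 _ _ _ _ R sleb1 sleb1 f intf). Qed.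

Lemma fubini_leb2' : \int[@leb2 R]_p f p = \int[mu]_a \int[mu]_b f (a, b).
Proof. exact/esym/(@integral12_prod_meas1 _ _ _ _ R sleb1 sleb1 f intf). Qed.

End Fubini2.

Lemma leb2_setX (A B : set mR) : measurable A -> measurable B ->
  @leb2 R (A `*` B) = mu A * mu B.
Proof. exact: (@product_measure1E _ _ _ _ _ sleb1 sleb1). Qed.

Lemma leb3_setX (A : set (mR * mR)%type) (B : set mR) : measurable A -> measurable B ->
  @leb3 R (A `*` B) = @leb2 R A * mu B.
Proof. exact: (@product_measure1E _ _ _ _ _ sleb2 sleb1). Qed.

End SigmaFinite.

(** * Calculus on the line *)

Section LineCalculus.
Context {R : realType}.
Implicit Types (f g : R -> R) (x a b : R).

Lemma is_derive1P f x d :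
  (fun h => h^-1 * (f (h + x) - f x)) @ 0^' --> d -> is_derive x 1 f d.
Proof.
move=> fd.
have fd' : (fun h : R => h^-1 *: ((f \o shift x) (h *: (1 : R)) - f x)) @ 0^' --> d.
  by under eq_fun do rewrite /= /GRing.scale/= mulr1.
apply: DeriveDef; first by apply/cvg_ex; exists d.
exact/cvg_lim.
Qed.

Lemma is_derive1_cvg f x d : is_derive x 1 f d ->
  (fun h => h^-1 * (f (h + x) - f x)) @ 0^' --> d.
Proof.
move=> [df <-]; rewrite /derive; move: df; rewrite /derivable.
by under eq_fun do rewrite /= /GRing.scale/= mulr1.
Qed.

Lemma is_derive_eqv f x a b : is_derive x 1 f a -> a = b -> is_derive x 1 f b.
Proof. by move=> fa <-. Qed.

Lemma near_is_derive1 f g x a : is_derive x 1 f a -> (\near x, f x = g x) ->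
  is_derive x 1 g a.
Proof. by move=> fa e; exact: near_eq_is_derive e fa. Qed.

Lemma line_derive_cst x a : is_derive x 1 (fun=> a) 0.
Proof. exact: is_derive_cst. Qed.

Lemma line_derive_id x : is_derive x 1 (fun x => x) 1.
Proof. exact: is_derive_id. Qed.

Lemma line_deriveD f g x a b : is_derive x 1 f a -> is_derive x 1 g b ->
  is_derive x 1 (fun y => f y + g y) (a + b).
Proof. by move=> fa gb; exact: is_deriveD. Qed.

Lemma line_deriveN f x a : is_derive x 1 f a -> is_derive x 1 (fun y => - f y) (- a).
Proof. by move=> fa; exact: is_deriveN. Qed.

Lemma line_deriveB f g x a b : is_derive x 1 f a -> is_derive x 1 g b ->
  is_derive x 1 (fun y => f y - g y) (a - b).
Proof. by move=> fa gb; exact: is_deriveB. Qed.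

Lemma line_deriveM f g x a b : is_derive x 1 f a -> is_derive x 1 g b ->
  is_derive x 1 (fun y => f y * g y) (a * g x + f x * b).
Proof.
move=> fa gb; have := is_deriveM fa gb.
by rewrite /GRing.scale/= addrC [g x * a]mulrC.
Qed.

Lemma line_deriveMl f x a (k : R) : is_derive x 1 f a -> is_derive x 1 (fun y => k * f y) (k * a).
Proof. by move=> fa; exact: is_deriveZ. Qed.

Lemma line_derive_sqr f x a : is_derive x 1 f a -> is_derive x 1 (fun y => f y ^+ 2) (2 * f x * a).
Proof. by move=> fa; apply: (is_derive_eqv (line_deriveM fa fa)); ring. Qed.

Lemma line_deriveV f x a : f x != 0 -> is_derive x 1 f a ->
  is_derive x 1 (fun y => (f y)^-1) (- a / f x ^+ 2).
Proof.
move=> fx0 fa; apply: (is_derive_eqv (is_deriveV fx0 fa)).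
by rewrite /GRing.scale/= mulNr mulNr mulrC.
Qed.

Lemma line_derive_comp f g x a b : is_derive (g x) 1 f a -> is_derive x 1 g b ->
  is_derive x 1 (fun y => f (g y)) (a * b).
Proof. by move=> fa gb; exact: is_derive1_comp. Qed.

Lemma line_derive_sqrt f x a : 0 < f x -> is_derive x 1 f a ->
  is_derive x 1 (fun y => Num.sqrt (f y)) (a / (2 * Num.sqrt (f x))).
Proof.
move=> fx0 fa; rewrite mulrC; apply: (line_derive_comp (f := Num.sqrt)) => //.
exact: is_derive1_sqrt.
Qed.

Lemma is_derive_continuous f x a : is_derive x 1 f a -> {for x, continuous f}.
Proof. by move=> [fd _]; exact/differentiable_continuous/derivable1_diffP. Qed.

(** The minimum and maximum allow the endpoints in either order, degenerate case included; below,
    the second endpoint is a perturbation that may fall on either side of the first. *)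
Lemma MVT_is_derive f df a b : (forall x, Num.min a b <= x <= Num.max a b -> is_derive x 1 f (df x)) ->
  exists2 c, Num.min a b <= c <= Num.max a b & f b - f a = df c * (b - a).
Proof.
have h a' b' : a' < b' -> (forall x, a' <= x <= b' -> is_derive x 1 f (df x)) ->
    exists2 c, a' <= c <= b' & f b' - f a' = df c * (b' - a').
  move=> ab fd.
  have [] := @MVT R f df a' b' ab.
  - by move=> x; rewrite in_itv/= => /andP[? ?]; apply: fd; rewrite !ltW.
  - apply: derivable_within_continuous => x; rewrite in_itv/= => hx.
    by have [] := fd x hx.
  - move=> c; rewrite in_itv/= => /andP[? ?] e; exists c => //.
    by rewrite !ltW.
have [ab|ab|->] := ltgtP a b.
- by move=> /(h _ _ ab).
- by move=> /(h _ _ ab)[c hc e]; exists c => //; rewrite -opprB e -mulrN opprB.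
- by exists b; rewrite ?lexx// !subrr mulr0.
Qed.

End LineCalculus.

(** * Tonelli's theorem on product domains, by extension by zero *)

Section TonelliDomains.
Local Open Scope ereal_scope.
Context {d1 d2} {T1 : measurableType d1} {T2 : measurableType d2} {R : realType}.
Context (m1 : {sigma_finite_measure set T1 -> \bar R})
        (m2 : {sigma_finite_measure set T2 -> \bar R}).
Variables (D1 : set T1) (D2 : set T2) (h : T1 * T2 -> \bar R).
Hypotheses (mD1 : measurable D1) (mD2 : measurable D2).
Hypothesis mh : measurable_fun (D1 `*` D2) h.
Hypothesis h0 : forall p, (D1 `*` D2) p -> 0 <= h p.

Let mD : measurable (D1 `*` D2). Proof. exact: measurableX. Qed.

Let H := h \_ (D1 `*` D2).

Let mH : measurable_fun setT H.
Proof. by apply/(measurable_restrictT _ mD). Qed.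

Let H0 p : 0 <= H p.
Proof. by rewrite /H patchE; case: ifPn => // /[!inE] /h0. Qed.

Let H1E x : \int[m2]_y H (x, y) = ((fun x => \int[m2]_(y in D2) h (x, y)) \_ D1) x.
Proof.
rewrite patchE; case: ifPn => xD1.
  rewrite [RHS]integral_mkcond; apply: eq_integral => y _.
  by rewrite /H !patchE in_setX xD1.
by apply: integral0_eq => y _; rewrite /H patchE in_setX (negbTE xD1).
Qed.

Let H2E y : \int[m1]_x H (x, y) = ((fun y => \int[m1]_(x in D1) h (x, y)) \_ D2) y.
Proof.
rewrite patchE; case: ifPn => yD2.
  rewrite [RHS]integral_mkcond; apply: eq_integral => x _.
  by rewrite /H !patchE in_setX yD2 andbT.
by apply: integral0_eq => x _; rewrite /H patchE in_setX (negbTE yD2) andbF.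
Qed.

Lemma tonelli_dom1 :
  \int[m1 \x m2]_(p in D1 `*` D2) h p = \int[m1]_(x in D1) \int[m2]_(y in D2) h (x, y).
Proof.
rewrite integral_mkcond fubini_tonelli1// [RHS]integral_mkcond.
by apply: eq_integral => x _; exact: H1E.
Qed.

Lemma tonelli_dom :
  \int[m1]_(x in D1) \int[m2]_(y in D2) h (x, y) =
  \int[m2]_(y in D2) \int[m1]_(x in D1) h (x, y).
Proof.
rewrite integral_mkcond [RHS]integral_mkcond.
transitivity (\int[m1]_x \int[m2]_y H (x, y)).
  by apply: eq_integral => x _; rewrite H1E.
by rewrite (fubini_tonelli H mH H0); apply: eq_integral => y _; rewrite H2E.
Qed.

Lemma measurable_tonelli_dom1 :
  measurable_fun D1 (fun x => \int[m2]_(y in D2) h (x, y)).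
Proof.
apply/(measurable_restrictT _ mD1).
rewrite (_ : _ \_ _ = fun x => \int[m2]_y H (x, y)); last by apply/funext.
exact: measurable_fun_fubini_tonelli_F.
Qed.

Lemma measurable_tonelli_dom2 :
  measurable_fun D2 (fun y => \int[m1]_(x in D1) h (x, y)).
Proof.
apply/(measurable_restrictT _ mD2).
rewrite (_ : _ \_ _ = fun y => \int[m1]_x H (x, y)); last by apply/funext.
exact: measurable_fun_fubini_tonelli_G.
Qed.

End TonelliDomains.

(** * Translations, reflections and dilations on the line *)

Section LineSubstitution.
Local Open Scope ereal_scope.
Context {R : realType}.
Notation mu := (@lebesgue_measure R).
Notation mR := (measurableTypeR R).

Lemma measurable_EFin_cont (h : R -> R) (D : set R) : continuous h ->
  measurable_fun (D : set mR) (fun x => (h x)%:E).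
Proof.
move=> ch; apply/measurable_EFinP.
by apply: measurable_funS (continuous_measurable_fun ch).
Qed.

Definition translate (c : R) (x : mR) : mR := (x + c)%R.

Let measurable_translate c : measurable_fun setT (translate c).
Proof. exact: measurable_funD. Qed.

HB.instance Definition _ c :=
  isMeasurableFun.Build _ _ _ _ (translate c) (measurable_translate c).

(** By uniqueness of Lebesgue measure: the push-forward gives half-open intervals their length. *)
Lemma lebesgue_measure_shift (c : R) (A : set R) : measurable A ->
  pushforward mu (translate c) A = mu A.
Proof.
move=> mA; apply/esym/lebesgue_measure_unique => //= _ [[a b]] _ <-.
rewrite /pushforward (_ : _ @^-1` _ = `](a - c)%R, (b - c)%R]%classic); last first.
  by apply/seteqP; split=> x /=; rewrite !in_itv/= ltrBlDr lerBrDr.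
rewrite !lebesgue_measure_itv/= !lte_fin ltrD2r; case: ifPn => // _.
by rewrite -!EFinB; congr EFin; ring.
Qed.

Lemma ge0_integral_shift (c : R) (f : R -> \bar R) :
  measurable_fun setT f -> (forall x, 0 <= f x) ->
  \int[mu]_x f (x + c)%R = \int[mu]_x f x.
Proof.
move=> mf f0.
transitivity (\int[pushforward mu (translate c)]_x f x).
  by rewrite ge0_integral_pushforward.
by apply: eq_measure_integral => A mA _; exact: lebesgue_measure_shift.
Qed.

Lemma ge0_integral_opp (f : R -> \bar R) :
  measurable_fun setT f -> (forall x, 0 <= f x) ->
  \int[mu]_x f (- x)%R = \int[mu]_x f x.
Proof.
move=> mf f0.
transitivity (\int[pushforward mu (-%R : R -> mR)]_x f x).
  by rewrite ge0_integral_pushforward.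
by apply: eq_measure_integral => A mA _; exact: lebesgue_measureN.
Qed.

(** The sign of [g] is only asked for positive arguments because the integrand it is meant for
    carries a Jacobian factor a / sin^2 p, which changes sign with a. *)
Lemma ge0_integral_scale (s : R) (g : R -> R) : (0 < s)%R -> continuous g ->
  (forall a, (0 < a)%R -> (0 <= g a)%R) ->
  \int[mu]_(a in `]0%R, +oo[) (g a)%:E = \int[mu]_(r in `]0%R, +oo[) (g (r * s) * s)%:E.
Proof.
move=> s0 cg g0.
have dF (r : R) : is_derive r 1%R (fun r => r * s)%R s.
  by apply: is_derive_eq; rewrite scaler0 add0r /GRing.scale/= mulr1.
have F'E : derive1 (fun r : R => r * s)%R = cst s.
  by apply/funext => r; rewrite derive1E derive_val.
have cF : continuous (fun r : R => r * s)%R.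
  by move=> r; apply: cvgM; [exact: cvg_id|exact: cvg_cst].
rewrite (@integral_itv_obnd_cbnd _ _ _ (fun a => (g a)%:E)); last first.
  exact: measurable_EFin_cont.
rewrite (@integral_itv_obnd_cbnd _ _ _ (fun r => (g (r * s) * s)%:E)); last first.
  apply: measurable_EFin_cont => r.
  by apply: continuousM; [apply: continuous_comp; [exact: cF|exact: cg]|exact: cst_continuous].
rewrite -[X in `[X, +oo[%classic](mul0r s).
rewrite (@increasing_ge0_integration_by_substitutiony _ (fun r => r * s)%R g 0%R)//.
- by rewrite mul0r; apply: eq_integral => r _; rewrite F'E.
- by move=> x y _ _ xy; rewrite ltr_pM2r.
- by rewrite F'E => ? _; exact: cst_continuous.
- by rewrite F'E; exact: is_cvg_cst.
- by rewrite F'E; exact: is_cvg_cst.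
- split; first by [].
  by rewrite mul0r -[X in _ --> X](mul0r s); apply: cvg_at_right_filter; exact: cF.
- by apply: gt0_cvgMly => //; exact: cvg_id.
- exact: continuous_subspaceT.
- by move=> x; rewrite in_itv/= mul0r andbT; exact: g0.
Qed.

End LineSubstitution.

Section Cotangent.
Context {R : realType}.
Notation mu := (@lebesgue_measure R).
Notation mR := (measurableTypeR R).

Lemma sin_neq0 (p : R) : 0 < p < pi -> sin p != 0.
Proof. by move=> h; rewrite gt_eqF// sin_gt0_pi. Qed.

Variables (a : R) (a0 : 0 < a).
Let F (p : R) := a * cos p / sin p.

Let dF p : 0 < p < pi -> is_derive p 1 F (- (a / sin p ^+ 2)).
Proof.
move=> /sin_neq0 sp.
have line_deriveV : is_derive p 1 (fun x => (sin x)^-1) (- (sin p ^- 2) *: cos p).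
  exact: is_deriveV.
apply: is_derive_eq.
rewrite /GRing.scale/=.
rewrite -[X in _ = - (X / _)]mulr1 -(cos2Dsin2 p).
by field.
Qed.

Let F_decr p q : 0 < p < pi -> 0 < q < pi -> p < q -> F q < F p.
Proof.
move=> hp hq pq; rewrite /F -!mulrA ltr_pM2l//.
have sp : 0 < sin p by rewrite sin_gt0_pi.
have sq : 0 < sin q by rewrite sin_gt0_pi.
rewrite ltr_pdivrMr// mulrAC ltr_pdivlMr// -subr_gt0.
(* After clearing denominators, cot p - cot q has the sign of sin (q - p). *)
rewrite (_ : _ - _ = sin (q - p)); last by rewrite sinB; ring.
by rewrite sin_gt0_pi// subr_gt0 pq/=; lra.
Qed.

Let F_surj b : exists2 p, 0 < p < pi & F p = b.
Proof.
(* Since cot (pi/2 - u) = tan u. *)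
exists (pi / 2 - atan (b / a)).
  have := atan_gtNpi2 (b / a); have := atan_ltpi2 (b / a); lra.
have := cos_gt0_pihalf; move=> /(_ _ (atan (b / a))) h.
have c0 : cos (atan (b / a)) != 0.
  by rewrite gt_eqF// h// ?atan_gtNpi2 ?atan_ltpi2// mulNr.
rewrite /F sinB cosB sin_pihalf cos_pihalf !mul0r !mul1r add0r subr0.
rewrite -mulrA -/(tan _) atanK; field.
by rewrite gt_eqF.
Qed.

(** Margin of the compact intervals [[al n], pi - [al n]] that exhaust ]0, pi[; starting from pi/2
    keeps them non-empty already for n = 0. *)
Let al n : R := pi / 2 / n.+1%:R.

Let al_bd n : 0 < al n <= pi / 2.
Proof.
have p0 := pi_gt0 R; rewrite /al divr_gt0// ?divr_gt0// ler_pdivrMr//.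
by rewrite ler_peMr ?ler1n// divr_ge0// ltW.
Qed.

Let al_le m n : (m <= n)%N -> al n <= al m.
Proof.
have p0 := pi_gt0 R; move=> mn; rewrite /al ler_pM2l ?divr_gt0//.
by rewrite lef_pV2 ?posrE ?ltr0n// ler_nat.
Qed.

Let al_small p : 0 < p -> exists n, al n <= p.
Proof.
move=> p0; have pi0 := pi_gt0 R.
have e0 : 0 < p / (pi / 2) by rewrite divr_gt0// divr_gt0.
have [n _ /(_ n (leqnn n)) /= h] := near_infty_natSinv_lt (PosNum e0).
exists n; rewrite /al -ler_pdivlMl ?divr_gt0// mulrC.
by rewrite mulrC ltW// mulrC.
Qed.

(** Substitution b = a cot p, decreasing from ]0, pi[ onto the line. The map blows up at both ends,
    so it is carried out on compact subintervals and both sides pass to the limit by monotone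
    convergence. *)
Lemma integral_cot (G : R -> R) : continuous G -> (forall b, 0 <= G b) ->
  (\int[mu]_b (G b)%:E =
   \int[mu]_(p in `]0%R, pi[) (G (a * cos p / sin p) * (a / sin p ^+ 2))%:E)%E.
Proof.
move=> cG G0.
have F'E p : 0 < p < pi -> derive1 F p = - (a / sin p ^+ 2).
  by move=> hp; rewrite derive1E; apply: derive_val; exact: dF.
have cF' p : 0 < p < pi -> {for p, continuous (fun p => - (a / sin p ^+ 2))}.
  move=> hp; apply: continuousN; apply: continuousM; first exact: cst_continuous.
  apply: continuousV; first by rewrite expf_neq0// sin_neq0.
  by apply: continuousM; exact: continuous_sin.
have cdF p : 0 < p < pi -> {for p, continuous (derive1 F)}.
  move=> hp; change (derive1 F q @[q --> p] --> derive1 F p); rewrite F'E//.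
  apply: cvg_trans (cF' _ hp); apply: near_eq_cvg.
  have : p \in `]0, pi[ by rewrite in_itv.
  move=> /near_in_itvoo; apply: filterS => q; rewrite in_itv/= => hq.
  by rewrite F'E.
have cF p : 0 < p < pi -> {for p, continuous F}.
  by move=> /dF[+ _] => /derivable1_diffP/differentiable_continuous.
pose I n := `[al n, pi - al n]%classic : set mR.
pose J n := `[F (pi - al n), F (al n)]%classic : set mR.
have Iin n p : I n p -> 0 < p < pi.
  by rewrite /I/= in_itv/=; have := al_bd n; lra.
have h n : (\int[mu]_(b in J n) (G b)%:E =
   \int[mu]_(p in I n) (G (a * cos p / sin p) * (a / sin p ^+ 2))%:E)%E.
  have [an1 an2] := andP (al_bd n); have pi0 := pi_gt0 R.
  have alin : 0 < al n < pi by lra.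
  have alin' : 0 < pi - al n < pi by lra.
  rewrite /J integration_by_substitution_decreasing//.
  - apply: eq_integral => p; rewrite inE => /Iin hp.
    by congr EFin; rewrite /= !fctE/= F'E// opprK.
  - lra.
  - move=> p q hp hq qp; apply: F_decr => //; [apply: (Iin n)|apply: (Iin n)]; rewrite /I/=; assumption.
  - move=> p; rewrite in_itv/= => hp; apply: cdF; lra.
  - by apply/cvg_ex; eexists; apply: cvg_at_right_filter; apply: cdF.
  - by apply/cvg_ex; eexists; apply: cvg_at_left_filter; apply: cdF.
  - split.
    + by move=> p; rewrite in_itv/= => hp; apply/(@ex_derive _ _ _ _ _ _ _ (dF _)); lra.
    + by apply: cvg_at_right_filter; apply: cF.
    + by apply: cvg_at_left_filter; apply: cF.
  - exact: continuous_subspaceT.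
have mG (D : set R) : measurable_fun (D : set mR) (fun b => (G b)%:E).
  exact: measurable_EFin_cont.
have mK : measurable_fun (`]0%R, pi[%classic : set mR)
    (fun p => (G (a * cos p / sin p) * (a / sin p ^+ 2))%:E).
  apply/measurable_EFinP; apply: open_continuous_measurable_fun => //.
  move=> p; rewrite inE/= in_itv/= => hp.
  apply: (@continuousM _ _ (fun p => G (F p)) (fun p => a / sin p ^+ 2)).
    by apply: continuous_comp; [exact: cF|exact: cG].
  rewrite (_ : (fun p => _) = fun p => - (- (a / sin p ^+ 2))); last first.
    by apply/funext => q; rewrite opprK.
  exact: continuousN (cF' _ hp).
have UI : \bigcup_n I n = `]0, pi[%classic.
  apply/seteqP; split=> [p [n _ /Iin]|p]; first by rewrite /= in_itv.
  rewrite /= in_itv/= => hp.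
  have pi0 := pi_gt0 R.
  have [n1 h1] : exists n, al n <= p by apply: al_small; lra.
  have [n2 h2] : exists n, al n <= pi - p by apply: al_small; lra.
  exists (maxn n1 n2) => //; rewrite /I/= in_itv/=.
  by have := al_le (leq_maxl n1 n2); have := al_le (leq_maxr n1 n2); lra.
have UJ : \bigcup_n J n = setT.
  apply/seteqP; split=> // b _; have [p hp <-] := F_surj b.
  have : (\bigcup_n I n) p by rewrite UI/= in_itv.
  move=> [n _ Ip]; exists n => //; rewrite /J/= in_itv/=.
  move: (Ip); rewrite /I/= in_itv/= => /andP[p1 p2].
  have := al_bd n => aln.
  apply/andP; split.
    move: p2; rewrite le_eqVlt => /orP[/eqP->//|p2].
    by apply/ltW/F_decr => //; lra.
  move: p1; rewrite le_eqVlt => /orP[/eqP->//|p1].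
  by apply/ltW/F_decr => //; lra.
have ndI : {homo I : m n / (m <= n)%N >-> (m <= n)%O}.
  move=> m n mn; apply/subsetPset => p; rewrite /I/= !in_itv/=.
  by have := al_le mn; lra.
have ndJ : {homo J : m n / (m <= n)%N >-> (m <= n)%O}.
  move=> m n mn; apply/subsetPset => b; rewrite /J/= !in_itv/= => /andP[b1 b2].
  have a1 := al_bd m; have a2 := al_bd n.
  have /predU1P[->|a3] : (al n == al m) || (al n < al m) by rewrite -le_eqVlt al_le.
    by rewrite b1 b2.
  have e1 : F (al m) < F (al n) by apply: F_decr => //; lra.
  have e2 : F (pi - al n) < F (pi - al m) by apply: F_decr => //; lra.
  lra.
have L1 := @ge0_nondecreasing_set_cvg_integral _ _ _ J (fun b => (G b)%:E) mu ndJ.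
have L2 := @ge0_nondecreasing_set_cvg_integral _ _ _ I (fun p => (G (a * cos p / sin p) * (a / sin p ^+ 2))%:E) mu ndI.
rewrite UJ in L1; rewrite UI in L2.
have {}L2 : (\int[mu]_(x in I i) (G (a * cos x / sin x) * (a / sin x ^+ 2))%:E)%E @[i --> \oo] -->
  (\int[mu]_(p in `]0%R, pi[) (G (a * cos p / sin p) * (a / sin p ^+ 2))%:E)%E.
  apply: L2 => [n|n|n p _]; first exact: measurable_itv.
    apply: measurable_funS mK; first exact: measurable_itv.
    by move=> p /Iin; rewrite /= in_itv.
  by rewrite lee_fin mulr_ge0// divr_ge0 ?sqr_ge0// ltW.
apply: (cvg_unique _ _ L2) => //.
rewrite [X in X @ _](_ : _ = (fun i => \int[mu]_(b in J i) (G b)%:E)%E); last first.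
  by apply/funext => n; rewrite h.
apply: L1 => [n|n|n b _]; [exact: measurable_itv|exact: mG|by rewrite lee_fin].
Qed.
End Cotangent.

Section Measurability.
Context {R : realType}.
Notation mR := (measurableTypeR R).

(** Pointwise limit of the continuous functions x / (x^2 + 1/(n+1)); at 0 they vanish, in agreement
    with the convention that the inverse of 0 is 0. *)
Lemma measurable_inv : measurable_fun setT (fun x : mR => x^-1 : R).
Proof.
pose g (n : nat) (x : mR) : R := x * (x ^+ 2 + n.+1%:R^-1)^-1.
have g0 n (x : R) : x ^+ 2 + n.+1%:R^-1 != 0.
  by rewrite gt_eqF// ltr_wpDl ?sqr_ge0// invr_gt0.
apply: (@measurable_fun_cvg _ _ _ _ g) => [n|x _].
  apply: continuous_measurable_fun => x.
  apply: (@continuousM _ _ id (fun x => (x ^+ 2 + n.+1%:R^-1)^-1)); first exact: cvg_id.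
  apply: continuousV; first exact: g0.
  by apply: continuousD; [exact: exprn_continuous|exact: cst_continuous].
have [->|x0] := eqVneq x 0.
  rewrite (_ : (fun n => _) = cst 0) ?invr0; first exact: cvg_cst.
  by apply/funext => n; rewrite /g mul0r.
rewrite -[X in _ --> X]mul1r -(divff x0) -mulrA -invfM -expr2.
apply: cvgM; first exact: cvg_cst.
apply: cvgV; first by rewrite expf_neq0.
rewrite -[X in _ --> X]addr0; apply: cvgD; first exact: cvg_cst.
apply/cvgrPdist_le => e e0; near=> n.
rewrite sub0r normrN ger0_norm ?invr_ge0//.
by near: n; exact: near_natSinv_le.
Unshelve. all: end_near. Qed.

Lemma measurable_sin : measurable_fun setT (fun x : mR => sin x : R).
Proof. by apply: continuous_measurable_fun; exact: continuous_sin. Qed.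
Lemma measurable_cos : measurable_fun setT (fun x : mR => cos x : R).
Proof. by apply: continuous_measurable_fun; exact: continuous_cos. Qed.

End Measurability.

(** * Polar and spherical coordinates *)

Section HalfPlanePolar.
Context {R : realType}.
Notation mu := (@lebesgue_measure R).
Notation mR := (measurableTypeR R).

(* Substitute b = a cot p for fixed a, then a = s sin p for fixed p, with Tonelli
   in between; this avoids any change of variables in the plane. *)
Lemma halfplane_polar (H : R -> R -> R) :
  measurable_fun setT (fun p : mR * mR => H p.1 p.2) ->
  (forall a b, 0 <= H a b) -> (forall a, continuous (H a)) ->
  (forall m, continuous (fun a => H a (a * m))) ->
  (\int[mu]_(a in `]0%R, +oo[) \int[mu]_b (H a b)%:E =
   \int[mu]_(p in `]0%R, pi[) \int[mu]_(s in `]0%R, +oo[)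
     (H (s * sin p) (s * cos p) * s)%:E)%E.
Proof.
move=> mH H0 cH cHm.
pose K (q : mR * mR) : R := H q.1 (q.1 * cos q.2 / sin q.2) * (q.1 / sin q.2 ^+ 2).
have mK : measurable_fun setT K.
  have m1 : measurable_fun setT (fun q : mR * mR => q.1 : R) by exact: measurable_fst.
  have m2 : measurable_fun setT (fun q : mR * mR => (sin q.2)^-1 : R).
    apply: (measurableT_comp (@measurable_inv R)).
    exact: (measurableT_comp measurable_sin measurable_snd).
  have m3 : measurable_fun setT (fun q : mR * mR => cos q.2 : R).
    exact: (measurableT_comp measurable_cos measurable_snd).
  apply: measurable_funM.
    apply: (measurableT_comp mH (g := fun q : mR * mR => (q.1, q.1 * cos q.2 / sin q.2))).
    apply: measurable_fun_pair => //.
    by apply: measurable_funM => //; exact: measurable_funM.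
  apply: measurable_funM => //.
  rewrite (_ : (fun q => _) = fun q : mR * mR => (sin q.2)^-1 ^+ 2).
    exact: measurable_funX.
  by apply/funext => q; rewrite exprVn.
transitivity (\int[mu]_(a in `]0%R, +oo[) \int[mu]_(p in `]0%R, pi[) (K (a, p))%:E)%E.
  apply: eq_integral => a; rewrite inE/= in_itv/= andbT => a0.
  by rewrite (integral_cot a0).
rewrite (@tonelli_dom _ _ _ _ _ mu mu _ _ (fun q => (K q)%:E))//; last 2 first.
- by apply/measurable_EFinP; apply: measurable_funS mK.
- move=> [a p] [/=]; rewrite !in_itv/= andbT => a0 hp.
  by rewrite lee_fin mulr_ge0// divr_ge0 ?sqr_ge0// ltW.
apply: eq_integral => p; rewrite inE/= in_itv/= => hp.
have sp : 0 < sin p by rewrite sin_gt0_pi.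
have cc x : continuous (fun s : R => s * x).
  by move=> r; apply: continuousM; [exact: cvg_id|exact: cst_continuous].
have cK : continuous ((fun a => K (a, p)) : R -> R).
  rewrite (_ : (fun a => _) = (fun a : R => H a (a * (cos p / sin p))) * (fun a : R => a * (sin p ^+ 2)^-1)).
    by move=> a; apply: continuousM; [exact: cHm|exact: cc].
  by apply/funext => a; rewrite /K; congr (H _ _ * _); rewrite /= mulrA.
rewrite (ge0_integral_scale sp cK); last first.
  by move=> a a0; rewrite mulr_ge0// divr_ge0 ?sqr_ge0// ltW.
apply: eq_integral => s _; congr EFin.
rewrite /K/= -!mulrA; congr (H _ _ * _); first by field; rewrite gt_eqF.
by field; rewrite gt_eqF.
Qed.

End HalfPlanePolar.

Section Spherical.
Context {R : realType}.
Notation vec := 'rV[R]_3.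
Notation mu := (@lebesgue_measure R).
Notation mR := (measurableTypeR R).
Local Open Scope ereal_scope.

Lemma ge0_integral_halves (g : R -> \bar R) :
  measurable_fun (setT : set mR) g -> (forall b, 0 <= g b) ->
  \int[mu]_b g b = \int[mu]_(b in `]0%R, +oo[) (g b + g (- b)%R).
Proof.
move=> mg g0.
have mgo : measurable_fun (setT : set mR) (fun b => g (- b)%R).
  by apply: measurableT_comp => //; exact: measurable_oppr.
have mS (h : R -> \bar R) (D : set R) :
    measurable_fun (setT : set mR) h -> measurable_fun (D : set mR) h.
  by move=> mh; apply: measurable_funS mh.
rewrite ge0_integralD//; [|exact: mS|exact: mS].
rewrite [X in _ = _ + X](@integral_itv_obnd_cbnd _ _ _ (fun b => g (- b)%R)); last exact: mS.
rewrite ge0_integration_by_substitution0//.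
under [X in _ = _ + X]eq_integral do rewrite opprK.
rewrite -ge0_integral_setU//=.
- congr (integral _ _ _); apply/seteqP; split=> // b _ /=.
  by rewrite !in_itv/= andbT; case: (ltP 0%R b); [left|right].
- exact: mS.
- by apply/disj_setPS => b /=; rewrite !in_itv/= andbT => -[/lt_geF ->].
Qed.

(** Half-plane polar coordinates only see the angles in ]0, pi[; the other half of the circle is
    recovered by the reflection p -> 2 pi - p, the endpoints and pi being negligible. *)
Lemma ge0_integral_circle (g : R -> R) : continuous g -> (forall p, (0 <= g p)%R) ->
  \int[mu]_(p in `]0%R, pi[) (g p + g (2 * pi - p)%R)%:E =
  \int[mu]_(p in `[0%R, (2 * pi)%R]) (g p)%:E.
Proof.
move=> cg g0; have pi0 := pi_gt0 R.
have cgo : continuous (fun p => g (2 * pi - p)%R).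
  move=> p; apply: continuous_comp; last exact: cg.
  by apply: cvgB; [exact: cvg_cst|exact: cvg_id].
have mg (D : set R) : measurable_fun (D : set mR) (EFin \o g).
  exact: measurable_EFin_cont.
under eq_integral do rewrite EFinD.
rewrite ge0_integralD//=; try exact: measurable_EFin_cont;
  try by move=> p _; rewrite lee_fin.
have -> : \int[mu]_(p in `]0%R, pi[) (g (2 * pi - p)%R)%:E =
          \int[mu]_(p in `]pi, (2 * pi)%R[) (g p)%:E.
  pose G := (EFin \o g) \_ (`]pi, (2 * pi)%R[%classic : set mR).
  have mG : measurable_fun (setT : set mR) G.
    by apply/(measurable_restrictT _ (measurable_itv _)); exact: mg.
  have G0 x : 0 <= G x by rewrite /G patchE; case: ifPn => //= _; rewrite lee_fin.
  transitivity (\int[mu]_x G x); last by rewrite /G -integral_mkcond.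
  rewrite -(ge0_integral_opp mG G0).
  rewrite -(@ge0_integral_shift _ (- (2 * pi))%R (fun x => G (- x)%R))//; last first.
    by apply: measurableT_comp => //; exact: measurable_oppr.
  rewrite integral_mkcond; apply: eq_integral => p _.
  rewrite (_ : - (p - 2 * pi) = 2 * pi - p)%R; last by ring.
  rewrite /G !patchE.
  have -> : ((2 * pi - p)%R \in `]pi, (2 * pi)%R[%classic) = (p \in `]0%R, pi[%classic).
    by rewrite !mem_setE !in_itv/=; apply/idP/idP; lra.
  by [].
rewrite [RHS](@integral_itv_bndoo _ _ _ _ true false); last exact: mg.
have -> : `]0%R, (2 * pi)%R[%classic = setU (`]0%R, pi]%classic : set R) (`]pi, (2 * pi)%R[%classic : set R).
  apply/seteqP; split=> p /=; rewrite !in_itv/=.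
    by move=> h; case: (ltP pi p); [right|left]; lra.
  by case; lra.
rewrite ge0_integral_setU//=; try exact: mg; try by move=> p _; rewrite lee_fin.
  congr (_ + _); rewrite -(@integral_itv_bndo_bndc _ (BRight 0%R) pi (EFin \o g)); last exact: mg.
  by [].
by apply/disj_setPS => b /=; rewrite !in_itv/= => -[]; lra.
Qed.

Section Triple.
Variables (A B C : set mR) (h : mR -> mR -> mR -> \bar R).
Hypotheses (mA : measurable A) (mB : measurable B) (mC : measurable C).
Hypothesis mh : measurable_fun setT (fun p : mR * mR * mR => h p.1.1 p.1.2 p.2).
Hypothesis h0 : forall x y z, 0 <= h x y z.

Let h1 (q : mR * mR) := \int[mu]_(z in C) h q.1 q.2 z.

Let mh1 : measurable_fun setT h1.
Proof.
apply: (@measurable_tonelli_dom1 _ _ _ _ _ sleb1 setT C (fun p => h p.1.1 p.1.2 p.2)) => //.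
by apply: measurable_funS mh.
Qed.

Let h10 q : 0 <= h1 q. Proof. by apply: integral_ge0 => z _. Qed.

Lemma tonelli_swap12 : \int[mu]_(x in A) \int[mu]_(y in B) \int[mu]_(z in C) h x y z =
  \int[mu]_(y in B) \int[mu]_(x in A) \int[mu]_(z in C) h x y z.
Proof.
apply: (@tonelli_dom _ _ _ _ _ sleb1 sleb1 A B h1) => //.
by apply: measurable_funS mh1 => //; exact: measurableX.
Qed.

Lemma tonelli_swap23 : \int[mu]_(x in A) \int[mu]_(y in B) \int[mu]_(z in C) h x y z =
  \int[mu]_(x in A) \int[mu]_(z in C) \int[mu]_(y in B) h x y z.
Proof.
apply: eq_integral => x _.
apply: (@tonelli_dom _ _ _ _ _ sleb1 sleb1 B C (fun q => h x q.1 q.2)) => //.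
have : measurable_fun setT (fun q : mR * mR => h x q.1 q.2).
  apply: (measurableT_comp mh (g := fun q : mR * mR => ((x, q.1), q.2))).
  by apply: measurable_fun_pair => //; exact: measurable_fun_pair.
by apply: measurable_funS => //; exact: measurableX.
Qed.
End Triple.

Let rect : set (mR * mR) := `[0%R, pi] `*` `[0%R, (2 * pi)%R].

Lemma sphere_paramE (x : vec) (r : R) (q : R * R) : sphere_param x r q =
  vec3 (x 0 i1 + r * (sin q.1 * cos q.2))%R (x 0 i2 + r * (sin q.1 * sin q.2))%R
       (x 0 i3 + r * cos q.1)%R.
Proof. by apply: vec_eqP; rewrite /sphere_param !mxE/=. Qed.

Lemma measurable_sphere (k : vec -> R) (x : vec) (r : R) : continuous k ->
  measurable_fun (setT : set (mR * mR)) (fun q => k (sphere_param x r q)).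
Proof.
move=> ck; under eq_fun do rewrite sphere_paramE.
have s1 := measurableT_comp measurable_sin (@measurable_fst _ _ mR mR).
have s2 := measurableT_comp measurable_sin (@measurable_snd _ _ mR mR).
have c1 := measurableT_comp measurable_cos (@measurable_fst _ _ mR mR).
have c2 := measurableT_comp measurable_cos (@measurable_snd _ _ mR mR).
have cst_r (a : R) : measurable_fun (setT : set (mR * mR)) (cst a) by [].
exact: (measurable_vec3_comp ck
  (measurable_funD (cst_r (x 0%R i1)) (measurable_funM (cst_r r) (measurable_funM s1 c2)))
  (measurable_funD (cst_r (x 0%R i2)) (measurable_funM (cst_r r) (measurable_funM s1 s2)))
  (measurable_funD (cst_r (x 0%R i3)) (measurable_funM (cst_r r) c1))).
Qed.

Lemma measurable_sphere_weight (k : vec -> R) (x : vec) (r : R) : continuous k ->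
  measurable_fun (setT : set (mR * mR))
    (fun q => k (sphere_param x r q) * (r ^+ 2 * sin q.1))%R.
Proof.
move=> ck; have s1 := measurableT_comp measurable_sin (@measurable_fst _ _ mR mR).
have cst_r (a : R) : measurable_fun (setT : set (mR * mR)) (cst a) by [].
exact: (measurable_funM (measurable_sphere x r ck) (measurable_funM (cst_r (r ^+ 2)%R) s1)).
Qed.

Lemma continuous_sphere_angle (x : vec) (r t : R) :
  continuous (fun p : R => sphere_param x r (t, p)).
Proof.
have -> : (fun p : R => sphere_param x r (t, p)) = fun p =>
    vec3 (x 0%R i1 + r * (sin t * cos p))%R (x 0%R i2 + r * (sin t * sin p))%R
         (x 0%R i3 + r * cos t)%R.
  by apply/funext => p; rewrite sphere_paramE.
move=> p; have h (a : R) (g : R -> R) : {for p, continuous g} ->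
    {for p, continuous (fun p => a + r * (sin t * g p))%R}.
  move=> cg; apply: cvgD; first exact: cvg_cst.
  apply: cvgM; first exact: cvg_cst.
  by apply: cvgM; [exact: cvg_cst|exact: cg].
apply: (@continuous_vec3 _ _ p (fun p => _) (fun p => _) (fun p => _)).
- by apply: h; exact: continuous_cos.
- by apply: h; exact: continuous_sin.
- exact: cst_continuous.
Qed.

(** Half-plane polar coordinates used twice: in a horizontal plane for the distance s to the axis
    and the azimuth p, then in the half plane (s, c) for the radius r and the polar angle t. The
    Jacobian r * (r sin t) is the product of the two planar ones. *)
Lemma spherical0 (k : vec -> R) : continuous k -> (forall y, (0 <= k y)%R) ->
  \int[@leb3 R]_p (k (vec3 p.1.1 p.1.2 p.2))%:E =
  \int[mu]_(r in `]0%R, +oo[) \int[@leb2 R]_(q in rect)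
    (k (sphere_param 0 r q) * (r ^+ 2 * sin q.1))%:E.
Proof.
move=> ck k0; have pi0 := pi_gt0 R.
(* Folds the half space of negative second coordinate onto the positive one, so that a half plane is
   enough. *)
pose k2 (y : vec) : R := (k y + k (vec3 (y 0 i1) (- y 0 i2) (y 0 i3)))%R.
have ck2 : continuous k2.
  move=> y; apply: continuousD; first exact: ck.
  apply: continuous_comp; last exact: ck.
  apply: continuous_vec3; try exact: continuous_coord.
  by apply: continuousN; exact: continuous_coord.
have k20 y : (0 <= k2 y)%R by rewrite /k2 addr_ge0.
have mk := measurable_vec3_cont ck; have mk2 := measurable_vec3_cont ck2.
transitivity (\int[mu]_c \int[mu]_(b in `]0%R, +oo[) \int[mu]_a (k2 (vec3 a b c))%:E).
  rewrite (@tonelli_leb3 _ (fun p : mR * mR * mR => (k (vec3 p.1.1 p.1.2 p.2))%:E))//; last 2 first.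
  - exact/measurable_EFinP.
  - by move=> p; rewrite lee_fin.
  apply: eq_integral => c _ /=.
  have mkc : measurable_fun setT (fun p : mR * mR => (k (vec3 p.1 p.2 c))%:E).
    by apply/measurable_EFinP; exact: measurable_vec3_plane_cont.
  have k0' (p : mR * mR) : 0 <= (k (vec3 p.1 p.2 c))%:E by rewrite lee_fin.
  rewrite (tonelli_leb2 mkc k0')/=.
  rewrite ge0_integral_halves; last 2 first.
  - exact: (measurable_tonelli_leb2 mkc k0').
  - by move=> b; apply: integral_ge0 => a _; rewrite lee_fin.
  apply: eq_integral => b _.
  have mline b' : measurable_fun (setT : set mR) (fun a => (k (vec3 a b' c))%:E).
    apply: measurable_EFin_cont => a; apply: continuous_comp; last exact: ck.
    exact: continuous_line1.
  rewrite -ge0_integralD//; try (by move=> a _; rewrite lee_fin).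
  by apply: eq_integral => a _; rewrite /k2 !vec3E.
have cs m n c : continuous (fun s : R => k2 (vec3 (s * m) (s * n) c)).
  move=> s; apply: (@continuous_comp _ _ _ (fun s : R => vec3 (s * m) (s * n) c) k2); last exact: ck2.
  by apply: continuous_vec3; last exact: cst_continuous;
    apply: continuousM; try exact: cvg_id; exact: cst_continuous.
have cs' m n c : continuous (fun s : R => k2 (vec3 m n (s * c))).
  move=> s; apply: (@continuous_comp _ _ _ (fun s : R => vec3 m n (s * c)) k2); last exact: ck2.
  apply: continuous_vec3; try exact: cst_continuous.
  by apply: continuousM; [exact: cvg_id|exact: cst_continuous].
have mp1 : measurable_fun setT (fun p : mR * mR * mR => p.1.1 : R).
  exact: (measurableT_comp measurable_fst measurable_fst).
have mp2 : measurable_fun setT (fun p : mR * mR * mR => p.1.2 : R).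
  exact: (measurableT_comp measurable_snd measurable_fst).
have mp3 : measurable_fun setT (fun p : mR * mR * mR => p.2 : R).
  exact: measurable_snd.
(* The Jacobian is written with an absolute value so that the integrand is non-negative for all real
   s, as the exchange lemmas require. *)
pose h1 c p s := (k2 (vec3 (s * cos p) (s * sin p) c) * `|s|)%:E.
transitivity (\int[mu]_c \int[mu]_(p in `]0%R, pi[) \int[mu]_(s in `]0%R, +oo[) h1 c p s).
  apply: eq_integral => c _.
  rewrite (@halfplane_polar _ (fun b a => k2 (vec3 a b c))).
  - apply: eq_integral => p _; apply: eq_integral => s; rewrite inE/= in_itv/= andbT => s0.
    by rewrite /h1 gtr0_norm.
  - exact: (measurable_vec3_comp ck2).
  - by [].
  - move=> b a; apply: (@continuous_comp _ _ _ (fun a => vec3 a b c) k2); last exact: ck2.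
    exact: continuous_line1.
  - by move=> m; under [X in continuous X]eq_fun do rewrite -[X in vec3 _ X]mulr1; exact: cs.
rewrite tonelli_swap12//; last 2 first.
- apply/measurable_EFinP/measurable_funM; last exact: measurableT_comp.
  by apply: (measurable_vec3_comp ck2) => //; apply: measurable_funM => //;
    [exact: (measurableT_comp measurable_cos mp2)|exact: (measurableT_comp measurable_sin mp2)].
- by move=> c p s; rewrite lee_fin mulr_ge0.
rewrite tonelli_swap23//; last 2 first.
- apply/measurable_EFinP/measurable_funM; last exact: measurableT_comp.
  by apply: (measurable_vec3_comp ck2) => //; apply: measurable_funM => //;
    [exact: (measurableT_comp measurable_cos mp1)|exact: (measurableT_comp measurable_sin mp1)].
- by move=> c p s; rewrite lee_fin mulr_ge0.
have cs3 m n l : continuous (fun s : R => k2 (vec3 (s * m) (s * n) (s * l))).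
  move=> s; apply: (@continuous_comp _ _ _ (fun s : R => vec3 (s * m) (s * n) (s * l)) k2); last exact: ck2.
  by apply: continuous_vec3; apply: continuousM; try exact: cvg_id; exact: cst_continuous.
pose h2 p t r := (k2 (vec3 (r * (sin t * cos p)) (r * (sin t * sin p)) (r * cos t)) *
   `|r * sin t| * `|r|)%:E.
transitivity (\int[mu]_(p in `]0%R, pi[) \int[mu]_(t in `]0%R, pi[) \int[mu]_(r in `]0%R, +oo[) h2 p t r).
  apply: eq_integral => p _.
  (* Now the distance s to the axis is the positive coordinate and the height c the free one; the
     factor |s| left by the first pass becomes r sin t. *)
  rewrite (@halfplane_polar _ (fun s c => k2 (vec3 (s * cos p) (s * sin p) c) * `|s|)%R).
  - apply: eq_integral => t _; apply: eq_integral => r; rewrite inE/= in_itv/= andbT => r0.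
    by rewrite /h2 [in RHS](gtr0_norm r0) !mulrA.
  - apply: measurable_funM; last exact: measurableT_comp.
    by apply: (measurable_vec3_comp ck2) => //; exact: measurable_funM.
  - by move=> a b; rewrite mulr_ge0.
  - move=> s c; apply: (@continuousM _ _ (fun c => k2 (vec3 (s * cos p) (s * sin p) c)) (cst `|s|%R)); last exact: cst_continuous.
    apply: (@continuous_comp _ _ _ (fun c => vec3 _ _ c) k2); last exact: ck2.
    exact: continuous_line3.
  - by move=> m s; exact: (continuousM (cs3 _ _ _ s) (@norm_continuous _ R s)).
have mtrig (f1 f2 f3 : mR * mR * mR -> R) : measurable_fun setT f1 ->
    measurable_fun setT f2 -> measurable_fun setT f3 ->
    measurable_fun setT (fun q => h2 (f1 q) (f2 q) (f3 q)).
  move=> m1 m2 m3.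
  have s1 := measurableT_comp measurable_sin m1; have s2 := measurableT_comp measurable_sin m2.
  have c1 := measurableT_comp measurable_cos m1; have c2 := measurableT_comp measurable_cos m2.
  apply/measurable_EFinP; apply: measurable_funM; last exact: measurableT_comp.
  apply: measurable_funM; last exact: (measurableT_comp _ (measurable_funM m3 s2)).
  have n1 := measurable_funM m3 (measurable_funM s2 c1).
  have n2 := measurable_funM m3 (measurable_funM s2 s1).
  exact: (measurable_vec3_comp ck2 n1 n2 (measurable_funM m3 c2)).
have h20 p t r : 0 <= h2 p t r by rewrite lee_fin !mulr_ge0.
rewrite tonelli_swap23//; last exact: mtrig.
rewrite (@tonelli_swap12 _ _ _ (fun p r t => h2 p t r))//; last exact: mtrig.
rewrite (@tonelli_swap23 _ _ _ (fun r p t => h2 p t r))//; last exact: mtrig.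
apply: eq_integral => r; rewrite inE/= in_itv/= andbT => r0.
have r20 : (0 <= r ^+ 2)%R by rewrite sqr_ge0.
pose w (q : mR * mR) := (k (sphere_param 0 r q) * (r ^+ 2 * sin q.1))%R.
have mw : measurable_fun (setT : set (mR * mR)) (EFin \o w).
  by apply/measurable_EFinP; exact: measurable_sphere_weight.
have w0 q : rect q -> 0 <= (w q)%:E.
  move=> [/=]; rewrite !in_itv/= => h _.
  by rewrite lee_fin mulr_ge0// mulr_ge0// sin_ge0_pi.
rewrite (@tonelli_dom1 _ _ _ _ _ sleb1 sleb1 `[0%R, pi]%classic `[0%R, (2 * pi)%R]%classic (EFin \o w))//; last first.
  by apply: measurable_funS mw.
rewrite [RHS](@integral_itv_bndoo _ _ _ _ true false); last first.
  apply: measurable_funS (@measurable_tonelli_dom1 _ _ _ _ _ sleb1 `[0%R, pi]%classic `[0%R, (2 * pi)%R]%classic (EFin \o w) _ _ _ _) => //.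
    by apply: subset_itvW.
  by apply: measurable_funS mw.
apply: eq_integral => t; rewrite inE/= in_itv/= => ht.
have st : (0 < sin t)%R by rewrite sin_gt0_pi.
rewrite -(@ge0_integral_circle (fun p => w (t, p))); last 2 first.
- move=> p; apply: (@continuousM _ _ (fun p => k (sphere_param 0 r (t, p))) (cst (r ^+ 2 * sin t)%R)); last exact: cst_continuous.
  apply: (@continuous_comp _ _ _ (fun p => sphere_param 0 r (t, p)) k); last exact: ck.
  exact: continuous_sphere_angle.
- by move=> p; rewrite /w/= !mulr_ge0// ltW.
apply: eq_integral => p _; congr EFin.
rewrite /h2 /w /= !sphere_paramE/= !mxE !add0r.
(* The reflected angle changes the sign of the sine only, which is the second summand of [k2]. *)
have -> : (cos (2 * pi - p) = cos p)%R by rewrite mulr_natl cosB cos2pi sin2pi mul1r mul0r addr0.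
have -> : (sin (2 * pi - p) = - sin p)%R by rewrite mulr_natl sinB cos2pi sin2pi mul1r mul0r add0r.
rewrite /k2 !vec3E gtr0_norm ?mulr_gt0// gtr0_norm//.
rewrite !mulrN; ring.
Qed.
End Spherical.

(** * A C^1 cutoff profile *)

Section Cutoff.
Context {R : realType}.

Definition pos2 (s : R) : R := Num.max 0 s ^+ 2.

Lemma is_derive_pos2 (s : R) : is_derive s 1 pos2 (2 * Num.max 0 s).
Proof.
have [s0|s0|<-] := ltgtP 0 s.
- have e : \near s, s ^+ 2 = pos2 s.
    near=> u; rewrite /pos2 max_r//; apply/ltW; near: u; exact: lt_nbhsr.
  by apply: near_is_derive1 e; apply: (is_derive_eqv (line_derive_sqr (line_derive_id _))); rewrite mulr1.
- have e : \near s, 0 = pos2 s.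
    near=> u; rewrite /pos2 max_l ?expr0n//; apply/ltW; near: u; exact: lt_nbhsl.
  by apply: near_is_derive1 e; rewrite mulr0; exact: line_derive_cst.
- rewrite mulr0; apply: is_derive1P; apply/cvgrPdist_le => e e0.
  near=> h; have h0 : h != 0 by near: h; exact: nbhs_dnbhs_neq.
  rewrite sub0r normrN addr0 /pos2 maxxx expr0n subr0 normrM normfV.
  rewrite ler_pdivrMl ?normr_gt0// normrX.
  apply: (@le_trans _ _ (`|h| ^+ 2)).
    rewrite ler_pXn2r ?nnegrE// ger0_norm ?le_max ?lexx// ge_max normr_ge0/=.
    exact: ler_norm.
  rewrite expr2 ler_wpM2l//; near: h.
  by apply: dnbhs0_le.
Unshelve. all: end_near. Qed.

(* A C^1 monotone step from 0 (for s <= 1) to 1 (for s >= 2), piecewise quadratic. *)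
Definition smoothstep (s : R) : R :=
  2 * pos2 (s - 1) - 4 * pos2 (s - 3 / 2) + 2 * pos2 (s - 2).

Definition smoothstep' (s : R) : R :=
  4 * Num.max 0 (s - 1) - 8 * Num.max 0 (s - 3 / 2) + 4 * Num.max 0 (s - 2).

Lemma is_derive_smoothstep (s : R) : is_derive s 1 smoothstep (smoothstep' s).
Proof.
have h (a : R) : is_derive s 1 (fun s => pos2 (s - a)) (2 * Num.max 0 (s - a)).
  rewrite -[X in is_derive _ _ _ X]mulr1; apply: line_derive_comp; first exact: is_derive_pos2.
  by apply: (is_derive_eqv (line_deriveB (line_derive_id _) (line_derive_cst _ _))); rewrite subr0.
apply: (is_derive_eqv (line_deriveD (line_deriveB (line_deriveMl _ (h 1)) (line_deriveMl _ (h (3 / 2)))) (line_deriveMl _ (h 2)))).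
by rewrite /smoothstep'; ring.
Qed.

Lemma continuous_smoothstep : continuous smoothstep.
Proof. by move=> s; exact: is_derive_continuous (is_derive_smoothstep s). Qed.

Lemma continuous_smoothstep' : continuous smoothstep'.
Proof.
have h (k a : R) : continuous (fun s => k * Num.max 0 (s - a)).
  move=> s; apply: (@continuousM _ _ (cst k) (fun s => Num.max 0 (s - a))); first exact: cst_continuous.
  apply: (@continuous_max _ _ (cst 0) (fun s => s - a)); first exact: cst_continuous.
  by apply: cvgB; [exact: cvg_id|exact: cvg_cst].
move=> s; apply: cvgD; last exact: h.
by apply: cvgB; exact: h.
Qed.

Ltac max_cases s := rewrite /smoothstep /smoothstep' /pos2;
  have [?|?] := lerP 0 (s - 1); have [?|?] := lerP 0 (s - 3 / 2);
  have [?|?] := lerP 0 (s - 2).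

Lemma smoothstep_le1 (s : R) : s <= 1 -> smoothstep s = 0.
Proof. by move=> s1; max_cases s; nra. Qed.

Lemma smoothstep_ge2 (s : R) : 2 <= s -> smoothstep s = 1.
Proof. by move=> s1; max_cases s; nra. Qed.

Lemma smoothstep'_le1 (s : R) : s <= 1 -> smoothstep' s = 0.
Proof. by move=> s1; max_cases s; nra. Qed.

Lemma smoothstep'_ge2 (s : R) : 2 <= s -> smoothstep' s = 0.
Proof. by move=> s1; max_cases s; nra. Qed.

Lemma smoothstep'_ge0 (s : R) : 0 <= smoothstep' s.
Proof. by max_cases s; nra. Qed.

Lemma smoothstep_itv (s : R) : 0 <= smoothstep s <= 1.
Proof. by max_cases s; apply/andP; split; nra. Qed.

End Cutoff.

(** * Spherical coordinates about any centre and on the half space *)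

Section SphericalUpper.
Context {R : realType}.
Notation vec := 'rV[R]_3.
Notation mu := (@lebesgue_measure R).
Notation mR := (measurableTypeR R).
Local Open Scope ereal_scope.
Let rect : set (mR * mR) := `[0%R, pi] `*` `[0%R, (2 * pi)%R].

Lemma measurable_rect : measurable rect.
Proof. exact: measurableX. Qed.

Lemma vec3D (a b c : R) (y : vec) :
  (vec3 a b c + y = vec3 (a + y 0 i1) (b + y 0 i2) (c + y 0 i3))%R.
Proof. by apply: vec_eqP; rewrite mxE !vec3E. Qed.

Lemma continuous_addr (c : vec) : continuous (fun y : vec => y + c)%R.
Proof. by move=> y; exact: (cvgD cvg_id (cvg_cst c)). Qed.

Lemma integral_leb3_shift (c : vec) (k : vec -> R) : continuous k ->
  (forall y, (0 <= k y)%R) ->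
  \int[@leb3 R]_p (k (vec3 p.1.1 p.1.2 p.2 + c)%R)%:E =
  \int[@leb3 R]_p (k (vec3 p.1.1 p.1.2 p.2))%:E.
Proof.
move=> ck k0.
have ck' : continuous (fun y : vec => k (y + c)%R).
  move=> y; apply: (@continuous_comp _ _ _ (fun y : vec => y + c)%R k); last exact: ck.
  exact: continuous_addr.
have m3 : measurable_fun setT (fun p : mR * mR * mR => (k (vec3 p.1.1 p.1.2 p.2))%:E).
  by apply/measurable_EFinP; exact: measurable_vec3_cont.
have m3' : measurable_fun setT (fun p : mR * mR * mR => (k (vec3 p.1.1 p.1.2 p.2 + c)%R)%:E).
  by apply/measurable_EFinP; exact: (measurable_vec3_cont ck').
have m2 z : measurable_fun setT (fun p : mR * mR => (k (vec3 p.1 p.2 z))%:E).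
  by apply/measurable_EFinP; exact: measurable_vec3_plane_cont.
have m2' z : measurable_fun setT (fun p : mR * mR => (k (vec3 p.1 p.2 z + c)%R)%:E).
  by apply/measurable_EFinP; exact: (measurable_vec3_plane_cont z ck').
have h3 (p : mR * mR * mR) : 0 <= (k (vec3 p.1.1 p.1.2 p.2))%:E by rewrite lee_fin.
have h3' (p : mR * mR * mR) : 0 <= (k (vec3 p.1.1 p.1.2 p.2 + c)%R)%:E by rewrite lee_fin.
have h2 z (p : mR * mR) : 0 <= (k (vec3 p.1 p.2 z))%:E by rewrite lee_fin.
have h2' z (p : mR * mR) : 0 <= (k (vec3 p.1 p.2 z + c)%R)%:E by rewrite lee_fin.
rewrite (tonelli_leb3 m3 h3) (tonelli_leb3 m3' h3').
rewrite -(@ge0_integral_shift _ (c 0%R i3) (fun z => \int[@leb2 R]_q (k (vec3 q.1 q.2 z))%:E)); last 2 first.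
- exact: (measurable_tonelli_leb3 m3 h3).
- by move=> z; apply: integral_ge0 => q _; rewrite lee_fin.
apply: eq_integral => z _.
rewrite (tonelli_leb2 (m2 _) (h2 _)) (tonelli_leb2 (m2' _) (h2' _)).
rewrite -(@ge0_integral_shift _ (c 0%R i2) (fun b => \int[mu]_a (k (vec3 a b (z + c 0%R i3)))%:E)); last 2 first.
- exact: (measurable_tonelli_leb2 (m2 _) (h2 _)).
- by move=> b; apply: integral_ge0 => a _; rewrite lee_fin.
apply: eq_integral => b _ /=.
rewrite -(@ge0_integral_shift _ (c 0%R i1)
  (fun a => (k (vec3 a (b + c 0%R i2) (z + c 0%R i3)))%:E)); last 2 first.
- apply: measurable_EFin_cont => a; apply: (@continuous_comp _ _ _ (fun a => vec3 a _ _) k); last exact: ck.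
  exact: continuous_line1.
- by move=> a; rewrite lee_fin.
by apply: eq_integral => a _; rewrite vec3D.
Qed.

Lemma sphere_param0D (c : vec) (r : R) q : (sphere_param 0 r q + c = sphere_param c r q)%R.
Proof. by rewrite /sphere_param add0r addrC. Qed.

Lemma spherical (c : vec) (k : vec -> R) : continuous k -> (forall y, (0 <= k y)%R) ->
  \int[@leb3 R]_p (k (vec3 p.1.1 p.1.2 p.2))%:E =
  \int[mu]_(r in `]0%R, +oo[) \int[@leb2 R]_(q in rect)
    (k (sphere_param c r q) * (r ^+ 2 * sin q.1))%:E.
Proof.
move=> ck k0; rewrite -(integral_leb3_shift c ck k0).
have ck' : continuous (fun y : vec => k (y + c)%R).
  move=> y; apply: (@continuous_comp _ _ _ (fun y : vec => y + c)%R k); last exact: ck.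
  exact: continuous_addr.
apply: etrans (spherical0 ck' (fun y => k0 _)) _.
apply: eq_integral => r _; apply: eq_integral => q _.
by rewrite sphere_param0D.
Qed.

Definition uind (y : vec) : R := ((0 < y 0 i3)%R)%:R.

Lemma uind_ge0 y : (0 <= uind y)%R. Proof. exact: ler0n. Qed.
Lemma uind_le1 y : (uind y <= 1)%R. Proof. by rewrite /uind lern1 leq_b1. Qed.

(** Continuous functions increasing to [uind]: spherical coordinates are established for continuous
    integrands, and the indicator of the half space is reached by monotone convergence. *)
Let uapprox (m : nat) (y : vec) : R := Num.min 1%R (m%:R * Num.max 0%R (y 0 i3))%R.

Let uapprox_cont m : continuous (uapprox m).
Proof.
have h : continuous (fun y : vec => Num.max 0 (y 0 i3))%R.
  move=> y; apply: (@continuous_max _ _ (cst 0%R) (fun y : vec => (y 0 i3)%R)); first exact: cst_continuous.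
  exact: continuous_coord.
move=> y; apply: (@continuous_min _ _ (cst 1%R) (fun y : vec => m%:R * Num.max 0 (y 0 i3))%R).
  exact: cst_continuous.
apply: (@continuousM _ _ (cst m%:R) (fun y : vec => Num.max 0 (y 0 i3))%R); [exact: cst_continuous|exact: h].
Qed.

Let uapprox_ge0 m y : (0 <= uapprox m y)%R.
Proof. by rewrite /uapprox le_min ler01/= mulr_ge0// le_max lexx. Qed.

Let uapprox_nd y m n : (m <= n)%N -> (uapprox m y <= uapprox n y)%R.
Proof.
move=> mn; rewrite /uapprox le_min ge_min lexx/= ge_min; apply/orP; right.
by rewrite ler_wpM2r ?ler_nat// le_max lexx.
Qed.

Let uapprox_cvg y : uapprox m y @[m --> \oo] --> uind y.
Proof.
rewrite /uind; have [y0|y0] := ltP 0%R (y 0 i3)%R; last first.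
  rewrite (_ : (fun m => _) = cst 0%R); first exact: cvg_cst.
  by apply/funext => m; rewrite /uapprox max_l// mulr0 min_r.
apply: (@cvg_trans _ (cst 1%R @ \oo)); last exact: cvg_cst.
apply: near_eq_cvg; near=> m; rewrite /uapprox max_r ?ltW// min_l//.
rewrite -ler_pdivrMr// mul1r; near: m; exact: nbhs_infty_ger.
Unshelve. all: end_near. Qed.

Lemma measurable_uind : measurable_fun setT (fun p : mR * mR * mR => uind (vec3 p.1.1 p.1.2 p.2)).
Proof.
apply: (@measurable_fun_cvg _ _ _ _ (fun m p => uapprox m (vec3 p.1.1 p.1.2 p.2))) => // m.
exact: measurable_vec3_cont.
Qed.

Lemma ge0_monotone_cvg d (T : measurableType d) (m : {measure set T -> \bar R})
    (D : set T) (f : nat -> T -> \bar R) (g : T -> \bar R) : measurable D ->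
  (forall n, measurable_fun D (f n)) -> (forall n x, D x -> 0 <= f n x) ->
  (forall x, D x -> {homo f ^~ x : n p / (n <= p)%N >-> n <= p}) ->
  (forall x, D x -> f n x @[n --> \oo] --> g x) ->
  (\int[m]_(x in D) f n x) @[n --> \oo] --> \int[m]_(x in D) g x.
Proof.
move=> mD mf f0 fnd fg.
suff -> : \int[m]_(x in D) g x = \int[m]_(x in D) limn (f ^~ x).
  exact: (cvg_monotone_convergence mD mf f0 fnd).
apply: eq_integral => x; rewrite inE => Dx.
by apply/esym/cvg_lim => //; exact: fg.
Qed.

Lemma measurable_sphere_joint (c : vec) (k : vec -> R) : continuous k ->
  measurable_fun setT (fun p : mR * mR * mR => k (sphere_param c p.2 p.1)).
Proof.
move=> ck; under eq_fun do rewrite sphere_paramE.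
have mp1 : measurable_fun setT (fun p : mR * mR * mR => p.1.1 : R).
  exact: (measurableT_comp measurable_fst measurable_fst).
have mp2 : measurable_fun setT (fun p : mR * mR * mR => p.1.2 : R).
  exact: (measurableT_comp measurable_snd measurable_fst).
have mp3 : measurable_fun setT (fun p : mR * mR * mR => p.2 : R).
  exact: measurable_snd.
have s1 := measurableT_comp measurable_sin mp1.
have s2 := measurableT_comp measurable_sin mp2.
have c1 := measurableT_comp measurable_cos mp1.
have c2 := measurableT_comp measurable_cos mp2.
have cst_r (a : R) : measurable_fun (setT : set (mR * mR * mR)) (cst a) by [].
exact: (measurable_vec3_comp ck
  (measurable_funD (cst_r (c 0%R i1)) (measurable_funM mp3 (measurable_funM s1 c2)))
  (measurable_funD (cst_r (c 0%R i2)) (measurable_funM mp3 (measurable_funM s1 s2)))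
  (measurable_funD (cst_r (c 0%R i3)) (measurable_funM mp3 c1))).
Qed.

Lemma measurable_sphere_joint_weight (c : vec) (k : vec -> R) : continuous k ->
  measurable_fun setT (fun p : mR * mR * mR =>
    k (sphere_param c p.2 p.1) * (p.2 ^+ 2 * sin p.1.1))%R.
Proof.
move=> ck.
have mp1 : measurable_fun setT (fun p : mR * mR * mR => p.1.1 : R).
  exact: (measurableT_comp measurable_fst measurable_fst).
have mp3 : measurable_fun setT (fun p : mR * mR * mR => p.2 : R).
  exact: measurable_snd.
exact: (measurable_funM (measurable_sphere_joint c ck)
  (measurable_funM (measurable_funX 2 mp3) (measurableT_comp measurable_sin mp1))).
Qed.

Lemma sin_rect_ge0 (q : R * R) : rect q -> (0 <= sin q.1)%R.
Proof. by move=> [/=]; rewrite in_itv/= => h _; exact: sin_ge0_pi. Qed.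

(** Monotone convergence along [uapprox]: once on the left, and on the right first in the angles and
    then in the radius. *)
Lemma spherical_upper (c : vec) (k : vec -> R) : continuous k -> (forall y, (0 <= k y)%R) ->
  \int[@leb3 R]_p (uind (vec3 p.1.1 p.1.2 p.2) * k (vec3 p.1.1 p.1.2 p.2))%:E =
  \int[mu]_(r in `]0%R, +oo[) \int[@leb2 R]_(q in rect)
    (uind (sphere_param c r q) * k (sphere_param c r q) * (r ^+ 2 * sin q.1))%:E.
Proof.
move=> ck k0.
pose km m y := (uapprox m y * k y)%R.
have ckm m : continuous (km m).
  by move=> y; apply: (@continuousM _ _ (uapprox m) k); [exact: uapprox_cont|exact: ck].
have km0 m y : (0 <= km m y)%R by rewrite mulr_ge0.
have kmnd y m n : (m <= n)%N -> (km m y <= km n y)%R.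
  by move=> mn; rewrite ler_wpM2r// uapprox_nd.
have kmcvg y : km m y @[m --> \oo] --> (uind y * k y)%R.
  by apply: cvgM; [exact: uapprox_cvg|exact: cvg_cst].
have L1 : (\int[@leb3 R]_p (km m (vec3 p.1.1 p.1.2 p.2))%:E) @[m --> \oo] -->
   \int[@leb3 R]_p (uind (vec3 p.1.1 p.1.2 p.2) * k (vec3 p.1.1 p.1.2 p.2))%:E.
  apply: (@ge0_monotone_cvg _ _ (@leb3 R) setT
    (fun m (p : mR * mR * mR) => (km m (vec3 p.1.1 p.1.2 p.2))%:E)
    (fun p : mR * mR * mR => (uind (vec3 p.1.1 p.1.2 p.2) * k (vec3 p.1.1 p.1.2 p.2))%:E)).
  - exact: measurableT.
  - by move=> m; apply/measurable_EFinP; exact: measurable_vec3_cont.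
  - by move=> m p _; rewrite lee_fin.
  - by move=> p _ m n mn; rewrite lee_fin; exact: kmnd.
  - by move=> p _; apply: cvg_EFin; [exact: nearW|exact: kmcvg].
pose w m r (q : mR * mR) := (km m (sphere_param c r q) * (r ^+ 2 * sin q.1))%R.
have w0 m r q : rect q -> (0 <= w m r q)%R.
  by move=> /sin_rect_ge0 h; rewrite /w mulr_ge0// mulr_ge0// sqr_ge0.
have wnd r q : rect q -> {homo (fun m => w m r q) : m n / (m <= n)%N >-> (m <= n)%R}.
  move=> /sin_rect_ge0 h m n mn; rewrite /w ler_wpM2r// ?kmnd//.
  by rewrite mulr_ge0// sqr_ge0.
have L2 : (\int[mu]_(r in `]0%R, +oo[) \int[@leb2 R]_(q in rect) (w m r q)%:E) @[m --> \oo] -->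
   \int[mu]_(r in `]0%R, +oo[) \int[@leb2 R]_(q in rect)
    (uind (sphere_param c r q) * k (sphere_param c r q) * (r ^+ 2 * sin q.1))%:E.
  apply: (@ge0_monotone_cvg _ _ mu `]0%R, +oo[%classic
     (fun m (r : mR) => \int[@leb2 R]_(q in rect) (w m r q)%:E)
     (fun r : mR => \int[@leb2 R]_(q in rect)
    (uind (sphere_param c r q) * k (sphere_param c r q) * (r ^+ 2 * sin q.1))%:E)).
  - exact: measurable_itv.
  - move=> m.
    have mw : measurable_fun (rect `*` (`]0%R, +oo[%classic : set mR)) (fun p : mR * mR * mR => (w m p.2 p.1)%:E).
      have : measurable_fun setT (fun p : mR * mR * mR => (w m p.2 p.1)%:E).
        by apply/measurable_EFinP; exact: measurable_sphere_joint_weight.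
      by apply: measurable_funS.
    have pw (p : mR * mR * mR) : (rect `*` (`]0%R, +oo[%classic : set mR)) p -> 0 <= (w m p.2 p.1)%:E.
      by move=> [hp _]; rewrite lee_fin w0.
    exact: (@measurable_tonelli_dom2 _ _ _ _ _ sleb2 rect _ _ measurable_rect (measurable_itv _) mw pw).
  - by move=> m r _; apply: integral_ge0 => q rq; rewrite lee_fin w0.
  - move=> r _ m n mn; apply: ge0_le_integral => //.
    + exact: measurable_rect.
    + by move=> q rq; rewrite lee_fin w0.
    + have mw : measurable_fun setT (fun q : mR * mR => (w m r q)%:E).
        by apply/measurable_EFinP; exact: measurable_sphere_weight.
      by apply: measurable_funS mw.
    + have mw : measurable_fun setT (fun q : mR * mR => (w n r q)%:E).
        by apply/measurable_EFinP; exact: measurable_sphere_weight.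
      by apply: measurable_funS mw.
    + by move=> q rq; rewrite lee_fin wnd.
  - move=> r _; apply: (@ge0_monotone_cvg _ _ (@leb2 R) rect (fun m q => (w m r q)%:E)).
    + exact: measurable_rect.
    + move=> m; have mw : measurable_fun setT (fun q : mR * mR => (w m r q)%:E).
        by apply/measurable_EFinP; exact: measurable_sphere_weight.
      by apply: measurable_funS mw.
    + by move=> m q rq; rewrite lee_fin w0.
    + by move=> q rq m n mn; rewrite lee_fin wnd.
    + move=> q _; apply: cvg_EFin; first exact: nearW.
      by apply: cvgM; [exact: kmcvg|exact: cvg_cst].
apply: (cvg_unique _ L1) => //.
rewrite [X in X @ _](_ : _ = (fun m => \int[mu]_(r in `]0%R, +oo[) \int[@leb2 R]_(q in rect) (w m r q)%:E)).
  exact: L2.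
by apply/funext => m; rewrite (spherical c (ckm m) (km0 m)).
Qed.

End SphericalUpper.

(** * Integrals over spheres *)

Section RealDominated.
Context {R : realType} d (T : measurableType d) (m : {measure set T -> \bar R}).

Lemma Rdominated_cvg (D : set T) (f : nat -> T -> R) (g G : T -> R) :
  measurable D -> (forall n, measurable_fun D (f n)) -> measurable_fun D g ->
  {ae m, forall x, D x -> f n x @[n --> \oo] --> g x} ->
  m.-integrable D (EFin \o G) -> (forall n x, D x -> `|f n x| <= G x) ->
  m.-integrable D (EFin \o g) /\
  \int[m]_(x in D) f n x @[n --> \oo] --> \int[m]_(x in D) g x.
Proof.
move=> mD mf mg fg iG fG.
have [] := @dominated_convergence _ _ _ m D mD (fun n => EFin \o f n) (EFin \o g) (EFin \o G).
- by move=> n; exact/measurable_EFinP.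
- exact/measurable_EFinP.
- apply: filterS fg => x h Dx; apply: cvg_EFin; [exact: nearW|exact: h].
- exact: iG.
- by apply: aeW => x n Dx; rewrite lee_fin fG.
move=> ig _ H; split => //.
apply: fine_cvg; rewrite fineK//.
exact: integrable_fin_num.
Qed.

Lemma integrable_bounded (D : set T) (f : T -> R) (M : R) :
  measurable D -> (m D < +oo)%E -> measurable_fun D f ->
  (forall x, D x -> `|f x| <= M) -> m.-integrable D (EFin \o f).
Proof.
move=> mD Dfin mf fM; apply: measurable_bounded_integrable => //.
exists M; split; first exact: num_real.
by move=> M' MM' x Dx; exact: (le_trans (fM x Dx) (ltW MM')).
Qed.
End RealDominated.

Section SphereMean.
Context {R : realType}.
Notation vec := 'rV[R]_3.
Notation mR := (measurableTypeR R).

Definition rect : set (mR * mR) := `[0, pi] `*` `[0, 2 * pi].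

Lemma leb2_rect : (@leb2 R rect < +oo)%E.
Proof.
have pi0 := pi_gt0 R; rewrite leb2_setX// !lebesgue_measure_itv/= !lte_fin.
by rewrite pi0 mulr_gt0// -!EFinB -EFinM ltry.
Qed.

Lemma enorm_scale (a : R) (u : vec) : enorm (a *: u) = `|a| * enorm u.
Proof.
rewrite /enorm !dotE !mxE -sqrtr_sqr -sqrtrM ?sqr_ge0//; congr Num.sqrt; ring.
Qed.

Lemma enormN (u : vec) : enorm (- u) = enorm u.
Proof. by rewrite -scaleN1r enorm_scale normrN1 mul1r. Qed.

Lemma enormB (u w : vec) : enorm (u - w) = enorm (w - u).
Proof. by rewrite -enormN opprB. Qed.

Lemma enorm_sphere (c : vec) (r : R) q : 0 <= r -> enorm (sphere_param c r q - c) = r.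
Proof.
move=> r0; rewrite /sphere_param addrC addKr enorm_scale ger0_norm//.
rewrite (_ : enorm _ = 1) ?mulr1//; apply/eqP.
rewrite -(@eqrXn2 _ 2)// ?enorm_ge0// expr1n; apply/eqP.
rewrite enorm_sqr !vec3E !exprMn -mulrDr cos2Dsin2 mulr1 addrC.
exact: cos2Dsin2.
Qed.

Lemma measurable_uind_comp d (T : measurableType d) (g : T -> vec) :
  measurable_fun setT (fun p => g p 0 i3) -> measurable_fun setT (fun p => uind (g p)).
Proof.
move=> mg; have mI : measurable_fun setT (\1_(`]0, +oo[%classic : set mR) : mR -> R).
  by apply: measurable_indic; exact: measurable_itv.
rewrite (_ : (fun p => _) = (\1_(`]0, +oo[%classic : set mR) : mR -> R) \o (fun p => g p 0 i3)).
  exact: measurableT_comp mI mg.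
by apply/funext => p; rewrite /uind/= indicE mem_setE in_itv/= andbT.
Qed.

Lemma measurable_uind_sphere (c : vec) (r : R) :
  measurable_fun (setT : set (mR * mR)) (fun q => uind (sphere_param c r q)).
Proof.
apply: measurable_uind_comp; under eq_fun do rewrite sphere_paramE vec3E.
have cst_r (a : R) : measurable_fun (setT : set (mR * mR)) (cst a) by [].
exact: (measurable_funD (cst_r _) (measurable_funM (cst_r r)
  (measurableT_comp measurable_cos (@measurable_fst _ _ mR mR)))).
Qed.

Lemma continuous_sphere_theta (x : vec) (r p : R) :
  continuous (fun t : R => sphere_param x r (t, p)).
Proof.
have -> : (fun t : R => sphere_param x r (t, p)) = fun t =>
    vec3 (x 0 i1 + r * (sin t * cos p)) (x 0 i2 + r * (sin t * sin p))
         (x 0 i3 + r * cos t).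
  by apply/funext => t; rewrite sphere_paramE.
have h (a b : R) (g : R -> R) : continuous g -> continuous (fun p => a + b * g p).
  move=> cg t; apply: cvgD; first exact: cvg_cst.
  by apply: cvgM; [exact: cvg_cst|exact: cg].
have hs : continuous (fun t : R => x 0 i1 + r * (sin t * cos p)).
  by under eq_fun do rewrite [sin _ * _]mulrC mulrA; apply: h; exact: continuous_sin.
have hc : continuous (fun t : R => x 0 i2 + r * (sin t * sin p)).
  by under eq_fun do rewrite [sin _ * _]mulrC mulrA; apply: h; exact: continuous_sin.
move=> t; apply: (@continuous_vec3 _ _ t (fun p => _) (fun p => _) (fun p => _)).
- exact: hs.
- exact: hc.
- by apply: h; exact: continuous_cos.
Qed.

Section Off.
Variables (c : vec) (k : vec -> R).
Hypothesis ck : forall y, y != c -> {for y, continuous k}.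

Lemma sphere_param_neq r q : 0 < r -> sphere_param c r q != c.
Proof.
move=> r0; rewrite -subr_eq0 -enorm_eq0 enorm_sphere ?gt_eqF//; exact: ltW.
Qed.

Lemma measurable_sphere_off (r : R) : 0 < r ->
  measurable_fun (setT : set (mR * mR)) (fun q => k (sphere_param c r q)).
Proof.
move=> r0.
rewrite (_ : (fun q => _) = fun q : mR * mR => k (sphere_param c r (q.1, q.2))); last first.
  by apply/funext => -[].
apply: (@measurable_fun_caratheodory _ _ mR (fun a b => k (sphere_param c r (a, b)))).
  move=> b a; apply: (@continuous_comp _ _ _ (fun a : R => sphere_param c r (a, b)) k).
    exact: continuous_sphere_theta.
  by apply: ck; exact: sphere_param_neq.
move=> a; apply: continuous_measurable_fun => b.
apply: (@continuous_comp _ _ _ (fun b : R => sphere_param c r (a, b)) k).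
  exact: continuous_sphere_angle.
by apply: ck; exact: sphere_param_neq.
Qed.

End Off.

(* Not normalised: the integral over the unit sphere of directions, without the
   factor r ^+ 2 and restricted to the directions that land in the half space. *)
Definition smean (c : vec) (Q : vec -> R) (r : R) : R :=
  \int[@leb2 R]_(q in rect) (uind (sphere_param c r q) * Q (sphere_param c r q) * sin q.1).

Lemma cvg_sphere_param (c : vec) (u : nat -> R) (r : R) q :
  u n @[n --> \oo] --> r -> sphere_param c (u n) q @[n --> \oo] --> sphere_param c r q.
Proof.
move=> ur; apply: (@cvg_comp _ _ _ u (fun r => sphere_param c r q) _ (nbhs r)) => //.
rewrite /sphere_param; apply: cvgD; first exact: cvg_cst.
by apply: cvgZr_tmp; exact: cvg_id.
Qed.

Lemma measurable_sin_rect : measurable_fun rect (fun q => sin q.1 : R).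
Proof.
have := measurableT_comp measurable_sin (@measurable_fst _ _ mR mR).
by apply: measurable_funS.
Qed.

End SphereMean.

Section SphereMeanLimits.
Context {R : realType}.
Notation vec := 'rV[R]_3.
Notation mu := (@lebesgue_measure R).
Notation mR := (measurableTypeR R).

Lemma continuous_uind (y : vec) : y 0 i3 != 0 -> {for y, continuous (@uind R)}.
Proof.
move=> y0; have cc := @continuous_coord R i3 y.
apply: (@cvg_near_cst _ _ (uind y) (@uind R) (nbhs y) _); rewrite /uind; have [y3|y3|e] := ltgtP 0 (y 0 i3).
- near=> z; have -> : 0 < z 0 i3 by near: z; exact: (cvgr_gt _ cc).
  by [].
- near=> z; have : z 0 i3 < 0 by near: z; exact: (cvgr_lt _ cc).
  by move=> /ltW; rewrite leNgt => /negbTE ->.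
- by rewrite -e eqxx in y0.
Unshelve. all: end_near. Qed.

Lemma integral_sin_rect : \int[@leb2 R]_(q in rect) sin q.1 = 4 * pi :> R.
Proof.
have pi0 := pi_gt0 R.
have isin : (\int[mu]_(t in `[0%R, pi]) (sin t)%:E = 2%:E)%E.
  rewrite (@continuous_FTC2 _ sin (fun t => - cos t) 0 pi)//.
  - by rewrite cospi cos0 opprK -EFinB; congr EFin; ring.
  - by apply: continuous_subspaceT => x; exact: continuous_sin.
  - have dc (x : R) : is_derive x 1 (fun t => - cos t) (sin x).
      by apply: (is_derive_eqv (line_deriveN (is_derive_cos x))); rewrite opprK.
    split.
    + by move=> x _; have [] := dc x.
    + by apply: cvg_at_right_filter; exact: is_derive_continuous (dc _).
    + by apply: cvg_at_left_filter; exact: is_derive_continuous (dc _).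
  - move=> x _; rewrite derive1E; apply: derive_val.
    by apply: (is_derive_eqv (line_deriveN (is_derive_cos x))); rewrite opprK.
rewrite /Rintegral.
have ms : measurable_fun (rect : set (mR * mR)) (fun q => (sin q.1 : R)%:E).
  by apply/measurable_EFinP; exact: measurable_sin_rect.
have h0 q : rect q -> (0 <= (sin q.1 : R)%:E)%E by move=> rq; rewrite lee_fin sin_rect_ge0.
have -> : (\int[@leb2 R]_(q in rect) (sin q.1)%:E =
    \int[mu]_(t in `[0%R, pi]) \int[mu]_(p in `[0%R, (2 * pi)%R]) (sin t)%:E)%E.
  exact: (@tonelli_dom1 _ _ _ _ _ sleb1 sleb1 _ _ (fun q : mR * mR => (sin q.1)%:E)
   (measurable_itv _) (measurable_itv _) ms h0).
under eq_integral do rewrite integral_cst//= lebesgue_measure_itv/= lte_fin mulr_gt0// -EFinB subr0.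
rewrite ge0_integralZr//=.
- by rewrite isin -EFinM/=; ring.
- by apply: measurable_EFin_cont; exact: continuous_sin.
- by move=> t; rewrite in_itv/= => h; rewrite lee_fin sin_ge0_pi.
- by rewrite lee_fin mulr_ge0// ltW.
Qed.

Variables (c : vec) (Q : vec -> R) (t M : R).
Hypothesis t0 : 0 < t.
Hypothesis cQ : forall y, y != c -> {for y, continuous Q}.
Hypothesis QM : forall y, 0 < enorm (y - c) <= t -> `|Q y| <= M.

Lemma sphere_integrand_le (r : R) q : rect q -> 0 < r <= t ->
  `|uind (sphere_param c r q) * Q (sphere_param c r q) * sin q.1| <= M.
Proof.
move=> rq /andP[r0 rt].
have QMs : `|Q (sphere_param c r q)| <= M.
  by apply: QM; rewrite enorm_sphere ?r0// ltW.
rewrite !normrM (ger0_norm (uind_ge0 _)) (ger0_norm (sin_rect_ge0 rq)).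
apply: le_trans QMs; apply: (@le_trans _ _ (uind (sphere_param c r q) * `|Q (sphere_param c r q)|)).
  by rewrite ler_piMr ?sin_le1// mulr_ge0 ?uind_ge0.
by rewrite ler_piMl// uind_le1.
Qed.

Lemma measurable_sphere_integrand (r : R) : 0 < r ->
  measurable_fun rect (fun q : mR * mR =>
    uind (sphere_param c r q) * Q (sphere_param c r q) * sin q.1).
Proof.
move=> r0; apply: (measurable_funM _ measurable_sin_rect).
apply: (@measurable_funS _ _ _ _ setT) => //.
exact: (measurable_funM (measurable_uind_sphere c r) (measurable_sphere_off cQ r0)).
Qed.

Lemma integrable_sphere_integrand (r : R) : 0 < r <= t ->
  (@leb2 R).-integrable rect (EFin \o (fun q : mR * mR =>
    uind (sphere_param c r q) * Q (sphere_param c r q) * sin q.1)).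
Proof.
move=> /andP[r0 rt]; apply: (@integrable_bounded _ _ _ _ _ _ M).
- exact: measurable_rect.
- exact: leb2_rect.
- exact: measurable_sphere_integrand.
- by move=> q rq; apply: sphere_integrand_le => //; rewrite r0.
Qed.

(** The sphere meets the boundary plane in at most one latitude cos theta = - c_3 / r, hence in a
    null segment of the angular rectangle. This is where [uind] jumps, and the only obstacle to the
    continuity of [smean] in r. *)
Lemma equator_negligible (r : R) : 0 < r ->
  (@leb2 R).-negligible [set q | rect q /\ sphere_param c r q 0 i3 = 0].
Proof.
move=> r0.
have [[t1 t1I e1]|noz] := pselect (exists2 t1, 0 <= t1 <= pi & c 0 i3 + r * cos t1 = 0).
  exists ([set t1] `*` `[0, 2 * pi]%classic); split.
  - by apply: measurableX => //; exact: measurable_itv.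
  - by rewrite [LHS]leb2_setX// lebesgue_measure_set1 mul0e.
  - move=> [a b] [[/= aI bI]]; rewrite sphere_paramE vec3E/= => e; split => //=.
    move: aI; rewrite in_itv/= => aI.
    apply: (@cos_inj R); rewrite ?in_itv//.
    by move: e; rewrite -e1 => /addrI /(mulfI (lt0r_neq0 r0)).
exists set0; split => // -[a b] [[/= aI bI]]; rewrite sphere_paramE vec3E/= => e.
by apply: noz; exists a => //; move: aI; rewrite in_itv.
Qed.

(** Dominated convergence in the angles; pointwise convergence is checked off the equator, where
    [uind] is continuous along the sphere. *)
Lemma smean_cvg (u : nat -> R) (r : R) : (forall n, 0 < u n <= t) -> 0 < r <= t ->
  u n @[n --> \oo] --> r -> smean c Q (u n) @[n --> \oo] --> smean c Q r.
Proof.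
move=> ut rt ur; have [r0 _] := andP rt.
have [] := @Rdominated_cvg R _ _ (@leb2 R) rect
  (fun n q => uind (sphere_param c (u n) q) * Q (sphere_param c (u n) q) * sin q.1)
  (fun q => uind (sphere_param c r q) * Q (sphere_param c r q) * sin q.1) (cst M).
- exact: measurable_rect.
- by move=> n; apply: measurable_sphere_integrand; have /andP[] := ut n.
- exact: measurable_sphere_integrand.
- apply: negligibleS (equator_negligible r0) => q /= nq.
  apply: contrapT => ns; apply: nq => rq.
  have s3 : sphere_param c r q 0 i3 != 0 by apply/eqP => e; apply: ns.
  have cs := cvg_sphere_param (c := c) (q := q) ur.
  apply: cvgM; last exact: cvg_cst.
  apply: cvgM.
    exact: (cvg_comp _ _ cs (continuous_uind s3)).
  by apply: (cvg_comp _ _ cs); apply: cQ; exact: sphere_param_neq.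
- apply: (@integrable_bounded _ _ _ _ _ _ `|M|) => //; [exact: measurable_rect|exact: leb2_rect].
- by move=> n q rq; apply: sphere_integrand_le.
- by [].
Qed.

(** Small spheres about a centre off the plane lie on one side of it, so [uind] tends to its value
    at c. This factor later separates the centre x, which yields the field, from bar x, which yields
    0. *)
Lemma smean_cvg0 (u : nat -> R) (q0 : R) : (forall n, 0 < u n <= t) ->
  c 0 i3 != 0 -> Q y @[y --> c^'] --> q0 ->
  u n @[n --> \oo] --> 0 -> smean c Q (u n) @[n --> \oo] --> uind c * q0 * (4 * pi).
Proof.
move=> ut c3 Qc u0.
have [] := @Rdominated_cvg R _ _ (@leb2 R) rect
  (fun n q => uind (sphere_param c (u n) q) * Q (sphere_param c (u n) q) * sin q.1)
  (fun q => uind c * q0 * sin q.1) (cst M).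
- exact: measurable_rect.
- by move=> n; apply: measurable_sphere_integrand; have /andP[] := ut n.
- by apply: measurable_funM => //; exact: measurable_sin_rect.
- apply: aeW => q rq.
  have cs := cvg_sphere_param (c := c) (q := q) u0.
  have s0 : sphere_param c 0 q = c by rewrite /sphere_param scale0r addr0.
  rewrite s0 in cs.
  apply: cvgM; last exact: cvg_cst.
  apply: cvgM; first exact: (cvg_comp _ _ cs (continuous_uind c3)).
  apply: (cvg_comp _ _ _ Qc) => A.
  rewrite /dnbhs /within/= => /cs; rewrite /nbhs/= => -[N _ NA].
  exists N => // n /NA /=; apply; apply: sphere_param_neq.
  by have /andP[] := ut n.
- apply: (@integrable_bounded _ _ _ _ _ _ `|M|) => //; [exact: measurable_rect|exact: leb2_rect].
- by move=> n q rq; apply: sphere_integrand_le.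
move=> _; rewrite RintegralZl ?integral_sin_rect//.
  exact: measurable_rect.
apply: (@integrable_bounded _ _ _ _ _ _ 1); [exact: measurable_rect|exact: leb2_rect|exact: measurable_sin_rect|].
by move=> q rq; rewrite ger0_norm ?sin_rect_ge0// sin_le1.
Qed.

Lemma smean_near0 (q0 : R) : c 0 i3 != 0 -> Q y @[y --> c^'] --> q0 ->
  smean c Q r @[r --> 0^'+] --> uind c * q0 * (4 * pi).
Proof.
move=> c3 Qc; apply/cvg_at_rightP => u [u0 ucvg].
(* The truncation only modifies finitely many terms and keeps every radius in the range where [Q] is
   bounded. *)
pose u' n := Num.min (u n) t.
have e : \forall n \near \oo, smean c Q (u' n) = smean c Q (u n).
  have : \forall n \near \oo, u n < t by apply: (cvgr_lt 0).
  by apply: filterS => n unt; rewrite /u' min_l// ltW.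
apply: cvg_trans; first exact: near_eq_cvg e.
apply: smean_cvg0 => //.
  by move=> n; rewrite lt_min u0 t0/= ge_min lexx orbT.
apply: cvg_trans (ucvg); apply: near_eq_cvg.
have : \forall n \near \oo, u n < t by apply: (cvgr_lt 0).
by apply: filterS => n unt; rewrite /u' min_l// ltW.
Qed.

Lemma smean_neart : smean c Q r @[r --> t^'-] --> smean c Q t.
Proof.
apply/cvg_at_leftP => u [ut ucvg].
(* Keeps all radii positive; eventually it changes nothing because the sequence tends to t > t/2. *)
pose u' n := Num.max (u n) (t / 2).
have h : \forall n \near \oo, u' n = u n.
  have t2 : t / 2 < t by have := t0; lra.
  have : \forall n \near \oo, t / 2 < u n by apply: (cvgr_gt t).
  by apply: filterS => n unt; rewrite /u' max_l// ltW.
have e : \forall n \near \oo, smean c Q (u' n) = smean c Q (u n).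
  by apply: filterS h => n ->.
apply: cvg_trans; first exact: near_eq_cvg e.
apply: smean_cvg.
- by move=> n; rewrite lt_max ge_max; have := ut n; have := t0; lra.
- by rewrite t0 lexx.
- by apply: cvg_trans ucvg; apply: near_eq_cvg; apply: filterS h => n ->.
Qed.

End SphereMeanLimits.

(** * Thin shells *)

Section Shells.
Context {R : realType}.
Notation vec := 'rV[R]_3.
Notation mu := (@lebesgue_measure R).
Notation mR := (measurableTypeR R).

Lemma continuous_dist (c : vec) : continuous (fun y : vec => enorm (y - c)).
Proof.
move=> y; apply: (@continuous_comp _ _ _ (fun y : vec => y + - c) (@enorm R)).
  exact: continuous_addr.
exact: continuous_enorm.
Qed.

Lemma near_dist_lt (c y : vec) (a : R) : enorm (y - c) < a ->
  \forall z \near y, enorm (z - c) < a.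
Proof. by move=> h; have cd := @continuous_dist c y; exact: (cvgr_lt _ cd). Qed.

Lemma near_dist_gt (c y : vec) (a : R) : a < enorm (y - c) ->
  \forall z \near y, a < enorm (z - c).
Proof. by move=> h; have cd := @continuous_dist c y; exact: (cvgr_gt _ cd). Qed.

Lemma dist_gt0 (c y : vec) : (0 < enorm (y - c)) = (y != c).
Proof. by rewrite enorm_gt0 subr_eq0. Qed.

(** A weight that vanishes near c removes the singularity at c, so the product is continuous on the
    whole space. *)
Lemma cut_continuous (c : vec) (a : R) (w f : vec -> R) : 0 < a ->
  (forall y, enorm (y - c) < a -> w y = 0) -> continuous w ->
  (forall y, y != c -> {for y, continuous f}) -> continuous (fun y => w y * f y).
Proof.
move=> a0 wa cw cf y; have [ya|ya] := ltP (enorm (y - c)) a.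
  apply: (@cvg_near_cst _ _ (w y * f y) (fun y => w y * f y) (nbhs y) _).
  by apply: filterS (near_dist_lt ya) => z za; rewrite !wa// !mul0r.
apply: (@continuousM _ _ w f); first exact: cw.
by apply: cf; rewrite -dist_gt0 (lt_le_trans a0).
Qed.

Lemma measurable_spherical_upper (c : vec) (k : vec -> R) : continuous k ->
  (forall y, 0 <= k y) ->
  measurable_fun (`]0%R, +oo[%classic : set mR) (fun r => \int[@leb2 R]_(q in rect)
    (uind (sphere_param c r q) * k (sphere_param c r q) * (r ^+ 2 * sin q.1))%:E)%E.
Proof.
move=> ck k0.
have mu' : measurable_fun setT (fun p : mR * mR * mR => uind (sphere_param c p.2 p.1)).
  apply: measurable_uind_comp; under eq_fun do rewrite sphere_paramE vec3E.
  have mp1 : measurable_fun setT (fun p : mR * mR * mR => p.1.1 : R).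
    exact: (measurableT_comp measurable_fst measurable_fst).
  have mp3 : measurable_fun setT (fun p : mR * mR * mR => p.2 : R).
    exact: measurable_snd.
  have cst_r (a : R) : measurable_fun (setT : set (mR * mR * mR)) (cst a) by [].
  exact: (measurable_funD (cst_r _) (measurable_funM mp3 (measurableT_comp measurable_cos mp1))).
have mw : measurable_fun (rect `*` (`]0%R, +oo[%classic : set mR)) (fun p : mR * mR * mR =>
    (uind (sphere_param c p.2 p.1) * k (sphere_param c p.2 p.1) * (p.2 ^+ 2 * sin p.1.1))%:E).
  have m1 := measurable_funM mu' (measurable_sphere_joint_weight c ck).
  have : measurable_fun setT (fun p : mR * mR * mR =>
    (uind (sphere_param c p.2 p.1) * k (sphere_param c p.2 p.1) * (p.2 ^+ 2 * sin p.1.1))%:E).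
    apply/measurable_EFinP; rewrite (_ : (fun p => _) = (fun p : mR * mR * mR =>
      uind (sphere_param c p.2 p.1) * (k (sphere_param c p.2 p.1) * (p.2 ^+ 2 * sin p.1.1)))) //.
    by apply/funext => p; rewrite !mulrA.
  by apply: measurable_funS.
have pw (p : mR * mR * mR) : (rect `*` (`]0%R, +oo[%classic : set mR)) p ->
    (0 <= (uind (sphere_param c p.2 p.1) * k (sphere_param c p.2 p.1) * (p.2 ^+ 2 * sin p.1.1))%:E)%E.
  move=> [hp _]; rewrite lee_fin; apply: mulr_ge0; first by rewrite mulr_ge0 ?uind_ge0.
  by apply: mulr_ge0; [exact: sqr_ge0|exact: sin_rect_ge0 hp].
exact: (@measurable_tonelli_dom2 _ _ _ _ _ sleb2 rect _ _ measurable_rect (measurable_itv _) mw pw).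
Qed.

Section Weight.
Variables (c : vec) (t M : R) (k : R -> R) (a : R).
Hypotheses (t0 : 0 < t) (a0 : 0 < a).
Hypothesis ck : continuous k.
Hypothesis k0 : forall r, 0 <= r -> 0 <= k r.
Hypothesis ksupp : forall r, 0 <= r -> k r != 0 -> a <= r <= t.
Hypothesis k1 : (\int[mu]_(r in `]0%R, +oo[) (k r)%:E = 1)%E.

(** The division by r^2 cancels the Jacobian: over the half space this function integrates to the
    integral of k(r) times [smean c Q r], a radial average of spherical integrals. *)
Definition shell (Q : vec -> R) (y : vec) : R :=
  k (enorm (y - c)) * (Q y / enorm (y - c) ^+ 2).

Section Density.
Variable Q : vec -> R.
Hypothesis cQ : forall y, y != c -> {for y, continuous Q}.
Hypothesis QM : forall y, 0 < enorm (y - c) <= t -> `|Q y| <= M.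

Lemma continuous_shell : continuous (shell Q).
Proof.
apply: (@cut_continuous c a (fun y => k (enorm (y - c)))) => //.
- move=> y ya; apply/eqP; apply: contraTT ya => kn0.
  by have /andP[h _] := ksupp (enorm_ge0 _) kn0; rewrite -leNgt.
- by move=> y; apply: (@continuous_comp _ _ _ (fun y : vec => enorm (y - c)) k);
    [exact: continuous_dist|exact: ck].
- move=> y yc; have yc' : 0 < enorm (y - c) by rewrite dist_gt0.
  apply: (@continuousM _ _ Q (fun y => (enorm (y - c) ^+ 2)^-1)); first exact: cQ.
  apply: continuousV; first by rewrite expf_neq0// gt_eqF.
  apply: (@continuous_comp _ _ _ (fun y : vec => enorm (y - c)) (fun x => x ^+ 2)).
    exact: continuous_dist.
  exact: exprn_continuous.
Qed.

Lemma measurable_uind_shell : measurable_fun setT (fun p : mR * mR * mR =>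
  uind (vec3 p.1.1 p.1.2 p.2) * shell Q (vec3 p.1.1 p.1.2 p.2)).
Proof. exact: (measurable_funM measurable_uind (measurable_vec3_cont continuous_shell)). Qed.

Hypothesis Q0 : forall y, 0 < enorm (y - c) <= t -> 0 <= Q y.

Lemma shell_ge0 y : 0 <= shell Q y.
Proof.
rewrite /shell; have [->|kn0] := eqVneq (k (enorm (y - c))) 0; first by rewrite mul0r.
have /andP[h1 h2] := ksupp (enorm_ge0 _) kn0.
rewrite mulr_ge0 ?k0 ?enorm_ge0// divr_ge0 ?sqr_ge0// Q0// h2 andbT.
exact: lt_le_trans h1.
Qed.

(** The integral is the average of [smean c Q] against the unit mass [k], so it inherits any bound
    valid on the support of [k]. With [Q] non-negative, Tonelli gives integrability and value
    together. *)
Lemma shell_nonneg (S0 e : R) : 0 <= e ->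
  (forall r, 0 <= r -> k r != 0 -> `|smean c Q r - S0| <= e) ->
  (@leb3 R).-integrable setT (EFin \o (fun p : mR * mR * mR =>
    uind (vec3 p.1.1 p.1.2 p.2) * shell Q (vec3 p.1.1 p.1.2 p.2))) /\
  `|\int[@leb3 R]_p (uind (vec3 p.1.1 p.1.2 p.2) * shell Q (vec3 p.1.1 p.1.2 p.2)) - S0| <= e.
Proof.
move=> e0 SS.
have E0 r : 0 < r -> ((k r * smean c Q r)%:E = \int[@leb2 R]_(q in rect)
    (uind (sphere_param c r q) * shell Q (sphere_param c r q) * (r ^+ 2 * sin q.1))%:E)%E.
  move=> r0.
  have Ek q : uind (sphere_param c r q) * shell Q (sphere_param c r q) * (r ^+ 2 * sin q.1) =
      k r * (uind (sphere_param c r q) * Q (sphere_param c r q) * sin q.1).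
    rewrite /shell enorm_sphere ?ltW//; field; exact: lt0r_neq0.
  under [RHS]eq_integral do rewrite Ek.
  have [->|kn0] := eqVneq (k r) 0.
    by rewrite mul0r; apply/esym/integral0_eq => q _; rewrite mul0r.
  have /andP[_ rt] := ksupp (ltW r0) kn0.
  have iq : (@leb2 R).-integrable rect (EFin \o (fun q : mR * mR =>
      uind (sphere_param c r q) * Q (sphere_param c r q) * sin q.1)).
    by apply: (integrable_sphere_integrand cQ QM); rewrite r0.
  have fq := integrable_fin_num measurable_rect iq.
  rewrite /smean /Rintegral EFinM fineK; last exact: fq.
  by rewrite -integralZl//; exact: measurable_rect.
have mS : measurable_fun (`]0%R, +oo[%classic : set mR) (fun r => (k r * smean c Q r)%:E).
  apply: eq_measurable_fun (measurable_spherical_upper c continuous_shell shell_ge0).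
  by move=> r; rewrite inE/= in_itv/= andbT => r0; rewrite E0.
have E1 : (\int[@leb3 R]_p (uind (vec3 p.1.1 p.1.2 p.2) * shell Q (vec3 p.1.1 p.1.2 p.2))%:E =
    \int[mu]_(r in `]0%R, +oo[) (k r * smean c Q r)%:E)%E.
  rewrite (spherical_upper c continuous_shell shell_ge0).
  apply: eq_integral => r; rewrite inE/= in_itv/= andbT => r0.
  by rewrite E0.
have b1 r : 0 < r -> k r * (S0 - e) <= k r * smean c Q r <= k r * (S0 + e).
  move=> r0; have [->|kn0] := eqVneq (k r) 0; first by rewrite !mul0r lexx.
  have kp : 0 < k r by rewrite lt_neqAle eq_sym kn0 k0// ltW.
  have := SS r (ltW r0) kn0; rewrite ler_norml !ler_pM2l//; lra.
have Sm0 r : 0 < r -> 0 <= k r * smean c Q r.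
  move=> r0; rewrite -lee_fin E0//; apply: integral_ge0 => q rq.
  rewrite lee_fin; apply: mulr_ge0; first by rewrite mulr_ge0 ?uind_ge0 ?shell_ge0.
  by apply: mulr_ge0; [exact: sqr_ge0|exact: sin_rect_ge0 rq].
have mk : measurable_fun (`]0%R, +oo[%classic : set mR) (EFin \o k).
  exact: measurable_EFin_cont.
have I1 (s : R) : 0 <= s -> (\int[mu]_(r in `]0%R, +oo[) (k r * s)%:E = s%:E)%E.
  move=> s0; under eq_integral do rewrite EFinM.
  rewrite ge0_integralZr//; first by rewrite k1 mul1e.
  by move=> r; rewrite /= in_itv/= andbT => r0; rewrite lee_fin k0// ltW.
have up s : (forall r, 0 < r -> k r * smean c Q r <= k r * s) -> 0 <= s ->
    (\int[mu]_(r in `]0%R, +oo[) (k r * smean c Q r)%:E <= s%:E)%E.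
  move=> h s0; rewrite -(I1 s s0); apply: ge0_le_integral => //.
  - by move=> r; rewrite /= in_itv/= andbT => r0; rewrite lee_fin Sm0.
  - by apply/measurable_EFinP; apply: measurable_funM => //; exact/measurable_EFinP.
  - by move=> r; rewrite /= in_itv/= andbT => r0; rewrite lee_fin h.
have low s : (forall r, 0 < r -> k r * s <= k r * smean c Q r) -> 0 <= s ->
    (s%:E <= \int[mu]_(r in `]0%R, +oo[) (k r * smean c Q r)%:E)%E.
  move=> h s0; rewrite -{1}(I1 s s0); apply: ge0_le_integral => //.
  - by move=> r; rewrite /= in_itv/= andbT => r0; rewrite lee_fin mulr_ge0// k0// ltW.
  - by apply/measurable_EFinP; apply: measurable_funM => //; exact/measurable_EFinP.
  - by move=> r; rewrite /= in_itv/= andbT => r0; rewrite lee_fin h.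
(* Otherwise the inequalities 0 <= k * smean <= k * (S0 + e) would force k = 0 on the half-line,
   against its total mass 1. *)
have Se : 0 <= S0 + e.
  rewrite leNgt; apply/negP => neg.
  have : (\int[mu]_(r in `]0%R, +oo[) (k r)%:E <= 0)%E.
    rewrite le_eqVlt; apply/orP; left; apply/eqP; apply: integral0_eq => r.
    rewrite /= in_itv/= andbT => r0; congr EFin; apply/eqP.
    have := b1 r r0; have := Sm0 r r0; have := k0 (ltW r0) => k0r s1 /andP[_ s2].
    rewrite eq_le k0r andbT leNgt; apply/negP => kr.
    have : k r * (S0 + e) < 0 by rewrite pmulr_rlt0.
    by rewrite ltNge (le_trans s1 s2).
  by rewrite k1 lee_fin; lra.
have U := up _ (fun r r0 => proj2 (andP (b1 r r0))) Se.
have I0 : (0 <= \int[mu]_(r in `]0%R, +oo[) (k r * smean c Q r)%:E)%E.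
  by apply: integral_ge0 => r; rewrite /= in_itv/= andbT => r0; rewrite lee_fin Sm0.
have fI : (\int[mu]_(r in `]0%R, +oo[) (k r * smean c Q r)%:E)%E \is a fin_num.
  by rewrite ge0_fin_numE// (le_lt_trans U)// ltry.
split.
  apply/integrableP; split; first by apply/measurable_EFinP; exact: measurable_uind_shell.
  under eq_integral => p _.
    rewrite gee0_abs; last by rewrite lee_fin mulr_ge0 ?uind_ge0 ?shell_ge0.
    over.
  by rewrite E1 (le_lt_trans U)// ltry.
rewrite /Rintegral E1 ler_norml; apply/andP; split; last first.
  by rewrite lerBlDl -lee_fin fineK.
rewrite lerBrDl -lee_fin fineK//.
have [Sn|Sn] := leP 0 (S0 - e); first by apply: (low _ (fun r r0 => proj1 (andP (b1 r r0)))).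
by apply: (le_trans _ I0); rewrite lee_fin ltW.
Qed.

End Density.
End Weight.
End Shells.

Section ShellLimits.
Context {R : realType}.
Notation vec := 'rV[R]_3.
Notation mu := (@lebesgue_measure R).
Notation mR := (measurableTypeR R).

Variables (c : vec) (t M : R) (Q : vec -> R).
Hypotheses (t0 : 0 < t) (M0 : 0 <= M).
Hypothesis cQ : forall y, y != c -> {for y, continuous Q}.
Hypothesis QM : forall y, 0 < enorm (y - c) <= t -> `|Q y| <= M.

Let cM y : y != c -> {for y, continuous (cst M : vec -> R)}.
Proof. by move=> _; exact: cst_continuous. Qed.

Let bM (y : vec) : 0 < enorm (y - c) <= t -> `|cst M y| <= M.
Proof. by move=> _; rewrite ger0_norm. Qed.

(** Signed [Q] is reduced to the non-negative case by writing it as (Q + M) - M; the errors 2e and e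
    add up to 3e. *)
Lemma shell_approx (k : R -> R) (a S0 S1 e : R) : 0 < a -> continuous k ->
  (forall r, 0 <= r -> 0 <= k r) -> (forall r, 0 <= r -> k r != 0 -> a <= r <= t) ->
  (\int[mu]_(r in `]0%R, +oo[) (k r)%:E = 1)%E ->
  (forall r, 0 <= r -> k r != 0 ->
    `|smean c Q r - S0| <= e /\ `|smean c (cst M) r - S1| <= e) ->
  0 <= e ->
  (@leb3 R).-integrable setT (EFin \o (fun p : mR * mR * mR =>
    uind (vec3 p.1.1 p.1.2 p.2) * shell c k Q (vec3 p.1.1 p.1.2 p.2))) /\
  `|\int[@leb3 R]_p (uind (vec3 p.1.1 p.1.2 p.2) * shell c k Q (vec3 p.1.1 p.1.2 p.2)) - S0| <= 3 * e.
Proof.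
move=> a0 ck k0 ks k1 SS e0.
have cP y : y != c -> {for y, continuous (fun y => Q y + M)}.
  by move=> yc; apply: (@continuousD _ _ _ Q (cst M)); [exact: cQ|exact: cM].
have [iM IM] : (@leb3 R).-integrable setT (EFin \o (fun p : mR * mR * mR =>
    uind (vec3 p.1.1 p.1.2 p.2) * shell c k (cst M) (vec3 p.1.1 p.1.2 p.2))) /\
  `|\int[@leb3 R]_p (uind (vec3 p.1.1 p.1.2 p.2) * shell c k (cst M) (vec3 p.1.1 p.1.2 p.2)) - S1| <= e.
  apply: (shell_nonneg (M := M) a0 ck k0 ks k1 cM bM) => //.
  by move=> r r0 kr; have [] := SS r r0 kr.
have [iP IP] : (@leb3 R).-integrable setT (EFin \o (fun p : mR * mR * mR =>
    uind (vec3 p.1.1 p.1.2 p.2) * shell c k (fun y => Q y + M) (vec3 p.1.1 p.1.2 p.2))) /\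
  `|\int[@leb3 R]_p (uind (vec3 p.1.1 p.1.2 p.2) * shell c k (fun y => Q y + M) (vec3 p.1.1 p.1.2 p.2)) - (S0 + S1)| <= 2 * e.
  apply: (shell_nonneg (M := M + M) a0 ck k0 ks k1 cP).
  - by move=> y hy; rewrite (le_trans (ler_normD _ _))// lerD ?QM// ger0_norm.
  - by move=> y hy; have := QM hy; rewrite ler_norml; lra.
  - lra.
  - move=> r r0 kr; have [s1 s2] := SS r r0 kr.
    have rt : 0 < r <= t by have := ks r r0 kr; lra.
    have -> : smean c (fun y => Q y + M) r = smean c Q r + smean c (cst M) r.
      rewrite /smean -RintegralD.
      + by apply: eq_Rintegral => q _; rewrite -mulrDl -mulrDr.
      + exact: measurable_rect.
      + exact: (integrable_sphere_integrand cQ QM).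
      + exact: (integrable_sphere_integrand cM bM).
    by move: s1 s2; rewrite !ler_norml; lra.
have E (p : mR * mR * mR) : uind (vec3 p.1.1 p.1.2 p.2) * shell c k Q (vec3 p.1.1 p.1.2 p.2) =
   uind (vec3 p.1.1 p.1.2 p.2) * shell c k (fun y => Q y + M) (vec3 p.1.1 p.1.2 p.2) -
   uind (vec3 p.1.1 p.1.2 p.2) * shell c k (cst M) (vec3 p.1.1 p.1.2 p.2).
  by rewrite /shell/=; ring.
have iB := integrableB measurableT iP iM.
split.
  by apply: eq_integrable iB => // p _; rewrite /= -EFinB E.
rewrite (eq_Rintegral _ (fun p _ => E p)) RintegralB//.
by move: IM IP; rewrite !ler_norml; lra.
Qed.

(* Derivatives in r of the two factors of the radial cutoff: unit masses
   concentrating at r = 0 and r = t respectively. *)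
Definition bump_in (n : nat) (r : R) : R := 2 * r * n.+1%:R * smoothstep' (n.+1%:R * r ^+ 2).
Definition bump_out (n : nat) (r : R) : R := 2 * r * n.+1%:R * smoothstep' (n.+1%:R * (t ^+ 2 - r ^+ 2)).

Lemma is_derive_bump_in n (r : R) :
  is_derive r 1 (fun r => smoothstep (n.+1%:R * r ^+ 2)) (bump_in n r).
Proof.
have h : is_derive r 1 (fun r : R => n.+1%:R * r ^+ 2) (n.+1%:R * (2 * r * 1)).
  exact: (line_deriveMl _ (line_derive_sqr (line_derive_id _))).
by apply: (is_derive_eqv (line_derive_comp (is_derive_smoothstep _) h)); rewrite /bump_in; ring.
Qed.

Lemma is_derive_bump_out n (r : R) :
  is_derive r 1 (fun r => - smoothstep (n.+1%:R * (t ^+ 2 - r ^+ 2))) (bump_out n r).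
Proof.
have h : is_derive r 1 (fun r : R => n.+1%:R * (t ^+ 2 - r ^+ 2)) (n.+1%:R * (0 - 2 * r * 1)).
  exact: (line_deriveMl _ (line_deriveB (line_derive_cst _ _) (line_derive_sqr (line_derive_id _)))).
by apply: (is_derive_eqv (line_deriveN (line_derive_comp (is_derive_smoothstep _) h))); rewrite /bump_out; ring.
Qed.

Let continuous_lin (n : nat) (r : R) : {for r, continuous (fun r : R => 2 * r * n.+1%:R)}.
Proof. exact: (is_derive_continuous (line_deriveM (line_deriveMl 2 (line_derive_id r)) (line_derive_cst r n.+1%:R))). Qed.

Lemma continuous_bump_in n : continuous (bump_in n).
Proof.
move=> r; apply: (@continuousM _ _ (fun r : R => 2 * r * n.+1%:R)
  (fun r : R => smoothstep' (n.+1%:R * r ^+ 2))); first exact: continuous_lin.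
apply: (@continuous_comp _ _ _ (fun r : R => n.+1%:R * r ^+ 2) smoothstep'); last exact: continuous_smoothstep'.
exact: is_derive_continuous (line_deriveMl n.+1%:R (line_derive_sqr (line_derive_id r))).
Qed.

Lemma continuous_bump_out n : continuous (bump_out n).
Proof.
move=> r; apply: (@continuousM _ _ (fun r : R => 2 * r * n.+1%:R)
  (fun r : R => smoothstep' (n.+1%:R * (t ^+ 2 - r ^+ 2)))); first exact: continuous_lin.
apply: (@continuous_comp _ _ _ (fun r : R => n.+1%:R * (t ^+ 2 - r ^+ 2)) smoothstep'); last exact: continuous_smoothstep'.
exact: is_derive_continuous (line_deriveMl n.+1%:R (line_deriveB (line_derive_cst r _) (line_derive_sqr (line_derive_id r)))).
Qed.

Lemma bump_in_ge0 n r : 0 <= r -> 0 <= bump_in n r.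
Proof. by move=> r0; rewrite !mulr_ge0// smoothstep'_ge0. Qed.

Lemma bump_out_ge0 n r : 0 <= r -> 0 <= bump_out n r.
Proof. by move=> r0; rewrite !mulr_ge0// smoothstep'_ge0. Qed.

Lemma integral_bump (F k : R -> R) : (forall r : R, is_derive r 1 F (k r)) -> continuous k ->
  (forall r, t < r -> k r = 0) ->
  (\int[mu]_(r in `]0%R, +oo[) (k r)%:E = (F t - F 0)%:E)%E.
Proof.
move=> dF ck kt.
have mk (D : set R) : measurable_fun (D : set mR) (EFin \o k) by exact: measurable_EFin_cont.
rewrite (@integral_itv_obnd_cbnd _ _ _ (EFin \o k)); last exact: mk.
rewrite -(_ : (\int[mu]_(r in `[0%R, t]) (k r)%:E = (F t - F 0)%:E)%E).
  rewrite integral_mkcond [RHS]integral_mkcond; apply: eq_integral => r _.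
  rewrite !patchE !mem_setE !in_itv/= andbT.
  by have [r0|r0] := leP 0 r => //=; have [rt|rt] := leP r t => //=; rewrite kt.
rewrite EFinB; apply: continuous_FTC2 => //.
- by apply: continuous_subspaceT => x; exact: ck.
- split.
  + by move=> r _; have [] := dF r.
  + by apply: cvg_at_right_filter; exact: is_derive_continuous (dF _).
  + by apply: cvg_at_left_filter; exact: is_derive_continuous (dF _).
- by move=> r _; rewrite derive1E; apply: derive_val; exact: dF.
Qed.

Let near_small (e : R) : 0 < e -> \forall n \near \oo, n.+1%:R^-1 <= e.
Proof. exact: near_natSinv_le. Qed.

Let inv_n (n : nat) (e : R) : n.+1%:R^-1 <= e -> 1 <= n.+1%:R * e.
Proof. by move=> h; rewrite -ler_pdivrMl// mulr1. Qed.

(** Common frame for the two shell limits. The spherical integral of the constant [M] is carried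
    along because [shell_approx] adds and subtracts that constant. *)
Lemma near_shell (k : nat -> R -> R) (S0 S1 : R) (P : R -> R -> Prop) :
  (forall n, continuous (k n)) -> (forall n r, 0 <= r -> 0 <= k n r) ->
  (forall e, 0 < e -> \forall n \near \oo,
    [/\ exists2 a, 0 < a & forall r, 0 <= r -> k n r != 0 -> a <= r <= t,
        (\int[mu]_(r in `]0%R, +oo[) (k n r)%:E = 1)%E &
        forall r, 0 <= r -> k n r != 0 ->
          `|smean c Q r - S0| <= e /\ `|smean c (cst M) r - S1| <= e]) ->
  \int[@leb3 R]_p (uind (vec3 p.1.1 p.1.2 p.2) * shell c (k n) Q (vec3 p.1.1 p.1.2 p.2))
    @[n --> \oo] --> S0.
Proof.
move=> ck k0 h; apply/cvgrPdist_le => e e0.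
have e3 : 0 < e / 3 by rewrite divr_gt0.
near=> n; have [[a a0 ks] k1 SS] : [/\ exists2 a, 0 < a & forall r, 0 <= r -> k n r != 0 -> a <= r <= t,
        (\int[mu]_(r in `]0%R, +oo[) (k n r)%:E = 1)%E &
        forall r, 0 <= r -> k n r != 0 ->
          `|smean c Q r - S0| <= e / 3 /\ `|smean c (cst M) r - S1| <= e / 3].
  by near: n; exact: h.
have [_] := shell_approx a0 (ck n) (k0 n) ks k1 SS (ltW e3).
by rewrite distrC; move=> /le_trans; apply; lra.
Unshelve. all: end_near. Qed.

(** The bump lives where 1 < (n+1) r^2 < 2. The hypothesis on n keeps this inside the ball, and
    1/(n+1) is a crude but sufficient lower bound for (n+1)^(-1/2). *)
Lemma bump_in_supp n r : 2 <= n.+1%:R * t ^+ 2 -> 0 <= r -> bump_in n r != 0 ->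
  n.+1%:R^-1 <= r <= t /\ r ^+ 2 <= 2 / n.+1%:R.
Proof.
move=> nt r0 kn; have n0 : (0 : R) < n.+1%:R by [].
have h1 : 1 < n.+1%:R * r ^+ 2.
  rewrite ltNge; apply/negP => h; move/eqP: kn; apply.
  by rewrite /bump_in smoothstep'_le1// mulr0.
have h2 : n.+1%:R * r ^+ 2 < 2.
  rewrite ltNge; apply/negP => h; move/eqP: kn; apply.
  by rewrite /bump_in smoothstep'_ge2// mulr0.
have n1 : (1 : R) <= n.+1%:R by rewrite ler1n.
split; last by rewrite ler_pdivlMr// mulrC ltW.
apply/andP; split; last first.
  rewrite -(@ler_pXn2r _ 2)// ?nnegrE//; last exact: ltW.
  by rewrite -(ler_pM2l n0); apply: ltW; apply: lt_le_trans nt.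
rewrite -(ler_pM2l n0) mulfV ?gt_eqF// leNgt; apply/negP => h.
have : r <= 1 by nra.
by nra.
Qed.

(** The bump lives where 1 < (n+1) (t^2 - r^2) < 2; with (n+1) t^2 >= 4 this gives r^2 >= t^2/2,
    more than enough for r >= t/2. *)
Lemma bump_out_supp n r : 4 <= n.+1%:R * t ^+ 2 -> 0 <= r -> bump_out n r != 0 ->
  t / 2 <= r < t /\ t ^+ 2 - r ^+ 2 <= 2 / n.+1%:R.
Proof.
move=> nt r0 kn; have n0 : (0 : R) < n.+1%:R by [].
have h1 : 1 < n.+1%:R * (t ^+ 2 - r ^+ 2).
  rewrite ltNge; apply/negP => h; move/eqP: kn; apply.
  by rewrite /bump_out smoothstep'_le1// mulr0.
have h2 : n.+1%:R * (t ^+ 2 - r ^+ 2) < 2.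
  rewrite ltNge; apply/negP => h; move/eqP: kn; apply.
  by rewrite /bump_out smoothstep'_ge2// mulr0.
split; last by rewrite ler_pdivlMr// mulrC ltW.
have rt : r < t.
  rewrite -(@ltr_pXn2r _ 2)// ?nnegrE//; last exact: ltW.
  have : 0 < n.+1%:R * (t ^+ 2 - r ^+ 2) by apply: lt_trans h1.
  by rewrite pmulr_rgt0// subr_gt0.
rewrite rt andbT leNgt; apply/negP => h.
have rr : r ^+ 2 <= (t / 2) ^+ 2 by rewrite ler_pXn2r ?nnegrE// ?divr_ge0// ltW.
have : n.+1%:R * r ^+ 2 <= n.+1%:R * (t / 2) ^+ 2 by rewrite ler_pM2l.
by move: h2 nt; rewrite expr_div_n mulrBr; lra.
Qed.

Lemma shell_in_cvg (q0 : R) : c 0 i3 != 0 -> Q y @[y --> c^'] --> q0 ->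
  \int[@leb3 R]_p (uind (vec3 p.1.1 p.1.2 p.2) * shell c (bump_in n) Q (vec3 p.1.1 p.1.2 p.2))
    @[n --> \oo] --> uind c * q0 * (4 * pi).
Proof.
move=> c3 Qc; apply: (@near_shell bump_in _ (uind c * M * (4 * pi))).
- exact: (fun _ _ => True).
- exact: continuous_bump_in.
- exact: bump_in_ge0.
move=> e e0.
have S1 := smean_near0 t0 cQ QM c3 Qc.
have S2 : smean c (cst M) r @[r --> 0^'+] --> uind c * M * (4 * pi).
  exact: (smean_near0 t0 cM bM c3 (cvg_cst _)).
have : \forall r \near 0^'+, `|smean c Q r - uind c * q0 * (4 * pi)| <= e /\
    `|smean c (cst M) r - uind c * M * (4 * pi)| <= e.
  by near=> r; split; rewrite distrC; near: r; [move/cvgrPdist_le: S1|move/cvgrPdist_le: S2]; apply.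
rewrite near_withinE => -[d /= d0 hd].
have d2 : 0 < d ^+ 2 / 4 by rewrite divr_gt0// exprn_gt0.
have t2 : 0 < t ^+ 2 / 2 by rewrite divr_gt0// exprn_gt0.
near=> n.
(* On the support r^2 <= 2/(n+1) <= d^2/2, which is below d^2. *)
have nd : n.+1%:R^-1 <= d ^+ 2 / 4 by near: n; exact: near_small.
have nt : 2 <= n.+1%:R * t ^+ 2.
  have : n.+1%:R^-1 <= t ^+ 2 / 2 by near: n; exact: near_small.
  by move=> /inv_n; lra.
split.
- by exists n.+1%:R^-1; [rewrite invr_gt0|move=> r r0 kr; have [] := bump_in_supp nt r0 kr].
- rewrite (integral_bump (is_derive_bump_in n) (@continuous_bump_in n)).
  + rewrite smoothstep_ge2// expr0n/= mulr0 smoothstep_le1 ?subr0//.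
  + move=> r tr; apply/eqP; apply: contraTT tr => kr.
    have r0 : 0 <= r \/ r < 0 by have [|] := leP 0 r; [left|right].
    case: r0 => [r0|r0]; last by rewrite -leNgt (le_trans (ltW r0))// ltW.
    by have [/andP[_ h] _] := bump_in_supp nt r0 kr; rewrite -leNgt.
- move=> r r0 kr; have [/andP[h1 h2] h3] := bump_in_supp nt r0 kr.
  have rp : 0 < r by apply: lt_le_trans h1; rewrite invr_gt0.
  apply: hd => //=; rewrite sub0r normrN gtr0_norm//.
  rewrite -(@ltr_pXn2r _ 2)// ?nnegrE//; last exact: ltW.
  have dp : 0 < d ^+ 2 by rewrite exprn_gt0.
  by move: nd h3; set w := n.+1%:R^-1 => nd h3; lra.
Unshelve. all: end_near. Qed.

Lemma shell_out_cvg :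
  \int[@leb3 R]_p (uind (vec3 p.1.1 p.1.2 p.2) * shell c (bump_out n) Q (vec3 p.1.1 p.1.2 p.2))
    @[n --> \oo] --> smean c Q t.
Proof.
apply: (@near_shell bump_out _ (smean c (cst M) t)).
- exact: (fun _ _ => True).
- exact: continuous_bump_out.
- exact: bump_out_ge0.
move=> e e0.
have S1 := smean_neart t0 cQ QM.
have S2 : smean c (cst M) r @[r --> t^'-] --> smean c (cst M) t.
  exact: (smean_neart t0 cM bM).
have : \forall r \near t^'-, `|smean c Q r - smean c Q t| <= e /\
    `|smean c (cst M) r - smean c (cst M) t| <= e.
  by near=> r; split; rewrite distrC; near: r; [move/cvgrPdist_le: S1|move/cvgrPdist_le: S2]; apply.
rewrite near_withinE => -[d /= d0 hd].
have d2 : 0 < d * t / 4 by rewrite divr_gt0// mulr_gt0.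
have t2 : 0 < t ^+ 2 / 4 by rewrite divr_gt0// exprn_gt0.
near=> n.
(* On the support (t - r)(t + r) <= 2/(n+1) <= d t / 2, and dividing by t + r >= t gives t - r <
   d. *)
have nd : n.+1%:R^-1 <= d * t / 4 by near: n; exact: near_small.
have nt : 4 <= n.+1%:R * t ^+ 2.
  have : n.+1%:R^-1 <= t ^+ 2 / 4 by near: n; exact: near_small.
  by move=> /inv_n; lra.
split.
- exists (t / 2); first by rewrite divr_gt0.
  by move=> r r0 kr; have [h _] := bump_out_supp nt r0 kr; lra.
- rewrite (integral_bump (is_derive_bump_out n) (@continuous_bump_out n)).
  + rewrite subrr mulr0 smoothstep_le1// expr0n/= subr0 smoothstep_ge2; last by lra.
    by congr EFin; ring.
  + move=> r tr; apply/eqP; apply: contraTT tr => kr.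
    have r0 : 0 <= r \/ r < 0 by have [|] := leP 0 r; [left|right].
    case: r0 => [r0|r0]; last by rewrite -leNgt (le_trans (ltW r0))// ltW.
    by have [/andP[_ h] _] := bump_out_supp nt r0 kr; rewrite -leNgt ltW.
- move=> r r0 kr; have [/andP[h1 h2] h3] := bump_out_supp nt r0 kr.
  apply: hd => //=; rewrite gtr0_norm ?subr_gt0//.
  have h4 : (t - r) * (t + r) <= d * t / 2.
    rewrite (_ : _ * _ = t ^+ 2 - r ^+ 2); last by ring.
    by move: nd h3; set w := n.+1%:R^-1 => nd h3; lra.
  have tp := t0; nra.
Unshelve. all: end_near. Qed.

End ShellLimits.

(** * The divergence theorem on a half ball *)

Section HalfSpaceDivergence.
Context {R : realType}.
Notation vec := 'rV[R]_3.
Notation mu := (@lebesgue_measure R).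
Notation mR := (measurableTypeR R).

(** A partial derivative, encoded as an ordinary derivative at 0 along a coordinate line so that the
    one-variable calculus applies directly. *)
Definition pd (j : 'I_3) (F : vec -> R) (y : vec) (d : R) : Prop :=
  is_derive (0 : R) 1 (fun h => F (h *: basis R j + y)) d.

Definition box (L : R) : set vec := [set y | forall k, `|y 0 k| <= L].

Lemma compact_box L : compact (box L).
Proof.
have h := @rV_compact R 3 (fun _ => `[- L, L]%classic) (fun _ => @segment_compact R (- L) L).
rewrite (_ : box L = [set v : 'rV[R]_3 | forall i, `[- L, L]%classic (v ord0 i)])//.
by apply/seteqP; split=> y yL k; have := yL k; rewrite /= in_itv/= ler_norml.
Qed.

Lemma continuous_box_bounded (L : R) (f : vec -> R) :
  {within box L, continuous f} -> exists2 M, 0 <= M & forall y, box L y -> `|f y| <= M.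
Proof.
move=> cf; have := compact_bounded (continuous_compact cf (@compact_box L)).
move=> [M [_ hM]]; exists (`|M| + 1) => [|y Ly]; first by rewrite addr_ge0.
apply: (hM (`|M| + 1)); first by rewrite (le_lt_trans (ler_norm _))// ltrDl.
by exists y.
Qed.

Section Supported.
Variables (P : vec -> R) (L : R).
Hypotheses (L0 : 0 < L) (cP : continuous P).
Hypothesis P0 : forall y, ~ box L y -> P y = 0.

Let cube : set (mR * mR * mR) := `[- L, L] `*` `[- L, L] `*` `[- L, L].

Let square : set (mR * mR) := `[- L, L] `*` `[- L, L].

Lemma measurable_cube : measurable cube.
Proof. by apply: measurableX => //; exact: measurableX. Qed.

Lemma leb3_cube : (@leb3 R cube < +oo)%E.
Proof.
rewrite leb3_setX//; last exact: measurableX.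
rewrite leb2_setX// !lebesgue_measure_itv/= lte_fin.
by case: ifPn => _; rewrite -?EFinB -?EFinM ?mul0e ltry.
Qed.

Lemma leb2_square : (@leb2 R square < +oo)%E.
Proof.
rewrite leb2_setX// !lebesgue_measure_itv/= lte_fin.
by case: ifPn => _; rewrite -?EFinB -?EFinM ?mul0e ltry.
Qed.

Lemma cubeP (a b c : R) : cube ((a, b), c) <-> box L (vec3 a b c).
Proof.
split=> [[[/= +] + +]|h].
  by rewrite !in_itv/= -!ler_norml => ha hb hc; apply: ord3E; rewrite vec3E.
have := h i1; have := h i2; have := h i3; rewrite !vec3E => hc hb ha.
by split => /=; [split => /=|]; rewrite in_itv/= -ler_norml.
Qed.

Lemma integrable_uind_supported : (@leb3 R).-integrable setT
  (EFin \o (fun p : mR * mR * mR => uind (vec3 p.1.1 p.1.2 p.2) * P (vec3 p.1.1 p.1.2 p.2))).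
Proof.
have [M M0 PM] := @continuous_box_bounded L P (continuous_subspaceT cP).
have mf : measurable_fun setT
    (fun p : mR * mR * mR => uind (vec3 p.1.1 p.1.2 p.2) * P (vec3 p.1.1 p.1.2 p.2)).
  exact: measurable_funM measurable_uind (measurable_vec3_cont cP).
have ib : (@leb3 R).-integrable cube
  (EFin \o (fun p : mR * mR * mR => uind (vec3 p.1.1 p.1.2 p.2) * P (vec3 p.1.1 p.1.2 p.2))).
  apply: (@integrable_bounded _ _ _ _ _ _ M).
  - exact: measurable_cube.
  - exact: leb3_cube.
  - by apply: measurable_funS mf.
  - move=> [[a b] c] /cubeP h; rewrite normrM ger0_norm ?uind_ge0//.
    by rewrite (le_trans _ (PM _ h))// ler_piMl// uind_le1.
have := (integrable_mkcond (EFin \o (fun p : mR * mR * mR =>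
  uind (vec3 p.1.1 p.1.2 p.2) * P (vec3 p.1.1 p.1.2 p.2))) measurable_cube).1 ib.
apply: eq_integrable => // -[[a b] c] _; rewrite patchE; case: ifPn => //.
rewrite notin_setE => h; rewrite /= P0 ?mulr0// => hb; apply: h; exact/cubeP.
Qed.

Lemma integrable_plane_supported (c : R) : (@leb2 R).-integrable setT
  (EFin \o (fun p : mR * mR => P (vec3 p.1 p.2 c))).
Proof.
have [M M0 PM] := @continuous_box_bounded L P (continuous_subspaceT cP).
have mf : measurable_fun setT (fun p : mR * mR => P (vec3 p.1 p.2 c)).
  exact: measurable_vec3_plane_cont.
have mS : measurable square by exact: measurableX.
have bM y : `|P y| <= M.
  by have [h|h] := pselect (box L y); [exact: PM|rewrite P0// normr0].
have ib : (@leb2 R).-integrable square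
  (EFin \o (fun p : mR * mR => P (vec3 p.1 p.2 c))).
  apply: (@integrable_bounded _ _ _ _ _ _ M) => //.
  - exact: leb2_square.
  - by apply: measurable_funS mf.
have := (integrable_mkcond (EFin \o (fun p : mR * mR => P (vec3 p.1 p.2 c))) mS).1 ib.
apply: eq_integrable => // -[a b] _; rewrite patchE; case: ifPn => //.
rewrite notin_setE => h; rewrite /= P0// => hb; apply: h; split => /=; rewrite in_itv/= -ler_norml.
  by have := hb i1; rewrite vec3E.
by have := hb i2; rewrite vec3E.
Qed.
End Supported.

Lemma pd_line1 F a b c d : pd i1 F (vec3 a b c) d -> is_derive a 1 (fun a => F (vec3 a b c)) d.
Proof.
move=> h; have s : is_derive a 1 (fun s : R => s - a) 1.
  by apply: (is_derive_eqv (line_deriveB (line_derive_id a) (line_derive_cst a a))); rewrite subr0.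
have h' : is_derive (a - a) 1 (fun h => F (h *: basis R i1 + vec3 a b c)) d by rewrite subrr.
have := line_derive_comp (g := fun s : R => s - a) h' s; rewrite mulr1; congr is_derive; apply/funext => u; congr F.
by apply: vec_eqP; rewrite !mxE ?eqxx/= ?mulr1 ?mulr0 ?add0r// subrK.
Qed.

Lemma pd_line2 F a b c d : pd i2 F (vec3 a b c) d -> is_derive b 1 (fun b => F (vec3 a b c)) d.
Proof.
move=> h; have s : is_derive b 1 (fun s : R => s - b) 1.
  by apply: (is_derive_eqv (line_deriveB (line_derive_id b) (line_derive_cst b b))); rewrite subr0.
have h' : is_derive (b - b) 1 (fun h => F (h *: basis R i2 + vec3 a b c)) d by rewrite subrr.
have := line_derive_comp (g := fun s : R => s - b) h' s; rewrite mulr1; congr is_derive; apply/funext => u; congr F.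
by apply: vec_eqP; rewrite !mxE ?eqxx/= ?mulr1 ?mulr0 ?add0r// subrK.
Qed.

Lemma pd_line3 F a b c d : pd i3 F (vec3 a b c) d -> is_derive c 1 (fun c => F (vec3 a b c)) d.
Proof.
move=> h; have s : is_derive c 1 (fun s : R => s - c) 1.
  by apply: (is_derive_eqv (line_deriveB (line_derive_id c) (line_derive_cst c c))); rewrite subr0.
have h' : is_derive (c - c) 1 (fun h => F (h *: basis R i3 + vec3 a b c)) d by rewrite subrr.
have := line_derive_comp (g := fun s : R => s - c) h' s; rewrite mulr1; congr is_derive; apply/funext => u; congr F.
by apply: vec_eqP; rewrite !mxE ?eqxx/= ?mulr1 ?mulr0 ?add0r// subrK.
Qed.

Lemma integral_line (f g : R -> R) (a b : R) : a < b -> continuous f -> continuous g ->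
  (forall x : R, a < x < b -> is_derive x 1 f (g x)) ->
  (\int[mu]_(x in `[a, b]) (g x)%:E = (f b - f a)%:E)%E.
Proof.
move=> ab cf cg fg; rewrite EFinB; apply: continuous_FTC2 => //.
- by apply: continuous_subspaceT => x; exact: cg.
- split.
  + by move=> x; rewrite in_itv/= => hx; have [] := fg x hx.
  + by apply: cvg_at_right_filter; exact: cf.
  + by apply: cvg_at_left_filter; exact: cf.
- by move=> x; rewrite in_itv/= => hx; rewrite derive1E; apply: derive_val; exact: fg.
Qed.

Lemma integral_line0 (f g : R -> R) (L : R) : 0 < L -> continuous f -> continuous g ->
  (forall x : R, is_derive x 1 f (g x)) ->
  (forall x, L < `|x| -> f x = 0) -> (forall x, L < `|x| -> g x = 0) ->
  (\int[mu]_x (g x)%:E = 0)%E.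
Proof.
move=> L0 cf cg fg f0 g0; pose b := L + 1.
have bb : - b < b by rewrite /b; lra.
have Lb : L < `|b| by rewrite ger0_norm /b; lra.
rewrite -(_ : (f b - f (- b))%:E = 0%E); last by rewrite !f0 ?normrN// subrr.
rewrite -(integral_line bb cf cg (fun x _ => fg x)).
rewrite [RHS]integral_mkcond; apply: eq_integral => x _; rewrite patchE.
case: ifPn => //; rewrite mem_setE in_itv/= -ler_norml -ltNge => h.
by rewrite g0//; apply: lt_trans h; rewrite /b; lra.
Qed.

(** Differentiability is used only on x > 0; continuity at 0 is what produces the boundary value, as
    the solution is differentiated only inside the half space. *)
Lemma integral_halfline (f g : R -> R) (L : R) : 0 < L -> continuous f -> continuous g ->
  (forall x : R, 0 < x -> is_derive x 1 f (g x)) ->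
  (forall x, L < `|x| -> f x = 0) -> (forall x, L < `|x| -> g x = 0) ->
  (\int[mu]_x (((0 : R) < x)%R%:R * g x)%:E = (- f 0)%:E)%E.
Proof.
move=> L0 cf cg fg f0 g0; pose b := L + 1.
have b0 : 0 < b by rewrite /b; lra.
have Lb : L < `|b| by rewrite ger0_norm /b; lra.
transitivity (\int[mu]_(x in `]0%R, b]) (g x)%:E)%E.
  rewrite [RHS]integral_mkcond; apply: eq_integral => x _; rewrite patchE.
  rewrite mem_setE in_itv/=; have [x0|x0] := ltP 0 x; rewrite ?mul0r//= mul1r.
  case: ifPn => //; rewrite -ltNge => h; rewrite g0// gtr0_norm//.
  by apply: lt_trans h; rewrite /b; lra.
rewrite (@integral_itv_obnd_cbnd _ _ _ (EFin \o g)); last exact: measurable_EFin_cont.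
rewrite (integral_line b0 cf cg (fun x h => fg x (proj1 (andP h)))).
by rewrite (f0 b)// sub0r.
Qed.

Section Main.
Variables (P D : vec -> R) (L : R).
Hypotheses (L0 : 0 < L) (cP : continuous P) (cD : continuous D).
Hypothesis P0 : forall y, ~ box L y -> P y = 0.
Hypothesis D0 : forall y, ~ box L y -> D y = 0.

Let out1 a b c : L < `|a| -> ~ box L (vec3 a b c).
Proof. by move=> h /(_ i1); rewrite vec3E leNgt h. Qed.
Let out2 a b c : L < `|b| -> ~ box L (vec3 a b c).
Proof. by move=> h /(_ i2); rewrite vec3E leNgt h. Qed.
Let out3 a b c : L < `|c| -> ~ box L (vec3 a b c).
Proof. by move=> h /(_ i3); rewrite vec3E leNgt h. Qed.

Let c1 (f : vec -> R) b c : continuous f -> continuous (fun a => f (vec3 a b c)).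
Proof. by move=> cf a; apply: (@continuous_comp _ _ _ (fun a => vec3 a b c) f); [exact: continuous_line1|exact: cf]. Qed.
Let c2 (f : vec -> R) a c : continuous f -> continuous (fun b => f (vec3 a b c)).
Proof. by move=> cf b; apply: (@continuous_comp _ _ _ (fun b => vec3 a b c) f); [exact: continuous_line2|exact: cf]. Qed.
Let c3 (f : vec -> R) a b : continuous f -> continuous (fun c => f (vec3 a b c)).
Proof. by move=> cf c; apply: (@continuous_comp _ _ _ (fun c => vec3 a b c) f); [exact: continuous_line3|exact: cf]. Qed.

Let uindE a b c : uind (vec3 a b c : vec) = (0 < c)%R%:R.
Proof. by rewrite /uind vec3E. Qed.

(** Fubini with the first coordinate innermost: each horizontal line stays in the half space and the
    compactly supported primitive vanishes at both ends. *)
Lemma halfspace_tangential1 : (forall y : vec, 0 < y 0 i3 -> pd i1 P y (D y)) ->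
  \int[@leb3 R]_p (uind (vec3 p.1.1 p.1.2 p.2) * D (vec3 p.1.1 p.1.2 p.2)) = 0.
Proof.
move=> PD; rewrite /Rintegral (fubini_leb3 (integrable_uind_supported cD D0))/=.
rewrite integral0_eq// => c _.
under eq_integral do rewrite uindE.
have [c0|c0] := ltP 0 c; last by apply: integral0_eq => q _; rewrite mul0r.
under eq_integral do rewrite mul1r.
rewrite (fubini_leb2 (integrable_plane_supported cD D0 c))/=.
apply: integral0_eq => b _; apply: (@integral_line0 (fun a => P (vec3 a b c)) _ L) => //.
- exact: c1.
- exact: c1.
- by move=> a; apply: pd_line1; apply: PD; rewrite vec3E.
- by move=> a La; rewrite P0//; exact: out1.
- by move=> a La; rewrite D0//; exact: out1.
Qed.

Lemma halfspace_tangential2 : (forall y : vec, 0 < y 0 i3 -> pd i2 P y (D y)) ->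
  \int[@leb3 R]_p (uind (vec3 p.1.1 p.1.2 p.2) * D (vec3 p.1.1 p.1.2 p.2)) = 0.
Proof.
move=> PD; rewrite /Rintegral (fubini_leb3 (integrable_uind_supported cD D0))/=.
rewrite integral0_eq// => c _.
under eq_integral do rewrite uindE.
have [c0|c0] := ltP 0 c; last by apply: integral0_eq => q _; rewrite mul0r.
under eq_integral do rewrite mul1r.
rewrite (fubini_leb2' (integrable_plane_supported cD D0 c))/=.
apply: integral0_eq => a _; apply: (@integral_line0 (fun b => P (vec3 a b c)) _ L) => //.
- exact: c2.
- exact: c2.
- by move=> b; apply: pd_line2; apply: PD; rewrite vec3E.
- by move=> b Lb; rewrite P0//; exact: out2.
- by move=> b Lb; rewrite D0//; exact: out2.
Qed.

(** Fubini with the third coordinate innermost: each vertical half-line contributes minus the value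
    at its foot. This is the only component that sees the boundary plane. *)
Lemma halfspace_normal : (forall y : vec, 0 < y 0 i3 -> pd i3 P y (D y)) ->
  \int[@leb3 R]_p (uind (vec3 p.1.1 p.1.2 p.2) * D (vec3 p.1.1 p.1.2 p.2)) =
  - \int[@leb2 R]_p P (vec3 p.1 p.2 0).
Proof.
move=> PD; have iP := integrable_plane_supported cP P0 0.
rewrite -mulN1r -RintegralZl//.
rewrite /Rintegral (fubini_leb3_line (integrable_uind_supported cD D0))/=; congr fine.
apply: eq_integral => -[a b] _ /=; rewrite mulN1r.
under eq_integral do rewrite uindE.
apply: (@integral_halfline (fun c => P (vec3 a b c)) _ L) => //.
- exact: c3.
- exact: c3.
- by move=> c c0; apply: pd_line3; apply: PD; rewrite vec3E.
- by move=> c Lc; rewrite P0//; exact: out3.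
- by move=> c Lc; rewrite D0//; exact: out3.
Qed.

End Main.
End HalfSpaceDivergence.

(** * Radial cutoffs and integrability of |y - c|^-2 on a ball *)

Section HalfBall.
Context {R : realType}.
Notation vec := 'rV[R]_3.
Notation mu := (@lebesgue_measure R).
Notation mR := (measurableTypeR R).
Variables (c : vec) (t : R).
Hypothesis t0 : 0 < t.

(* As a function of q = |y - c| ^ 2, so that it is C^1 through the centre. *)
Definition cutoff (n : nat) (q : R) : R :=
  smoothstep (n.+1%:R * q) * smoothstep (n.+1%:R * (t ^+ 2 - q)).

Definition cutoff' (n : nat) (q : R) : R :=
  n.+1%:R * smoothstep' (n.+1%:R * q) * smoothstep (n.+1%:R * (t ^+ 2 - q))
  - n.+1%:R * smoothstep (n.+1%:R * q) * smoothstep' (n.+1%:R * (t ^+ 2 - q)).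

Lemma is_derive_cutoff n (q : R) : is_derive q 1 (cutoff n) (cutoff' n q).
Proof.
have h1 : is_derive q 1 (fun q : R => n.+1%:R * q) (n.+1%:R * 1) by exact: (line_deriveMl _ (line_derive_id q)).
have h2 : is_derive q 1 (fun q : R => n.+1%:R * (t ^+ 2 - q)) (n.+1%:R * (0 - 1)).
  exact: (line_deriveMl _ (line_deriveB (line_derive_cst q _) (line_derive_id q))).
apply: (is_derive_eqv (line_deriveM (line_derive_comp (is_derive_smoothstep _) h1) (line_derive_comp (is_derive_smoothstep _) h2))).
by rewrite /cutoff'; ring.
Qed.

Lemma continuous_cutoff n : continuous (cutoff n).
Proof. by move=> q; exact: is_derive_continuous (is_derive_cutoff n q). Qed.

Lemma continuous_cutoff' n : continuous (cutoff' n).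
Proof.
move=> q.
have h1 : {for q, continuous (fun q : R => n.+1%:R * q)} := is_derive_continuous (line_deriveMl _ (line_derive_id q)).
have h2 : {for q, continuous (fun q : R => n.+1%:R * (t ^+ 2 - q))} :=
  is_derive_continuous (line_deriveMl _ (line_deriveB (line_derive_cst q _) (line_derive_id q))).
have s1 : {for q, continuous (fun q : R => smoothstep (n.+1%:R * q))}.
  exact: (continuous_comp h1 (@continuous_smoothstep R _)).
have s2 : {for q, continuous (fun q : R => smoothstep (n.+1%:R * (t ^+ 2 - q)))}.
  exact: (continuous_comp h2 (@continuous_smoothstep R _)).
have d1 : {for q, continuous (fun q : R => smoothstep' (n.+1%:R * q))}.
  exact: (continuous_comp h1 (@continuous_smoothstep' R _)).
have d2 : {for q, continuous (fun q : R => smoothstep' (n.+1%:R * (t ^+ 2 - q)))}.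
  exact: (continuous_comp h2 (@continuous_smoothstep' R _)).
have cn : {for q, continuous (cst n.+1%:R : R -> R)} by exact: cst_continuous.
exact: (continuousB (continuousM (continuousM cn d1) s2) (continuousM (continuousM cn s1) d2)).
Qed.

Lemma cutoff_lo n q : n.+1%:R * q <= 1 -> cutoff n q = 0 /\ cutoff' n q = 0.
Proof.
by move=> h; rewrite /cutoff /cutoff' smoothstep_le1// smoothstep'_le1// !(mulr0, mul0r) subrr.
Qed.

Lemma cutoff_hi n q : n.+1%:R * (t ^+ 2 - q) <= 1 -> cutoff n q = 0 /\ cutoff' n q = 0.
Proof.
by move=> h; rewrite /cutoff /cutoff' (@smoothstep_le1 _ (_ * (_ - _)))// (@smoothstep'_le1 _ (_ * (_ - _)))// !(mulr0, mul0r) subrr.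
Qed.

Lemma cutoff_itv n q : 0 <= cutoff n q <= 1.
Proof.
have /andP[a1 a2] := @smoothstep_itv R (n.+1%:R * q).
have /andP[b1 b2] := @smoothstep_itv R (n.+1%:R * (t ^+ 2 - q)).
by rewrite mulr_ge0//= mulr_ile1.
Qed.

Lemma cutoff_cvg q : cutoff n q @[n --> \oo] --> (((0 < q) && (q < t ^+ 2))%R%:R : R).
Proof.
have far (a : R) : 0 < a -> \forall n \near \oo, 2 <= n.+1%:R * a.
  move=> a0; have a2 : 0 < a / 2 by rewrite divr_gt0.
  apply: filterS (near_natSinv_le a2) => n h.
  have : 1 <= n.+1%:R * (a / 2) by rewrite -ler_pdivrMl// mulr1.
  by lra.
have [q0|q0] := ltP 0 q; last first.
  apply: (@cvg_near_cst _ _ _ _ \oo _); apply: nearW => n.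
  rewrite /= /cutoff smoothstep_le1 ?mul0r//.
  by apply: (@le_trans _ _ 0) => //; rewrite pmulr_rle0.
have [qt|qt] := ltP q (t ^+ 2); last first.
  apply: (@cvg_near_cst _ _ _ _ \oo _); apply: nearW => n.
  rewrite /= /cutoff (@smoothstep_le1 _ (_ * (_ - _))) ?mulr0//.
  by apply: (@le_trans _ _ 0) => //; rewrite pmulr_rle0// subr_le0.
apply: (@cvg_near_cst _ _ _ _ \oo _); near=> n.
have e1 : 2 <= n.+1%:R * q by near: n; exact: far.
have e2 : 2 <= n.+1%:R * (t ^+ 2 - q) by near: n; apply: far; rewrite subr_gt0.
by rewrite /cutoff !smoothstep_ge2//= mulr1.
Unshelve. all: end_near. Qed.

Let q2 (y : vec) : R := enorm (y - c) ^+ 2.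

Let continuous_q2 : continuous q2.
Proof.
move=> y; apply: (@continuous_comp _ _ _ (fun y : vec => enorm (y - c)) (fun x : R => x ^+ 2)).
  exact: continuous_dist.
exact: exprn_continuous.
Qed.

Lemma dist_sqr_lt y : (0 < enorm (y - c) < t) = (0 < q2 y) && (q2 y < t ^+ 2).
Proof.
rewrite /q2 exprn_even_gt0//= lt0r enorm_ge0 andbT.
by rewrite ltr_pXn2r// ?nnegrE ?enorm_ge0 ?ltW.
Qed.

Let cut_near n y : enorm (y - c) < n.+1%:R^-1 -> n.+1%:R * q2 y <= 1.
Proof.
move=> h; have e0 := enorm_ge0 (y - c).
have n0 : (0 : R) < n.+1%:R by [].
have h1 : n.+1%:R * enorm (y - c) <= 1 by rewrite -ler_pdivlMl// mulr1 ltW.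
have n1 : (1 : R) <= n.+1%:R by rewrite ler1n.
rewrite /q2; nra.
Qed.

Let inv_n0 n : (0 : R) < n.+1%:R^-1. Proof. by rewrite invr_gt0. Qed.

Lemma continuous_cut (g : nat -> R -> R) n (f : vec -> R) :
  continuous (g n) -> (forall q, n.+1%:R * q <= 1 -> g n q = 0) ->
  (forall y, y != c -> {for y, continuous f}) ->
  continuous (fun y : vec => g n (enorm (y - c) ^+ 2) * f y).
Proof.
move=> cg g0 cf.
apply: (@cut_continuous _ c n.+1%:R^-1 (fun y => g n (q2 y))) => //.
- by move=> y h; rewrite g0//; exact: cut_near.
- move=> y; apply: (@continuous_comp _ _ _ q2 (g n)); first exact: continuous_q2.
  exact: cg.
Qed.

Let continuous_invdist y : y != c -> {for y, continuous (fun y : vec => (enorm (y - c) ^+ 2)^-1)}.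
Proof.
move=> yc; apply: continuousV; last exact: continuous_q2.
by rewrite expf_neq0// gt_eqF// dist_gt0.
Qed.

(** The dominating function of the volume terms: the strongest singularity that survives in the
    divergence of the flux is of order two. *)
Definition inv_dist2 (y : vec) : R :=
  ((0 < enorm (y - c) < t)%R : bool)%:R / enorm (y - c) ^+ 2.

Let approx n (y : vec) : R := cutoff n (q2 y) * (q2 y)^-1.

Let approx_cvg y : approx n y @[n --> \oo] --> inv_dist2 y.
Proof. by rewrite /inv_dist2 dist_sqr_lt; apply: cvgM; [exact: cutoff_cvg|exact: cvg_cst]. Qed.

Let continuous_approx n : continuous (approx n).
Proof.
by apply: continuous_cut => //; [exact: continuous_cutoff|move=> q /cutoff_lo[]].
Qed.

Let approx_ge0 n y : 0 <= approx n y.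
Proof.
by rewrite /approx mulr_ge0 ?invr_ge0 ?sqr_ge0//; have /andP[] := cutoff_itv n (q2 y).
Qed.

Lemma measurable_inv_dist2 :
  measurable_fun setT (fun p : mR * mR * mR => inv_dist2 (vec3 p.1.1 p.1.2 p.2)).
Proof.
apply: (@measurable_fun_cvg _ _ _ _ (fun n p => approx n (vec3 p.1.1 p.1.2 p.2))) => // n.
exact: measurable_vec3_cont.
Qed.

Lemma inv_dist2_ge0 y : 0 <= inv_dist2 y.
Proof. by rewrite divr_ge0 ?sqr_ge0. Qed.

(** In spherical coordinates the singularity cancels against r^2, and what remains is at most 4 pi
    on the radii in ]0, t]. *)
Lemma integral_approx n :
  (\int[@leb3 R]_p (approx n (vec3 p.1.1 p.1.2 p.2))%:E <= (t * (4 * pi))%:E)%E.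
Proof.
have p0 := pi_gt0 R.
rewrite (spherical c (@continuous_approx n) (approx_ge0 n)).
have E r : 0 < r -> (\int[@leb2 R]_(q in rect) (approx n (sphere_param c r q) * (r ^+ 2 * sin q.1))%:E
    = (cutoff n (r ^+ 2) * (4 * pi))%:E)%E.
  move=> r0.
  have Ek q : approx n (sphere_param c r q) * (r ^+ 2 * sin q.1) = cutoff n (r ^+ 2) * sin q.1.
    rewrite /approx /q2 enorm_sphere ?ltW//; field; exact: lt0r_neq0.
  under eq_integral do rewrite Ek.
  have is' : (@leb2 R).-integrable rect (EFin \o (fun q : mR * mR => sin q.1)).
    apply: (@integrable_bounded _ _ _ _ _ _ 1); [exact: measurable_rect|exact: leb2_rect|exact: measurable_sin_rect|].
    by move=> q rq; rewrite ger0_norm ?sin_rect_ge0// sin_le1.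
  under eq_integral do rewrite EFinM.
  rewrite integralZl//; last exact: measurable_rect.
  have fs := integrable_fin_num measurable_rect is'.
  have e4 : (\int[@leb2 R]_(q in rect) (sin q.1)%:E = (4 * pi)%:E)%E.
    by rewrite -integral_sin_rect /Rintegral fineK.
  by rewrite [X in (_ * X)%E]e4 EFinM.
rewrite (eq_integral (fun r : mR => (cutoff n ((r : R) ^+ 2) * (4 * pi))%:E)); last by move=> r; rewrite inE/= in_itv/= andbT => /E.
have cc : continuous (fun r : R => cutoff n (r ^+ 2) * (4 * pi)).
  move=> r; apply: (@continuousM _ _ (fun r : R => cutoff n (r ^+ 2)) (cst (4 * pi))); last exact: cst_continuous.
  apply: (@continuous_comp _ _ _ (fun r : R => r ^+ 2) (cutoff n)); last exact: continuous_cutoff.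
  exact: exprn_continuous.
have -> : (t * (4 * pi))%:E = (\int[mu]_(r in `]0%R, t]) (4 * pi)%:E)%E.
  by rewrite integral_cst//= lebesgue_measure_itv/= lte_fin t0 -EFinB subr0 -EFinM mulrC.
have m1 (D : set R) : measurable_fun (D : set mR) (fun r => (cutoff n (r ^+ 2) * (4 * pi))%:E).
  exact: measurable_EFin_cont.
have q0 : 0 <= 4 * (pi : R) by apply: mulr_ge0 => //; exact: ltW.
rewrite integral_mkcond [leRHS]integral_mkcond; apply: ge0_le_integral => //.
- move=> r _; rewrite patchE; case: ifPn => // _; rewrite lee_fin.
  by have /andP[h _] := cutoff_itv n (r ^+ 2); exact: mulr_ge0.
- apply: (measurable_restrictT _ _).1; [exact: measurable_itv|exact: m1].
- apply: (measurable_restrictT _ _).1; [exact: measurable_itv|exact: measurable_cst].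
move=> r _; rewrite !patchE !mem_setE !in_itv/= andbT.
have [r0|r0] := ltP 0 r => //=; have [rt|rt] := leP r t.
  rewrite lee_fin ler_piMl//.
  by have /andP[_] := cutoff_itv n (r ^+ 2).
rewrite (proj1 (@cutoff_hi n (r ^+ 2) _)) ?mul0r//.
apply: (@le_trans _ _ 0) => //; rewrite pmulr_rle0// subr_le0.
by rewrite ler_pXn2r ?nnegrE// ltW.
Qed.

(** Fatou's lemma along the cutoffs, whose integrals are bounded uniformly in n. *)
Lemma integrable_inv_dist2 : (@leb3 R).-integrable setT
  (EFin \o (fun p : mR * mR * mR => inv_dist2 (vec3 p.1.1 p.1.2 p.2))).
Proof.
apply/integrableP; split; first by apply/measurable_EFinP; exact: measurable_inv_dist2.
under eq_integral => p _ do rewrite /= ger0_norm ?inv_dist2_ge0//.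
have ma n : measurable_fun setT (fun p : mR * mR * mR => (approx n (vec3 p.1.1 p.1.2 p.2))%:E).
  by apply/measurable_EFinP; exact: measurable_vec3_cont.
have a0 n (p : mR * mR * mR) : setT p -> (0 <= (approx n (vec3 p.1.1 p.1.2 p.2))%:E)%E.
  by rewrite lee_fin.
have := @fatou _ _ _ (@leb3 R) setT measurableT _ ma a0.
rewrite (eq_integral (fun p : mR * mR * mR => (inv_dist2 (vec3 p.1.1 p.1.2 p.2))%:E)); last first.
  move=> p _.
  have h : (approx n (vec3 p.1.1 p.1.2 p.2))%:E @[n --> \oo] --> (inv_dist2 (vec3 p.1.1 p.1.2 p.2))%:E.
    by apply: cvg_EFin; [exact: nearW|exact: approx_cvg].
  by rewrite (cvg_limn_einf_sup h).1.
move=> /le_lt_trans; apply.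
apply: (@le_lt_trans _ _ (t * (4 * pi))%:E); last exact: ltry.
rewrite limn_einf_lim; apply: lime_le; first exact: is_cvg_einfs.
apply: nearW => n; apply: le_trans (integral_approx n).
by apply: ereal_inf_lbound; exists n => /=.
Qed.

End HalfBall.

(** * The divergence theorem for a field with a singular centre *)

Section HalfBallDivergence.
Context {R : realType}.
Notation vec := 'rV[R]_3.
Notation mR := (measurableTypeR R).

Variables (c : vec) (t M C q0 : R) (F G : 'I_3 -> vec -> R).
Hypotheses (t0 : 0 < t) (M0 : 0 <= M) (C0 : 0 <= C) (c3 : c 0 i3 != 0).
Hypothesis cF : forall j (y : vec), y != c -> {for y, continuous (F j)}.
Hypothesis cG : forall j (y : vec), y != c -> {for y, continuous (G j)}.
Hypothesis FG : forall j (y : vec), 0 < y 0 i3 -> 0 < enorm (y - c) < t -> pd j (F j) y (G j y).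
Hypothesis FM : forall j (y : vec), 0 < enorm (y - c) <= t -> `|F j y| <= M / enorm (y - c) ^+ 2.
Hypothesis GC : forall y : vec, 0 < y 0 i3 -> 0 < enorm (y - c) < t ->
  `|\sum_j G j y| <= C / enorm (y - c) ^+ 2.

(** Equal to r^2 times the component of F along omega: the flux per unit solid angle through the
    sphere of radius r. *)
Definition radial_flux (y : vec) : R := enorm (y - c) * dot (y - c) (\row_j F j y).

Hypothesis Qc : radial_flux y @[y --> c^'] --> q0.

Let q2 (y : vec) : R := enorm (y - c) ^+ 2.
Let L := enorm c + t.

Let L0 : 0 < L. Proof. by rewrite /L ltr_wpDl// enorm_ge0. Qed.

Let continuous_q2 : continuous q2.
Proof.
move=> y; apply: (@continuous_comp _ _ _ (fun y : vec => enorm (y - c)) (fun x : R => x ^+ 2)).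
  exact: continuous_dist.
exact: exprn_continuous.
Qed.

Let cz k : continuous (fun y : vec => (y - c) 0 k).
Proof.
move=> y; rewrite (_ : (fun y : vec => _) = (fun y : vec => y 0 k - c 0 k)); last by apply/funext => z; rewrite !mxE.
by apply: (@continuousB _ _ _ (fun y : vec => y 0 k) (cst (c 0 k))); [exact: coord_continuous|exact: cst_continuous].
Qed.

Let continuous_radial y : y != c -> {for y, continuous radial_flux}.
Proof.
move=> yc.
have hz k : {for y, continuous (fun y : vec => (y - c) 0 k * (\row_j F j y) 0 k)}.
  rewrite (_ : (fun y => _) = (fun y : vec => (y - c) 0 k * F k y)); last by apply/funext => z; rewrite !mxE.
  exact: (continuousM (@cz k y) (cF yc)).
have hd : {for y, continuous (fun y : vec => dot (y - c) (\row_j F j y))}.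
  rewrite (_ : (fun y => _) = (fun y : vec => (y - c) 0 i1 * (\row_j F j y) 0 i1 +
     (y - c) 0 i2 * (\row_j F j y) 0 i2 + (y - c) 0 i3 * (\row_j F j y) 0 i3)).
    exact: (continuousD (continuousD (hz i1) (hz i2)) (hz i3)).
  by apply/funext => z; rewrite dotE.
exact: (continuousM (@continuous_dist _ c y) hd).
Qed.

Let radial_le y : 0 < enorm (y - c) <= t -> `|radial_flux y| <= 3 * M.
Proof.
move=> h; have /andP[r0 rt] := h.
rewrite /radial_flux normrM ger0_norm ?enorm_ge0//.
have e k : `|(y - c) 0 k * (\row_j F j y) 0 k| <= enorm (y - c) * (M / enorm (y - c) ^+ 2).
  by rewrite normrM mxE ler_pM// ?le_coord_enorm// FM.
have d : `|dot (y - c) (\row_j F j y)| <= 3 * (enorm (y - c) * (M / enorm (y - c) ^+ 2)).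
  rewrite dotE; have := e i1; have := e i2; have := e i3.
  rewrite !ler_norml; lra.
apply: (le_trans (ler_wpM2l (enorm_ge0 _) d)).
rewrite le_eqVlt; apply/orP; left; apply/eqP; field; exact: lt0r_neq0.
Qed.

Let pd_q2 j y : pd j q2 y (2 * (y - c) 0 j).
Proof.
have e : (fun h : R => q2 (h *: basis R j + y)) = (fun h : R => h ^+ 2 + (2 * (y - c) 0 j * h + q2 y)).
  apply/funext => h; rewrite /q2 !enorm_sqr.
  by move: j; apply: ord3E; rewrite !mxE/= ?mulr1 ?mulr0; ring.
rewrite /pd e; apply: (is_derive_eqv (line_deriveD (line_derive_sqr (line_derive_id _)) (line_deriveD (line_deriveMl _ (line_derive_id _)) (line_derive_cst _ _)))).
by rewrite !mulr0 mul0r add0r mulr1 addr0.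
Qed.

Let outside n y : ~ box L y -> cutoff t n (q2 y) = 0 /\ cutoff' t n (q2 y) = 0.
Proof.
move=> h; apply: cutoff_hi; apply: (@le_trans _ _ 0) => //.
rewrite pmulr_rle0// subr_le0.
have : t <= enorm (y - c).
  rewrite leNgt; apply/negP => h1; apply: h => k.
  have := le_coord_enorm (y - c) k; have := le_coord_enorm c k.
  by rewrite !mxE /L !ler_norml => ? ?; apply/andP; split; lra.
by move=> h1; rewrite ler_pXn2r ?nnegrE ?enorm_ge0// ltW.
Qed.

Let P n j y : R := cutoff t n (q2 y) * F j y.
Let D n j y : R := cutoff t n (q2 y) * G j y + cutoff' t n (q2 y) * (2 * (y - c) 0 j * F j y).

Let cP n j : continuous (P n j).
Proof.
apply: (@continuous_cut _ c (cutoff t) n (F j)); [exact: (@continuous_cutoff _ t n)|by move=> q /(@cutoff_lo _ t)[]|exact: cF].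
Qed.

Let cD n j : continuous (D n j).
Proof.
move=> y; apply: (@continuousD _ _ _ (fun y : vec => cutoff t n (q2 y) * G j y) (fun y : vec => cutoff' t n (q2 y) * (2 * (y - c) 0 j * F j y))).
  apply: (@continuous_cut _ c (cutoff t) n (G j)); [exact: (@continuous_cutoff _ t n)|by move=> q /(@cutoff_lo _ t)[]|exact: cG].
apply: (@continuous_cut _ c (cutoff' t) n (fun y : vec => 2 * (y - c) 0 j * F j y)); [exact: (@continuous_cutoff' _ t n)|by move=> q /(@cutoff_lo _ t)[]|].
move=> z zc; have c2 : {for z, continuous (cst 2 : vec -> R)} by exact: cst_continuous.
exact: (continuousM (continuousM c2 (@cz j z)) (cF zc)).
Qed.

Let P0 n j y : ~ box L y -> P n j y = 0.
Proof. by move=> /(@outside n)[h _]; rewrite /P h mul0r. Qed.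

Let D0 n j y : ~ box L y -> D n j y = 0.
Proof. by move=> /(@outside n)[h h']; rewrite /D h h' !mul0r addr0. Qed.

Let line_cont j y : {for (0 : R), continuous (fun h : R => q2 (h *: basis R j + y))}.
Proof. exact: is_derive_continuous (pd_q2 j y). Qed.

(** Three regimes: at the centre and from radius t on, the cutoff vanishes in a neighbourhood, so
    nothing is asked of F; in between, the product and chain rules apply. *)
Let pd_PD n j (y : vec) : 0 < y 0 i3 -> pd j (P n j) y (D n j y).
Proof.
move=> y3.
have [yc|yc] := eqVneq y c.
  have q20 : q2 (0 *: basis R j + y) < n.+1%:R^-1.
    by rewrite scale0r add0r /q2 yc subrr (eqP (_ : enorm _ == 0)) ?enorm_eq0// expr0n/= invr_gt0.
  have e0 : n.+1%:R * q2 y <= 1 by rewrite -ler_pdivlMl// mulr1 ltW//; move: q20; rewrite scale0r add0r.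
  have -> : D n j y = 0 by rewrite /D; have [-> ->] := @cutoff_lo _ t n _ e0; rewrite !mul0r addr0.
  have hn : \forall h \near (0 : R), q2 (h *: basis R j + y) < n.+1%:R^-1.
    exact: (cvgr_lt _ (@line_cont j y) _ q20).
  rewrite /pd; apply: (near_is_derive1 (line_derive_cst 0 0)); near=> h.
  have hh : q2 (h *: basis R j + y) < n.+1%:R^-1 by near: h.
  by rewrite /P (proj1 (@cutoff_lo _ t n _ _)) ?mul0r// -ler_pdivlMl// mulr1 ltW.
have [rt|rt] := ltP (enorm (y - c)) t; last first.
  have q20 : t ^+ 2 - n.+1%:R^-1 < q2 (0 *: basis R j + y).
    rewrite scale0r add0r ltrBlDr (@lt_le_trans _ _ (t ^+ 2 + n.+1%:R^-1)) ?ltrDl ?invr_gt0//.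
    by rewrite lerD2r ler_pXn2r ?nnegrE ?enorm_ge0// ltW.
  have e0 q : t ^+ 2 - n.+1%:R^-1 < q -> n.+1%:R * (t ^+ 2 - q) <= 1.
    by move=> h; rewrite -ler_pdivlMl// mulr1; move: h; set w := n.+1%:R^-1; lra.
  have -> : D n j y = 0.
    rewrite /D; have [] := @cutoff_hi _ t n (q2 y); first by apply: e0; move: q20; rewrite scale0r add0r.
    by move=> -> ->; rewrite !mul0r addr0.
  have hn : \forall h \near (0 : R), t ^+ 2 - n.+1%:R^-1 < q2 (h *: basis R j + y).
    exact: (cvgr_gt _ (@line_cont j y) _ q20).
  rewrite /pd; apply: (near_is_derive1 (line_derive_cst 0 0)); near=> h.
  have hh : t ^+ 2 - n.+1%:R^-1 < q2 (h *: basis R j + y) by near: h.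
  by rewrite /P (proj1 (@cutoff_hi _ t n _ _)) ?mul0r//; exact: e0.
have r0 : 0 < enorm (y - c) < t by rewrite rt dist_gt0 yc.
have h1 : is_derive (q2 (0 *: basis R j + y)) 1 (cutoff t n) (cutoff' t n (q2 y)).
  by rewrite scale0r add0r; exact: is_derive_cutoff.
have h2 : is_derive (0 : R) 1 (fun h : R => F j (h *: basis R j + y)) (G j y) := @FG j y y3 r0.
have h3 : is_derive (0 : R) 1 (fun h : R => cutoff t n (q2 (h *: basis R j + y))) _ :=
  line_derive_comp (g := fun h : R => q2 (h *: basis R j + y)) h1 (pd_q2 j y).
have h4 := line_deriveM h3 h2; rewrite /pd /P; apply: (is_derive_eqv h4).
by rewrite scale0r add0r /D; ring.
Unshelve. all: end_near. Qed.

Let sumD n y : 4 <= n.+1%:R * t ^+ 2 -> \sum_j D n j y =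
  cutoff t n (q2 y) * (\sum_j G j y) + (shell c (bump_in n) radial_flux y - shell c (bump_out t n) radial_flux y).
Proof.
move=> nt; rewrite !big3E /D /shell /bump_in /bump_out /radial_flux dotE -/(q2 y).
have [r0|r0] := eqVneq (enorm (y - c)) 0.
  have [h h'] : cutoff t n (q2 y) = 0 /\ cutoff' t n (q2 y) = 0.
    by apply: cutoff_lo; rewrite /q2 r0 expr0n/= mulr0.
  by rewrite h h' r0; ring.
(* The two steps do not interact: their arguments a and b add up to (n+1) t^2 >= 4, so one of them
   is at least 2, where that step is constantly 1. *)
have e : cutoff' t n (q2 y) = n.+1%:R * smoothstep' (n.+1%:R * q2 y) - n.+1%:R * smoothstep' (n.+1%:R * (t ^+ 2 - q2 y)).
  rewrite /cutoff'; set a := n.+1%:R * q2 y; set b := n.+1%:R * (t ^+ 2 - q2 y).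
  have ab : 4 <= a + b by rewrite /a /b -mulrDr addrC subrK.
  have [a2|a2] := leP 2 a.
    by rewrite (@smoothstep'_ge2 _ a)// (@smoothstep_ge2 _ a)//; ring.
  by rewrite (@smoothstep_ge2 _ b) ?(@smoothstep'_ge2 _ b); [ring|lra|lra].
rewrite e !mxE /q2; set s1 := smoothstep' _; set s2 := smoothstep' _; field; exact: r0.
Qed.

Let bump_in0 n (r : R) : 2 <= n.+1%:R * t ^+ 2 -> 0 <= r -> bump_in n r != 0 -> n.+1%:R^-1 <= r <= t.
Proof. by move=> nt r0 /(bump_in_supp t0 nt r0)[]. Qed.

Let ub (f : vec -> R) (p : mR * mR * mR) : R := uind (vec3 p.1.1 p.1.2 p.2) * f (vec3 p.1.1 p.1.2 p.2).

Let shell_integrable (k : R -> R) (a : R) : 0 < a -> continuous k ->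
  (forall r, 0 <= r -> k r != 0 -> a <= r <= t) ->
  (@leb3 R).-integrable setT (EFin \o ub (shell c k radial_flux)).
Proof.
move=> a0 ck ks; apply: (@integrable_uind_supported _ (shell c k radial_flux) L).
  exact: (continuous_shell a0 ck ks continuous_radial).
move=> y h; rewrite /shell; have [->|kr] := eqVneq (k (enorm (y - c))) 0; first by rewrite mul0r.
have /andP[_ rt] := ks _ (enorm_ge0 _) kr; exfalso; apply: h => j.
have := le_coord_enorm (y - c) j; have := le_coord_enorm c j.
by rewrite !mxE /L !ler_norml => ? ?; apply/andP; split; lra.
Qed.

(** The divergence theorem before the limit: the gradient of the cutoff contributes the inner shell
    minus the outer one. *)
Let identity n : 4 <= n.+1%:R * t ^+ 2 ->
  \int[@leb3 R]_p ub (fun y : vec => cutoff t n (q2 y) * (\sum_j G j y)) p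
  + (\int[@leb3 R]_p ub (shell c (bump_in n) radial_flux) p
     - \int[@leb3 R]_p ub (shell c (bump_out t n) radial_flux) p)
  = - \int[@leb2 R]_p P n i3 (vec3 p.1 p.2 0).
Proof.
move=> nt.
have iD j : (@leb3 R).-integrable setT (EFin \o ub (D n j)).
  exact: (integrable_uind_supported (@cD n j) (@D0 n j)).
have IT j : j != i3 -> \int[@leb3 R]_p ub (D n j) p = 0.
  move: j; apply: ord3E => // _.
    exact: (halfspace_tangential1 L0 (@cP n i1) (@cD n i1) (@P0 n i1) (@D0 n i1) (@pd_PD n i1)).
  exact: (halfspace_tangential2 L0 (@cP n i2) (@cD n i2) (@P0 n i2) (@D0 n i2) (@pd_PD n i2)).
have I3 : \int[@leb3 R]_p ub (D n i3) p = - \int[@leb2 R]_p P n i3 (vec3 p.1 p.2 0).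
  exact: (halfspace_normal L0 (@cP n i3) (@cD n i3) (@P0 n i3) (@D0 n i3) (@pd_PD n i3)).
have iS : (@leb3 R).-integrable setT (EFin \o ub (shell c (bump_in n) radial_flux)).
  apply: (@shell_integrable _ n.+1%:R^-1); rewrite ?invr_gt0//; first exact: continuous_bump_in.
  by move=> r; apply: bump_in0; lra.
have iS' : (@leb3 R).-integrable setT (EFin \o ub (shell c (bump_out t n) radial_flux)).
  apply: (@shell_integrable _ (t / 2)); rewrite ?divr_gt0//; first exact: continuous_bump_out.
  by move=> r r0 /(bump_out_supp t0 nt r0)[]; lra.
have iG : (@leb3 R).-integrable setT (EFin \o ub (fun y : vec => cutoff t n (q2 y) * (\sum_j G j y))).
  apply: (@integrable_uind_supported _ (fun y : vec => cutoff t n (q2 y) * (\sum_j G j y)) L).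
    apply: (@continuous_cut _ c (cutoff t) n (fun y => \sum_j G j y)); [exact: (@continuous_cutoff _ t n)|by move=> q /(@cutoff_lo _ t)[]|].
    move=> y yc; rewrite (_ : (fun y => _) = (fun y => G i1 y + G i2 y + G i3 y)); last by apply/funext => z; rewrite big3E.
    exact: (continuousD (continuousD (cG yc) (cG yc)) (cG yc)).
  by move=> y /(@outside n)[-> _]; rewrite mul0r.
transitivity (\int[@leb3 R]_p ub (D n i1) p + \int[@leb3 R]_p ub (D n i2) p + \int[@leb3 R]_p ub (D n i3) p); last first.
  by rewrite (IT i1 isT) (IT i2 isT) !add0r.
have iD12 : (@leb3 R).-integrable setT (EFin \o (fun p => ub (D n i1) p + ub (D n i2) p)).
  exact: (integrableD measurableT (iD i1) (iD i2)).
have iSS : (@leb3 R).-integrable setT (EFin \o (fun p =>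
    ub (shell c (bump_in n) radial_flux) p - ub (shell c (bump_out t n) radial_flux) p)).
  exact: (integrableB measurableT iS iS').
rewrite -RintegralB// -RintegralD// -RintegralD// -RintegralD//.
apply: eq_Rintegral => p _; rewrite /ub -!mulrDr -mulrBr -mulrDr; congr (_ * _).
by have := sumD (vec3 p.1.1 p.1.2 p.2) nt; rewrite big3E => ->.
Qed.

Let Gind (y : vec) : R := (0 < enorm (y - c) < t)%R%:R * (\sum_j G j y).

Let Gn_cvg y : cutoff t n (q2 y) * (\sum_j G j y) @[n --> \oo] --> Gind y.
Proof.
by rewrite /Gind (dist_sqr_lt c t0); apply: cvgM; [exact: cutoff_cvg|exact: cvg_cst].
Qed.

Let Gn_le n y : `|uind y * (cutoff t n (q2 y) * \sum_j G j y)| <= C * inv_dist2 c t y.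
Proof.
have rhs0 : 0 <= C * inv_dist2 c t y by rewrite mulr_ge0// inv_dist2_ge0.
rewrite /uind; have [y3|y3] := ltP 0 (y 0 i3); last by rewrite mul0r normr0.
rewrite mul1r /inv_dist2.
have [r0|r0] := boolP (0 < enorm (y - c) < t); last first.
  suff -> : cutoff t n (q2 y) = 0 by rewrite !mul0r normr0 mulr0.
  move: r0; rewrite (dist_sqr_lt c t0) negb_and -!leNgt => /orP[h|h].
    by apply: (proj1 (cutoff_lo _ _)); apply: (@le_trans _ _ 0) => //; rewrite pmulr_rle0.
  by apply: (proj1 (cutoff_hi _)); apply: (@le_trans _ _ 0) => //; rewrite pmulr_rle0// subr_le0.
have /andP[k0 k1] := cutoff_itv t n (q2 y).
rewrite normrM ger0_norm// mul1r (le_trans _ (GC y3 r0))// ler_piMl//.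
Qed.

Let mGn n : measurable_fun setT (ub (fun y : vec => cutoff t n (q2 y) * (\sum_j G j y))).
Proof.
apply: measurable_funM; first exact: measurable_uind.
apply: (@measurable_vec3_cont _ (fun y : vec => cutoff t n (q2 y) * (\sum_j G j y))).
apply: (@continuous_cut _ c (cutoff t) n (fun y => \sum_j G j y)); [exact: (@continuous_cutoff _ t n)|by move=> q /(@cutoff_lo _ t)[]|].
move=> y yc; rewrite (_ : (fun y => _) = (fun y => G i1 y + G i2 y + G i3 y)); last by apply/funext => z; rewrite big3E.
exact: (continuousD (continuousD (cG yc) (cG yc)) (cG yc)).
Qed.

Let G_limit : (@leb3 R).-integrable setT (EFin \o ub Gind) /\
  \int[@leb3 R]_p ub (fun y : vec => cutoff t n (q2 y) * (\sum_j G j y)) p @[n --> \oo] -->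
  \int[@leb3 R]_p ub Gind p.
Proof.
have uc p : ub (fun y : vec => cutoff t n (q2 y) * (\sum_j G j y)) p @[n --> \oo] --> ub Gind p.
  by apply: cvgM; [exact: cvg_cst|exact: Gn_cvg].
apply: (@Rdominated_cvg _ _ _ (@leb3 R) setT (fun n => ub (fun y => cutoff t n (q2 y) * (\sum_j G j y))) (ub Gind) (fun p => C * inv_dist2 c t (vec3 p.1.1 p.1.2 p.2))) => //.
- by apply: (@measurable_fun_cvg _ _ _ _ (fun n p => ub (fun y : vec => cutoff t n (q2 y) * (\sum_j G j y)) p)).
- by apply: aeW => p _; exact: uc.
- have := integrableZl measurableT C (integrable_inv_dist2 c t0).
  by apply: eq_integrable.
- by move=> n p _; exact: Gn_le.
Qed.

Let Pind (y : vec) : R := (enorm (y - c) < t)%R%:R * F i3 y.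

Let dist_plane (a b : R) : `|c 0 i3| <= enorm (vec3 a b 0 - c).
Proof.
by apply: le_trans (le_coord_enorm _ i3); rewrite !mxE/= sub0r normrN.
Qed.

Let square : set (mR * mR) := `[- L, L] `*` `[- L, L].

(** Points of the plane have distance at least |c_3| from the centre, so the flux is bounded there;
    the square contains the trace of the ball. *)
Let bound_plane (p : mR * mR) : R := (M / `|c 0 i3| ^+ 2) * \1_square p.

Let Pn_le n (p : mR * mR) : `|P n i3 (vec3 p.1 p.2 0)| <= bound_plane p.
Proof.
set y := vec3 p.1 p.2 0; have cp : 0 < `|c 0 i3| by rewrite normr_gt0.
have bp : 0 <= bound_plane p by rewrite mulr_ge0// divr_ge0// sqr_ge0.
have yr := dist_plane p.1 p.2; rewrite -/y in yr.
have [h|h] := eqVneq (cutoff t n (q2 y)) 0; first by rewrite /P h mul0r normr0.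
have rt : 0 < enorm (y - c) < t.
  rewrite (dist_sqr_lt c t0) exprn_gt0 ?(lt_le_trans cp)//= ltNge; apply/negP => h1.
  move/eqP: h; apply; apply: (proj1 (cutoff_hi _)).
  by apply: (@le_trans _ _ 0) => //; rewrite pmulr_rle0// subr_le0.
have -> : bound_plane p = M / `|c 0 i3| ^+ 2.
  rewrite /bound_plane indicE mem_set ?mulr1//.
  have h1 k : `|y 0 k| <= L.
    have := le_coord_enorm (y - c) k; have := le_coord_enorm c k; move/andP: rt => [_].
    by rewrite !mxE /L !ler_norml => ? ? ?; apply/andP; split; lra.
  split => /=; rewrite in_itv/= -ler_norml.
    by have := h1 i1; rewrite vec3E.
  by have := h1 i2; rewrite vec3E.
have /andP[k0 k1] := cutoff_itv t n (q2 y).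
have /andP[r0 rt'] := rt.
rewrite /P normrM ger0_norm//.
have hF : `|F i3 y| <= M / enorm (y - c) ^+ 2 by apply: FM; rewrite r0 ltW.
apply: (@le_trans _ _ `|F i3 y|); first by rewrite ler_piMl.
rewrite (le_trans hF)// ler_wpM2l// lef_pV2 ?posrE ?exprn_gt0//.
by rewrite ler_pXn2r ?nnegrE ?enorm_ge0.
Qed.

Let P_limit : (@leb2 R).-integrable setT (EFin \o (fun p : mR * mR => Pind (vec3 p.1 p.2 0))) /\
  \int[@leb2 R]_p P n i3 (vec3 p.1 p.2 0) @[n --> \oo] -->
  \int[@leb2 R]_p Pind (vec3 p.1 p.2 0).
Proof.
have uc (p : mR * mR) : P n i3 (vec3 p.1 p.2 0) @[n --> \oo] --> Pind (vec3 p.1 p.2 0).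
  apply: cvgM; last exact: cvg_cst.
  have := @cutoff_cvg _ t (q2 (vec3 p.1 p.2 0)).
  rewrite -(dist_sqr_lt c t0) (_ : 0 < enorm _) //.
  by apply: lt_le_trans (dist_plane _ _); rewrite normr_gt0.
have mP n : measurable_fun setT (fun p : mR * mR => P n i3 (vec3 p.1 p.2 0)).
  exact: measurable_vec3_plane_cont.
apply: (@Rdominated_cvg _ _ _ (@leb2 R) setT (fun n (p : mR * mR) => P n i3 (vec3 p.1 p.2 0)) (fun p => Pind (vec3 p.1 p.2 0)) bound_plane) => //.
- by apply: (@measurable_fun_cvg _ _ _ _ (fun n (p : mR * mR) => P n i3 (vec3 p.1 p.2 0))).
- by apply: aeW => p _; exact: uc.
- have mS : measurable square by exact: measurableX.
  have iS : (@leb2 R).-integrable square (EFin \o cst (M / `|c 0 i3| ^+ 2)).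
    apply: (@integrable_bounded _ _ _ _ _ _ `|M / `|c 0 i3| ^+ 2|) => //.
    exact: leb2_square.
  have := (integrable_mkcond (EFin \o cst (M / `|c 0 i3| ^+ 2)) mS).1 iS.
  apply: eq_integrable => // p _; rewrite patchE /bound_plane /= indicE.
  by case: (p \in square); rewrite ?mulr1 ?mulr0.
Qed.

(* Apply the divergence theorem on the half space to F times a cutoff that
   vanishes near c and near the sphere; the gradient of the cutoff is a sum of two
   thin shells, which give the two sphere terms on the left. *)
Theorem half_ball_divergence :
  [/\ (@leb3 R).-integrable setT (EFin \o (fun p : mR * mR * mR =>
        let y := vec3 p.1.1 p.1.2 p.2 in
        uind y * ((0 < enorm (y - c) < t)%R%:R * \sum_j G j y))),
      (@leb2 R).-integrable setT (EFin \o (fun p : mR * mR =>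
        let y := vec3 p.1 p.2 0 in (enorm (y - c) < t)%R%:R * F i3 y)) &
      smean c radial_flux t - uind c * q0 * (4 * pi) =
      \int[@leb3 R]_p (let y := vec3 p.1.1 p.1.2 p.2 in
        uind y * ((0 < enorm (y - c) < t)%R%:R * \sum_j G j y))
      + \int[@leb2 R]_p (let y := vec3 p.1 p.2 0 in (enorm (y - c) < t)%R%:R * F i3 y)].
Proof.
have [iG limG] := G_limit; have [iP limP] := P_limit; split => //.
have M30 : 0 <= 3 * M by rewrite mulr_ge0.
have h1 := shell_in_cvg t0 M30 continuous_radial radial_le c3 Qc.
have h2 := shell_out_cvg t0 M30 continuous_radial radial_le.
have h4 : (- \int[@leb2 R]_p P n i3 (vec3 p.1 p.2 0)) @[n --> \oo] --> - \int[@leb2 R]_p Pind (vec3 p.1 p.2 0).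
  exact: cvgN limP.
have e : \int[@leb3 R]_p ub Gind p + (uind c * q0 * (4 * pi) - smean c radial_flux t) =
    - \int[@leb2 R]_p Pind (vec3 p.1 p.2 0).
  have H := @Rhausdorff R.
  have t2 : 0 < t ^+ 2 / 4 by rewrite divr_gt0// exprn_gt0.
  rewrite -(cvg_lim H h4); apply/esym/(cvg_lim H).
  apply: cvg_trans (cvgD limG (cvgB h1 h2)); apply: near_eq_cvg; near=> n.
  have nt : 4 <= n.+1%:R * t ^+ 2.
    have : n.+1%:R^-1 <= t ^+ 2 / 4 by near: n; exact: near_natSinv_le.
    move=> h; have : 1 <= n.+1%:R * (t ^+ 2 / 4) by rewrite -ler_pdivrMl// mulr1.
    lra.
  exact: identity nt.
move: e; rewrite /ub /Gind /Pind; lra.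
Unshelve. all: end_near. Qed.

End HalfBallDivergence.

(** * Integrals over the velocity variable *)

Section MomentumIntegrals.
Context {R : realType}.
Notation vec := 'rV[R]_3.
Notation mu := (@lebesgue_measure R).
Notation mR := (measurableTypeR R).

(** The square of the Lorentz factor, a polynomial in v. *)
Definition gamma2 (v : vec) : R := 1 + enorm v ^+ 2.

Lemma gamma2_ge1 v : 1 <= gamma2 v.
Proof. by rewrite lerDl sqr_ge0. Qed.

Lemma gamma2_gt0 v : 0 < gamma2 v.
Proof. exact: lt_le_trans (gamma2_ge1 v). Qed.

Lemma continuous_gamma2 : continuous gamma2.
Proof.
move=> v; apply: (@continuousD _ _ _ (cst 1 : vec -> R) (fun v : vec => enorm v ^+ 2)); first exact: cst_continuous.
apply: (@continuous_comp _ _ _ (@enorm R) (fun x : R => x ^+ 2)); first exact: continuous_enorm.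
exact: exprn_continuous.
Qed.

(** Decay of order |v|^-6. The exponent makes the radial integrand r^2 (1 + r^2)^-3, which the
    integrable function (1 + r^2)^-1 dominates. *)
Definition weight (v : vec) : R := (gamma2 v ^+ 3)^-1.

Lemma weight_gt0 v : 0 < weight v.
Proof. by rewrite invr_gt0 exprn_gt0// gamma2_gt0. Qed.

Lemma continuous_weight : continuous weight.
Proof.
move=> v; rewrite /weight; apply: (@continuousV _ _ (fun v => gamma2 v ^+ 3)); first by rewrite expf_neq0// gt_eqF// gamma2_gt0.
apply: (@continuous_comp _ _ _ gamma2 (fun x : R => x ^+ 3)); first exact: continuous_gamma2.
exact: exprn_continuous.
Qed.

Lemma integrable_weight : (@leb3 R).-integrable setT
  (EFin \o (fun p : mR * mR * mR => weight (vec3 p.1.1 p.1.2 p.2))).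
Proof.
have w0 v : 0 <= weight v by exact/ltW/weight_gt0.
apply/integrableP; split.
  by apply/measurable_EFinP; exact: (measurable_vec3_cont continuous_weight).
under eq_integral => p _ do rewrite /= ger0_norm//.
rewrite (spherical 0 continuous_weight w0).
have p0 := pi_gt0 R; have q0 : 0 <= 4 * (pi : R) by apply: mulr_ge0 => //; exact: ltW.
have E (r : R) : 0 < r -> (\int[@leb2 R]_(q in rect) (weight (sphere_param 0 r q) * (r ^+ 2 * sin q.1))%:E
    = (r ^+ 2 / (1 + r ^+ 2) ^+ 3 * (4 * pi))%:E)%E.
  move=> r0.
  have Ek q : weight (sphere_param 0 r q) * (r ^+ 2 * sin q.1) = r ^+ 2 / (1 + r ^+ 2) ^+ 3 * sin q.1.
    by rewrite /weight /gamma2 -[X in enorm X]subr0 enorm_sphere ?ltW// mulrCA mulrA.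
  under eq_integral do rewrite Ek.
  have is' : (@leb2 R).-integrable rect (EFin \o (fun q : mR * mR => sin q.1)).
    apply: (@integrable_bounded _ _ _ _ _ _ 1); [exact: measurable_rect|exact: leb2_rect|exact: measurable_sin_rect|].
    by move=> q rq; rewrite ger0_norm ?sin_rect_ge0// sin_le1.
  under eq_integral do rewrite EFinM.
  rewrite integralZl//; last exact: measurable_rect.
  have fs := integrable_fin_num measurable_rect is'.
  have e4 : (\int[@leb2 R]_(q in rect) (sin q.1)%:E = (4 * pi)%:E)%E.
    by rewrite -integral_sin_rect /Rintegral fineK.
  by rewrite [X in (_ * X)%E]e4 EFinM.
rewrite (eq_integral (fun r : mR => ((r : R) ^+ 2 / (1 + (r : R) ^+ 2) ^+ 3 * (4 * pi))%:E)); last by move=> r; rewrite inE/= in_itv/= andbT => /E.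
have b1 (r : R) : 1 <= 1 + r ^+ 2 by rewrite lerDl sqr_ge0.
have b0 (r : R) : 0 < 1 + r ^+ 2 by exact: lt_le_trans (b1 r).
have co : continuous (fun r : R => (4 * pi) * (oneDsqr r)^-1).
  move=> r; apply: (@continuousM _ _ (cst (4 * pi)) (fun r => (oneDsqr r)^-1)); first exact: cst_continuous.
  exact: continuous_oneDsqrV.
have c1 : continuous (fun r : R => r ^+ 2 / (1 + r ^+ 2) ^+ 3 * (4 * pi)).
  move=> r; apply: (@continuousM _ _ (fun r : R => r ^+ 2 / (1 + r ^+ 2) ^+ 3) (cst (4 * pi))); last exact: cst_continuous.
  apply: (@continuousM _ _ (fun r : R => r ^+ 2) (fun r : R => ((1 + r ^+ 2) ^+ 3)^-1)); first exact: exprn_continuous.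
  apply: continuousV; first by rewrite expf_neq0// gt_eqF.
  apply: (@continuous_comp _ _ _ (fun r : R => 1 + r ^+ 2) (fun x : R => x ^+ 3)); last exact: exprn_continuous.
  exact: continuous_oneDsqr.
have m1 (D : set R) : measurable_fun (D : set mR) (fun r => (r ^+ 2 / (1 + r ^+ 2) ^+ 3 * (4 * pi))%:E).
  exact: measurable_EFin_cont.
have m2 (D : set R) : measurable_fun (D : set mR) (fun r => ((4 * pi) * (oneDsqr r)^-1)%:E).
  exact: measurable_EFin_cont.
apply: (@le_lt_trans _ _ (\int[mu]_(r in `[0%R, +oo[) ((4 * pi) * (oneDsqr r)^-1)%:E)%E).
  rewrite integral_mkcond [leRHS]integral_mkcond; apply: ge0_le_integral => //.
  - move=> r _; rewrite patchE; case: ifPn => // _; rewrite lee_fin.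
    apply: mulr_ge0 => //; apply: mulr_ge0; first exact: sqr_ge0.
    by rewrite invr_ge0 exprn_ge0// ltW.
  - apply: (measurable_restrictT _ _).1; [exact: measurable_itv|exact: m1].
  - apply: (measurable_restrictT _ _).1; [exact: measurable_itv|exact: m2].
  - move=> r _; rewrite !patchE !mem_setE !in_itv/= !andbT.
    have [r0|r0|<-] := ltgtP 0 r => //=.
    + rewrite lee_fin mulrC ler_wpM2l// /oneDsqr ler_pdivrMr ?exprn_gt0//.
      have -> : (1 + r ^+ 2)^-1 * (1 + r ^+ 2) ^+ 3 = (1 + r ^+ 2) ^+ 2 by field; rewrite gt_eqF.
      have := b1 r; nra.
    + by rewrite lee_fin mulr_ge0// invr_ge0 /oneDsqr ltW.
under eq_integral do rewrite EFinM.
rewrite ge0_integralZl//.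
- by rewrite integral0y_oneDsqr -EFinM ltry.
by apply: measurable_EFin_cont; exact: continuous_oneDsqrV.
Qed.

Definition vint (P : vec -> R) : R := \int[@leb3 R]_p P (vec3 p.1.1 p.1.2 p.2).

Lemma vintE P : int_space setT P = vint P.
Proof. by []. Qed.

(* Domination by a fixed integrable weight; every velocity integral below is
   absolutely convergent for this reason. *)
Definition vdom (C : R) (P : vec -> R) : Prop :=
  continuous P /\ forall v, `|P v| <= C * weight v.

Lemma vdom_integrable C P : vdom C P -> (@leb3 R).-integrable setT
  (EFin \o (fun p : mR * mR * mR => P (vec3 p.1.1 p.1.2 p.2))).
Proof.
move=> [cP PC]; have := integrableZl measurableT C integrable_weight.
apply: le_integrable => //.
  by apply/measurable_EFinP; exact: (measurable_vec3_cont cP).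
by move=> p _; rewrite /= lee_fin (le_trans (PC _))// ler_norm.
Qed.

Lemma vdom_ge0 C P : vdom C P -> 0 <= C.
Proof.
by move=> [_ /(_ 0)] /(le_trans (normr_ge0 _)); rewrite pmulr_lge0// weight_gt0.
Qed.

Lemma vdomD C C' P P' : vdom C P -> vdom C' P' -> vdom (C + C') (fun v => P v + P' v).
Proof.
move=> [cP PC] [cP' PC']; split; first by move=> v; apply: (@continuousD _ _ _ P P'); [exact: cP|exact: cP'].
by move=> v; rewrite mulrDl (le_trans (ler_normD _ _))// lerD.
Qed.

Lemma vdomZ C P k : vdom C P -> vdom (`|k| * C) (fun v => k * P v).
Proof.
move=> [cP PC]; split; last by move=> v; rewrite normrM -mulrA ler_wpM2l.
by move=> v; apply: (@continuousM _ _ (cst k) P); [exact: cst_continuous|exact: cP].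
Qed.

Lemma vdomN C P : vdom C P -> vdom C (fun v => - P v).
Proof.
move=> [cP PC]; split; last by move=> v; rewrite normrN.
by move=> v; apply: (@continuousN _ _ _ P); exact: cP.
Qed.

Lemma vint_ext P P' : (forall v, P v = P' v) -> vint P = vint P'.
Proof. by move=> h; apply: eq_Rintegral => p _; exact: h. Qed.

Lemma vintD C C' P P' : vdom C P -> vdom C' P' ->
  vint (fun v => P v + P' v) = vint P + vint P'.
Proof.
by move=> /vdom_integrable iP /vdom_integrable iP'; rewrite /vint RintegralD.
Qed.

Lemma vintZ C P k : vdom C P -> vint (fun v => k * P v) = k * vint P.
Proof. by move=> /vdom_integrable iP; rewrite /vint RintegralZl. Qed.

Lemma vintB C C' P P' : vdom C P -> vdom C' P' ->
  vint (fun v => P v - P' v) = vint P - vint P'.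
Proof.
by move=> /vdom_integrable iP /vdom_integrable iP'; rewrite /vint RintegralB.
Qed.

Lemma vint_le C P : vdom C P -> `|vint P| <= C * vint weight.
Proof.
move=> dP; have iP := vdom_integrable dP.
rewrite /vint -RintegralZl//; last exact: integrable_weight.
apply: (le_trans (le_normr_Rintegral measurableT iP)).
apply: le_Rintegral => //.
- exact: (integrable_norm iP).
- exact: (integrableZl measurableT C integrable_weight).
- by move=> p _; have [_] := dP; apply.
Qed.

Lemma vint_weight_ge0 : 0 <= vint weight.
Proof. by apply: Rintegral_ge0 => p _; exact/ltW/weight_gt0. Qed.

(** Dominated convergence is a statement about sequences, so continuity is proved by contradiction:
    a failing neighbourhood basis yields a sequence tending to x whose integrals stay away from the
    limit. *)
Lemma vint_continuous (X : pseudoMetricType R) (P : X -> vec -> R) (x : X) (C : R) :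
  (forall v, {for x, continuous (P ^~ v)}) -> (\forall y \near x, vdom C (P y)) ->
  {for x, continuous (fun y => vint (P y))}.
Proof.
move=> cP PC; apply/cvgrPdist_le => e e0; apply: contrapT => nn.
have H (n : nat) : exists y : X, [/\ ball x n.+1%:R^-1 y, vdom C (P y)
    & ~ (`|vint (P x) - vint (P y)| <= e)].
  apply: contrapT => nex; apply: nn; near=> y.
  apply: contrapT => ny; apply: nex; exists y; split => //; near: y; last exact: PC.
  by apply: nbhsx_ballx; rewrite invr_gt0.
have [u hu] := choice H.
have ux : u n @[n --> \oo] --> x.
  apply/cvg_ballP => d d0; near=> n; have [h _ _] := hu n.
  by apply: le_ball h; near: n; exact: near_natSinv_le.
have dx : vdom C (P x) by exact: (nbhs_singleton PC).
have dn n : vdom C (P (u n)) by have [] := hu n.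
have cn : {ae @leb3 R, forall p : mR * mR * mR, setT p ->
    P (u n) (vec3 p.1.1 p.1.2 p.2) @[n --> \oo] --> P x (vec3 p.1.1 p.1.2 p.2)}.
  apply: aeW => p _; apply: (@cvg_comp _ _ _ u (fun y => P y (vec3 p.1.1 p.1.2 p.2)) \oo (nbhs x)) => //.
  exact: cP.
have [_] := @Rdominated_cvg _ _ _ (@leb3 R) setT
  (fun n p => P (u n) (vec3 p.1.1 p.1.2 p.2)) (fun p => P x (vec3 p.1.1 p.1.2 p.2))
  (fun p => C * weight (vec3 p.1.1 p.1.2 p.2)) measurableT
  (fun n => measurable_vec3_cont (dn n).1) (measurable_vec3_cont dx.1)
  cn (integrableZl measurableT C integrable_weight) (fun n p _ => (dn n).2 _).
move=> /cvgrPdist_le/(_ e e0) [N _ /(_ N (leqnn N))]; by have [] := hu N.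
Unshelve. all: end_near. Qed.

Lemma vint_derive (P P' : R -> vec -> R) (d C : R) : 0 < d ->
  (forall h v, `|h| < d -> is_derive (h : R) 1 (P ^~ v) (P' h v)) ->
  (forall h, `|h| < d -> vdom C (P h)) ->
  (forall h v, `|h| < d -> `|P' h v| <= C * weight v) ->
  is_derive (0 : R) 1 (fun h => vint (P h)) (vint (P' 0)).
Proof.
move=> d0 dP bP bP'.
have itvE (h : R) : `]- d, d[%classic h -> `|h| < d by rewrite /= in_itv/= -ltr_norml.
have I0 : `]- d, d[%classic (0 : R) by rewrite /= in_itv/= d0 oppr_lt0 d0.
have C0 : 0 <= C by apply: (@vdom_ge0 C (P 0)); apply: bP; rewrite normr0.
have := @cvg_differentiation_under_integral _ _ _ (@leb3 R)
  (fun h p => P h (vec3 p.1.1 p.1.2 p.2)) setT measurableT 0 (- d) d I0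
  (fun h Ih => vdom_integrable (bP h (itvE h Ih)))
  (fun h p Ih _ => let: DeriveDef hd _ := dP h (vec3 p.1.1 p.1.2 p.2) (itvE h Ih) in hd)
  (fun p => C * weight (vec3 p.1.1 p.1.2 p.2))
  (fun p => mulr_ge0 C0 (ltW (weight_gt0 _)))
  (integrableZl measurableT C integrable_weight).
have dE h p : `|h| < d -> (partial1of2 (fun h (p : mR * mR * mR) => P h (vec3 p.1.1 p.1.2 p.2))) h p = P' h (vec3 p.1.1 p.1.2 p.2).
  move=> hd; rewrite partial1of2E; exact: (@derive_val _ _ _ _ _ _ _ (dP h _ hd)).
move=> /(_ _)-H; apply: is_derive1P; rewrite /vint.
rewrite -(eq_Rintegral (@leb3 R) (g := fun p => P' 0 (vec3 p.1.1 p.1.2 p.2)) (f := fun p => (partial1of2 (fun h (p : mR * mR * mR) => P h (vec3 p.1.1 p.1.2 p.2))) 0 p)).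
  by apply: H => h p Ih _; rewrite dE; [exact/bP'/itvE|exact: itvE].
by move=> p _; rewrite dE// normr0.
Qed.

(** From |v|^2 <= 2 |v + e|^2 + 2 |e|^2 follows [gamma2 v] <= 3 [gamma2 (v + e)]; the cube of 3 is
    the constant. *)
Lemma weight_shift (C : R) (e : vec) : enorm e <= 1 -> forall v, weight (v + e) <= 27 * weight v.
Proof.
move=> e1 v; rewrite /weight.
have g0 := gamma2_gt0 v; have g1 := gamma2_gt0 (v + e).
have h : gamma2 v <= 3 * gamma2 (v + e).
  have : enorm e ^+ 2 <= 1 by rewrite expr_le1// enorm_ge0.
  rewrite /gamma2 !enorm_sqr !mxE.
  have q (a b : R) : a ^+ 2 <= 2 * (a + b) ^+ 2 + 2 * b ^+ 2.
    by have := sqr_ge0 (a + 2 * b); nra.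
  have := q (v 0 i1) (e 0 i1); have := q (v 0 i2) (e 0 i2); have := q (v 0 i3) (e 0 i3).
  have := sqr_ge0 (v 0 i1 + e 0 i1); have := sqr_ge0 (v 0 i2 + e 0 i2); have := sqr_ge0 (v 0 i3 + e 0 i3).
  lra.
have h3 : gamma2 v ^+ 3 <= (3 * gamma2 (v + e)) ^+ 3.
  by rewrite lerXn2r ?nnegrE ?mulr_ge0// ltW.
rewrite -(ler_pM2r (exprn_gt0 3 g0)) mulfVK ?expf_neq0 ?gt_eqF//.
by rewrite ler_pdivrMl ?exprn_gt0//; move: h3; rewrite exprMn; lra.
Qed.

(** Translation invariance is known for non-negative integrands; P is the difference of P + C weight
    and C weight, both non-negative and integrable. *)
Lemma vint_shift (C : R) P (e : vec) : vdom C P -> vint (fun v => P (v + e)) = vint P.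
Proof.
move=> dP; have C0 := vdom_ge0 dP; have [cP PC] := dP.
have cadd (k : vec -> R) : continuous k -> continuous (fun v : vec => k (v + e)).
  move=> ck v; apply: (@continuous_comp _ _ _ (fun v : vec => v + e) k); last exact: ck.
  exact: continuous_addr.
pose S v := P v + C * weight v.
have cCw : continuous (fun v => C * weight v).
  by move=> v; apply: (@continuousM _ _ (cst C) weight); [exact: cst_continuous|exact: continuous_weight].
have cS : continuous S.
  by move=> v; apply: (@continuousD _ _ _ P (fun v => C * weight v)); [exact: cP|exact: cCw].
have S0 v : 0 <= S v by have := PC v; rewrite /S ler_norml; lra.
have Cw0 v : 0 <= C * weight v by rewrite mulr_ge0// ltW// weight_gt0.
have dw : vdom C (fun v => C * weight v) by split => // v; rewrite ger0_norm.
have dS : vdom (C + C) S by exact: vdomD.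
have ge0_shift (k : vec -> R) D : vdom D k -> (forall v, 0 <= k v) ->
    (@leb3 R).-integrable setT (EFin \o (fun p : mR * mR * mR => k (vec3 p.1.1 p.1.2 p.2 + e))) /\
    vint (fun v => k (v + e)) = vint k.
  move=> dk k0; have ik := vdom_integrable dk.
  have E := integral_leb3_shift e dk.1 k0.
  split; last by rewrite /vint /Rintegral E.
  apply/integrableP; split.
    by apply/measurable_EFinP; exact: (measurable_vec3_cont (cadd _ dk.1)).
  move/integrableP: ik => [_].
  under eq_integral => p _ do rewrite /= ger0_norm//.
  by under [X in _ -> (X < _)%E]eq_integral => p _ do rewrite /= ger0_norm//; rewrite E.
have [iS ES] := ge0_shift _ _ dS S0.
have [iw Ew] := ge0_shift _ _ dw Cw0.
transitivity (vint (fun v => S (v + e)) - vint (fun v => C * weight (v + e))).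
  by rewrite /vint -RintegralB//; apply: eq_Rintegral => p _; rewrite /S addrK.
rewrite ES Ew -(vintB dS dw); apply: vint_ext => v; rewrite /S addrK//.
Qed.

Lemma pd_line (j : 'I_3) (F : vec -> R) (y : vec) (h d : R) : pd j F (h *: basis R j + y) d ->
  is_derive h 1 (fun s => F (s *: basis R j + y)) d.
Proof.
move=> H; have s : is_derive h 1 (fun s : R => s - h) 1.
  by apply: (is_derive_eqv (line_deriveB (line_derive_id h) (line_derive_cst h h))); rewrite subr0.
have h' : is_derive (h - h) 1 (fun s => F (s *: basis R j + (h *: basis R j + y))) d by rewrite subrr.
have := line_derive_comp (g := fun s : R => s - h) h' s; rewrite mulr1; congr is_derive; apply/funext => u; congr F.
by rewrite addrA -scalerDl subrK.
Qed.

(** The integral of P translated by h e_j is constant in h, and its derivative at 0 is the integral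
    of P'. No boundary term at infinity has to be discussed; [weight_shift] dominates the translates
    for |h| < 1. *)
Lemma vint_pd0 (C : R) j (P P' : vec -> R) : vdom C P -> (forall v, pd j P v (P' v)) ->
  (forall v, `|P' v| <= C * weight v) -> vint P' = 0.
Proof.
move=> dP PP' bP'; have C0 := vdom_ge0 dP; have [cP PC] := dP.
have e1 (h : R) : `|h| < 1 -> enorm (h *: basis R j) <= 1.
  move=> h1; rewrite enorm_scale (_ : enorm (basis R j) = 1) ?mulr1 ?ltW//.
  apply/eqP; rewrite -(@eqrXn2 _ 2)// ?enorm_ge0// expr1n; apply/eqP.
  by rewrite enorm_sqr !basisE; move: j {PP'}; apply: ord3E; rewrite /= ?expr1n ?expr0n/=; ring.
have sw (Q : vec -> R) (h : R) v : `|h| < 1 -> (forall v, `|Q v| <= C * weight v) ->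
    `|Q (h *: basis R j + v)| <= (27 * C) * weight v.
  move=> h1 bQ; apply: (le_trans (bQ _)).
  rewrite (_ : 27 * C * weight v = C * (27 * weight v)); last by ring.
  by rewrite ler_wpM2l// addrC; apply: weight_shift => //; exact: e1.
have D : is_derive (0 : R) 1 (fun h => vint (fun v => P (h *: basis R j + v))) (vint (fun v => P' (0 *: basis R j + v))).
  apply: (@vint_derive (fun h v => P (h *: basis R j + v)) (fun h v => P' (h *: basis R j + v)) 1 (27 * C)) => //.
  - by move=> h v _; exact: pd_line.
  - move=> h h1; split; last by move=> v; exact: sw.
    move=> v; apply: (@continuous_comp _ _ _ (fun v : vec => h *: basis R j + v) P); last exact: cP.
    exact: (cvgD (cvg_cst _) cvg_id).
  - by move=> h v h1; exact: sw.
have E : (fun h => vint (fun v => P (h *: basis R j + v))) = cst (vint P).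
  apply/funext => h; rewrite -(@vint_shift C P (h *: basis R j) dP).
  by apply: vint_ext => v; rewrite addrC.
rewrite E in D; have [_ D1] := D; have [_ D2] := line_derive_cst (0 : R) (vint P).
rewrite -D2 D1; apply: vint_ext => v; by rewrite scale0r add0r.
Qed.

End MomentumIntegrals.

(** * Fields on the closed half space and retarded times *)

Section Calculus.
Context {R : realType}.
Notation vec := 'rV[R]_3.

Lemma within_continuous_comp (X Y Z : topologicalType) (A : set Y) (f : Y -> Z) (g : X -> Y) :
  {within A, continuous f} -> continuous g -> (forall x, A (g x)) -> continuous (f \o g).
Proof.
move=> /subspace_continuousP cf cg Ag x W /(cf _ (Ag x)) h.
have K : \forall y \near x, W (f (g y)).
  near=> y; have : A (g y) by exact: Ag.
  near: y; exact: (cg x _ h).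
exact: K.
Unshelve. all: end_near.
Qed.

Lemma continuous_pair (X Y Z : topologicalType) (f : X -> Y) (g : X -> Z) x :
  {for x, continuous f} -> {for x, continuous g} -> {for x, continuous (fun x => (f x, g x))}.
Proof. by move=> cf cg; exact: cvg_pair. Qed.

Lemma pd_dist2 (c : vec) j (y : vec) : pd j (fun y : vec => enorm (y - c) ^+ 2) y (2 * (y - c) 0 j).
Proof.
have e : (fun h : R => enorm (h *: basis R j + y - c) ^+ 2) =
    (fun h : R => h ^+ 2 + (2 * (y - c) 0 j * h + enorm (y - c) ^+ 2)).
  apply/funext => h; rewrite !enorm_sqr.
  by move: j; apply: ord3E; rewrite !mxE/= ?mulr1 ?mulr0; ring.
rewrite /pd e; apply: (is_derive_eqv (line_deriveD (line_derive_sqr (line_derive_id _)) (line_deriveD (line_deriveMl _ (line_derive_id _)) (line_derive_cst _ _)))).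
by rewrite !mulr0 mul0r add0r mulr1 addr0.
Qed.

Lemma pd_dist (c : vec) j (y : vec) : y != c ->
  pd j (fun y : vec => enorm (y - c)) y ((y - c) 0 j / enorm (y - c)).
Proof.
move=> yc; have r0 : 0 < enorm (y - c) by rewrite dist_gt0.
have e : (fun h : R => enorm (h *: basis R j + y - c)) =
    (fun h : R => Num.sqrt (enorm (h *: basis R j + y - c) ^+ 2)).
  by apply/funext => h; rewrite sqrtr_sqr ger0_norm// enorm_ge0.
have p0 : 0 < enorm (0 *: basis R j + y - c) ^+ 2 by rewrite scale0r add0r exprn_gt0.
have D : is_derive (0 : R) 1 (fun h : R => enorm (h *: basis R j + y - c) ^+ 2) _ := pd_dist2 c j y.
rewrite /pd e; apply: (is_derive_eqv (@line_derive_sqrt _ (fun h : R => enorm (h *: basis R j + y - c) ^+ 2) 0 _ p0 D)).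
rewrite scale0r add0r sqrtr_sqr ger0_norm ?enorm_ge0//.
by field; rewrite gt_eqF.
Qed.

(** Functions on the light cone depend on y through the retarded time and directly. The increment is
    split along the two arguments: the first part is treated by the mean value theorem at a
    displaced second argument, so Ut must be continuous in both variables, and the second needs a
    derivative at one point only. *)
Lemma chain2 (U Ut : R -> R -> R) (s : R -> R) (d s' : R) :
  (\forall p \near ((s 0, 0) : R * R), is_derive (p.1 : R) 1 (U ^~ p.2) (Ut p.1 p.2)) ->
  {for ((s 0, 0) : R * R), continuous (fun p : R * R => Ut p.1 p.2)} ->
  is_derive (0 : R) 1 (U (s 0)) d -> is_derive (0 : R) 1 s s' ->
  is_derive (0 : R) 1 (fun h => U (s h) h) (Ut (s 0) 0 * s' + d).
Proof.
move=> dU cU dd ds; apply: is_derive1P.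
have c1 := is_derive1_cvg dd; have c2 := is_derive1_cvg ds.
have cs := is_derive_continuous ds.
pose q h := h^-1 * (s (h + 0) - s 0).
pose m h := h^-1 * (U (s h) h - U (s 0) h).
suff cm : m h @[h --> 0^'] --> Ut (s 0) 0 * s'.
  have cm' : (m h + h^-1 * (U (s 0) (h + 0) - U (s 0) 0)) @[h --> 0^'] --> Ut (s 0) 0 * s' + d.
    exact: cvgD cm c1.
  rewrite (_ : (fun h => _) = (fun h => m h + h^-1 * (U (s 0) (h + 0) - U (s 0) 0)))//.
  by apply/funext => h; rewrite /m !addr0 -mulrDr addrA subrK.
(* The quotient m is Ut at an intermediate point times q, and q is eventually bounded by |s'| + 1;
   continuity of Ut makes the difference small. *)
have c3 : (m h - Ut (s 0) 0 * q h) @[h --> 0^'] --> (0 : R).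
  apply/cvgrPdist_le => e e0.
  have S0 : 0 < `|s'| + 1 by rewrite ltr_wpDl.
  have e1 : 0 < e / (`|s'| + 1) by rewrite divr_gt0.
  move/cvgrPdist_le: (cU) => /(_ _ e1) cU1.
  have N : \forall p \near ((s 0, 0) : R * R), is_derive (p.1 : R) 1 (U ^~ p.2) (Ut p.1 p.2) /\
      `|Ut (s 0) 0 - Ut p.1 p.2| <= e / (`|s'| + 1).
    by near=> p; split; near: p.
  have [r /= r0 hr] := (nbhs_ballP _ _).1 N.
  have qb : \forall h \near 0^', `|q h| <= `|s'| + 1.
    move/cvgrPdist_le: (c2) => /(_ 1 ltr01) hn; near=> h.
    have hq : `|s' - q h| <= 1 by near: h.
    have := ler_normD (s' - q h) (- s'); rewrite addrAC subrr add0r !normrN; lra.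
  have sb : \forall h \near 0^', `|s 0 - s h| < r.
    by apply: nbhs_dnbhs; move/cvgrPdist_lt: (cs) => /(_ _ r0).
  have hb : \forall h \near (0 : R)^', `|0 - h| < r.
    by near=> h; rewrite sub0r normrN; near: h; exact: dnbhs0_lt.
  near=> h; rewrite sub0r normrN.
  have hq : `|q h| <= `|s'| + 1 by near: h.
  have hs : `|s 0 - s h| < r by near: h.
  have hh : `|0 - h| < r by near: h.
  have inb xi : Num.min (s 0) (s h) <= xi <= Num.max (s 0) (s h) -> ball ((s 0, 0) : R * R) r (xi, h).
    move=> hx; split => //=; rewrite /ball/=; apply: le_lt_trans hs.
    move: hx; have [hl|hl] := leP (s 0) (s h) => /andP[x1 x2].
      by rewrite distrC ger0_norm ?subr_ge0// distrC ger0_norm ?subr_ge0//; lra.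
    by rewrite ger0_norm ?subr_ge0// ger0_norm ?subr_ge0//; lra.
  have [xi hx e2] : exists2 xi, Num.min (s 0) (s h) <= xi <= Num.max (s 0) (s h) &
      U (s h) h - U (s 0) h = Ut xi h * (s h - s 0).
    by apply: (@MVT_is_derive _ (U ^~ h) (Ut ^~ h)) => x hx; exact: (hr _ (inb x hx)).1.
  have /= h3 := (hr _ (inb xi hx)).2.
  rewrite /m e2 /q addr0.
  rewrite (_ : _ - _ = (Ut xi h - Ut (s 0) 0) * q h); last by rewrite /q addr0; ring.
  rewrite normrM distrC.
  apply: (@le_trans _ _ (e / (`|s'| + 1) * (`|s'| + 1))); first by apply: ler_pM.
  by rewrite divfK// gt_eqF.
have c4 : Ut (s 0) 0 * q h @[h --> 0^'] --> Ut (s 0) 0 * s'.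
  by apply: cvgMr; exact: c2.
have C := cvgD c3 c4; rewrite add0r in C.
have -> : m = (fun h => (m h - Ut (s 0) 0 * q h) + Ut (s 0) 0 * q h) by apply/funext => h; rewrite subrK.
exact: C.
Unshelve. all: end_near. Qed.

(** The second difference over a small square, evaluated by the mean value theorem in both orders,
    is a value of Uab and also a value of Uba, each at a point close to (a, b). *)
Lemma schwarz (U Ua Ub Uab Uba : R -> R -> R) (a b : R) :
  (\forall p \near ((a, b) : R * R), [/\ is_derive (p.1 : R) 1 (U ^~ p.2) (Ua p.1 p.2),
    is_derive (p.2 : R) 1 (U p.1) (Ub p.1 p.2),
    is_derive (p.2 : R) 1 (Ua p.1) (Uab p.1 p.2) &
    is_derive (p.1 : R) 1 (Ub ^~ p.2) (Uba p.1 p.2)]) ->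
  {for ((a, b) : R * R), continuous (fun p : R * R => Uab p.1 p.2)} ->
  {for ((a, b) : R * R), continuous (fun p : R * R => Uba p.1 p.2)} ->
  Uab a b = Uba a b.
Proof.
move=> dU c1 c2; apply/eqP; rewrite -subr_eq0 -normr_le0; apply/ler_addgt0Pr => e e0; rewrite add0r.
have e2 : 0 < e / 2 by rewrite divr_gt0.
move/cvgrPdist_le: (c1) => /(_ _ e2) H1; move/cvgrPdist_le: (c2) => /(_ _ e2) H2.
have N : \forall p \near ((a, b) : R * R), [/\ is_derive (p.1 : R) 1 (U ^~ p.2) (Ua p.1 p.2),
    is_derive (p.2 : R) 1 (U p.1) (Ub p.1 p.2),
    is_derive (p.2 : R) 1 (Ua p.1) (Uab p.1 p.2) &
    is_derive (p.1 : R) 1 (Ub ^~ p.2) (Uba p.1 p.2)] /\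
    (`|Uab a b - Uab p.1 p.2| <= e / 2 /\ `|Uba a b - Uba p.1 p.2| <= e / 2).
  by near=> p; split; [|split]; near: p.
have [r /= r0 hr] := (nbhs_ballP _ _).1 N.
have [h [h0 hE]] : exists h, 0 < h /\ h = r / 2 by exists (r / 2); rewrite divr_gt0.
have minE z : Num.min z (z + h) = z by rewrite min_l// lerDl ltW.
have maxE z : Num.max z (z + h) = z + h by rewrite max_r// lerDl ltW.
have inb x y : Num.min a (a + h) <= x <= Num.max a (a + h) ->
    Num.min b (b + h) <= y <= Num.max b (b + h) -> ball ((a, b) : R * R) r (x, y).
  rewrite !minE !maxE => /andP[x1 x2] /andP[y1 y2].
  by split; rewrite /ball/= distrC ger0_norm ?subr_ge0//; lra.
have ia : Num.min a (a + h) <= a <= Num.max a (a + h) by rewrite minE maxE lexx lerDl ltW.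
have iah : Num.min a (a + h) <= a + h <= Num.max a (a + h) by rewrite minE maxE lexx lerDl ltW.
have ib : Num.min b (b + h) <= b <= Num.max b (b + h) by rewrite minE maxE lexx lerDl ltW.
have ibh : Num.min b (b + h) <= b + h <= Num.max b (b + h) by rewrite minE maxE lexx lerDl ltW.
have [x hx ex] : exists2 x, Num.min a (a + h) <= x <= Num.max a (a + h) &
    (U (a + h) (b + h) - U (a + h) b) - (U a (b + h) - U a b) = (Ua x (b + h) - Ua x b) * (a + h - a).
  apply: (@MVT_is_derive _ (fun x => U x (b + h) - U x b) (fun x => Ua x (b + h) - Ua x b)) => x hx.
  have [[D1 _ _ _] _] := hr _ (inb x _ hx ibh); have [[D2 _ _ _] _] := hr _ (inb x _ hx ib).
  exact: line_deriveB D1 D2.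
have [y hy ey] : exists2 y, Num.min b (b + h) <= y <= Num.max b (b + h) &
    (U (a + h) (b + h) - U a (b + h)) - (U (a + h) b - U a b) = (Ub (a + h) y - Ub a y) * (b + h - b).
  apply: (@MVT_is_derive _ (fun y => U (a + h) y - U a y) (fun y => Ub (a + h) y - Ub a y)) => y hy.
  have [[_ D1 _ _] _] := hr _ (inb _ y iah hy); have [[_ D2 _ _] _] := hr _ (inb _ y ia hy).
  exact: line_deriveB D1 D2.
have [y' hy' ey'] : exists2 y', Num.min b (b + h) <= y' <= Num.max b (b + h) &
    Ua x (b + h) - Ua x b = Uab x y' * (b + h - b).
  by apply: MVT_is_derive => z hz; have [[_ _ D1 _] _] := hr _ (inb x z hx hz).
have [x' hx' ex'] : exists2 x', Num.min a (a + h) <= x' <= Num.max a (a + h) &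
    Ub (a + h) y - Ub a y = Uba x' y * (a + h - a).
  by apply: (@MVT_is_derive _ (Ub ^~ y) (Uba ^~ y)) => z hz; have [[_ _ _ D1] _] := hr _ (inb z y hz hy).
have hh : h * h != 0 by rewrite mulf_eq0 gt_eqF.
have E : Uab x y' = Uba x' y.
  rewrite ey' in ex; rewrite ex' in ey.
  have : Uab x y' * (b + h - b) * (a + h - a) = Uba x' y * (a + h - a) * (b + h - b).
    by rewrite -ex -ey; ring.
  have eh z : z + h - z = h by rewrite addrC addKr.
  by rewrite (eh a) (eh b) => /eqP; rewrite -subr_eq0 -!mulrBl !mulf_eq0 (gt_eqF h0) !orbF subr_eq0 => /eqP.
have [_ [/= n1 _]] := hr _ (inb x y' hx hy'); have [_ [_ /= n2]] := hr _ (inb x' y hx' hy).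
rewrite (_ : _ - _ = (Uab a b - Uab x y') + - (Uba a b - Uba x' y)); last by rewrite E; ring.
by rewrite (le_trans (ler_normD _ _))// normrN; lra.
Unshelve. all: end_near. Qed.

Section Within.
Variables (V : normedModType R) (D : set V).

Lemma derive_within_interior (F : V -> R) (a e : V) :
  (\forall h \near (0 : R), D (h *: e + a)) -> derivable_within D F a e ->
  (fun h : R => h^-1 *: ((F \o shift a) (h *: e) - F a)) @ 0^' --> derive_within D F a e.
Proof.
move=> nD dF W /dF; rewrite /derive_within /= => hW.
have nD' : \forall h \near 0^', D (h *: e + a) by exact: (nbhs_dnbhs nD).
have K : \forall h \near 0^', W (h^-1 *: ((F \o shift a) (h *: e) - F a)).
  near=> h; have hD : D (h *: e + a) by near: h.
  by move: hD; near: h.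
exact: K.
Unshelve. all: end_near. Qed.

Lemma derive_within_eq (F G : V -> R) (a e : V) : (forall z, D z -> F z = G z) -> D a ->
  derive_within D F a e = derive_within D G a e.
Proof.
move=> FG Da; rewrite /derive_within; congr (lim _); apply/funext => W; apply/propext.
by split => hW; apply: (@filterS _ (0^' : set_system R) _ _ _ _ hW) => h hWh Dh; have := hWh Dh; rewrite /= /shift/= !FG.
Qed.
End Within.

Lemma is_derive_dt (T : R) (u : R -> R) (s : R) : 0 < s < T -> dt_exists T u s ->
  is_derive s 1 u (dt T u s).
Proof.
move=> /andP[s0 sT] du; apply: is_derive1P.
have : \forall h \near (0 : R), `[0, T]%classic (h *: (1 : R^o) + s).
  near=> h; rewrite /= in_itv/= /GRing.scale/= mulr1; apply/andP; split.
    have : `|h| < s by near: h; exact: (cvgr0_norm_lt _ cvg_id).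
    by rewrite ltr_norml; lra.
  have : `|h| < T - s by near: h; apply: (cvgr0_norm_lt _ cvg_id); rewrite subr_gt0.
  by rewrite ltr_norml; lra.
move=> /derive_within_interior/(_ du).
by under eq_fun do rewrite /= /GRing.scale/= mulr1.
Unshelve. all: end_near. Qed.

Lemma pd_dx j (u : vec -> R) (y : vec) : 0 < y 0 i3 -> dx_exists j u y -> pd j u y (dx j u y).
Proof.
move=> y3 du; apply: is_derive1P.
have : \forall h \near (0 : R), Omega_bar (h *: basis R j + y).
  near=> h; rewrite /Omega_bar /= !mxE.
  have : `|h| < y 0 i3 by near: h; exact: (cvgr0_norm_lt _ cvg_id).
  by rewrite ltr_norml andbC => /andP[_]; case: (i3 == j); rewrite /= ?mulr1 ?mulr0; lra.
move=> /derive_within_interior/(_ du).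
by under [X in _ -> X @ _ --> _]eq_fun do rewrite /= addr0 scale0r add0r.
Unshelve. all: end_near. Qed.

(* [ext] extends a function on [0, T] x Omega_bar to all of space-time by clamping
   the arguments; continuity up to the boundary becomes plain continuity, and the
   values outside never enter the formula. *)
Definition clampt (T s : R) : R := Num.max 0 (Num.min s T).
Definition clampx (y : vec) : vec := vec3 (y 0 i1) (y 0 i2) (Num.max 0 (y 0 i3)).
Definition ext {X : Type} (T : R) (u : R -> vec -> X) (s : R) (y : vec) : X := u (clampt T s) (clampx y).

Lemma clampt_in T s : 0 <= T -> 0 <= clampt T s <= T.
Proof. by move=> T0; rewrite /clampt le_max lexx ge_max T0 ge_min lexx orbT. Qed.

Lemma clampt_id T s : 0 <= s <= T -> clampt T s = s.
Proof. by move=> /andP[s0 sT]; rewrite /clampt min_l// max_r. Qed.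

Lemma clampx_in y : Omega_bar (clampx y).
Proof. by rewrite /Omega_bar /= vec3E le_max lexx. Qed.

Lemma clampx_id y : Omega_bar y -> clampx y = y.
Proof. by rewrite /Omega_bar /= => h; rewrite /clampx max_r// vec3_eta. Qed.

Lemma ext_id (X : Type) T (u : R -> vec -> X) s y : 0 <= s <= T -> Omega_bar y -> ext T u s y = u s y.
Proof. by move=> hs hy; rewrite /ext clampt_id// clampx_id. Qed.

Lemma continuous_clampt T : continuous (clampt T).
Proof.
move=> s; apply: (@continuous_max _ _ (cst (0 : R)) (fun s : R => Num.min s T)); first exact: cst_continuous.
by apply: (@continuous_min _ _ (fun s : R => s) (cst T)); [exact: cvg_id|exact: cst_continuous].
Qed.

Lemma continuous_clampx : continuous clampx.
Proof.
move=> y; apply: (@continuous_vec3 _ _ y (fun y : vec => y 0 i1) (fun y : vec => y 0 i2) (fun y : vec => Num.max 0 (y 0 i3))).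
- exact: coord_continuous.
- exact: coord_continuous.
- by apply: (@continuous_max _ _ (cst (0 : R)) (fun y : vec => y 0 i3)); [exact: cst_continuous|exact: coord_continuous].
Qed.

Lemma continuous_ext T (u : R -> vec -> R) : 0 <= T ->
  {within `[0, T]%classic `*` @Omega_bar R, continuous (fun p : R * vec => u p.1 p.2)} ->
  continuous (fun p : R * vec => ext T u p.1 p.2).
Proof.
move=> T0 cu.
apply: (@within_continuous_comp _ _ _ _ (fun p : R * vec => u p.1 p.2)
  (fun p : R * vec => (clampt T p.1, clampx p.2)) cu).
- move=> p; apply: (@continuous_pair _ _ _ (fun p : R * vec => clampt T p.1) (fun p : R * vec => clampx p.2)).
    by apply: (@continuous_comp _ _ _ fst (clampt T)); [exact: cvg_fst|exact: continuous_clampt].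
  by apply: (@continuous_comp _ _ _ snd clampx); [exact: cvg_snd|exact: continuous_clampx].
- move=> p; split; last exact: clampx_in.
  by rewrite /= in_itv/=; exact: clampt_in.
Qed.

Lemma continuous_ext_density T (u : R -> vec -> vec -> R) : 0 <= T -> continuous_density T u ->
  continuous (fun p : R * vec * vec => ext T u p.1.1 p.1.2 p.2).
Proof.
move=> T0 cu.
apply: (@within_continuous_comp _ _ _ _ (fun p : R * vec * vec => u p.1.1 p.1.2 p.2)
  (fun p : R * vec * vec => ((clampt T p.1.1, clampx p.1.2), p.2)) cu).
- move=> p.
  have c1 : {for p, continuous (fun p : R * vec * vec => clampt T p.1.1)}.
    apply: (@continuous_comp _ _ _ (fun p : R * vec * vec => p.1.1) (clampt T)); last exact: continuous_clampt.
    by apply: (@continuous_comp _ _ _ (fun p : R * vec * vec => p.1) fst); exact: cvg_fst.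
  have c2 : {for p, continuous (fun p : R * vec * vec => clampx p.1.2)}.
    apply: (@continuous_comp _ _ _ (fun p : R * vec * vec => p.1.2) clampx); last exact: continuous_clampx.
    by apply: (@continuous_comp _ _ _ (fun p : R * vec * vec => p.1) snd); [exact: cvg_fst|exact: cvg_snd].
  apply: (@continuous_pair _ _ _ (fun p : R * vec * vec => (clampt T p.1.1, clampx p.1.2)) (fun p : R * vec * vec => p.2)).
    exact: (continuous_pair c1 c2).
  exact: cvg_snd.
- move=> p; split => //; split; last exact: clampx_in.
  by rewrite /= in_itv/=; exact: clampt_in.
Qed.

Definition Dt (T : R) (u : R -> vec -> R) (s : R) (y : vec) : R := dt T (u ^~ y) s.
Definition Dx (j : 'I_3) (u : R -> vec -> R) (s : R) (y : vec) : R := dx j (u s) y.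

(** Continuity is global, thanks to clamping, while derivatives are only asked at interior times and
    points, where the clamped extension agrees with the function nearby. *)
Record C1on (T : R) (u ut : R -> vec -> R) (ux : 'I_3 -> R -> vec -> R) : Prop := {
  C1on_cont : continuous (fun p : R * vec => u p.1 p.2);
  C1on_contt : continuous (fun p : R * vec => ut p.1 p.2);
  C1on_contx : forall j, continuous (fun p : R * vec => ux j p.1 p.2);
  C1on_dt : forall (s : R) (y : vec), 0 < s < T -> 0 < y 0 i3 -> is_derive s 1 (u ^~ y) (ut s y);
  C1on_dx : forall j (s : R) (y : vec), 0 < s < T -> 0 < y 0 i3 -> pd j (u s) y (ux j s y)
}.

Lemma near_itv (a b s : R) : a < s < b -> \forall s' \near s, a < s' < b.
Proof.
move=> /andP[h1 h2]; near=> s'; apply/andP; split; near: s'; [exact: lt_nbhsr|exact: lt_nbhsl].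
Unshelve. all: end_near. Qed.

Lemma near_upper (y : vec) : 0 < y 0 i3 -> \forall z \near y, 0 < (z : vec) 0 i3.
Proof. by move=> y3; apply: (cvgr_gt _ (@coord_continuous _ _ _ 0 i3 y)). Qed.

Lemma continuous_line (j : 'I_3) (y : vec) : continuous (fun h : R => h *: basis R j + y).
Proof.
move=> h; apply: (cvgD _ (cvg_cst y)); apply: cvgZr_tmp; exact: cvg_id.
Qed.

Lemma near_upper_line j (y : vec) (h : R) : 0 < (h *: basis R j + y) 0 i3 ->
  \forall h' \near h, 0 < (h' *: basis R j + y) 0 i3.
Proof. by move=> /near_upper H; exact: (@continuous_line j y h _ H). Qed.

Lemma C1on_ext (T : R) (u ut : R -> vec -> R) (ux : 'I_3 -> R -> vec -> R) :
  continuous (fun p : R * vec => ext T u p.1 p.2) ->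
  continuous (fun p : R * vec => ext T ut p.1 p.2) ->
  (forall j, continuous (fun p : R * vec => ext T (ux j) p.1 p.2)) ->
  (forall (s : R) (y : vec), 0 < s < T -> 0 < y 0 i3 -> is_derive s 1 (u ^~ y) (ut s y)) ->
  (forall j (s : R) (y : vec), 0 < s < T -> 0 < y 0 i3 -> pd j (u s) y (ux j s y)) ->
  C1on T (ext T u) (ext T ut) (fun j => ext T (ux j)).
Proof.
move=> c0 ct cx d0 dx'; split => //.
- move=> s y hs hy; have /andP[s0 sT] := hs; rewrite ext_id ?ltW//; last exact: ltW.
  apply: (near_is_derive1 (d0 s y hs hy)); have := near_itv hs; apply: filterS => s' /andP[? ?].
  by rewrite ext_id ?ltW//; exact: ltW.
- move=> j s y hs hy; have /andP[s0 sT] := hs; rewrite ext_id ?ltW//; last exact: ltW.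
  rewrite /pd; apply: (near_is_derive1 (dx' j s y hs hy)).
  have hy' : 0 < ((0 : R) *: basis R j + y) 0 i3 by rewrite scale0r add0r.
  have := near_upper_line hy'; apply: filterS => h' ?.
  by rewrite ext_id ?ltW//; exact: ltW.
Qed.

Lemma Ck_C1on (T : R) (u : R -> vec -> R) : 0 <= T -> Ck_field T 1 u ->
  C1on T (ext T u) (ext T (Dt T u)) (fun j => ext T (Dx j u)).
Proof.
move=> T0 [cu [du [ct _] cx]].
apply: C1on_ext.
- exact: continuous_ext.
- exact: continuous_ext.
- by move=> j; apply: continuous_ext => //; have [] := cx j.
- move=> s y hs hy; have /andP[s0 sT] := hs; apply: is_derive_dt => //.
  have [|] := du s y _ (ltW hy) => //; by rewrite in_itv/= !ltW.
- move=> j s y hs hy; have /andP[s0 sT] := hs; apply: pd_dx => //.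
  have [|_] := du s y _ (ltW hy); [by rewrite in_itv/= !ltW|exact].
Qed.

Section Mixed.
Variables (T : R) (u ut utt : R -> vec -> R) (ux utx uxt : 'I_3 -> R -> vec -> R).
Variables (uxx : 'I_3 -> 'I_3 -> R -> vec -> R).
Hypotheses (hu : C1on T u ut ux) (ht : C1on T ut utt utx)
  (hx : forall j, C1on T (ux j) (uxt j) (uxx j)).

Lemma mixed_tx j (s : R) (y : vec) : 0 < s < T -> 0 < y 0 i3 -> utx j s y = uxt j s y.
Proof.
move=> hs hy.
have cl (w : R -> vec -> R) : continuous (fun p : R * vec => w p.1 p.2) ->
    {for ((s, 0) : R * R), continuous (fun p : R * R => w p.1 (p.2 *: basis R j + y))}.
  move=> cw; apply: (@continuous_comp _ _ _ (fun p : R * R => (p.1, p.2 *: basis R j + y)) (fun p : R * vec => w p.1 p.2)); last exact: cw.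
  apply: (@continuous_pair _ _ _ (fun p : R * R => p.1) (fun p : R * R => p.2 *: basis R j + y)); first exact: cvg_fst.
  by apply: (@continuous_comp _ _ _ snd (fun h : R => h *: basis R j + y)); [exact: cvg_snd|exact: continuous_line].
have := @schwarz (fun a h => u a (h *: basis R j + y)) (fun a h => ut a (h *: basis R j + y))
  (fun a h => ux j a (h *: basis R j + y)) (fun a h => utx j a (h *: basis R j + y))
  (fun a h => uxt j a (h *: basis R j + y)) s 0 _ (cl _ (@C1on_contx _ _ _ _ ht j)) (cl _ (@C1on_contt _ _ _ _ (hx j))).
rewrite scale0r add0r; apply.
have hy' : 0 < ((0 : R) *: basis R j + y) 0 i3 by rewrite scale0r add0r.
have n1 := near_itv hs; have n2 := near_upper_line hy'.
have N : \forall p \near ((s, 0) : R * R), 0 < p.1 < T /\ 0 < (p.2 *: basis R j + y) 0 i3.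
  by near=> p; split; near: p; [exact: (@cvg_fst _ _ (nbhs s) (nbhs (0 : R)) _ _ n1)|exact: (@cvg_snd _ _ (nbhs s) (nbhs (0 : R)) _ _ n2)].
apply: (filterS _ N) => -[a b] /= [ha hb]; split.
- exact: (C1on_dt hu).
- by apply: pd_line; exact: (C1on_dx hu).
- by apply: pd_line; exact: (C1on_dx ht).
- exact: (C1on_dt (hx j)).
Unshelve. all: end_near. Qed.

Lemma mixed_xx j k (s : R) (y : vec) : 0 < s < T -> 0 < y 0 i3 -> uxx j k s y = uxx k j s y.
Proof.
move=> hs hy.
pose P (a b : R) : vec := a *: basis R j + (b *: basis R k + y).
have PE a b : P a b = b *: basis R k + (a *: basis R j + y) by rewrite /P addrCA.
have cP : {for ((0, 0) : R * R), continuous (fun p : R * R => P p.1 p.2)}.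
  apply: (@continuousD _ _ _ (fun p : R * R => p.1 *: basis R j) (fun p : R * R => p.2 *: basis R k + y)).
    by apply: (@continuous_comp _ _ _ fst (fun h : R => h *: basis R j)); [exact: cvg_fst|move=> ?; apply: cvgZr_tmp; exact: cvg_id].
  by apply: (@continuous_comp _ _ _ snd (fun h : R => h *: basis R k + y)); [exact: cvg_snd|exact: continuous_line].
have cl (w : R -> vec -> R) : continuous (fun p : R * vec => w p.1 p.2) ->
    {for ((0, 0) : R * R), continuous (fun p : R * R => w s (P p.1 p.2))}.
  move=> cw; apply: (@continuous_comp _ _ _ (fun p : R * R => (s, P p.1 p.2)) (fun p : R * vec => w p.1 p.2)); last exact: cw.
  by apply: (@continuous_pair _ _ _ (fun p : R * R => s) (fun p : R * R => P p.1 p.2)); [exact: cvg_cst|exact: cP].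
have := @schwarz (fun a b => u s (P a b)) (fun a b => ux j s (P a b))
  (fun a b => ux k s (P a b)) (fun a b => uxx j k s (P a b))
  (fun a b => uxx k j s (P a b)) 0 0 _ (cl _ (@C1on_contx _ _ _ _ (hx j) k)) (cl _ (@C1on_contx _ _ _ _ (hx k) j)).
have P00 : P 0 0 = y by rewrite /P !scale0r !add0r.
rewrite P00; apply.
have hy' : 0 < P 0 0 0 i3 by rewrite P00.
have N : \forall p \near ((0, 0) : R * R), 0 < P p.1 p.2 0 i3 by exact: (cP _ (near_upper hy')).
apply: (filterS _ N) => -[a b] /= hb; split.
- by apply: pd_line; exact: (C1on_dx hu).
- under eq_fun do rewrite PE; rewrite PE in hb *; apply: pd_line; exact: (C1on_dx hu).
- under eq_fun do rewrite PE; rewrite PE in hb *; apply: pd_line; exact: (C1on_dx (hx j)).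
- by apply: pd_line; exact: (C1on_dx (hx k)).
Qed.

End Mixed.

Section Retarded.
Variables (T t : R) (c : vec).
Hypotheses (t0 : 0 < t) (tT : t <= T).

Definition ret {X : Type} (u : R -> vec -> X) (y : vec) : X := u (t - enorm (y - c)) y.

Lemma continuous_ret (u : R -> vec -> R) : continuous (fun p : R * vec => u p.1 p.2) ->
  continuous (ret u).
Proof.
move=> cu y; apply: (@continuous_comp _ _ _ (fun y : vec => (t - enorm (y - c), y)) (fun p : R * vec => u p.1 p.2)); last exact: cu.
apply: (@continuous_pair _ _ _ (fun y : vec => t - enorm (y - c)) (fun y : vec => y)); last exact: cvg_id.
by apply: (@continuousB _ _ _ (cst t : vec -> R) (fun y : vec => enorm (y - c))); [exact: cst_continuous|exact: continuous_dist].
Qed.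

(** The second term is the derivative - omega_j of the retarded time. For 0 < r < t <= T that time
    lies strictly between 0 and T, so interior derivatives suffice. *)
Lemma pd_ret (u ut : R -> vec -> R) (ux : 'I_3 -> R -> vec -> R) j (y : vec) :
  C1on T u ut ux -> 0 < enorm (y - c) < t -> 0 < y 0 i3 ->
  pd j (ret u) y (ret (ux j) y - (y - c) 0 j / enorm (y - c) * ret ut y).
Proof.
move=> hu /andP[r0 rt] y3.
have yc : y != c by rewrite -dist_gt0.
pose s (h : R) := t - enorm (h *: basis R j + y - c).
have ds : is_derive (0 : R) 1 s (0 - (y - c) 0 j / enorm (y - c)).
  exact: line_deriveB (line_derive_cst _ _) (pd_dist j yc).
have s0E : s 0 = t - enorm (y - c) by rewrite /s scale0r add0r.
have hs : 0 < s 0 < T by rewrite s0E subr_gt0 rt/= ltrBlDr (le_lt_trans tT)// ltrDl.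
have hy' : 0 < ((0 : R) *: basis R j + y) 0 i3 by rewrite scale0r add0r.
have n1 := near_itv hs; have n2 := near_upper_line hy'.
have nD : \forall p \near ((s 0, 0) : R * R), is_derive (p.1 : R) 1 (fun a => u a (p.2 *: basis R j + y)) (ut p.1 (p.2 *: basis R j + y)).
  have N : \forall p \near ((s 0, 0) : R * R), 0 < p.1 < T /\ 0 < (p.2 *: basis R j + y) 0 i3.
    by near=> p; split; near: p; [exact: (@cvg_fst _ _ (nbhs (s 0)) (nbhs (0 : R)) _ _ n1)|exact: (@cvg_snd _ _ (nbhs (s 0)) (nbhs (0 : R)) _ _ n2)].
  by apply: (filterS _ N) => -[a b] /= [ha hb]; exact: (C1on_dt hu).
have cU : {for ((s 0, 0) : R * R), continuous (fun p : R * R => ut p.1 (p.2 *: basis R j + y))}.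
  apply: (@continuous_comp _ _ _ (fun p : R * R => (p.1, p.2 *: basis R j + y)) (fun p : R * vec => ut p.1 p.2)); last exact: (@C1on_contt _ _ _ _ hu).
  apply: (@continuous_pair _ _ _ (fun p : R * R => p.1) (fun p : R * R => p.2 *: basis R j + y)); first exact: cvg_fst.
  by apply: (@continuous_comp _ _ _ snd (fun h : R => h *: basis R j + y)); [exact: cvg_snd|exact: continuous_line].
have D := @chain2 (fun a h => u a (h *: basis R j + y)) (fun a h => ut a (h *: basis R j + y)) s _ _ nD cU (C1on_dx hu j hs y3) ds.
rewrite /pd /ret; apply: (is_derive_eqv D); rewrite scale0r add0r s0E; ring.
Unshelve. all: end_near. Qed.

End Retarded.
End Calculus.

(** * The Glassey-Strauss kernels *)

Section Kernel.
Context {R : realType}.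
Notation vec := 'rV[R]_3.
Implicit Types (a b u v w : vec) (i j k : 'I_3).

Lemma dotC u w : dot u w = dot w u.
Proof. by rewrite !dotE; ring. Qed.

Lemma continuous_dot (X : topologicalType) (x : X) (a b : X -> vec) :
  {for x, continuous a} -> {for x, continuous b} -> {for x, continuous (fun y => dot (a y) (b y))}.
Proof.
move=> ca cb.
have h k : {for x, continuous (fun y => a y 0 k * b y 0 k)}.
  apply: (@continuousM _ _ (fun y => a y 0 k) (fun y => b y 0 k)).
    by apply: (@continuous_comp _ _ _ a (fun u : vec => u 0 k)); [exact: ca|exact: coord_continuous].
  by apply: (@continuous_comp _ _ _ b (fun u : vec => u 0 k)); [exact: cb|exact: coord_continuous].
rewrite (_ : (fun y => _) = (fun y => a y 0 i1 * b y 0 i1 + a y 0 i2 * b y 0 i2 + a y 0 i3 * b y 0 i3)).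
  exact: (continuousD (continuousD (h i1) (h i2)) (h i3)).
by apply/funext => y; rewrite dotE.
Qed.

Lemma continuous_coord_comp (X : topologicalType) (x : X) (a : X -> vec) k :
  {for x, continuous a} -> {for x, continuous (fun y => a y 0 k)}.
Proof.
by move=> ca; apply: (@continuous_comp _ _ _ a (fun u : vec => u 0 k)); [exact: ca|exact: coord_continuous].
Qed.

Definition lorentz v : R := Num.sqrt (gamma2 v).

Lemma lorentz_ge1 v : 1 <= lorentz v.
Proof. by rewrite -[leLHS]sqrtr1 ler_sqrt ?gamma2_ge1// ltW// gamma2_gt0. Qed.

Lemma lorentz_gt0 v : 0 < lorentz v.
Proof. exact: lt_le_trans (lorentz_ge1 v). Qed.

Lemma lorentz_sqr v : lorentz v ^+ 2 = gamma2 v.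
Proof. by rewrite sqr_sqrtr// ltW// gamma2_gt0. Qed.

Lemma vhatE v k : vhat v 0 k = v 0 k / lorentz v.
Proof. by rewrite /vhat mxE mulrC. Qed.

Lemma continuous_lorentz : continuous lorentz.
Proof.
move=> v; apply: (@continuous_comp _ _ _ gamma2 (@Num.sqrt R)); first exact: continuous_gamma2.
exact: sqrt_continuous.
Qed.

Lemma continuous_lorentzV : continuous (fun v => (lorentz v)^-1).
Proof.
by move=> v; apply: (@continuousV _ _ lorentz); [rewrite gt_eqF// lorentz_gt0|exact: continuous_lorentz].
Qed.

Lemma continuous_vhat : continuous (@vhat R).
Proof.
move=> v; apply: continuous_vec => k.
rewrite (_ : (fun y => _) = (fun y : vec => y 0 k * (lorentz y)^-1)); last by apply/funext => u; rewrite vhatE.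
apply: (@continuousM _ _ (fun y : vec => y 0 k) (fun y => (lorentz y)^-1)); first exact: coord_continuous.
exact: continuous_lorentzV.
Qed.

Lemma vhat_sqr v : enorm (vhat v) ^+ 2 = 1 - (gamma2 v)^-1.
Proof.
have g0 := gamma2_gt0 v; have l0 := lorentz_gt0 v.
rewrite enorm_sqr !vhatE !exprMn -!mulrDl exprVn lorentz_sqr -enorm_sqr.
rewrite (_ : enorm v ^+ 2 = gamma2 v - 1); last by rewrite /gamma2 addrC addKr.
by field; rewrite gt_eqF.
Qed.

Lemma vhat_lt1 v : enorm (vhat v) < 1.
Proof.
rewrite -(@ltr_pXn2r _ 2)// ?nnegrE ?enorm_ge0// expr1n vhat_sqr.
by rewrite ltrBlDr ltrDl invr_gt0 gamma2_gt0.
Qed.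

Lemma vhat_le1 v k : `|vhat v 0 k| <= 1.
Proof. by apply: le_trans (le_coord_enorm _ k) _; exact/ltW/vhat_lt1. Qed.

(** 1 + vhat . w >= 1 - |vhat| >= (1 - |vhat|^2) / 2, and 1 - |vhat|^2 is the inverse of [gamma2 v].
    This bounds the kernels polynomially in v although 1 + vhat . w has no uniform lower bound. *)
Lemma dot_vhat_ge v w : enorm w = 1 -> (2 * gamma2 v)^-1 <= 1 + dot (vhat v) w.
Proof.
move=> w1; have := CauchySchwarz3 (vhat v) w; rewrite w1 mulr1 => h.
have l1 := vhat_lt1 v; have l0 := enorm_ge0 (vhat v); have e := vhat_sqr v.
rewrite invfM; move: h e; rewrite ler_norml; set x := enorm (vhat v); set g := (gamma2 v)^-1.
move=> /andP[h _] e; have : g <= 2 * (1 - x) by rewrite /x in l0 l1 e *; nra.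
by rewrite /x in h *; lra.
Qed.

Lemma dot_vhat_gt0 v w : enorm w = 1 -> 0 < 1 + dot (vhat v) w.
Proof. by move=> /(dot_vhat_ge v); apply: lt_le_trans; rewrite invr_gt0 mulr_gt0// gamma2_gt0. Qed.

Lemma dot_vhat_inv v w : enorm w = 1 -> (1 + dot (vhat v) w)^-1 <= 2 * gamma2 v.
Proof.
move=> w1; rewrite -[leRHS]invrK lef_pV2 ?posrE ?dot_vhat_gt0//; first exact: dot_vhat_ge.
by rewrite invr_gt0 mulr_gt0// gamma2_gt0.
Qed.

(* Differentiated in v through a = vhat and in y through a = omega.  In both cases
   the j-th derivative of a is a multiple of e_j - a_j a, so [dqk] serves twice. *)
Definition qk i a b : R := (a 0 i + b 0 i) / (1 + dot a b).

Definition dqk i j a b : R :=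
  ((delta R i j - a 0 i * a 0 j) * (1 + dot a b) - (a 0 i + b 0 i) * (b 0 j - dot a b * a 0 j))
  / (1 + dot a b) ^+ 2.

Lemma qkC i a b : qk i a b = qk i b a.
Proof. by rewrite /qk dotC addrC. Qed.

Lemma continuous_qk (X : topologicalType) (x : X) (a b : X -> vec) i : 1 + dot (a x) (b x) != 0 ->
  {for x, continuous a} -> {for x, continuous b} -> {for x, continuous (fun y => qk i (a y) (b y))}.
Proof.
move=> d0 ca cb; have cd := continuous_dot ca cb.
apply: (@continuousM _ _ (fun y => a y 0 i + b y 0 i) (fun y => (1 + dot (a y) (b y))^-1)).
  exact: (continuousD (continuous_coord_comp (k := i) ca) (continuous_coord_comp (k := i) cb)).
apply: (@continuousV _ _ (fun y => 1 + dot (a y) (b y))) => //.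
by apply: (@continuousD _ _ _ (cst 1 : X -> R) (fun y => dot (a y) (b y))); [exact: cst_continuous|exact: cd].
Qed.

Lemma continuous_dqk (X : topologicalType) (x : X) (a b : X -> vec) i j : 1 + dot (a x) (b x) != 0 ->
  {for x, continuous a} -> {for x, continuous b} -> {for x, continuous (fun y => dqk i j (a y) (b y))}.
Proof.
move=> d0 ca cb; have cd := continuous_dot ca cb.
have c1 : {for x, continuous (fun y => 1 + dot (a y) (b y))}.
  by apply: (@continuousD _ _ _ (cst 1 : X -> R) (fun y => dot (a y) (b y))); [exact: cst_continuous|exact: cd].
have ai := continuous_coord_comp (k := i) ca; have aj := continuous_coord_comp (k := j) ca.
have bi := continuous_coord_comp (k := i) cb; have bj := continuous_coord_comp (k := j) cb.
have cc : {for x, continuous (cst (delta R i j) : X -> R)} by exact: cst_continuous.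
apply: (@continuousM _ _ (fun y => (delta R i j - a y 0 i * a y 0 j) * (1 + dot (a y) (b y))
    - (a y 0 i + b y 0 i) * (b y 0 j - dot (a y) (b y) * a y 0 j)) (fun y => ((1 + dot (a y) (b y)) ^+ 2)^-1)).
  apply: (@continuousB _ _ _ (fun y => (delta R i j - a y 0 i * a y 0 j) * (1 + dot (a y) (b y)))
    (fun y => (a y 0 i + b y 0 i) * (b y 0 j - dot (a y) (b y) * a y 0 j))).
    exact: (continuousM (continuousB cc (continuousM ai aj)) c1).
  exact: (continuousM (continuousD ai bi) (continuousB bj (continuousM cd aj))).
apply: (@continuousV _ _ (fun y => (1 + dot (a y) (b y)) ^+ 2)); first by rewrite expf_neq0.
by apply: (@continuous_comp _ _ _ (fun y => 1 + dot (a y) (b y)) (fun x : R => x ^+ 2)); [exact: c1|exact: exprn_continuous].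
Qed.

Lemma is_derive_qk i j (a : R -> vec) b (s : R) : 1 + dot (a 0) b != 0 ->
  (forall k, is_derive (0 : R) 1 (fun h => a h 0 k) (s * (delta R j k - a 0 0 j * a 0 0 k))) ->
  is_derive (0 : R) 1 (fun h => qk i (a h) b) (s * dqk i j (a 0) b).
Proof.
move=> d0 da.
have dd : is_derive (0 : R) 1 (fun h => dot (a h) b) (s * (b 0 j - dot (a 0) b * a 0 0 j)).
  rewrite (_ : (fun h => _) = (fun h => b 0 i1 * a h 0 i1 + b 0 i2 * a h 0 i2 + b 0 i3 * a h 0 i3)); last first.
    by apply/funext => h; rewrite dotE; ring.
  apply: (is_derive_eqv (line_deriveD (line_deriveD (line_deriveMl (b 0 i1) (da i1)) (line_deriveMl (b 0 i2) (da i2))) (line_deriveMl (b 0 i3) (da i3)))).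
  rewrite dotE /delta; move: j {da}; apply: ord3E; rewrite /=; ring.
have d1 : is_derive (0 : R) 1 (fun h => 1 + dot (a h) b) (0 + s * (b 0 j - dot (a 0) b * a 0 0 j)).
  exact: line_deriveD (line_derive_cst _ _) dd.
apply: (is_derive_eqv (line_deriveM (line_deriveD (da i) (line_derive_cst _ (b 0 i))) (@line_deriveV _ (fun h => 1 + dot (a h) b) 0 _ d0 d1))).
rewrite /dqk /delta [j == i]eq_sym; field; exact: d0.
Qed.

Lemma norm_add_le2 (x y : R) : `|x| <= 1 -> `|y| <= 1 -> `|x + y| <= 2.
Proof. by rewrite !ler_norml; lra. Qed.

Lemma qk_le i v w : enorm w = 1 -> `|qk i (vhat v) w| <= 4 * gamma2 v.
Proof.
move=> w1; have d0 := dot_vhat_gt0 v w1.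
rewrite /qk normrM [X in _ * X]ger0_norm; last by rewrite invr_ge0 ltW.
have h : `|vhat v 0 i + w 0 i| <= 2.
  by apply: norm_add_le2; [exact: vhat_le1|rewrite -w1; exact: le_coord_enorm].
rewrite (_ : 4 * _ = 2 * (2 * gamma2 v)); last by ring.
by apply: ler_pM => //; [rewrite invr_ge0 ltW|exact: dot_vhat_inv].
Qed.

Lemma dqk_num (i j : 'I_3) (x y z a b c d : R) : `|x| <= 1 -> `|y| <= 1 -> `|z| <= 1 -> `|a| <= 1 ->
  `|d| <= 1 ->
  `|(delta R i j - x * y) * (1 + d) - (x + z) * (a - d * y)| <= 8.
Proof.
move=> hx hy hz ha hd.
have p1 : `|x * y| <= 1 by rewrite normrM mulr_ile1.
have p2 : `|d * y| <= 1 by rewrite normrM mulr_ile1.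
have q1 : `|delta R i j - x * y| <= 2.
  by apply: norm_add_le2; rewrite ?normrN// /delta; case: eqP => _; rewrite ?normr1 ?normr0.
have q2 : `|1 + d| <= 2 by apply: norm_add_le2; rewrite ?normr1.
have q3 : `|x + z| <= 2 by exact: norm_add_le2.
have q4 : `|a - d * y| <= 2 by apply: norm_add_le2; rewrite ?normrN.
have r1 : `|(delta R i j - x * y) * (1 + d)| <= 2 * 2 by rewrite normrM ler_pM.
have r2 : `|(x + z) * (a - d * y)| <= 2 * 2 by rewrite normrM ler_pM.
by rewrite (le_trans (ler_normB _ _))//; lra.
Qed.

Lemma inv_sqr_le v w : enorm w = 1 -> ((1 + dot (vhat v) w) ^+ 2)^-1 <= 4 * gamma2 v ^+ 2.
Proof.
move=> w1; have d0 := dot_vhat_gt0 v w1; have h := dot_vhat_inv v w1.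
rewrite -exprVn (_ : 4 * _ = (2 * gamma2 v) ^+ 2); last by rewrite exprMn; ring.
by rewrite lerXn2r// ?nnegrE ?invr_ge0 ?mulr_ge0// ltW// gamma2_gt0.
Qed.

Lemma dot_vhat_le1 v w : enorm w = 1 -> `|dot (vhat v) w| <= 1.
Proof.
by move=> w1; rewrite (le_trans (CauchySchwarz3 _ _))// w1 mulr1 ltW// vhat_lt1.
Qed.

(** The numerator is at most 8 and the inverse square of 1 + vhat . w at most 4 [gamma2 v]
    squared. *)
Lemma dqk_le i j v w : enorm w = 1 -> `|dqk i j (vhat v) w| <= 32 * gamma2 v ^+ 2.
Proof.
move=> w1; have d0 := dot_vhat_gt0 v w1.
rewrite /dqk normrM [X in _ * X]ger0_norm ?invr_ge0 ?sqr_ge0//.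
rewrite (_ : 32 * _ = 8 * (4 * gamma2 v ^+ 2)); last by ring.
have wk k : `|w 0 k| <= 1 by rewrite -w1; exact: le_coord_enorm.
apply: ler_pM => //; first by rewrite invr_ge0 sqr_ge0.
  by apply: (dqk_num _ _ 0 0) => //; [exact: vhat_le1|exact: vhat_le1|exact: dot_vhat_le1].
exact: inv_sqr_le.
Qed.

Lemma dqk_le' i j v w : enorm w = 1 -> `|dqk i j w (vhat v)| <= 32 * gamma2 v ^+ 2.
Proof.
move=> w1; have d0 := dot_vhat_gt0 v w1.
rewrite /dqk dotC normrM [X in _ * X]ger0_norm ?invr_ge0 ?sqr_ge0//.
rewrite (_ : 32 * _ = 8 * (4 * gamma2 v ^+ 2)); last by ring.
have wk k : `|w 0 k| <= 1 by rewrite -w1; exact: le_coord_enorm.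
apply: ler_pM => //; first by rewrite invr_ge0 sqr_ge0.
  by apply: (dqk_num _ _ 0 0) => //; [exact: vhat_le1|exact: vhat_le1|exact: dot_vhat_le1].
exact: inv_sqr_le.
Qed.

Lemma pd_vhat j k v : pd j (fun u => vhat u 0 k) v
  ((lorentz v)^-1 * (delta R j k - vhat v 0 j * vhat v 0 k)).
Proof.
have l0 := lorentz_gt0 v; have g0 := gamma2_gt0 v.
have dg : is_derive (0 : R) 1 (fun h => gamma2 (h *: basis R j + v)) (2 * v 0 j).
  have h := pd_dist2 0 j v; rewrite subr0 in h.
  have h' : is_derive (0 : R) 1 (fun h => 1 + enorm (h *: basis R j + v - 0) ^+ 2) (0 + 2 * v 0 j).
    exact: line_deriveD (line_derive_cst _ _) h.
  rewrite add0r in h'; move: h'; congr is_derive; apply/funext => x; by rewrite subr0.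
have g0' : 0 < gamma2 (0 *: basis R j + v) by exact: gamma2_gt0.
have dl := @line_derive_sqrt _ (fun h : R => gamma2 (h *: basis R j + v)) 0 _ g0' dg.
have l0' : Num.sqrt (gamma2 (0 *: basis R j + v)) != 0 by rewrite scale0r add0r gt_eqF.
have dli := @line_deriveV _ (fun h : R => Num.sqrt (gamma2 (h *: basis R j + v))) 0 _ l0' dl.
have dv : is_derive (0 : R) 1 (fun h : R => delta R j k * h + v 0 k) (delta R j k * 1 + 0).
  exact: line_deriveD (line_deriveMl _ (line_derive_id _)) (line_derive_cst _ _).
rewrite /pd (_ : (fun h : R => _) = (fun h : R => (delta R j k * h + v 0 k) * (Num.sqrt (gamma2 (h *: basis R j + v)))^-1)); last first.
  by apply/funext => h; rewrite vhatE !mxE eqxx/= eq_sym mulrC [h * _]mulrC mulrC.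
apply: (is_derive_eqv (line_deriveM dv dli)); rewrite scale0r add0r -!/(lorentz _) !vhatE.
rewrite lorentz_sqr -lorentz_sqr; field; exact: lt0r_neq0.
Qed.

Lemma pd_derive j (F : vec -> R) v d : pd j F v d -> 'D_(basis R j) F v = d.
Proof.
move=> /is_derive1_cvg h; apply/cvg_lim; first exact: Rhausdorff.
rewrite (_ : (fun h : R => _) = (fun h : R => h^-1 * (F ((h + 0) *: basis R j + v) - F (0 *: basis R j + v))))//.
by apply/funext => x; rewrite /= addr0 scale0r add0r.
Qed.

Lemma derivable_pd j (F : vec -> R) v : derivable F v (basis R j) -> pd j F v ('D_(basis R j) F v).
Proof.
move=> h; apply: is_derive1P.
rewrite (_ : (fun x : R => _) = (fun x : R => x^-1 *: ((F \o shift v) (x *: basis R j) - F v)))//.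
by apply/funext => x; rewrite /= addr0 scale0r add0r.
Qed.

Lemma pd_qk_vhat i j v w : enorm w = 1 ->
  pd j (fun u => qk i (vhat u) w) v ((lorentz v)^-1 * dqk i j (vhat v) w).
Proof.
move=> w1; have := @is_derive_qk i j (fun h => vhat (h *: basis R j + v)) w (lorentz v)^-1.
rewrite scale0r add0r; apply; first by rewrite gt_eqF// dot_vhat_gt0.
by move=> k; exact: pd_vhat.
Qed.

Lemma aE_dqk i j v w : enorm w = 1 -> aE i v w 0 j = (lorentz v)^-1 * dqk i j (vhat v) w.
Proof.
move=> w1; rewrite /aE mxE; apply: pd_derive.
rewrite (_ : (fun u => _) = (fun u => qk i (vhat u) w)); first exact: pd_qk_vhat.
by apply/funext => u; rewrite /qk addrC.
Qed.

Section Omega.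
Variable c : vec.

Lemma omega_unit y : y != c -> enorm (omega c y) = 1.
Proof.
move=> yc; have r0 : 0 < enorm (y - c) by rewrite dist_gt0.
by rewrite /omega enorm_scale ger0_norm ?invr_ge0 ?enorm_ge0// mulVf// gt_eqF.
Qed.

Lemma omegaE (y : vec) k : omega c y 0 k = (y - c) 0 k / enorm (y - c).
Proof. by rewrite /omega mxE mulrC. Qed.

Lemma continuous_omega y : y != c -> {for y, continuous (omega c)}.
Proof.
move=> yc; apply: continuous_vec => k.
rewrite (_ : (fun y => _) = (fun y : vec => (y - c) 0 k * (enorm (y - c))^-1)); last by apply/funext => u; rewrite omegaE.
apply: (@continuousM _ _ (fun y : vec => (y - c) 0 k) (fun y : vec => (enorm (y - c))^-1)).
  by apply: (@continuous_comp _ _ _ (fun y : vec => y + - c) (fun u : vec => u 0 k)); [exact: continuous_addr|exact: coord_continuous].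
apply: (@continuousV _ _ (fun y : vec => enorm (y - c))); last exact: continuous_dist.
by rewrite gt_eqF// dist_gt0.
Qed.

Lemma pd_omega j k y : y != c -> pd j (fun y => omega c y 0 k) y
  ((enorm (y - c))^-1 * (delta R j k - omega c y 0 j * omega c y 0 k)).
Proof.
move=> yc; have r0 : 0 < enorm (y - c) by rewrite dist_gt0.
have r0' : enorm (0 *: basis R j + y - c) != 0 by rewrite scale0r add0r gt_eqF.
have dr := @line_deriveV _ (fun h : R => enorm (h *: basis R j + y - c)) 0 _ r0' (pd_dist j yc).
have dv : is_derive (0 : R) 1 (fun h : R => delta R j k * h + (y - c) 0 k) (delta R j k * 1 + 0).
  exact: line_deriveD (line_deriveMl _ (line_derive_id _)) (line_derive_cst _ _).
rewrite /pd (_ : (fun h : R => _) = (fun h : R => (delta R j k * h + (y - c) 0 k) * (enorm (h *: basis R j + y - c))^-1)); last first.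
  by apply/funext => h; rewrite omegaE !mxE eqxx/= eq_sym [delta R _ _ * h]mulrC addrA.
apply: (is_derive_eqv (line_deriveM dv dr)); rewrite scale0r add0r !omegaE; field; exact: lt0r_neq0.
Qed.

Lemma pd_qk_omega i j v y : y != c -> pd j (fun y => qk i (omega c y) (vhat v)) y
  ((enorm (y - c))^-1 * dqk i j (omega c y) (vhat v)).
Proof.
move=> yc; have := @is_derive_qk i j (fun h => omega c (h *: basis R j + y)) (vhat v) (enorm (y - c))^-1.
rewrite scale0r add0r; apply.
  by rewrite dotC gt_eqF// dot_vhat_gt0// omega_unit.
by move=> k; exact: pd_omega.
Qed.

(* The coefficient of f in [flux]. *)
Definition kap i j (y v : vec) : R :=
  (delta R i j - qk i (omega c y) (vhat v) * vhat v 0 j) / enorm (y - c).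

Definition dkap i j (y v : vec) : R :=
  - ((delta R i j - qk i (omega c y) (vhat v) * vhat v 0 j) * omega c y 0 j
     + vhat v 0 j * dqk i j (omega c y) (vhat v)) / enorm (y - c) ^+ 2.

Lemma pd_kap i j y v : y != c -> pd j (fun y => kap i j y v) y (dkap i j y v).
Proof.
move=> yc; have r0 : 0 < enorm (y - c) by rewrite dist_gt0.
have r0' : enorm (0 *: basis R j + y - c) != 0 by rewrite scale0r add0r gt_eqF.
have dr := @line_deriveV _ (fun h : R => enorm (h *: basis R j + y - c)) 0 _ r0' (pd_dist j yc).
have dq : is_derive (0 : R) 1 (fun h : R => delta R i j - qk i (omega c (h *: basis R j + y)) (vhat v) * vhat v 0 j) _ :=
  line_deriveB (line_derive_cst _ _) (line_deriveM (pd_qk_omega i j v yc) (line_derive_cst _ (vhat v 0 j))).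
rewrite /pd /kap; apply: (is_derive_eqv (line_deriveM dq dr)).
rewrite scale0r !add0r /dkap omegaE; field; exact: lt0r_neq0.
Qed.

Lemma kap_le i j y v : y != c -> `|kap i j y v| <= 5 * gamma2 v ^+ 2 / enorm (y - c).
Proof.
move=> yc; have r0 : 0 < enorm (y - c) by rewrite dist_gt0.
have g1 := gamma2_ge1 v; have w1 := omega_unit yc.
rewrite /kap normrM [X in _ * X]ger0_norm ?invr_ge0 ?enorm_ge0// ler_pM2r ?invr_gt0//.
have h1 : `|qk i (omega c y) (vhat v) * vhat v 0 j| <= 4 * gamma2 v.
  by rewrite normrM -[leRHS]mulr1 qkC; apply: ler_pM => //; [exact: qk_le|exact: vhat_le1].
have h2 : `|delta R i j| <= 1 by rewrite /delta; case: eqP => _; rewrite ?normr1 ?normr0.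
have gg : gamma2 v <= gamma2 v ^+ 2 by rewrite expr2; nra.
by rewrite (le_trans (ler_normB _ _))//; lra.
Qed.

Lemma dkap_le i j y v : y != c -> `|dkap i j y v| <= 37 * gamma2 v ^+ 2 / enorm (y - c) ^+ 2.
Proof.
move=> yc; have r0 : 0 < enorm (y - c) by rewrite dist_gt0.
have g1 := gamma2_ge1 v; have w1 := omega_unit yc.
have wk k : `|omega c y 0 k| <= 1 by rewrite -w1; exact: le_coord_enorm.
rewrite /dkap normrM [X in _ * X]ger0_norm ?invr_ge0 ?sqr_ge0// ler_pM2r ?invr_gt0 ?exprn_gt0// normrN.
have h1 : `|qk i (omega c y) (vhat v) * vhat v 0 j| <= 4 * gamma2 v.
  by rewrite normrM -[leRHS]mulr1 qkC; apply: ler_pM => //; [exact: qk_le|exact: vhat_le1].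
have h2 : `|delta R i j| <= 1 by rewrite /delta; case: eqP => _; rewrite ?normr1 ?normr0.
have gg : gamma2 v <= gamma2 v ^+ 2 by rewrite expr2; nra.
have h3 : `|(delta R i j - qk i (omega c y) (vhat v) * vhat v 0 j) * omega c y 0 j| <= 5 * gamma2 v ^+ 2.
  rewrite normrM -[leRHS]mulr1; apply: ler_pM => //.
  by rewrite (le_trans (ler_normB _ _))//; lra.
have h4 : `|vhat v 0 j * dqk i j (omega c y) (vhat v)| <= 32 * gamma2 v ^+ 2.
  by rewrite normrM -[leRHS]mul1r; apply: ler_pM => //; [exact: vhat_le1|exact: dqk_le'].
by rewrite (le_trans (ler_normD _ _))//; lra.
Qed.

(** With s = vhat . omega, the numerators over (1 + s)^2 add up, apart from the sign in front of
    [dkap], to (omega_i + vhat_i) ((1 - s^2) - (|vhat|^2 - s^2)); the s^2 cancel and 1 - |vhat|^2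
    remains. *)
Lemma sum_dkap i y v : y != c -> \sum_j dkap i j y v =
  (enorm (vhat v) ^+ 2 - 1) * (vhat v 0 i + omega c y 0 i)
    / (enorm (y - c) ^+ 2 * (1 + dot (vhat v) (omega c y)) ^+ 2).
Proof.
move=> yc; have r0 : 0 < enorm (y - c) by rewrite dist_gt0.
have w1 := omega_unit yc; have d0 := dot_vhat_gt0 v w1.
rewrite big3E /dkap /qk /dqk /delta [dot (omega c y) _]dotC [enorm (vhat v) ^+ 2]enorm_sqr.
move: d0; rewrite dotE.
move: i; apply: ord3E;
move: (vhat v 0 i1) (vhat v 0 i2) (vhat v 0 i3) => p1 p2 p3;
move: (omega c y 0 i1) (omega c y 0 i2) (omega c y 0 i3) => o1 o2 o3 d0; rewrite /=.
- by field; rewrite (gt_eqF r0) (gt_eqF d0).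
- by field; rewrite (gt_eqF r0) (gt_eqF d0).
- by field; rewrite (gt_eqF r0) (gt_eqF d0).
Qed.

Lemma sum_kap i y v : \sum_j omega c y 0 j *
  (delta R i j - (omega c y 0 i + vhat v 0 i) * vhat v 0 j / (1 + dot (vhat v) (omega c y))) =
  \sum_j (y - c) 0 j * kap i j y v.
Proof.
by apply: eq_bigr => j _; rewrite omegaE /kap /qk [dot (omega c y) _]dotC; ring.
Qed.

Lemma continuous_kap_y i j v y : y != c -> {for y, continuous (fun y => kap i j y v)}.
Proof.
move=> yc; have w1 := omega_unit yc.
have cv : {for y, continuous (cst (vhat v) : vec -> vec)} by exact: cst_continuous.
have d0 : 1 + dot (omega c y) (vhat v) != 0 by rewrite dotC gt_eqF// dot_vhat_gt0.
have cq := continuous_qk (i := i) d0 (continuous_omega yc) cv.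
have cj : {for y, continuous (cst (vhat v 0 j) : vec -> R)} by exact: cst_continuous.
have cd : {for y, continuous (cst (delta R i j) : vec -> R)} by exact: cst_continuous.
apply: (@continuousM _ _ (fun y => delta R i j - qk i (omega c y) (vhat v) * vhat v 0 j) (fun y : vec => (enorm (y - c))^-1)).
  exact: (continuousB cd (continuousM cq cj)).
apply: (@continuousV _ _ (fun y : vec => enorm (y - c))); last exact: continuous_dist.
by rewrite gt_eqF// dist_gt0.
Qed.

Lemma continuous_kap_v i j y : y != c -> continuous (fun v => kap i j y v).
Proof.
move=> yc v; have w1 := omega_unit yc.
have cv : {for v, continuous (cst (omega c y) : vec -> vec)} by exact: cst_continuous.
have d0 : 1 + dot (omega c y) (vhat v) != 0 by rewrite dotC gt_eqF// dot_vhat_gt0.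
have cq := continuous_qk (a := cst (omega c y)) (i := i) d0 cv (@continuous_vhat v).
have cj := continuous_coord_comp (k := j) (@continuous_vhat v).
have cd : {for v, continuous (cst (delta R i j) : vec -> R)} by exact: cst_continuous.
have cr : {for v, continuous (cst (enorm (y - c))^-1 : vec -> R)} by exact: cst_continuous.
exact: (continuousM (continuousB cd (continuousM cq cj)) cr).
Qed.

Lemma continuous_dkap_y i j v y : y != c -> {for y, continuous (fun y => dkap i j y v)}.
Proof.
move=> yc; have w1 := omega_unit yc.
have cv : {for y, continuous (cst (vhat v) : vec -> vec)} by exact: cst_continuous.
have d0 : 1 + dot (omega c y) (vhat v) != 0 by rewrite dotC gt_eqF// dot_vhat_gt0.
have cq := continuous_qk (i := i) d0 (continuous_omega yc) cv.
have cdq := continuous_dqk (i := i) (j := j) d0 (continuous_omega yc) cv.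
have co := continuous_coord_comp (k := j) (continuous_omega yc).
have cj : {for y, continuous (cst (vhat v 0 j) : vec -> R)} by exact: cst_continuous.
have cd : {for y, continuous (cst (delta R i j) : vec -> R)} by exact: cst_continuous.
apply: (@continuousM _ _ (fun y => - ((delta R i j - qk i (omega c y) (vhat v) * vhat v 0 j) * omega c y 0 j
     + vhat v 0 j * dqk i j (omega c y) (vhat v))) (fun y : vec => (enorm (y - c) ^+ 2)^-1)).
  exact: (continuousN (continuousD (continuousM (continuousB cd (continuousM cq cj)) co) (continuousM cj cdq))).
apply: (@continuousV _ _ (fun y : vec => enorm (y - c) ^+ 2)); first by rewrite expf_neq0// gt_eqF// dist_gt0.
apply: (@continuous_comp _ _ _ (fun y : vec => enorm (y - c)) (fun x : R => x ^+ 2)); first exact: continuous_dist.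
exact: exprn_continuous.
Qed.

Lemma continuous_dkap_v i j y : y != c -> continuous (fun v => dkap i j y v).
Proof.
move=> yc v; have w1 := omega_unit yc.
have cv : {for v, continuous (cst (omega c y) : vec -> vec)} by exact: cst_continuous.
have d0 : 1 + dot (omega c y) (vhat v) != 0 by rewrite dotC gt_eqF// dot_vhat_gt0.
have cq := continuous_qk (a := cst (omega c y)) (i := i) d0 cv (@continuous_vhat v).
have cdq := continuous_dqk (a := cst (omega c y)) (i := i) (j := j) d0 cv (@continuous_vhat v).
have cj := continuous_coord_comp (k := j) (@continuous_vhat v).
have cd : {for v, continuous (cst (delta R i j) : vec -> R)} by exact: cst_continuous.
have co : {for v, continuous (cst (omega c y 0 j) : vec -> R)} by exact: cst_continuous.
have cr : {for v, continuous (cst (enorm (y - c) ^+ 2)^-1 : vec -> R)} by exact: cst_continuous.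
exact: (continuousM (continuousN (continuousD (continuousM (continuousB cd (continuousM cq cj)) co) (continuousM cj cdq))) cr).
Qed.

End Omega.
End Kernel.

(** * Velocity integrals of a density along the cone *)

Section DensityIntegrals.
Context {R : realType}.
Notation vec := 'rV[R]_3.
Implicit Types (g : R -> vec -> vec -> R).

Definition cont3 g : Prop := continuous (fun p : R * vec * vec => g p.1.1 p.1.2 p.2).

(** The decay hypothesis in powers of [gamma2], locally uniform in space; the time runs over all
    reals because it is meant for clamped densities. *)
Definition decays g : Prop := forall (N : nat) (L : R), exists C : R,
  forall (s : R) (y v : vec), box L y -> gamma2 v ^+ N * `|g s y v| <= C.

Lemma cont3_xt g v : cont3 g -> continuous (fun p : R * vec => g p.1 p.2 v).
Proof.
move=> cg p; apply: (@continuous_comp _ _ _ (fun p : R * vec => (p, v)) (fun p : R * vec * vec => g p.1.1 p.1.2 p.2)); last exact: cg.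
by apply: (@continuous_pair _ _ _ (fun p : R * vec => p) (fun _ => v)); [exact: cvg_id|exact: cvg_cst].
Qed.

Lemma cont3_v g s y : cont3 g -> continuous (g s y).
Proof.
move=> cg v; apply: (@continuous_comp _ _ _ (fun v : vec => ((s, y), v)) (fun p : R * vec * vec => g p.1.1 p.1.2 p.2)); last exact: cg.
by apply: (@continuous_pair _ _ _ (fun _ : vec => (s, y)) (fun v => v)); [exact: cst_continuous|exact: cvg_id].
Qed.

(** N powers of [gamma2] absorb the growth of the kernel and three more produce [weight]. *)
Lemma vdom_mul (k f : vec -> R) (A C : R) (N : nat) : 0 <= A -> continuous k -> continuous f ->
  (forall v, `|k v| <= A * gamma2 v ^+ N) -> (forall v, gamma2 v ^+ (N + 3) * `|f v| <= C) ->
  vdom (A * C) (fun v => k v * f v).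
Proof.
move=> A0 ck cf kA fC; split=> [v|v].
  by apply: (@continuousM _ _ k f); [exact: ck|exact: cf].
have g0 := gamma2_gt0 v; have gN : 0 < gamma2 v ^+ N by rewrite exprn_gt0.
have g3 : 0 < gamma2 v ^+ 3 by rewrite exprn_gt0.
rewrite normrM /weight ler_pdivlMr//.
apply: (@le_trans _ _ (A * gamma2 v ^+ N * `|f v| * gamma2 v ^+ 3)).
  by rewrite ler_pM2r// ler_wpM2r.
rewrite (_ : _ * _ = A * (gamma2 v ^+ (N + 3) * `|f v|)); last by rewrite exprD; ring.
by rewrite ler_wpM2l.
Qed.

(** N measures growth in the velocity and m the order of the singularity at c. Continuity in y and
    in v is separate, which is what [vint_continuous] consumes. *)
Record kernel (c : vec) (k : vec -> vec -> R) (A : R) (N m : nat) : Prop := {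
  kernel_v : forall y, y != c -> continuous (k y);
  kernel_y : forall y v, y != c -> {for y, continuous (k ^~ v)};
  kernel_le : forall y v, y != c -> `|k y v| <= A * gamma2 v ^+ N / enorm (y - c) ^+ m
}.

Lemma kernel_vdom (c : vec) k (A C L : R) (N m : nat) g (s : R) y : 0 <= A -> kernel c k A N m -> cont3 g ->
  (forall s y v, box L y -> gamma2 v ^+ (N + 3) * `|g s y v| <= C) -> y != c -> box L y ->
  vdom (A * C / enorm (y - c) ^+ m) (fun v => k y v * g s y v).
Proof.
move=> A0 [kv ky kl] cg gC yc yL.
have r0 : 0 < enorm (y - c) by rewrite dist_gt0.
rewrite (_ : A * C / _ = (A / enorm (y - c) ^+ m) * C); last by rewrite mulrAC.
apply: (@vdom_mul _ _ _ _ N).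
- by rewrite divr_ge0// exprn_ge0// ltW.
- exact: kv.
- exact: cont3_v.
- by move=> v; rewrite mulrAC; exact: kl.
- by move=> v; exact: gC.
Qed.

Section Ret.
Variables (T t : R) (c : vec).
Hypotheses (t0 : 0 < t) (tT : t <= T).

Definition vret k g (y : vec) : R := vint (fun v => k y v * ret t c g y v).

Lemma box_enorm (y : vec) L : enorm y <= L -> box L y.
Proof. by move=> h j; exact: le_trans (le_coord_enorm _ _) h. Qed.

Lemma continuous_vret k g (A : R) N m y : 0 <= A -> kernel c k A N m -> cont3 g -> decays g ->
  y != c -> {for y, continuous (vret k g)}.
Proof.
move=> A0 hk cg dg yc; have [C gC] := dg (N + 3)%N (enorm y + 1).
have r0 : 0 < enorm (y - c) by rewrite dist_gt0.
have C0 : 0 <= C.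
  apply: le_trans (gC 0 0 0 _); first by rewrite mulr_ge0// exprn_ge0// ltW// gamma2_gt0.
  by move=> j; rewrite mxE normr0 addr_ge0// enorm_ge0.
apply: (@vint_continuous _ _ _ _ (A * C / (enorm (y - c) / 2) ^+ m)).
  move=> v; apply: (@continuousM _ _ (k ^~ v) (fun y => ret t c g y v)); first exact: (kernel_y hk).
  apply: (@continuous_ret _ t c (fun s y => g s y v)); exact: cont3_xt.
have n1 : \forall z \near y, enorm (y - c) / 2 < enorm (z - c) by apply: near_dist_gt; lra.
have n2 : \forall z \near y, enorm (z - 0) < enorm y + 1.
  by apply: near_dist_lt; rewrite subr0 ltrDl.
near=> z.
have z1 : enorm (y - c) / 2 < enorm (z - c) by near: z.
have z2 : enorm (z - 0) < enorm y + 1 by near: z.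
have z0 : 0 < enorm (z - c) by apply: lt_trans z1; rewrite divr_gt0.
have zL : box (enorm y + 1) z by apply: box_enorm; rewrite subr0 in z2; exact: ltW.
have zc : z != c by rewrite -dist_gt0.
have [cv le] := kernel_vdom (t - enorm (z - c)) A0 hk cg gC zc zL; split => // v.
rewrite (le_trans (le v))// ler_wpM2r//; first exact/ltW/weight_gt0.
rewrite ler_wpM2l ?mulr_ge0// lef_pV2 ?posrE ?exprn_gt0 ?divr_gt0//.
by rewrite lerXn2r ?nnegrE ?divr_ge0 ?enorm_ge0// ltW.
Unshelve. all: end_near. Qed.

Lemma vret_le k g (A C L : R) N m y : 0 <= A -> kernel c k A N m -> cont3 g ->
  (forall s y v, box L y -> gamma2 v ^+ (N + 3) * `|g s y v| <= C) -> y != c -> box L y ->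
  `|vret k g y| <= A * C / enorm (y - c) ^+ m * vint (@weight R).
Proof. by move=> A0 hk cg gC yc yL; apply: vint_le; exact: (kernel_vdom _ A0 hk cg gC). Qed.

(** Differentiation under the integral sign, with three contributions: derivative of the kernel (one
    order more singular), spatial derivative of the density, and its time derivative times - omega_j
    from the retarded time. *)
Lemma pd_vret j k dk g gt (gx : 'I_3 -> R -> vec -> vec -> R) (A : R) N m y : 0 <= A ->
  kernel c k A N m -> kernel c dk A N m.+1 ->
  kernel c (fun y v => omega c y 0 j * k y v) A N m ->
  (forall y v, y != c -> pd j (k ^~ v) y (dk y v)) ->
  cont3 g -> cont3 gt -> cont3 (gx j) -> decays g -> decays gt -> decays (gx j) ->
  (forall v, C1on T (fun s y => g s y v) (fun s y => gt s y v) (fun j s y => gx j s y v)) ->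
  0 < enorm (y - c) < t -> 0 < y 0 i3 ->
  pd j (vret k g) y
    (vret dk g y + (vret k (gx j) y - vret (fun y v => omega c y 0 j * k y v) gt y)).
Proof.
move=> A0 hk hdk hwk kdk cg cgt cgx dg dgt dgx hC1 /andP[r0 rt] y3.
have [C gC] := dg (N + 3)%N (enorm y + 1); have [Ct gtC] := dgt (N + 3)%N (enorm y + 1).
have [Cx gxC] := dgx (N + 3)%N (enorm y + 1).
have C0 (g' : R -> vec -> vec -> R) (C' : R) : (forall s z v, box (enorm y + 1) z -> gamma2 v ^+ (N + 3) * `|g' s z v| <= C') -> 0 <= C'.
  move=> h; apply: le_trans (h 0 0 0 _); first by rewrite mulr_ge0// exprn_ge0// ltW// gamma2_gt0.
  by move=> i; rewrite mxE normr0 addr_ge0// enorm_ge0.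
have yc : y != c by rewrite -dist_gt0.
pose z (h : R) : vec := h *: basis R j + y.
have z0E : z 0 = y by rewrite /z scale0r add0r.
have cz : {for (0 : R), continuous z} by exact: continuous_line.
have : \forall h \near (0 : R), [/\ enorm (y - c) / 2 < enorm (z h - c), enorm (z h - c) < t,
    0 < z h 0 i3 & enorm (z h) < enorm y + 1].
  have n1 : \forall h \near (0 : R), enorm (y - c) / 2 < enorm (z h - c).
    by apply: (cz (fun y' => enorm (y - c) / 2 < enorm (y' - c))); rewrite z0E; apply: near_dist_gt; lra.
  have n2 : \forall h \near (0 : R), enorm (z h - c) < t.
    by apply: (cz (fun y' => enorm (y' - c) < t)); rewrite z0E; exact: near_dist_lt.
  have n3 : \forall h \near (0 : R), 0 < z h 0 i3.
    by apply: (cz (fun y' => 0 < y' 0 i3)); rewrite z0E; exact: near_upper.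
  have n4 : \forall h \near (0 : R), enorm (z h - 0) < enorm y + 1.
    by apply: (cz (fun y' => enorm (y' - 0) < enorm y + 1)); rewrite z0E; apply: near_dist_lt; rewrite subr0 ltrDl.
  near=> h; split; [near: h; exact: n1|near: h; exact: n2|near: h; exact: n3|].
  by rewrite -[z h]subr0; near: h; exact: n4.
move=> /nbhs_ballP[d /= d0 hd].
have hd' (h : R) : `|h| < d -> [/\ enorm (y - c) / 2 < enorm (z h - c), enorm (z h - c) < t,
    0 < z h 0 i3 & enorm (z h) < enorm y + 1].
  by move=> hh; apply: hd; rewrite /ball/= sub0r normrN.
(* Near y the distance to c stays above half its value, which makes the bounds uniform in h. *)
pose D (g' : R) m' := A * g' / (enorm (y - c) / 2) ^+ m'.
have vd (k' : vec -> vec -> R) g' C' m' (h : R) s : kernel c k' A N m' -> cont3 g' ->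
    (forall s y' v, box (enorm y + 1) y' -> gamma2 v ^+ (N + 3) * `|g' s y' v| <= C') -> `|h| < d ->
    vdom (D C' m') (fun v => k' (z h) v * g' s (z h) v).
  move=> hk' cg' gC' hh; have [z1 z2 z3 z4] := hd' h hh.
  have zr : 0 < enorm (z h - c) by apply: lt_trans z1; rewrite divr_gt0.
  have zc : z h != c by rewrite -dist_gt0.
  have [cv le] := kernel_vdom s A0 hk' cg' gC' zc (box_enorm (ltW z4)).
  split => // v; rewrite (le_trans (le v))// ler_wpM2r//; first exact/ltW/weight_gt0.
  rewrite ler_wpM2l ?mulr_ge0//; first exact: (C0 _ _ gC').
  rewrite lef_pV2 ?posrE ?exprn_gt0 ?divr_gt0//.
  by rewrite lerXn2r ?nnegrE ?divr_ge0 ?enorm_ge0// ltW.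
pose P' (h : R) (v : vec) : R := dk (z h) v * ret t c g (z h) v +
   (k (z h) v * ret t c (gx j) (z h) v - omega c (z h) 0 j * k (z h) v * ret t c gt (z h) v).
have d00 : `|0 : R| < d by rewrite normr0.
have dP : is_derive (0 : R) 1 (fun h => vint (fun v => k (z h) v * ret t c g (z h) v)) (vint (P' 0)).
  apply: (@vint_derive _ (fun h v => k (z h) v * ret t c g (z h) v) P' d (D C m + (D C m.+1 + (D Cx m + D Ct m)))) => //.
  - move=> h v hh; have [z1 z2 z3 z4] := hd' h hh.
    have zr : 0 < enorm (z h - c) by apply: lt_trans z1; rewrite divr_gt0.
    have zc : z h != c by rewrite -dist_gt0.
    have zrt : 0 < enorm (z h - c) < t by rewrite zr.
    have H1 : is_derive (h : R) 1 (fun h => k (z h) v) (dk (z h) v) by exact: (pd_line (kdk _ v zc)).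
    have H2' : pd j (ret t c (fun s y => g s y v)) (z h) (ret t c (fun s y => gx j s y v) (z h)
        - (z h - c) 0 j / enorm (z h - c) * ret t c (fun s y => gt s y v) (z h)).
      exact: (@pd_ret _ T t c tT _ _ _ j (z h) (hC1 v) zrt z3).
    have H2 : is_derive (h : R) 1 (fun h => ret t c g (z h) v) _ := pd_line H2'.
    apply: (is_derive_eqv (line_deriveM H1 H2)); rewrite /P' omegaE /ret; ring.
  - move=> h hh; have [cv le] := vd k g C m h (t - enorm (z h - c)) hk cg gC hh; split => // v.
    rewrite (le_trans (le v))// ler_wpM2r//; first exact/ltW/weight_gt0.
    have D0 C' m' : 0 <= C' -> 0 <= D C' m'.
      by move=> h0; rewrite /D divr_ge0 ?mulr_ge0// exprn_ge0// divr_ge0// ltW.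
    have := D0 _ m.+1 (C0 _ _ gC); have := D0 _ m (C0 _ _ gxC); have := D0 _ m (C0 _ _ gtC); lra.
  - move=> h v hh.
    have [_ l1] := vd dk g C m.+1 h (t - enorm (z h - c)) hdk cg gC hh.
    have [_ l2] := vd k (gx j) Cx m h (t - enorm (z h - c)) hk cgx gxC hh.
    have [_ l3] := vd _ gt Ct m h (t - enorm (z h - c)) hwk cgt gtC hh.
    have [_ l4] := vd k g C m h (t - enorm (z h - c)) hk cg gC hh.
    have := l1 v; have := l2 v; have := l3 v; have := le_trans (normr_ge0 _) (l4 v).
    rewrite /P' /ret !ler_norml !mulrDl; lra.
rewrite /pd; apply: (is_derive_eqv dP).
have := vd dk g C m.+1 0 (t - enorm (z 0 - c)) hdk cg gC d00.
have := vd k (gx j) Cx m 0 (t - enorm (z 0 - c)) hk cgx gxC d00.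
have := vd _ gt Ct m 0 (t - enorm (z 0 - c)) hwk cgt gtC d00.
rewrite z0E => v3 v2 v1.
rewrite /vret -(vintB v2 v3) -(@vintD _ _ _ _ _ v1 (vdomD v2 (vdomN v3))).
by apply: vint_ext => v; rewrite /P' z0E.
Unshelve. all: end_near. Qed.

End Ret.

(** * Integration by parts in the velocity *)

Section VelocityIBP.
Variables (i : 'I_3) (f : vec -> R) (fv : 'I_3 -> vec -> R) (e b w : vec) (gr C : R).
Hypothesis w1 : enorm w = 1.
Hypotheses (cf : continuous f) (cfv : forall j, continuous (fv j)).
Hypothesis dfv : forall j v, pd j f v (fv j v).
Hypothesis fC : forall v, gamma2 v ^+ 5 * `|f v| <= C.
Hypothesis fvC : forall j v, gamma2 v ^+ 5 * `|fv j v| <= C.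

Let F (v : vec) : vec := e + cross (vhat v) b - gr *: basis R i3.
Let M : R := enorm e + 2 * enorm b + `|gr|.

Let M0 : 0 <= M.
Proof. by rewrite /M !addr_ge0 ?mulr_ge0 ?enorm_ge0. Qed.

Let cross_le v j : `|cross (vhat v) b 0 j| <= 2 * enorm b.
Proof.
have h k l : `|vhat v 0 k * b 0 l| <= enorm b.
  by rewrite normrM -[leRHS]mul1r ler_pM ?vhat_le1 ?le_coord_enorm.
have h2 (x y : R) : `|x| <= enorm b -> `|y| <= enorm b -> `|x - y| <= 2 * enorm b.
  by rewrite !ler_norml; lra.
by move: j; apply: ord3E; rewrite /cross vec3E; apply: h2.
Qed.

Lemma force_le v j : `|F v 0 j| <= M.
Proof.
have h1 := le_coord_enorm e j; have h2 := cross_le v j.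
have h3 : `|gr * (i3 == j)%:R| <= `|gr|.
  by rewrite normrM -[leRHS]mulr1 ler_wpM2l//; case: (_ == _); rewrite ?normr1 ?normr0.
have -> : F v 0 j = e 0 j + cross (vhat v) b 0 j - gr * (i3 == j)%:R by rewrite /F !mxE eqxx/= eq_sym.
by move: h1 h2 h3; rewrite /M !ler_norml; lra.
Qed.

Let continuous_cross j : continuous (fun v => cross (vhat v) b 0 j).
Proof.
move=> v; have cw k := continuous_coord_comp (k := k) (@continuous_vhat R v).
have cb k : {for v, continuous (cst (b 0 k) : vec -> R)} by exact: cst_continuous.
by move: j; apply: ord3E; rewrite /cross; under eq_fun do rewrite vec3E;
  exact: (continuousB (continuousM (cw _) (cb _)) (continuousM (cw _) (cb _))).
Qed.

Let FE v j : F v 0 j = (e 0 j - gr * basis R i3 0 j) + cross (vhat v) b 0 j.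
Proof. by rewrite /F !mxE; ring. Qed.

Let continuous_F j : continuous (fun v => F v 0 j).
Proof.
move=> v; under eq_fun do rewrite FE.
by apply: (@continuousD _ _ _ (cst (e 0 j - gr * basis R i3 0 j) : vec -> R) (fun v => cross (vhat v) b 0 j)); [exact: cst_continuous|exact: continuous_cross].
Qed.

Let dF j (v : vec) : R := - ((lorentz v)^-1 * vhat v 0 j * cross (vhat v) b 0 j).

Let pd_F j v : pd j (fun v => F v 0 j) v (dF j v).
Proof.
have H k : is_derive (0 : R) 1 (fun h => vhat (h *: basis R j + v) 0 k) _ := pd_vhat j k v.
rewrite /pd; under eq_fun do rewrite FE.
rewrite (_ : dF j v = 0 + dF j v); last by rewrite add0r.
apply: (line_deriveD (line_derive_cst _ _)); rewrite /dF; move: j H; apply: ord3E => H; rewrite /cross; under eq_fun do rewrite vec3E.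
- apply: (is_derive_eqv (line_deriveB (line_deriveM (H i2) (line_derive_cst _ (b 0 i3))) (line_deriveM (H i3) (line_derive_cst _ (b 0 i2))))); rewrite vec3E /delta/=; ring.
- apply: (is_derive_eqv (line_deriveB (line_deriveM (H i3) (line_derive_cst _ (b 0 i1))) (line_deriveM (H i1) (line_derive_cst _ (b 0 i3))))); rewrite vec3E /delta/=; ring.
- apply: (is_derive_eqv (line_deriveB (line_deriveM (H i1) (line_derive_cst _ (b 0 i2))) (line_deriveM (H i2) (line_derive_cst _ (b 0 i1))))); rewrite vec3E /delta/=; ring.
Qed.

(** The Lorentz force is divergence free in v: the sum is - vhat . (vhat x b) / [lorentz v]. *)
Let sum_dF v : dF i1 v + dF i2 v + dF i3 v = 0.
Proof. by rewrite /dF /cross !vec3E; ring. Qed.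

Let cq : continuous (fun v => qk i (vhat v) w).
Proof.
move=> v; apply: (continuous_qk (b := cst w)); [by rewrite gt_eqF// dot_vhat_gt0|exact: continuous_vhat|exact: cst_continuous].
Qed.

Let cdq j : continuous (fun v => dqk i j (vhat v) w).
Proof.
move=> v; apply: (continuous_dqk (b := cst w)); [by rewrite gt_eqF// dot_vhat_gt0|exact: continuous_vhat|exact: cst_continuous].
Qed.

Let lV_le (v : vec) : 0 <= (lorentz v)^-1 <= 1.
Proof. by rewrite invr_ge0 invf_le1 ?lorentz_gt0// lorentz_ge1 ltW// lorentz_gt0. Qed.

Let gg (v : vec) : gamma2 v <= gamma2 v ^+ 2.
Proof. by have := gamma2_ge1 v; rewrite expr2; nra. Qed.

Let vA j : vdom (32 * M * C) (fun v => (lorentz v)^-1 * dqk i j (vhat v) w * F v 0 j * f v).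
Proof.
apply: (@vdom_mul (fun v => (lorentz v)^-1 * dqk i j (vhat v) w * F v 0 j) _ _ _ 2) => //.
- by rewrite mulr_ge0.
- move=> v; exact: (continuousM (continuousM (@continuous_lorentzV R v) (@cdq j v)) (@continuous_F j v)).
- move=> v; have /andP[l0 l1] := lV_le v; have q := dqk_le i j v w1; have fl := force_le v j.
  rewrite !normrM (ger0_norm l0) (_ : 32 * M * _ = 1 * (32 * gamma2 v ^+ 2) * M); last by ring.
  apply: ler_pM => //; first by apply: mulr_ge0.
  apply: ler_pM => //.
  by rewrite -normrM; exact: q.
Qed.

Let vZ j : vdom (4 * (2 * enorm b) * C) (fun v => qk i (vhat v) w * dF j v * f v).
Proof.
apply: (@vdom_mul (fun v => qk i (vhat v) w * dF j v) _ _ _ 2) => //.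
- by rewrite !mulr_ge0// enorm_ge0.
- move=> v; have cw := continuous_coord_comp (k := j) (@continuous_vhat R v).
  exact: (continuousM (@cq v) (continuousN (continuousM (continuousM (@continuous_lorentzV R v) cw) (@continuous_cross j v)))).
- move=> v; have /andP[l0 l1] := lV_le v; have q := qk_le i v w1.
  have h : `|dF j v| <= 1 * 1 * (2 * enorm b).
    by rewrite /dF normrN !normrM (ger0_norm l0) !ler_pM ?mulr_ge0 ?vhat_le1 ?cross_le.
  rewrite normrM; apply: (@le_trans _ _ (4 * gamma2 v * (1 * 1 * (2 * enorm b)))); first by rewrite ler_pM.
  by have := gg v; have := enorm_ge0 b; nra.
Qed.

Let vB j : vdom (4 * M * C) (fun v => qk i (vhat v) w * F v 0 j * fv j v).
Proof.
apply: (@vdom_mul (fun v => qk i (vhat v) w * F v 0 j) _ _ _ 2) => //.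
- by rewrite mulr_ge0.
- move=> v; exact: (continuousM (@cq v) (@continuous_F j v)).
- move=> v; have q := qk_le i v w1; have fl := force_le v j.
  rewrite normrM; apply: (@le_trans _ _ (4 * gamma2 v * M)); first by rewrite ler_pM.
  by have := gg v; have := M0; nra.
Qed.

Let vP j : vdom (4 * M * C) (fun v => qk i (vhat v) w * F v 0 j * f v).
Proof.
apply: (@vdom_mul (fun v => qk i (vhat v) w * F v 0 j) _ _ _ 2) => //.
- by rewrite mulr_ge0.
- move=> v; exact: (continuousM (@cq v) (@continuous_F j v)).
- move=> v; have q := qk_le i v w1; have fl := force_le v j.
  rewrite normrM; apply: (@le_trans _ _ (4 * gamma2 v * M)); first by rewrite ler_pM.
  by have := gg v; have := M0; nra.
Qed.

Let P' j v := (lorentz v)^-1 * dqk i j (vhat v) w * F v 0 j * f v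
   + qk i (vhat v) w * dF j v * f v + qk i (vhat v) w * F v 0 j * fv j v.

Let vP' j : vdom (32 * M * C + 4 * (2 * enorm b) * C + 4 * M * C) (P' j).
Proof. exact: (vdomD (vdomD (vA j) (vZ j)) (vB j)). Qed.

Let vint_P' j : vint (P' j) = 0.
Proof.
have [_ le] := vP' j.
have vPj := vP j.
have C' := vdom_ge0 (vA j); have C'' := vdom_ge0 (vZ j).
apply: (@vint_pd0 _ (32 * M * C + 4 * (2 * enorm b) * C + 4 * M * C) j (fun v => qk i (vhat v) w * F v 0 j * f v)) => //.
  split; first exact: vPj.1.
  move=> v; rewrite (le_trans (vPj.2 v))// ler_wpM2r//; first exact/ltW/weight_gt0.
  by lra.
move=> v.
have H1 : is_derive (0 : R) 1 (fun h => qk i (vhat (h *: basis R j + v)) w) _ := pd_qk_vhat i j v w1.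
have H2 : is_derive (0 : R) 1 (fun h => F (h *: basis R j + v) 0 j) _ := pd_F j v.
have H3 : is_derive (0 : R) 1 (fun h => f (h *: basis R j + v)) _ := dfv j v.
rewrite /pd; apply: (is_derive_eqv (line_deriveM (line_deriveM H1 H2) H3)).
by rewrite /P' scale0r !add0r; ring.
Qed.

(** The divergence in v of q F f integrates to 0. It has three parts: the gradient of q, which is
    [aE]; the divergence of F, which vanishes; and q F . grad_v f. *)
Lemma velocity_parts : [/\ vdom (32 * M * C + 32 * M * C + 32 * M * C) (fun v => dot (aE i v w) (f v *: F v)),
  vdom (4 * M * C + 4 * M * C + 4 * M * C) (fun v => qk i (vhat v) w * dot (F v) (\row_j fv j v)) &
  vint (fun v => qk i (vhat v) w * dot (F v) (\row_j fv j v)) =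
  - vint (fun v => dot (aE i v w) (f v *: F v))].
Proof.
have eA v : dot (aE i v w) (f v *: F v) = \sum_j (lorentz v)^-1 * dqk i j (vhat v) w * F v 0 j * f v.
  by apply: eq_bigr => j _; rewrite (aE_dqk i j v w1) [(f v *: F v) 0 j]mxE; ring.
have eB v : qk i (vhat v) w * dot (F v) (\row_j fv j v) = \sum_j qk i (vhat v) w * F v 0 j * fv j v.
  by rewrite mulr_sumr; apply: eq_bigr => j _; rewrite [(\row_j _) 0 j]mxE; ring.
have vAA := vdomD (vdomD (vA i1) (vA i2)) (vA i3).
have vBB := vdomD (vdomD (vB i1) (vB i2)) (vB i3).
have eA' : (fun v => dot (aE i v w) (f v *: F v)) = (fun v =>
   (lorentz v)^-1 * dqk i i1 (vhat v) w * F v 0 i1 * f v + (lorentz v)^-1 * dqk i i2 (vhat v) w * F v 0 i2 * f v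
   + (lorentz v)^-1 * dqk i i3 (vhat v) w * F v 0 i3 * f v).
  by apply/funext => v; rewrite eA big3E.
have eB' : (fun v => qk i (vhat v) w * dot (F v) (\row_j fv j v)) = (fun v =>
   qk i (vhat v) w * F v 0 i1 * fv i1 v + qk i (vhat v) w * F v 0 i2 * fv i2 v
   + qk i (vhat v) w * F v 0 i3 * fv i3 v).
  by apply/funext => v; rewrite eB big3E.
rewrite eA' eB'; split => //.
apply/eqP; rewrite -addr_eq0 -(vintD vBB vAA); apply/eqP.
transitivity (vint (P' i1) + vint (P' i2) + vint (P' i3)); last by rewrite !vint_P' !addr0.
rewrite -(vintD (vP' i1) (vP' i2)) -(vintD (vdomD (vP' i1) (vP' i2)) (vP' i3)).
apply: vint_ext => v; have := sum_dF v; rewrite /P' => h.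
have -> : dF i3 v = - dF i1 v - dF i2 v by lra.
ring.
Qed.

End VelocityIBP.
End DensityIntegrals.

(** * Consequences of the Vlasov-Maxwell system *)

Section SolutionData.
Context {R : realType}.
Notation vec := 'rV[R]_3.

Section C2.
Variables (T : R) (u : R -> vec -> R).
Hypotheses (T0 : 0 <= T) (hu : Ck_field T 2 u).

Lemma C2_C1 : Ck_field T 1 u.
Proof.
have [cu [du ct cx]] := hu; split => //; split => //; first by split => //; have [] := ct.
by move=> j; split => //; have [] := cx j.
Qed.

Lemma C2on : C1on T (ext T u) (ext T (Dt T u)) (fun j => ext T (Dx j u)).
Proof. exact: (Ck_C1on T0 C2_C1). Qed.

Lemma C2ont : C1on T (ext T (Dt T u)) (ext T (Dt T (Dt T u))) (fun j => ext T (Dx j (Dt T u))).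
Proof. by have [_ [_ ct _]] := hu; exact: (Ck_C1on T0 ct). Qed.

Lemma C2onx j : C1on T (ext T (Dx j u)) (ext T (Dt T (Dx j u))) (fun l => ext T (Dx l (Dx j u))).
Proof. by have [_ [_ _ cx]] := hu; exact: (Ck_C1on T0 (cx j)). Qed.

Lemma C2_tx j (s : R) (y : vec) : 0 < s < T -> 0 < y 0 i3 ->
  ext T (Dx j (Dt T u)) s y = ext T (Dt T (Dx j u)) s y.
Proof. exact: (mixed_tx C2on C2ont C2onx). Qed.

Lemma C2_xx j l (s : R) (y : vec) : 0 < s < T -> 0 < y 0 i3 ->
  ext T (Dx l (Dx j u)) s y = ext T (Dx j (Dx l u)) s y.
Proof. exact: (mixed_xx C2on C2onx). Qed.

End C2.

(** This and the next two are the components of curl curl = grad div - Laplacian combined with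
    Maxwell's equations. The variables y and z stand for the mixed second derivatives in the two
    orders. *)
Let A1 (x11 x22 x33 y1 y2 z1 z2 p q r J e : R) : x11 + y1 + y2 = r -> z1 - x22 = - p -> x33 - z2 = - q ->
    p - q = J + e -> y1 = z1 -> y2 = z2 -> x11 + x22 + x33 - e = r + J.
Proof. lra. Qed.
Let A2 (x11 x22 x33 y1 y2 z1 z2 p q r J e : R) : y1 + x22 + y2 = r -> x11 - z1 = - p -> z2 - x33 = - q ->
    q - p = J + e -> z1 = y1 -> y2 = z2 -> x11 + x22 + x33 - e = r + J.
Proof. lra. Qed.
Let A3 (x11 x22 x33 y1 y2 z1 z2 p q r J e : R) : y1 + y2 + x33 = r -> z1 - x11 = - p -> x22 - z2 = - q ->
    p - q = J + e -> z1 = y1 -> z2 = y2 -> x11 + x22 + x33 - e = r + J.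
Proof. lra. Qed.

Lemma is_derive_unique (F : R -> R) (x a b : R) : is_derive x 1 F a -> is_derive x 1 F b -> a = b.
Proof. by move=> [_ <-] [_ <-]. Qed.

(** Stated along a curve (sg, z) in space-time so that one lemma serves both for the spatial
    derivative of rho and for the time derivative of the current. *)
Lemma vint_derive_density (k : vec -> R) (g g' : R -> vec -> vec -> R) (sg : R -> R) (z : R -> vec) (L d : R) :
  0 < d -> continuous k -> (forall v, `|k v| <= 1) -> cont3 g -> decays g -> decays g' ->
  (forall h, `|h| < d -> box L (z h)) ->
  (forall h v, `|h| < d -> is_derive (h : R) 1 (fun h => g (sg h) (z h) v) (g' (sg h) (z h) v)) ->
  is_derive (0 : R) 1 (fun h => vint (fun v => k v * g (sg h) (z h) v)) (vint (fun v => k v * g' (sg 0) (z 0) v)).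
Proof.
move=> d0 ck k1 cg dg dg' hz D; have [C gC] := dg 3 L; have [C' gC'] := dg' 3 L.
have C0 (h0 : R -> vec -> vec -> R) (K : R) : (forall s y v, box L y -> gamma2 v ^+ 3 * `|h0 s y v| <= K) -> 0 <= K.
  move=> h; apply: le_trans (h (sg 0) (z 0) 0 _); last by apply: hz; rewrite normr0.
  by rewrite mulr_ge0// exprn_ge0// ltW// gamma2_gt0.
have bd (h0 : R -> vec -> vec -> R) (K : R) h v : (forall s y v, box L y -> gamma2 v ^+ 3 * `|h0 s y v| <= K) -> `|h| < d ->
    `|k v * h0 (sg h) (z h) v| <= K * weight v.
  move=> hK hh; rewrite /weight ler_pdivlMr ?exprn_gt0 ?gamma2_gt0// normrM mulrC.
  apply: le_trans (hK (sg h) (z h) v (hz h hh)).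
  apply: ler_wpM2l; first by rewrite exprn_ge0// ltW// gamma2_gt0.
  by rewrite -[leRHS]mul1r; apply: ler_wpM2r; rewrite ?k1.
apply: (@vint_derive _ (fun h v => k v * g (sg h) (z h) v) (fun h v => k v * g' (sg h) (z h) v) d (C + C')) => //.
- by move=> h v hh; exact: (line_deriveMl _ (D h v hh)).
- move=> h hh; split.
    by move=> v; apply: (@continuousM _ _ k (g (sg h) (z h))); [exact: ck|exact: cont3_v].
  move=> v; rewrite (le_trans (bd g C h v gC hh))// ler_wpM2r//; first exact/ltW/weight_gt0.
  by have := C0 _ _ gC'; lra.
- move=> h v hh; rewrite (le_trans (bd g' C' h v gC' hh))// ler_wpM2r//; first exact/ltW/weight_gt0.
  by have := C0 _ _ gC; lra.
Qed.

Section Sol.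
Variables (T gr : R) (f : R -> vec -> vec -> R) (E B : R -> vec -> vec) (E0 B0 : vec -> vec).
Hypotheses (T0 : 0 < T) (sol : RVM_solution T gr f E B E0 B0).

Let T0' : 0 <= T. Proof. exact: ltW. Qed.

Definition comp (F : R -> vec -> vec) (k : 'I_3) (s : R) (y : vec) : R := F s y 0 k.

Let E2 k : Ck_field T 2 (comp E k). Proof. exact: (RVM_E_C2 sol). Qed.
Let B2 k : Ck_field T 2 (comp B k). Proof. exact: (RVM_B_C2 sol). Qed.

Definition fe := ext T f.
Definition ft := ext T (dtf T f).
Definition fx j := ext T (fun s y v => gradxf f s y v 0 j).
Definition fv j := ext T (fun s y v => gradvf f s y v 0 j).

Lemma cont3_fe : cont3 fe.
Proof. by have [h _ _ _ _] := RVM_f_C1 sol; exact: (continuous_ext_density T0' h). Qed.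
Lemma cont3_ft : cont3 ft.
Proof. by have [_ _ h _ _] := RVM_f_C1 sol; exact: (continuous_ext_density T0' h). Qed.
Lemma cont3_fx j : cont3 (fx j).
Proof. by have [_ _ _ h _] := RVM_f_C1 sol; exact: (continuous_ext_density T0' (h j)). Qed.
Lemma cont3_fv j : cont3 (fv j).
Proof. by have [_ _ _ _ h] := RVM_f_C1 sol; exact: (continuous_ext_density T0' (h j)). Qed.

Lemma in_itvP (s : R) : 0 <= s <= T -> s \in `[0, T].
Proof. by rewrite in_itv. Qed.

Lemma clampt_itv s : clampt T s \in `[0, T].
Proof. by apply: in_itvP; exact: clampt_in. Qed.

Lemma fv_pd j s y v : pd j (fe s y) v (fv j s y v).
Proof.
have [_ h _ _ _] := RVM_f_C1 sol.
have [_ _ hv] := h (clampt T s) (clampx y) v (clampt_itv s) (clampx_in y).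
have := derivable_pd (hv j); rewrite /fv /ext /gradvf /gradv mxE; exact.
Qed.

Lemma C1on_f v : C1on T (fun s y => fe s y v) (fun s y => ft s y v) (fun j s y => fx j s y v).
Proof.
have [_ h _ _ _] := RVM_f_C1 sol.
apply: (@C1on_ext _ T (fun s y => f s y v) (fun s y => dtf T f s y v) (fun j s y => gradxf f s y v 0 j)).
- by move=> p; exact: (@cont3_xt _ fe v cont3_fe p).
- by move=> p; exact: (@cont3_xt _ ft v cont3_ft p).
- by move=> j p; exact: (@cont3_xt _ (fx j) v (@cont3_fx j) p).
- move=> s y hs hy; have /andP[s0 sT] := hs; apply: is_derive_dt => //.
  by have [] := h s y v (in_itvP (_ : 0 <= s <= T)) (ltW hy); rewrite ?ltW.
- move=> j s y hs hy; have /andP[s0 sT] := hs; rewrite /gradxf /gradx mxE; apply: pd_dx => //.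
  by have [] := h s y v (in_itvP (_ : 0 <= s <= T)) (ltW hy); rewrite ?ltW.
Qed.

Lemma compact_half_box L : compact (box L `&` @Omega_bar R).
Proof.
apply: (@subclosed_compact _ _ (box L)) => //; last exact: compact_box.
apply: closedI; first by apply: compact_closed; [exact: norm_hausdorff|exact: compact_box].
rewrite (_ : @Omega_bar R = (fun y : vec => y 0 i3) @^-1` [set x : R | 0 <= x])//.
apply: closed_comp; last exact: closed_ge.
by move=> y _; exact: coord_continuous.
Qed.

(** Since [gamma2 v] <= (1 + |v|)^2, the given decay is used with exponent 2N. Clamping maps the box
    of half-side |L| into its part in the closed half space, a compact set; the absolute value
    accommodates a third coordinate clamped to 0. *)
Lemma decays_all (N : nat) (L : R) : exists C : R, forall (s : R) (y v : vec), box L y ->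
  gamma2 v ^+ N * (`|fe s y v| + `|ft s y v| + enorm (gradxf f (clampt T s) (clampx y) v)
     + enorm (gradvf f (clampt T s) (clampx y) v)) <= C.
Proof.
have [C hC] := RVM_f_decay sol (2 * N)%N (@compact_half_box `|L|) (@subIsetr _ _ _).
exists C => s y v yL.
have yL' : (box `|L| `&` @Omega_bar R) (clampx y).
  split; last exact: clampx_in.
  have a k : `|y 0 k| <= `|L| by apply: le_trans (yL k) (ler_norm _).
  apply: ord3E; rewrite /clampx vec3E//.
  by have := a i3; case: (leP 0 (y 0 i3)) => // _ _; rewrite normr0.
have := hC (clampt T s) (clampx y) v (clampt_itv s) yL'.
apply: le_trans; apply: ler_wpM2r; first by rewrite !addr_ge0 ?enorm_ge0.
have e0 := enorm_ge0 v; rewrite exprM.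
have g1 : gamma2 v <= (1 + enorm v) ^+ 2 by rewrite /gamma2 sqrrD expr1n mul1r; lra.
have g0 : 0 <= gamma2 v by exact/ltW/gamma2_gt0.
have q0 : 0 <= (1 + enorm v) ^+ 2 by exact: sqr_ge0.
by rewrite lerXn2r ?nnegrE.
Qed.

Let decays_le (h : R -> vec -> vec -> R) : (forall s y v, `|h s y v| <= `|fe s y v| + `|ft s y v| +
     enorm (gradxf f (clampt T s) (clampx y) v) + enorm (gradvf f (clampt T s) (clampx y) v)) -> decays h.
Proof.
move=> hle N L; have [C hC] := decays_all N L; exists C => s y v yL.
apply: le_trans (hC s y v yL); rewrite ler_wpM2l ?hle// exprn_ge0// ltW// gamma2_gt0 //.
Qed.

Let pos4 (a b c d : R) : 0 <= a -> 0 <= b -> 0 <= c -> 0 <= d ->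
  [/\ a <= a + b + c + d, b <= a + b + c + d, c <= a + b + c + d & d <= a + b + c + d].
Proof. by move=> *; split; lra. Qed.

Lemma decays_fe : decays fe.
Proof. by apply: decays_le => s y v; have [h _ _ _] := pos4 (normr_ge0 (fe s y v)) (normr_ge0 (ft s y v)) (enorm_ge0 (gradxf f (clampt T s) (clampx y) v)) (enorm_ge0 (gradvf f (clampt T s) (clampx y) v)); exact: h. Qed.
Lemma decays_ft : decays ft.
Proof. by apply: decays_le => s y v; have [_ h _ _] := pos4 (normr_ge0 (fe s y v)) (normr_ge0 (ft s y v)) (enorm_ge0 (gradxf f (clampt T s) (clampx y) v)) (enorm_ge0 (gradvf f (clampt T s) (clampx y) v)); exact: h. Qed.
Lemma decays_fx j : decays (fx j).
Proof.
apply: decays_le => s y v; apply: le_trans (le_coord_enorm _ j) _.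
by have [_ _ h _] := pos4 (normr_ge0 (fe s y v)) (normr_ge0 (ft s y v)) (enorm_ge0 (gradxf f (clampt T s) (clampx y) v)) (enorm_ge0 (gradvf f (clampt T s) (clampx y) v)); exact: h.
Qed.
Lemma decays_fv j : decays (fv j).
Proof.
apply: decays_le => s y v; apply: le_trans (le_coord_enorm _ j) _.
by have [_ _ _ h] := pos4 (normr_ge0 (fe s y v)) (normr_ge0 (ft s y v)) (enorm_ge0 (gradxf f (clampt T s) (clampx y) v)) (enorm_ge0 (gradvf f (clampt T s) (clampx y) v)); exact: h.
Qed.

Definition fieldE k := ext T (comp E k).
Definition fieldEt k := ext T (Dt T (comp E k)).
Definition fieldEx k j := ext T (Dx j (comp E k)).
Definition fieldB k := ext T (comp B k).
Definition fieldBt k := ext T (Dt T (comp B k)).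
Definition fieldBx k j := ext T (Dx j (comp B k)).
Definition fieldEtt k := ext T (Dt T (Dt T (comp E k))).
Definition fieldEtx k j := ext T (Dx j (Dt T (comp E k))).
Definition fieldExx k j l := ext T (Dx l (Dx j (comp E k))).

Lemma C1on_E k : C1on T (fieldE k) (fieldEt k) (fieldEx k).
Proof. exact: (C2on T0' (E2 k)). Qed.
Lemma C1on_Et k : C1on T (fieldEt k) (fieldEtt k) (fieldEtx k).
Proof. exact: (C2ont T0' (E2 k)). Qed.
Lemma C1on_Ex k j : C1on T (fieldEx k j) (ext T (Dt T (Dx j (comp E k)))) (fieldExx k j).
Proof. exact: (C2onx T0' (E2 k)). Qed.
Lemma C1on_B k : C1on T (fieldB k) (fieldBt k) (fieldBx k).
Proof. exact: (C2on T0' (B2 k)). Qed.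
Lemma fieldExtE k j s (y : vec) : 0 < s < T -> 0 < y 0 i3 -> ext T (Dt T (Dx j (comp E k))) s y = fieldEtx k j s y.
Proof. by move=> hs hy; rewrite -(C2_tx T0' (E2 k)). Qed.

Section Interior.
Variables (s : R) (y : vec).
Hypotheses (hs : 0 < s < T) (hy : 0 < y 0 i3).

Let sin : 0 <= s <= T. Proof. by have /andP[? ?] := hs; rewrite !ltW. Qed.

Let in_ext (X : Type) (u : R -> vec -> X) : ext T u s y = u s y.
Proof. by apply: ext_id => //; exact: ltW. Qed.

Let exE k j : fieldEx k j s y = dx j (fun z => E s z 0 k) y.
Proof. exact: (in_ext (Dx j (comp E k))). Qed.
Let etE k : fieldEt k s y = dt T (fun s => E s y 0 k) s.
Proof. exact: (in_ext (Dt T (comp E k))). Qed.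
Let bxE k j : fieldBx k j s y = dx j (fun z => B s z 0 k) y.
Proof. exact: (in_ext (Dx j (comp B k))). Qed.
Let btE k : fieldBt k s y = dt T (fun s => B s y 0 k) s.
Proof. exact: (in_ext (Dt T (comp B k))). Qed.
Let feE : fe s y = f s y.
Proof. exact: (in_ext f). Qed.

Lemma gauss_int : fieldEx i1 i1 s y + fieldEx i2 i2 s y + fieldEx i3 i3 s y = 4 * pi * vint (fe s y).
Proof.
have := RVM_gauss sol (in_itvP sin) hy; rewrite /divx big3E /rho vintE => h.
by rewrite !exE feE.
Qed.

Let curl_row (a b c a' b' c' : R) : vec3 a b c = - vec3 a' b' c' -> [/\ a = - a', b = - b' & c = - c'].
Proof. by move=> /rowP h; split; [have := h i1|have := h i2|have := h i3]; rewrite !mxE. Qed.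

Lemma faraday_int : [/\ fieldEx i3 i2 s y - fieldEx i2 i3 s y = - fieldBt i1 s y,
  fieldEx i1 i3 s y - fieldEx i3 i1 s y = - fieldBt i2 s y &
  fieldEx i2 i1 s y - fieldEx i1 i2 s y = - fieldBt i3 s y].
Proof.
have := RVM_faraday sol (in_itvP sin) hy; rewrite -[dt_field _ _ _ _]vec3_eta => /curl_row[].
by rewrite !mxE !exE !btE => h1 h2 h3; split; [exact: h1|exact: h2|exact: h3].
Qed.

Lemma ampere_int : [/\ fieldBx i3 i2 s y - fieldBx i2 i3 s y = 4 * pi * vint (fun v => vhat v 0 i1 * fe s y v) + fieldEt i1 s y,
  fieldBx i1 i3 s y - fieldBx i3 i1 s y = 4 * pi * vint (fun v => vhat v 0 i2 * fe s y v) + fieldEt i2 s y &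
  fieldBx i2 i1 s y - fieldBx i1 i2 s y = 4 * pi * vint (fun v => vhat v 0 i3 * fe s y v) + fieldEt i3 s y].
Proof.
have := RVM_ampere sol (in_itvP sin) hy => /rowP h.
rewrite !bxE !etE feE; have := h i1; have := h i2; have := h i3; rewrite !mxE => h3 h2 h1.
by split; [exact: h1|exact: h2|exact: h3].
Qed.

Lemma vlasov_int v : ft s y v + dot (vhat v) (\row_j fx j s y v)
   + dot (ext T (force gr E B) s y v) (\row_j fv j s y v) = 0.
Proof.
have := RVM_vlasov sol v (in_itvP sin) hy; rewrite /ft !in_ext.
congr (_ + dot _ _ + dot _ _ = 0); apply/rowP => j; by rewrite mxE /fx /fv in_ext.
Qed.

End Interior.

Section Wave.
Variables (s : R) (y : vec).
Hypotheses (hs : 0 < s < T) (hy : 0 < y 0 i3).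

Let near_line l : \forall h \near (0 : R), 0 < (h *: basis R l + y) 0 i3.
Proof. by apply: near_upper_line; rewrite scale0r add0r. Qed.

Let line_box l : exists2 d, 0 < d & forall h, `|h| < d ->
  0 < (h *: basis R l + y) 0 i3 /\ box (enorm y + 1) (h *: basis R l + y).
Proof.
have /nbhs_ballP[d /= d0 hd] := near_line l.
have /nbhs_ballP[d' /= d0' hd'] : \forall h \near (0 : R), enorm (h *: basis R l + y - 0) < enorm y + 1.
  have := @continuous_line R l y 0 (fun z => enorm (z - 0) < enorm y + 1); apply.
  by rewrite scale0r add0r; apply: near_dist_lt; rewrite subr0 ltrDl.
exists (Num.min d d') => [|h]; first by rewrite lt_min d0.
rewrite lt_min => /andP[h1 h2]; split; first by apply: hd; rewrite /ball/= sub0r normrN.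
apply: box_enorm; apply: ltW; rewrite -[X in enorm X]subr0; apply: hd'; by rewrite /ball/= sub0r normrN.
Qed.

Let one_continuous : continuous (fun _ : vec => 1 : R).
Proof. by move=> v; exact: cst_continuous. Qed.

Let pd_rho l : pd l (fun z => vint (fe s z)) y (vint (fx l s y)).
Proof.
have [d d0 hd] := line_box l.
have := @vint_derive_density (fun _ => 1) fe (fx l) (fun _ => s) (fun h => h *: basis R l + y) (enorm y + 1) d
  d0 one_continuous (fun v => _) cont3_fe decays_fe (@decays_fx l) (fun h hh => (hd h hh).2).
rewrite scale0r add0r /pd => H.
have e (g : vec -> R) : vint (fun v => 1 * g v) = vint g by apply: vint_ext => v; rewrite mul1r.
rewrite -e; under eq_fun do rewrite -e.
apply: H; first by rewrite normr1.
by move=> h v hh; exact: (pd_line (C1on_dx (C1on_f v) l hs (hd h hh).1)).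
Qed.

(** Gauss's law holds on a neighbourhood of y, so its two sides have the same derivative along e_l;
    [faraday_x] and [ampere_t] differentiate their equations in the same way. *)
Lemma gauss_x l : fieldExx i1 i1 l s y + fieldExx i2 i2 l s y + fieldExx i3 i3 l s y = 4 * pi * vint (fx l s y).
Proof.
have D k : is_derive (0 : R) 1 (fun h => fieldEx k k s (h *: basis R l + y)) (fieldExx k k l s y).
  exact: (C1on_dx (C1on_Ex k k) l hs hy).
apply: is_derive_unique (line_deriveMl (4 * pi) (pd_rho l)).
apply: (near_is_derive1 (line_deriveD (line_deriveD (D i1) (D i2)) (D i3))).
near=> h; apply: gauss_int => //; near: h; exact: near_line.
Unshelve. all: end_near. Qed.

Let D l k j : is_derive (0 : R) 1 (fun h => fieldEx k j s (h *: basis R l + y)) (fieldExx k j l s y).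
Proof. exact: (C1on_dx (C1on_Ex k j) l hs hy). Qed.

Let DB l k : is_derive (0 : R) 1 (fun h => fieldBt k s (h *: basis R l + y)) (ext T (Dt T (Dx l (comp B k))) s y).
Proof.
have := C1on_dx (C2ont T0' (B2 k)) l hs hy; by rewrite (C2_tx T0' (B2 k)).
Qed.

Let bxt k l := ext T (Dt T (Dx l (comp B k))) s y.

Lemma faraday_x l : [/\ fieldExx i3 i2 l s y - fieldExx i2 i3 l s y = - bxt i1 l,
  fieldExx i1 i3 l s y - fieldExx i3 i1 l s y = - bxt i2 l &
  fieldExx i2 i1 l s y - fieldExx i1 i2 l s y = - bxt i3 l].
Proof.
split.
- apply: is_derive_unique (line_deriveN (DB l i1)); apply: (near_is_derive1 (line_deriveB (D l i3 i2) (D l i2 i3))).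
  by near=> h; have [] := faraday_int hs (_ : 0 < (h *: basis R l + y) 0 i3) => //; near: h; exact: near_line.
- apply: is_derive_unique (line_deriveN (DB l i2)); apply: (near_is_derive1 (line_deriveB (D l i1 i3) (D l i3 i1))).
  by near=> h; have [] := faraday_int hs (_ : 0 < (h *: basis R l + y) 0 i3) => //; near: h; exact: near_line.
- apply: is_derive_unique (line_deriveN (DB l i3)); apply: (near_is_derive1 (line_deriveB (D l i2 i1) (D l i1 i2))).
  by near=> h; have [] := faraday_int hs (_ : 0 < (h *: basis R l + y) 0 i3) => //; near: h; exact: near_line.
Unshelve. all: end_near. Qed.

Let s_near : exists2 d, 0 < d & forall h, `|h| < d -> 0 < s + h < T.
Proof.
have /andP[s0 sT] := hs; exists (Num.min s (T - s)); first by rewrite lt_min s0 subr_gt0.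
by move=> h; rewrite lt_min !ltr_norml; lra.
Qed.

Let D_J k : is_derive s 1 (fun s => vint (fun v => vhat v 0 k * fe s y v)) (vint (fun v => vhat v 0 k * ft s y v)).
Proof.
have [d d0 hd] := s_near.
have cw : continuous (fun v : vec => vhat v 0 k).
  by move=> v; apply: continuous_coord_comp; exact: continuous_vhat.
have H := @vint_derive_density (fun v => vhat v 0 k) fe ft (fun h => s + h) (fun _ => y) (enorm y) d
  d0 cw (fun v => vhat_le1 v k) cont3_fe decays_fe decays_ft (fun _ _ => box_enorm (lexx _)).
have {}H : is_derive (0 : R) 1 (fun h => vint (fun v => vhat v 0 k * fe (s + h) y v)) (vint (fun v => vhat v 0 k * ft (s + 0) y v)).
  apply: H => h v hh.
  have D1 : is_derive (h : R) 1 (fun h => s + h) (0 + 1) := line_deriveD (line_derive_cst _ _) (line_derive_id _).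
  have D2 := C1on_dt (C1on_f v) (hd h hh) hy.
  by have := line_derive_comp (g := fun h => s + h) D2 D1; rewrite add0r mulr1.
have D1 : is_derive s 1 (fun x : R => x - s) 1.
  by apply: (is_derive_eqv (line_deriveB (line_derive_id s) (line_derive_cst s s))); rewrite subr0.
rewrite addr0 in H; have H' : is_derive (s - s) 1 (fun h => vint (fun v => vhat v 0 k * fe (s + h) y v)) (vint (fun v => vhat v 0 k * ft s y v)) by rewrite subrr.
have := line_derive_comp (g := fun x : R => x - s) H' D1; rewrite mulr1; congr is_derive; apply/funext => x.
by congr vint; apply/funext => v; rewrite addrC subrK.
Qed.

Lemma ampere_t : [/\ bxt i3 i2 - bxt i2 i3 = 4 * pi * vint (fun v => vhat v 0 i1 * ft s y v) + fieldEtt i1 s y,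
  bxt i1 i3 - bxt i3 i1 = 4 * pi * vint (fun v => vhat v 0 i2 * ft s y v) + fieldEtt i2 s y &
  bxt i2 i1 - bxt i1 i2 = 4 * pi * vint (fun v => vhat v 0 i3 * ft s y v) + fieldEtt i3 s y].
Proof.
have DBx k l : is_derive s 1 (fun s => fieldBx k l s y) (bxt k l) := C1on_dt (C2onx T0' (B2 k) l) hs hy.
have DE k : is_derive s 1 (fun s => fieldEt k s y) (fieldEtt k s y) := C1on_dt (C1on_Et k) hs hy.
have n : \forall x \near s, 0 < x < T by exact: near_itv.
split.
- apply: is_derive_unique (line_deriveD (line_deriveMl (4 * pi) (D_J i1)) (DE i1)); apply: (near_is_derive1 (line_deriveB (DBx i3 i2) (DBx i2 i3))).
  by near=> x; have [] := ampere_int (_ : 0 < x < T) hy => //; near: x.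
- apply: is_derive_unique (line_deriveD (line_deriveMl (4 * pi) (D_J i2)) (DE i2)); apply: (near_is_derive1 (line_deriveB (DBx i1 i3) (DBx i3 i1))).
  by near=> x; have [] := ampere_int (_ : 0 < x < T) hy => //; near: x.
- apply: is_derive_unique (line_deriveD (line_deriveMl (4 * pi) (D_J i3)) (DE i3)); apply: (near_is_derive1 (line_deriveB (DBx i2 i1) (DBx i1 i2))).
  by near=> x; have [] := ampere_int (_ : 0 < x < T) hy => //; near: x.
Unshelve. all: end_near. Qed.

(** The spatial derivative of Gauss's law, the curl of Faraday's law and the time derivative of
    Ampère's law; the derivatives of B cancel after exchanging d_t with d_l. *)
Lemma wave_equation i : fieldExx i i1 i1 s y + fieldExx i i2 i2 s y + fieldExx i i3 i3 s y - fieldEtt i s y =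
  4 * pi * (vint (fx i s y) + vint (fun v => vhat v 0 i * ft s y v)).
Proof.
have X k j l : fieldExx k j l s y = fieldExx k l j s y by exact: (C2_xx T0' (E2 k)).
have [f11 f12 f13] := faraday_x i1; have [f21 f22 f23] := faraday_x i2; have [f31 f32 f33] := faraday_x i3.
have [a1 a2 a3] := ampere_t; rewrite mulrDr.
have x1 k := X k i2 i1; have x2 k := X k i3 i1; have x3 k := X k i3 i2.
move: i; apply: ord3E.
- exact: (A1 (gauss_x i1) f23 f32 a1 (x1 i2) (x2 i3)).
- exact: (A2 (gauss_x i2) f13 f31 a2 (x1 i1) (x3 i3)).
- exact: (A3 (gauss_x i3) f12 f21 a3 (x2 i1) (x3 i2)).
Qed.

End Wave.

Section Boundary.
Variables (s : R) (y : vec).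
Hypotheses (hs : 0 < s < T) (hy : y 0 i3 = 0).

Let sin : 0 <= s <= T. Proof. by have /andP[? ?] := hs; rewrite !ltW. Qed.
Let in_ext (X : Type) (u : R -> vec -> X) : ext T u s y = u s y.
Proof. by apply: ext_id => //; rewrite /Omega_bar/= hy. Qed.

Lemma boundary_E i : i != i3 -> fieldE i s y = 0 /\ fieldEt i s y = 0.
Proof.
move=> ii3.
have E0' s' : 0 <= s' <= T -> E s' y 0 i = 0.
  move=> hs'; have [e1 e2 _] := RVM_bd_values sol (in_itvP hs') hy.
  by move: i ii3; apply: ord3E.
split; first by rewrite /fieldE in_ext /comp E0'.
rewrite /fieldEt in_ext /Dt.
have de : dt_exists T (comp E i ^~ y) s.
  have [_ [h _ _]] := E2 i; have [|//] := h s y (in_itvP sin).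
  by rewrite /Omega_bar/= hy.
apply: is_derive_unique (is_derive_dt hs de) _.
apply: (near_is_derive1 (line_derive_cst s 0)); near=> x.
have /andP[x0 xT] : 0 < x < T by near: x; exact: near_itv.
by rewrite /comp E0'// !ltW.
Unshelve. all: end_near. Qed.

Lemma boundary_E3 : fieldEx i3 i3 s y = 4 * pi * vint (fe s y).
Proof.
have [e _ _] := RVM_bd_derivatives sol (in_itvP sin) hy.
by rewrite /fieldEx /fe !in_ext; exact: e.
Qed.
End Boundary.

End Sol.
End SolutionData.

(** * The representation about one centre *)

Section Representation.
Context {R : realType}.
Notation vec := 'rV[R]_3.
Notation mR := (measurableTypeR R).
Variables (T gr : R) (f : R -> vec -> vec -> R) (E B : R -> vec -> vec) (E0 B0 : vec -> vec).
Hypotheses (T0 : 0 < T) (sol : RVM_solution T gr f E B E0 B0).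
Variables (t : R) (c : vec) (i : 'I_3).
Hypotheses (t0 : 0 < t) (tT : t <= T) (c3 : c 0 i3 != 0).

Local Notation fe := (fe T f).
Local Notation ft := (ft T f).
Local Notation fx := (fx T f).
Local Notation fv := (fv T f).
Local Notation vret := (vret t c).
Local Notation ret := (ret t c).
Local Notation fE := (fieldE T E i).
Local Notation fEt := (fieldEt T E i).
Local Notation fEx := (fieldEx T E i).
Local Notation kap := (kap c i).
Local Notation dkap := (dkap c i).

Let wkap j (y v : vec) : R := omega c y 0 j * kap j y v.

(** The constant 37 = 5 + 32 is the one needed for the derivative kernel; using it for all three
    kernels lets them enter [pd_vret] together. *)
Lemma kernel_kap j : kernel c (kap j) 37 2 1.
Proof.
split.
- by move=> y yc; exact: continuous_kap_v.
- by move=> y v yc; exact: continuous_kap_y.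
- move=> y v yc; apply: (le_trans (kap_le i j v yc)); rewrite expr1.
  have r0 : 0 < enorm (y - c) by rewrite dist_gt0.
  by rewrite ler_pM2r ?invr_gt0// ler_wpM2r ?sqr_ge0// ler_nat.
Qed.

Lemma kernel_dkap j : kernel c (dkap j) 37 2 2.
Proof.
split.
- by move=> y yc; exact: continuous_dkap_v.
- by move=> y v yc; exact: continuous_dkap_y.
- by move=> y v yc; exact: dkap_le.
Qed.

Lemma kernel_wkap j : kernel c (wkap j) 37 2 1.
Proof.
split.
- move=> y yc v; apply: (@continuousM _ _ (cst (omega c y 0 j)) (kap j y)); first exact: cst_continuous.
  exact: continuous_kap_v.
- move=> y v yc; apply: (@continuousM _ _ (fun y => omega c y 0 j) (fun y => kap j y v)).
    by apply: continuous_coord_comp; exact: continuous_omega.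
  exact: continuous_kap_y.
- move=> y v yc; apply: le_trans (kernel_le (kernel_kap j) v yc).
  rewrite normrM -[leRHS]mul1r ler_wpM2r//.
  by rewrite -(omega_unit yc); exact: le_coord_enorm.
Qed.

Let q0 : 0 <= 37 :> R. Proof. by []. Qed.

(** The first three terms are Kirchhoff's field: for u = E_i on the cone, grad u / r + omega (u /
    r^2 + u_t / r), whose divergence is (Laplacian u - u_tt) / r. The last term absorbs the part of
    the source that is tangential to the cone. *)
Definition flux j (y : vec) : R :=
  ret (fEx j) y / enorm (y - c) + omega c y 0 j * ret fE y / enorm (y - c) ^+ 2
  + omega c y 0 j * ret fEt y / enorm (y - c) - 4 * pi * vret (kap j) fe y.

Let retExx j y := ret (fieldExx T E i j j) y.
Let retExt j y := ret (ext T (Dt T (Dx j (comp E i)))) y.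
Let retEtx j y := ret (fieldEtx T E i j) y.
Let retEtt y := ret (fieldEtt T E i) y.

Definition dflux j (y : vec) : R :=
  ((retExx j y - omega c y 0 j * retExt j y) / enorm (y - c)
    - ret (fEx j) y * omega c y 0 j / enorm (y - c) ^+ 2)
  + ((1 - omega c y 0 j ^+ 2) * ret fE y / enorm (y - c) ^+ 3
    + omega c y 0 j * (ret (fEx j) y - omega c y 0 j * ret fEt y) / enorm (y - c) ^+ 2
    - 2 * omega c y 0 j ^+ 2 * ret fE y / enorm (y - c) ^+ 3)
  + ((1 - omega c y 0 j ^+ 2) * ret fEt y / enorm (y - c) ^+ 2
    + omega c y 0 j * (retEtx j y - omega c y 0 j * retEtt y) / enorm (y - c)
    - omega c y 0 j ^+ 2 * ret fEt y / enorm (y - c) ^+ 2)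
  - 4 * pi * (vret (dkap j) fe y + (vret (kap j) (fx j) y - vret (wkap j) ft y)).

Let cw j y : y != c -> {for y, continuous (fun y => omega c y 0 j)}.
Proof. by move=> yc; apply: continuous_coord_comp; exact: continuous_omega. Qed.

Let crV n y : y != c -> {for y, continuous (fun y : vec => (enorm (y - c) ^+ n)^-1)}.
Proof.
move=> yc; apply: (@continuousV _ _ (fun y : vec => enorm (y - c) ^+ n)); first by rewrite expf_neq0// gt_eqF// dist_gt0.
apply: (@continuous_comp _ _ _ (fun y : vec => enorm (y - c)) (fun x : R => x ^+ n)); first exact: continuous_dist.
exact: exprn_continuous.
Qed.

Let crV1 y : y != c -> {for y, continuous (fun y : vec => (enorm (y - c))^-1)}.
Proof.
move=> yc; apply: (@continuousV _ _ (fun y : vec => enorm (y - c))); last exact: continuous_dist.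
by rewrite gt_eqF// dist_gt0.
Qed.

Let ck (k : R) (y : vec) : {for y, continuous (fun _ : vec => k)}.
Proof. exact: cst_continuous. Qed.

Let cE : continuous (ret fE). Proof. exact: (continuous_ret (C1on_cont (C1on_E T0 sol i))). Qed.
Let cEt : continuous (ret fEt). Proof. exact: (continuous_ret (C1on_contt (C1on_E T0 sol i))). Qed.
Let cEx j : continuous (ret (fEx j)). Proof. exact: (continuous_ret (@C1on_contx _ _ _ _ _ (C1on_E T0 sol i) j)). Qed.
Let cExx j : continuous (retExx j). Proof. exact: (continuous_ret (@C1on_contx _ _ _ _ _ (C1on_Ex T0 sol i j) j)). Qed.
Let cExt j : continuous (retExt j). Proof. exact: (continuous_ret (C1on_contt (C1on_Ex T0 sol i j))). Qed.
Let cEtx j : continuous (retEtx j). Proof. exact: (continuous_ret (@C1on_contx _ _ _ _ _ (C1on_Et T0 sol i) j)). Qed.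
Let cEtt : continuous retEtt. Proof. exact: (continuous_ret (C1on_contt (C1on_Et T0 sol i))). Qed.

Let cfe := cont3_fe T0 sol.
Let cft := cont3_ft T0 sol.
Let cfx := cont3_fx T0 sol.
Let cfv := cont3_fv T0 sol.
Let dfe := decays_fe T0 sol.
Let dft := decays_ft T0 sol.
Let dfx := decays_fx T0 sol.
Let dfv := decays_fv T0 sol.

Lemma continuous_flux j y : y != c -> {for y, continuous (flux j)}.
Proof.
move=> yc; have w := @cw j y yc.
have a1 := continuousM (@cEx j y) (crV1 yc).
have a2 := continuousM (continuousM w (@cE y)) (@crV 2 y yc).
have a3 := continuousM (continuousM w (@cEt y)) (crV1 yc).
have a4 := continuousM (@ck (4 * pi) y) (continuous_vret (t := t) q0 (kernel_kap j) cfe dfe yc).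
exact: (continuousB (continuousD (continuousD a1 a2) a3) a4).
Qed.

Lemma continuous_dflux j y : y != c -> {for y, continuous (dflux j)}.
Proof.
move=> yc; have w := @cw j y yc.
have w2 : {for y, continuous (fun y => omega c y 0 j ^+ 2)}.
  by apply: (@continuous_comp _ _ _ (fun y => omega c y 0 j) (fun x : R => x ^+ 2)); [exact: w|exact: exprn_continuous].
have u2 := continuousB (@ck 1 y) w2.
have b1 := continuousM (continuousB (@cExx j y) (continuousM w (@cExt j y))) (crV1 yc).
have b2 := continuousM (continuousM (@cEx j y) w) (@crV 2 y yc).
have b3 := continuousM (continuousM u2 (@cE y)) (@crV 3 y yc).
have b4 := continuousM (continuousM w (continuousB (@cEx j y) (continuousM w (@cEt y)))) (@crV 2 y yc).
have b5 := continuousM (continuousM (continuousM (@ck 2 y) w2) (@cE y)) (@crV 3 y yc).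
have b6 := continuousM (continuousM u2 (@cEt y)) (@crV 2 y yc).
have b7 := continuousM (continuousM w (continuousB (@cEtx j y) (continuousM w (@cEtt y)))) (crV1 yc).
have b8 := continuousM (continuousM w2 (@cEt y)) (@crV 2 y yc).
have v1 := continuous_vret (t := t) q0 (kernel_dkap j) cfe dfe yc.
have v2 := continuous_vret (t := t) q0 (kernel_kap j) (@cfx j) (dfx j) yc.
have v3 := continuous_vret (t := t) q0 (kernel_wkap j) cft dft yc.
have b9 := continuousM (@ck (4 * pi) y) (continuousD v1 (continuousB v2 v3)).
exact: (continuousB (continuousD (continuousD (continuousB b1 b2) (continuousB (continuousD b3 b4) b5)) (continuousB (continuousD b6 b7) b8)) b9).
Qed.

Let s_itv (y : vec) : 0 < enorm (y - c) < t -> 0 < t - enorm (y - c) < T.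
Proof.
by move=> /andP[r0 rt]; rewrite subr_gt0 rt/= ltrBlDr (le_lt_trans tT)// ltrDl.
Qed.

Let flux_alg (ex exx ext' e et etx ett w r : R) : r != 0 ->
  (exx - w * ext') * r^-1 + ex * (- w / r ^+ 2)
  + ((r^-1 * (1 - w * w) * e + w * (ex - w * et)) * (r ^+ 2)^-1 + w * e * (- (2 * r * w) / (r ^+ 2) ^+ 2))
  + ((r^-1 * (1 - w * w) * et + w * (etx - w * ett)) * r^-1 + w * et * (- w / r ^+ 2))
  = ((exx - w * ext') / r - ex * w / r ^+ 2)
  + ((1 - w ^+ 2) * e / r ^+ 3 + w * (ex - w * et) / r ^+ 2 - 2 * w ^+ 2 * e / r ^+ 3)
  + ((1 - w ^+ 2) * et / r ^+ 2 + w * (etx - w * ett) / r - w ^+ 2 * et / r ^+ 2).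
Proof. by move=> r0; field. Qed.

Lemma pd_flux j (y : vec) : 0 < y 0 i3 -> 0 < enorm (y - c) < t -> pd j (flux j) y (dflux j y).
Proof.
move=> y3 hr; have /andP[r0 rt] := hr; have yc : y != c by rewrite -dist_gt0.
have r0' : enorm (0 *: basis R j + y - c) != 0 by rewrite scale0r add0r gt_eqF.
have r02 : enorm (0 *: basis R j + y - c) ^+ 2 != 0 by rewrite expf_neq0.
have dr : is_derive (0 : R) 1 (fun h : R => enorm (h *: basis R j + y - c)) (omega c y 0 j).
  by rewrite omegaE; exact: pd_dist.
have drV := @line_deriveV _ (fun h : R => enorm (h *: basis R j + y - c)) 0 _ r0' dr.
have drV2 := @line_deriveV _ (fun h : R => enorm (h *: basis R j + y - c) ^+ 2) 0 _ r02 (line_derive_sqr dr).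
have dw : is_derive (0 : R) 1 (fun h : R => omega c (h *: basis R j + y) 0 j) _ := pd_omega j j yc.
have de : is_derive (0 : R) 1 (fun h : R => ret fE (h *: basis R j + y)) (ret (fEx j) y - omega c y 0 j * ret fEt y).
  by rewrite omegaE; exact: (pd_ret tT j (C1on_E T0 sol i) hr y3).
have det : is_derive (0 : R) 1 (fun h : R => ret fEt (h *: basis R j + y)) (retEtx j y - omega c y 0 j * retEtt y).
  by rewrite omegaE; exact: (pd_ret tT j (C1on_Et T0 sol i) hr y3).
have dex : is_derive (0 : R) 1 (fun h : R => ret (fEx j) (h *: basis R j + y)) (retExx j y - omega c y 0 j * retExt j y).
  by rewrite omegaE; exact: (pd_ret tT j (C1on_Ex T0 sol i j) hr y3).
have dv : is_derive (0 : R) 1 (fun h : R => vret (kap j) fe (h *: basis R j + y))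
    (vret (dkap j) fe y + (vret (kap j) (fx j) y - vret (wkap j) ft y)).
  exact: (pd_vret tT (j := j) (gx := fx) q0 (kernel_kap j) (kernel_dkap j) (kernel_wkap j) (fun y v yc => pd_kap i j v yc)
    cfe cft (@cfx j) dfe dft (dfx j) (C1on_f T0 sol) hr y3).
have D1 := line_deriveM dex drV; have D2 := line_deriveM (line_deriveM dw de) drV2; have D3 := line_deriveM (line_deriveM dw det) drV.
have D := line_deriveB (line_deriveD (line_deriveD D1 D2) D3) (line_deriveMl (4 * pi) dv).
rewrite /pd /flux; apply: (is_derive_eqv D); rewrite scale0r add0r /dflux /delta eqxx.
by rewrite flux_alg// gt_eqF.
Qed.

(* [accel] and [kint] are the two volume densities that the divergence of the
   flux leaves: the acceleration term and the kernel of order |y - c| ^ -2. *)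
Definition forceE (y : vec) : vec -> vec := fun v => ret (ext T (force gr E B)) y v.

Definition accel (y : vec) : R := vint (fun v => dot (aE i v (omega c y)) (ret fe y v *: forceE y v)).

Definition kint (y : vec) : R := vret (dkap i1) fe y + vret (dkap i2) fe y + vret (dkap i3) fe y.

Let gfe (y : vec) : 0 < enorm (y - c) -> exists2 C : R, forall v, gamma2 v ^+ 5 * `|ret fe y v| <= C &
  forall j v, gamma2 v ^+ 5 * `|ret (fv j) y v| <= C.
Proof.
move=> _; have [C0 h0] := dfe 5 (enorm y).
have [C1 h1] := dfv i1 5 (enorm y); have [C2 h2] := dfv i2 5 (enorm y); have [C3 h3] := dfv i3 5 (enorm y).
have yL : box (enorm y) y by exact: box_enorm.
exists (Num.max C0 (Num.max C1 (Num.max C2 C3))) => [v|j v].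
  by rewrite le_max; apply/orP; left; exact: h0.
move: j; apply: ord3E; rewrite !le_max.
- by rewrite (h1 _ _ v yL) !orbT.
- by rewrite (h2 _ _ v yL) !orbT.
- by rewrite (h3 _ _ v yL) !orbT.
Qed.

Let vd (k : vec -> R) (A : R) g y : 0 <= A -> continuous k -> (forall v, `|k v| <= A * gamma2 v ^+ 2) ->
  cont3 g -> decays g -> exists C, vdom C (fun v => k v * ret g y v).
Proof.
move=> A0 ck' kA cg dg; have [C hC] := dg 5 (enorm y).
exists (A * C); apply: (@vdom_mul _ _ _ _ _ 2) => //; first exact: cont3_v.
by move=> v; apply: hC; exact: box_enorm.
Qed.

(** Pointwise in v this explains the shape of [kap]: with q (1 + s) = omega_i + vhat_i, subtracting
    the sum of [kap] times the tangential derivatives from (d_i f + vhat_i d_t f) / r leaves (q /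
    r)(d_t f + vhat . grad_x f), to which the Vlasov equation applies. *)
Let parts_alg (q s wi oi d1 d2 d3 ftv fx1 fx2 fx3 w1 w2 w3 o1 o2 o3 r F : R) : r != 0 -> 1 + s != 0 ->
  q = (oi + wi) / (1 + s) -> s = w1 * o1 + w2 * o2 + w3 * o3 ->
  oi = d1 * o1 + d2 * o2 + d3 * o3 ->
  ftv + (w1 * fx1 + w2 * fx2 + w3 * fx3) + F = 0 ->
  r^-1 * (d1 * fx1 + d2 * fx2 + d3 * fx3) + r^-1 * (wi * ftv)
  - (((d1 - q * w1) / r * fx1 - o1 * ((d1 - q * w1) / r) * ftv)
   + ((d2 - q * w2) / r * fx2 - o2 * ((d2 - q * w2) / r) * ftv)
   + ((d3 - q * w3) / r * fx3 - o3 * ((d3 - q * w3) / r) * ftv)) = - r^-1 * (q * F).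
Proof.
move=> r0 s0 hq hs ho hF.
have qs : q * (1 + s) = oi + wi by rewrite hq divfK.
have e : r^-1 * (wi * ftv) = r^-1 * ((q + q * s - oi) * ftv).
  by congr (_ * (_ * _)); rewrite -{1}[q]mulr1 -mulrDr qs; ring.
rewrite e hs ho (_ : F = - (ftv + (w1 * fx1 + w2 * fx2 + w3 * fx3))); first by ring.
by apply/eqP; rewrite -addr_eq0 addrC hF.
Qed.

(* The Glassey-Strauss decomposition followed by the Vlasov equation. *)
Lemma parts_density (y : vec) : 0 < y 0 i3 -> 0 < enorm (y - c) < t ->
  (enorm (y - c))^-1 * (vint (ret (fx i) y) + vint (fun v => vhat v 0 i * ret ft y v))
  - ((vret (kap i1) (fx i1) y - vret (wkap i1) ft y) + (vret (kap i2) (fx i2) y - vret (wkap i2) ft y)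
     + (vret (kap i3) (fx i3) y - vret (wkap i3) ft y))
  = (enorm (y - c))^-1 * accel y.
Proof.
move=> y3 hr; have /andP[r0 rt] := hr; have yc : y != c by rewrite -dist_gt0.
have w1 := omega_unit yc.
have [C fC fvC] := gfe r0.
have [_ vB parts] := velocity_parts i (ret (ext T E) y) (ret (ext T B) y) gr w1
  (@cont3_v _ fe (t - enorm (y - c)) y cfe) (fun j => @cont3_v _ (fv j) (t - enorm (y - c)) y (@cfv j))
  (fun j v => fv_pd T0 sol j (t - enorm (y - c)) y v) fC fvC.
have P : vint (fun v => qk i (vhat v) (omega c y) * dot (forceE y v) (\row_j ret (fv j) y v)) = - accel y := parts.
rewrite -[accel y]opprK -P mulrN -mulNr -(vintZ _ vB).
have kvd j g : cont3 g -> decays g -> exists C, vdom C (fun v => kap j y v * ret g y v).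
  move=> cg dg; have [C' hC] := dg 5 (enorm y); exists (37 * C' / enorm (y - c) ^+ 1).
  exact: (kernel_vdom _ q0 (kernel_kap j) cg hC yc (box_enorm (lexx _))).
have wvd j g : cont3 g -> decays g -> exists C, vdom C (fun v => wkap j y v * ret g y v).
  move=> cg dg; have [C' hC] := dg 5 (enorm y); exists (37 * C' / enorm (y - c) ^+ 1).
  exact: (kernel_vdom _ q0 (kernel_wkap j) cg hC yc (box_enorm (lexx _))).
have g1 v : 1 <= gamma2 v ^+ 2 by apply: exprn_ege1; exact: gamma2_ge1.
have c1 : continuous (fun _ : vec => 1 : R) by move=> v; exact: cst_continuous.
have cwh : continuous (fun v : vec => vhat v 0 i) by move=> v; apply: continuous_coord_comp; exact: continuous_vhat.
have [A0 a0] : exists C, vdom C (fun v => 1 * ret (fx i) y v).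
  have k1 (v : vec) : `|1 : R| <= 1 * gamma2 v ^+ 2 by rewrite normr1 mul1r; exact: g1.
  exact: (@vd (fun _ => 1) 1 _ y ler01 c1 k1 (@cfx i) (dfx i)).
have [A1 a1] : exists C, vdom C (fun v => vhat v 0 i * ret ft y v).
  have k1 (v : vec) : `|vhat v 0 i| <= 1 * gamma2 v ^+ 2 
    by rewrite (_ : 1 * gamma2 v ^+ 2 = gamma2 v ^+ 2); [apply: (le_trans (vhat_le1 v i)); exact: g1|exact: mul1r].
  exact: (@vd (fun v => vhat v 0 i) 1 _ y ler01 cwh k1 cft dft).
have [B1 b1] := kvd i1 _ (@cfx i1) (dfx i1); have [B2 b2] := kvd i2 _ (@cfx i2) (dfx i2).
have [B3 b3] := kvd i3 _ (@cfx i3) (dfx i3).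
have [D1 d1] := wvd i1 _ cft dft; have [D2 d2] := wvd i2 _ cft dft; have [D3 d3] := wvd i3 _ cft dft.
have e0 : vint (ret (fx i) y) = vint (fun v => 1 * ret (fx i) y v) by apply: vint_ext => v; rewrite mul1r.
have m1 := vdomD b1 (vdomN d1); have m2 := vdomD b2 (vdomN d2); have m3 := vdomD b3 (vdomN d3).
have p0 := vdomZ (enorm (y - c))^-1 a0; have p1 := vdomZ (enorm (y - c))^-1 a1.
rewrite e0 mulrDr -(vintZ _ a0) -(vintZ _ a1) -(vintD p0 p1).
rewrite /vret -(vintB b1 d1) -(vintB b2 d2) -(vintB b3 d3) -(vintD m1 m2) -(vintD (vdomD m1 m2) m3).
rewrite -(vintB (vdomD p0 p1) (vdomD (vdomD m1 m2) m3)).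
apply: vint_ext => v.
have V := vlasov_int sol (s_itv hr) y3 v.
have D0 : 1 + dot (vhat v) (omega c y) != 0 by rewrite gt_eqF// dot_vhat_gt0.
have eV : dot (vhat v) (\row_j fx j (t - enorm (y - c)) y v) = vhat v 0 i1 * ret (fx i1) y v
    + vhat v 0 i2 * ret (fx i2) y v + vhat v 0 i3 * ret (fx i3) y v.
  by rewrite dotE ![(\row_j _) 0 _]mxE.
rewrite eV in V.
have dE : ret (fx i) y v = delta R i i1 * ret (fx i1) y v + delta R i i2 * ret (fx i2) y v + delta R i i3 * ret (fx i3) y v.
  by rewrite /delta; move: i; apply: ord3E; rewrite /= ?mul1r ?mul0r ?addr0 ?add0r.
have oE : omega c y 0 i = delta R i i1 * omega c y 0 i1 + delta R i i2 * omega c y 0 i2 + delta R i i3 * omega c y 0 i3.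
  by rewrite /delta; move: i; apply: ord3E; rewrite /= ?mul1r ?mul0r ?addr0 ?add0r.
have qE : qk i (vhat v) (omega c y) = (omega c y 0 i + vhat v 0 i) / (1 + dot (vhat v) (omega c y)) by rewrite /qk addrC.
rewrite mul1r dE /wkap /kap [qk i (omega c y) _]qkC.
apply: parts_alg; [exact: lt0r_neq0|exact: D0|exact: qE|exact: dotE|exact: oE|exact: V].
Qed.

(** Three cancellations: |omega| = 1 removes the terms in u / r^3 and u_t / r^2; the mixed
    derivatives, both written z here, cancel; and the remaining second derivatives form the wave
    operator. *)
Let sum_alg (x1 x2 x3 z1 z2 z3 ett e et ex1 ex2 ex3 k1 k2 k3 l1 l2 l3 n1 n2 n3 o1 o2 o3 r p v1 v2 : R) : r != 0 ->
  o1 ^+ 2 + o2 ^+ 2 + o3 ^+ 2 = 1 -> x1 + x2 + x3 - ett = 4 * p * (v1 + v2) ->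
  ((x1 - o1 * z1) / r - ex1 * o1 / r ^+ 2)
  + ((1 - o1 ^+ 2) * e / r ^+ 3 + o1 * (ex1 - o1 * et) / r ^+ 2 - 2 * o1 ^+ 2 * e / r ^+ 3)
  + ((1 - o1 ^+ 2) * et / r ^+ 2 + o1 * (z1 - o1 * ett) / r - o1 ^+ 2 * et / r ^+ 2)
  - 4 * p * (k1 + (l1 - n1))
  + (((x2 - o2 * z2) / r - ex2 * o2 / r ^+ 2)
  + ((1 - o2 ^+ 2) * e / r ^+ 3 + o2 * (ex2 - o2 * et) / r ^+ 2 - 2 * o2 ^+ 2 * e / r ^+ 3)
  + ((1 - o2 ^+ 2) * et / r ^+ 2 + o2 * (z2 - o2 * ett) / r - o2 ^+ 2 * et / r ^+ 2)
  - 4 * p * (k2 + (l2 - n2)))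
  + (((x3 - o3 * z3) / r - ex3 * o3 / r ^+ 2)
  + ((1 - o3 ^+ 2) * e / r ^+ 3 + o3 * (ex3 - o3 * et) / r ^+ 2 - 2 * o3 ^+ 2 * e / r ^+ 3)
  + ((1 - o3 ^+ 2) * et / r ^+ 2 + o3 * (z3 - o3 * ett) / r - o3 ^+ 2 * et / r ^+ 2)
  - 4 * p * (k3 + (l3 - n3)))
  = 4 * p * ((r^-1 * (v1 + v2) - (l1 - n1 + (l2 - n2) + (l3 - n3))) - (k1 + k2 + k3)).
Proof.
move=> r0 S W.
transitivity ((x1 + x2 + x3 - (o1 ^+ 2 + o2 ^+ 2 + o3 ^+ 2) * ett) / r
  + (3 - 3 * (o1 ^+ 2 + o2 ^+ 2 + o3 ^+ 2)) * e / r ^+ 3 + (3 - 3 * (o1 ^+ 2 + o2 ^+ 2 + o3 ^+ 2)) * et / r ^+ 2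
  - 4 * p * ((l1 - n1 + (l2 - n2) + (l3 - n3)) + (k1 + k2 + k3))); first by field.
by rewrite S mul1r W; field.
Qed.

Lemma sum_dflux (y : vec) : 0 < y 0 i3 -> 0 < enorm (y - c) < t ->
  \sum_j dflux j y = 4 * pi * ((enorm (y - c))^-1 * accel y - kint y).
Proof.
move=> y3 hr; have /andP[r0 rt] := hr; have yc : y != c by rewrite -dist_gt0.
have w1 := omega_unit yc; have hs := s_itv hr.
have ww : omega c y 0 i1 ^+ 2 + omega c y 0 i2 ^+ 2 + omega c y 0 i3 ^+ 2 = 1 by rewrite -enorm_sqr w1 expr1n.
have W := wave_equation T0 sol hs y3 i.
have X j : retExt j y = retEtx j y := fieldExtE T0 sol i j hs y3.
rewrite -(parts_density y3 hr) big3E /dflux /kint !X.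
apply: sum_alg; [exact: lt0r_neq0|exact: ww|exact: W].
Qed.

Let L : R := enorm c + t.

Let inL (y : vec) : enorm (y - c) <= t -> box L y.
Proof.
move=> h k; have h1 := le_coord_enorm (y - c) k; have h2 := le_coord_enorm c k.
by move: h1 h2; rewrite !mxE /L !ler_norml => ? ?; apply/andP; split; lra.
Qed.

Let bounded_ret (u : vec -> R) : continuous u -> exists2 M, 0 <= M & forall y, enorm (y - c) <= t -> `|u y| <= M.
Proof.
move=> cu; have [M M0 h] := continuous_box_bounded (continuous_subspaceT cu : {within box L, continuous u}).
by exists M => // y hy; apply: h; exact: inL.
Qed.

Let vret_bound k m : kernel c k 37 2 m -> exists2 M, 0 <= M & forall y, 0 < enorm (y - c) <= t ->
  `|vret k fe y| <= M / enorm (y - c) ^+ m.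
Proof.
move=> hk; have [C hC] := dfe 5 L; have C0 : 0 <= C.
  apply: le_trans (hC 0 c 0 _); last by apply: inL; rewrite subrr (eqP (_ : enorm _ == 0)) ?enorm_eq0// ltW.
  by rewrite mulr_ge0// exprn_ge0// ltW// gamma2_gt0.
exists (37 * C * vint (@weight R)) => [|y /andP[r0 rt]]; first by rewrite !mulr_ge0// vint_weight_ge0.
have yc : y != c by rewrite -dist_gt0.
apply: (le_trans (vret_le t q0 hk cfe hC yc (inL rt))).
by rewrite le_eqVlt; apply/orP; left; apply/eqP; rewrite mulrAC.
Qed.

Let omega_le (y : vec) j : 0 < enorm (y - c) -> `|omega c y 0 j| <= 1.
Proof. by rewrite dist_gt0 => yc; rewrite -(omega_unit yc); exact: le_coord_enorm. Qed.

Lemma kap_bound : exists2 M, 0 <= M & forall j y, 0 < enorm (y - c) <= t -> `|vret (kap j) fe y| <= M / enorm (y - c).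
Proof.
  have [M1 M10 h1] := vret_bound (kernel_kap i1); have [M2 M20 h2] := vret_bound (kernel_kap i2).
  have [M3 M30 h3] := vret_bound (kernel_kap i3); exists (M1 + M2 + M3); first by rewrite !addr_ge0.
  move=> j y hy; have /andP[r0 _] := hy.
  have rv : 0 <= (enorm (y - c))^-1 by rewrite invr_ge0 ltW.
  move: j; apply: ord3E.
  - by apply: le_trans (h1 y hy) _; rewrite expr1 ler_wpM2r// -addrA lerDl addr_ge0.
  - by apply: le_trans (h2 y hy) _; rewrite expr1 ler_wpM2r// -addrA addrCA lerDl addr_ge0.
  - by apply: le_trans (h3 y hy) _; rewrite expr1 ler_wpM2r// lerDr addr_ge0.
Qed.

Lemma flux_le : exists2 M, 0 <= M & forall j y, 0 < enorm (y - c) <= t -> `|flux j y| <= M / enorm (y - c) ^+ 2.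
Proof.
have [MX MX0 hX] : exists2 M, 0 <= M & forall j y, enorm (y - c) <= t -> `|ret (fEx j) y| <= M.
  have [M1 M10 h1] := bounded_ret (@cEx i1); have [M2 M20 h2] := bounded_ret (@cEx i2).
  have [M3 M30 h3] := bounded_ret (@cEx i3); exists (M1 + M2 + M3); first by rewrite !addr_ge0.
  move=> j y hy; move: j; apply: ord3E.
  - by rewrite (le_trans (h1 y hy))// -addrA lerDl addr_ge0.
  - by rewrite (le_trans (h2 y hy))// -addrA addrCA lerDl addr_ge0.
  - by rewrite (le_trans (h3 y hy))// lerDr addr_ge0.
have [ME ME0 hE] := bounded_ret cE; have [MT MT0 hT] := bounded_ret cEt.
have [MK MK0 hK] := kap_bound.
have p0 := pi_ge0 R.
exists (MX * t + ME + MT * t + 4 * pi * MK * t).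
  by rewrite !addr_ge0 ?mulr_ge0// ltW.
move=> j y hy; have /andP[r0 rt] := hy.
rewrite ler_pdivlMr ?exprn_gt0//.
rewrite -[X in _ * X](ger0_norm (sqr_ge0 _)) -normrM.
have -> : flux j y * enorm (y - c) ^+ 2 = ret (fEx j) y * enorm (y - c) + omega c y 0 j * ret fE y
    + omega c y 0 j * ret fEt y * enorm (y - c) - 4 * pi * (vret (kap j) fe y * enorm (y - c)) * enorm (y - c).
  rewrite /flux; field; exact: lt0r_neq0.
have w := omega_le j r0.
have b1 : `|ret (fEx j) y * enorm (y - c)| <= MX * t.
  by rewrite normrM (ger0_norm (enorm_ge0 _)) ler_pM ?enorm_ge0 ?hX.
have b2 : `|omega c y 0 j * ret fE y| <= ME.
  by rewrite normrM -[leRHS]mul1r ler_pM ?hE.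
have b3 : `|omega c y 0 j * ret fEt y * enorm (y - c)| <= MT * t.
  rewrite !normrM (ger0_norm (enorm_ge0 _)) ler_pM ?enorm_ge0 ?mulr_ge0//.
  by rewrite -[leRHS]mul1r ler_pM ?hT.
have b4 : `|4 * pi * (vret (kap j) fe y * enorm (y - c)) * enorm (y - c)| <= 4 * pi * MK * t.
  rewrite !normrM (ger0_norm (enorm_ge0 _)) (ger0_norm p0) (ger0_norm (_ : 0 <= 4))//.
  rewrite ler_pM ?mulr_ge0 ?enorm_ge0// ler_wpM2l ?mulr_ge0//.
  by have := hK j y hy; rewrite ler_pdivlMr.
apply: (le_trans (ler_normB _ _)); apply: lerD; last exact: b4.
apply: (le_trans (ler_normD _ _)); apply: lerD; last exact: b3.
by apply: (le_trans (ler_normD _ _)); apply: lerD; [exact: b1|exact: b2].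
Qed.

Lemma kint_le : exists2 M, 0 <= M & forall y, 0 < enorm (y - c) <= t -> `|kint y| <= M / enorm (y - c) ^+ 2.
Proof.
have [M1 M10 h1] := vret_bound (kernel_dkap i1); have [M2 M20 h2] := vret_bound (kernel_dkap i2).
have [M3 M30 h3] := vret_bound (kernel_dkap i3); exists (M1 + M2 + M3); first by rewrite !addr_ge0.
move=> y hy; rewrite /kint !mulrDl.
apply: (le_trans (ler_normD _ _)); apply: lerD; last exact: h3.
by apply: (le_trans (ler_normD _ _)); apply: lerD; [exact: h1|exact: h2].
Qed.

Lemma continuous_kint y : y != c -> {for y, continuous kint}.
Proof.
move=> yc.
have v j := continuous_vret (t := t) q0 (kernel_dkap j) cfe dfe yc.
exact: (continuousD (continuousD (v i1) (v i2)) (v i3)).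
Qed.

Lemma accel_le : exists2 M, 0 <= M & forall y, 0 < enorm (y - c) <= t -> `|accel y| <= M.
Proof.
have cf (F : R -> vec -> vec) : (forall k, continuous (ret (ext T (comp F k)))) -> continuous (fun y => enorm (ret (ext T F) y)).
  move=> h y; apply: (@continuous_comp _ _ _ (ret (ext T F)) (@enorm R)); last exact: continuous_enorm.
  by apply: continuous_vec => k; exact: h.
have [ME ME0 hE] := bounded_ret (cf E (fun k => continuous_ret (C1on_cont (C1on_E T0 sol k)))).
have [MB MB0 hB] := bounded_ret (cf B (fun k => continuous_ret (C1on_cont (C1on_B T0 sol k)))).
have [C0 h0] := dfe 5 L.
have [C1 h1] := dfv i1 5 L; have [C2 h2] := dfv i2 5 L; have [C3 h3] := dfv i3 5 L.
pose C := Num.max C0 (Num.max C1 (Num.max C2 C3)).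
have hfe y v : box L y -> gamma2 v ^+ 5 * `|ret fe y v| <= C.
  by move=> yL; rewrite /C le_max; apply/orP; left; exact: h0.
have hfv j y v : box L y -> gamma2 v ^+ 5 * `|ret (fv j) y v| <= C.
  move=> yL; rewrite /C; move: j; apply: ord3E; rewrite !le_max.
  - by rewrite (h1 _ _ v yL) !orbT.
  - by rewrite (h2 _ _ v yL) !orbT.
  - by rewrite (h3 _ _ v yL) !orbT.
have CC : 0 <= C.
  apply: le_trans (hfe c 0 _); last by apply: inL; rewrite subrr (eqP (_ : enorm _ == 0)) ?enorm_eq0// ltW.
  by rewrite mulr_ge0// exprn_ge0// ltW// gamma2_gt0.
pose N := ME + 2 * MB + `|gr|.
have N0 : 0 <= N by rewrite /N !addr_ge0 ?mulr_ge0.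
exists ((32 * N * C + 32 * N * C + 32 * N * C) * vint (@weight R)).
  by rewrite mulr_ge0 ?vint_weight_ge0// !addr_ge0 ?mulr_ge0.
move=> y /andP[r0 rt]; have yc : y != c by rewrite -dist_gt0.
have yL := inL rt.
have [vd' _ _] := velocity_parts i (ret (ext T E) y) (ret (ext T B) y) gr (omega_unit yc)
  (@cont3_v _ fe (t - enorm (y - c)) y cfe) (fun j => @cont3_v _ (fv j) (t - enorm (y - c)) y (@cfv j))
  (fun j v => fv_pd T0 sol j (t - enorm (y - c)) y v) (fun v => hfe y v yL) (fun j v => hfv j y v yL).
apply: (le_trans (vint_le vd')); rewrite ler_wpM2r ?vint_weight_ge0//.
have e1 := hE y rt; have e2 := hB y rt.
rewrite !ger0_norm ?enorm_ge0// in e1 e2.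
have le : 32 * (enorm (ret (ext T E) y) + 2 * enorm (ret (ext T B) y) + `|gr|) * C <= 32 * N * C.
  by rewrite ler_wpM2r// ler_wpM2l// /N; lra.
by rewrite !lerD.
Qed.

Let norm3 (a1 a2 a3 m : R) : `|a1| <= m -> `|a2| <= m -> `|a3| <= m -> `|a1 + a2 + a3| <= 3 * m.
Proof. by rewrite !ler_norml; lra. Qed.

Let radial_alg (z1 z2 z3 ex1 ex2 ex3 e et k1 k2 k3 r p : R) : r != 0 -> z1 ^+ 2 + z2 ^+ 2 + z3 ^+ 2 = r ^+ 2 ->
  r * (z1 * (ex1 / r + z1 / r * e / r ^+ 2 + z1 / r * et / r - p * k1)
    + z2 * (ex2 / r + z2 / r * e / r ^+ 2 + z2 / r * et / r - p * k2)
    + z3 * (ex3 / r + z3 / r * e / r ^+ 2 + z3 / r * et / r - p * k3))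
  = (z1 * ex1 + z2 * ex2 + z3 * ex3) + (e + r * et) - p * (r * (z1 * k1 + z2 * k2 + z3 * k3)).
Proof.
move=> r0 S; transitivity ((z1 * ex1 + z2 * ex2 + z3 * ex3) + (z1 ^+ 2 + z2 ^+ 2 + z3 ^+ 2) * (e / r ^+ 2 + et / r)
   - p * (r * (z1 * k1 + z2 * k2 + z3 * k3))); first by field.
by rewrite S; field.
Qed.

(** [radial_flux] is split into a part continuous through the centre, with value E_i(t, c) there,
    and [density_part], of size O(r). On the sphere r = t the retarded time is 0 and this part
    becomes the initial data. *)
Definition data_part (y : vec) : R :=
  ((y - c) 0 i1 * ret (fEx i1) y + (y - c) 0 i2 * ret (fEx i2) y + (y - c) 0 i3 * ret (fEx i3) y)
  + (ret fE y + enorm (y - c) * ret fEt y).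

Definition density_part (y : vec) : R :=
  enorm (y - c) * ((y - c) 0 i1 * vret (kap i1) fe y + (y - c) 0 i2 * vret (kap i2) fe y + (y - c) 0 i3 * vret (kap i3) fe y).

Lemma radial_fluxE (y : vec) : y != c -> radial_flux c flux y = data_part y - 4 * pi * density_part y.
Proof.
move=> yc; have r0 : 0 < enorm (y - c) by rewrite dist_gt0.
rewrite /radial_flux dotE ![(\row_j _) 0 _]mxE /flux !omegaE.
exact: (radial_alg _ _ _ _ _ _ _ _ _ (lt0r_neq0 r0) (esym (enorm_sqr _))).
Qed.

Let cz k : continuous (fun y : vec => (y - c) 0 k).
Proof.
by move=> y; apply: (@continuous_comp _ _ _ (fun y : vec => y + - c) (fun u : vec => u 0 k)); [exact: continuous_addr|exact: coord_continuous].
Qed.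

Lemma continuous_data_part : continuous data_part.
Proof.
move=> y; have a k := continuousM (@cz k y) (@cEx k y).
have b := continuousD (@cE y) (continuousM (@continuous_dist _ c y) (@cEt y)).
exact: (continuousD (continuousD (continuousD (a i1) (a i2)) (a i3)) b).
Qed.

Lemma data_part_le : exists2 M, 0 <= M & forall y, 0 < enorm (y - c) <= t -> `|data_part y| <= M.
Proof.
have [M M0 h] := bounded_ret continuous_data_part; exists M => // y /andP[_ rt]; exact: h.
Qed.

Lemma continuous_density_part y : y != c -> {for y, continuous density_part}.
Proof.
move=> yc; have a k := continuousM (@cz k y) (continuous_vret (t := t) q0 (kernel_kap k) cfe dfe yc).
exact: (continuousM (@continuous_dist _ c y) (continuousD (continuousD (a i1) (a i2)) (a i3))).
Qed.

Lemma density_part_le : exists2 M, 0 <= M & forall y, 0 < enorm (y - c) <= t -> `|density_part y| <= enorm (y - c) * M.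
Proof.
have [MK MK0 hK] := kap_bound; exists (3 * MK) => [|y hy]; first exact: mulr_ge0.
have /andP[r0 rt] := hy.
have b k : `|(y - c) 0 k * vret (kap k) fe y| <= MK.
  have hk : `|vret (kap k) fe y| <= MK / enorm (y - c) by exact: hK.
  rewrite normrM; apply: (@le_trans _ _ (enorm (y - c) * (MK / enorm (y - c)))).
    by apply: ler_pM => //; exact: le_coord_enorm.
  by rewrite mulrC divfK// gt_eqF.
rewrite /density_part normrM (ger0_norm (enorm_ge0 _)); apply: ler_wpM2l; first exact: enorm_ge0.
by apply: norm3; exact: b.
Qed.

Lemma data_part_center : data_part c = fE t c.
Proof.
rewrite /data_part /ret subrr !mxE !mul0r !add0r (eqP (_ : enorm _ == 0)) ?enorm_eq0//.
by rewrite subr0 mul0r addr0.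
Qed.

(** The kernel term of the flux is one order less singular than the term in u / r^2, so it
    disappears in the limit. *)
Lemma radial_flux_cvg : radial_flux c flux y @[y --> c^'] --> fE t c.
Proof.
have [MD MD0 hD] := density_part_le.
have cS : 4 * pi * density_part y @[y --> c^'] --> (0 : R).
  apply/cvgrPdist_le => e e0; near=> y; rewrite sub0r normrN.
  have yc : y != c by near: y; exact: nbhs_dnbhs_neq.
  have r0 : 0 < enorm (y - c) by rewrite dist_gt0.
  have p0 := pi_ge0 R; have D0 : 0 < 4 * pi * MD + 1 by rewrite ltr_wpDl// !mulr_ge0.
  have rt : enorm (y - c) < t by near: y; apply: nbhs_dnbhs; apply: near_dist_lt; rewrite subrr (eqP (_ : enorm _ == 0)) ?enorm_eq0.
  have re : enorm (y - c) < e / (4 * pi * MD + 1).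
    near: y; apply: nbhs_dnbhs; apply: near_dist_lt; rewrite subrr (eqP (_ : enorm _ == 0)) ?enorm_eq0// divr_gt0//.
    by rewrite ltr_wpDl// !mulr_ge0// pi_ge0.
  have hd : `|density_part y| <= enorm (y - c) * MD by apply: hD; rewrite r0 ltW.
  have p4 : 0 <= 4 * (pi : R) by exact: mulr_ge0.
  rewrite normrM (ger0_norm p4).
  apply: (@le_trans _ _ (4 * pi * (enorm (y - c) * MD))); first exact: ler_wpM2l.
  move: re; rewrite ltr_pdivlMr// => re; apply: ltW; apply: le_lt_trans re.
  rewrite (_ : 4 * pi * _ = enorm (y - c) * (4 * pi * MD)); last by ring.
  by apply: ler_wpM2l; [exact: enorm_ge0|rewrite lerDl].
have cH' : data_part y @[y --> c^'] --> data_part c by apply: cvg_trans (@continuous_data_part c); apply: cvg_app; exact: nbhs_dnbhs.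
have F : (data_part y - 4 * pi * density_part y) @[y --> c^'] --> data_part c - 0 by exact: cvgB cH' cS.
rewrite data_part_center subr0 in F; apply: cvg_trans F; apply: near_eq_cvg.
by near=> y; rewrite radial_fluxE//; near: y; exact: nbhs_dnbhs_neq.
Unshelve. all: end_near. Qed.

Theorem retarded_representation :
  [/\ (@leb3 R).-integrable setT (EFin \o (fun p : mR * mR * mR =>
        let y := vec3 p.1.1 p.1.2 p.2 in
        uind y * ((0 < enorm (y - c) < t)%R%:R * \sum_j dflux j y))),
      (@leb2 R).-integrable setT (EFin \o (fun p : mR * mR =>
        let y := vec3 p.1 p.2 0 in (enorm (y - c) < t)%R%:R * flux i3 y)) &
      smean c (radial_flux c flux) t - uind c * fE t c * (4 * pi) =
      \int[@leb3 R]_p (let y := vec3 p.1.1 p.1.2 p.2 in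
        uind y * ((0 < enorm (y - c) < t)%R%:R * \sum_j dflux j y))
      + \int[@leb2 R]_p (let y := vec3 p.1 p.2 0 in (enorm (y - c) < t)%R%:R * flux i3 y)].
Proof.
have [M M0 fM] := flux_le; have [K K0 kK] := kint_le; have [A A0 aA] := accel_le.
have p0 := pi_ge0 R.
(* In the bound on the divergence, 1/r is estimated by t / r^2 on the ball; this is the origin of
   the factor t next to A. *)
apply: (@half_ball_divergence _ c t M (4 * pi * (A * t + K)) (fE t c) flux dflux) => //.
- by rewrite !mulr_ge0// addr_ge0// mulr_ge0// ltW.
- by move=> j y; exact: continuous_flux.
- by move=> j y; exact: continuous_dflux.
- by move=> j y; exact: pd_flux.
- move=> y y3 hr; rewrite (sum_dflux y3 hr); have /andP[r0 rt] := hr.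
  have hr' : 0 < enorm (y - c) <= t by rewrite r0 ltW.
  have h1 := aA y hr'; have h2 := kK y hr'.
  rewrite normrM (ger0_norm (_ : 0 <= 4 * pi)) ?mulr_ge0// -mulrA ler_wpM2l ?mulr_ge0//.
  rewrite mulrDl (le_trans (ler_normB _ _))// lerD//.
  rewrite normrM ger0_norm ?invr_ge0 ?enorm_ge0// (_ : A * t / _ = (enorm (y - c))^-1 * (A * (t / enorm (y - c)))); last first.
    by field; rewrite gt_eqF.
  rewrite ler_wpM2l ?invr_ge0 ?enorm_ge0// (le_trans h1)// ler_peMr// ler_pdivlMr// mul1r ltW//.
- exact: radial_flux_cvg.
Qed.

End Representation.

(** * Reflection in the boundary plane *)

Section Reflections.
Context {R : realType}.
Notation vec := 'rV[R]_3.
Notation mR := (measurableTypeR R).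

Lemma measurable_opp3 (h : mR * mR * mR -> \bar R) : measurable_fun setT h ->
  measurable_fun setT (fun p : mR * mR * mR => h (p.1, (- p.2)%R)).
Proof.
move=> mh; apply: (measurableT_comp mh); apply/measurable_fun_pairP; split => /=.
  exact: measurable_fst.
exact: (measurable_funN (@measurable_snd _ _ _ mR)).
Qed.

Lemma ge0_integral_leb3_opp (h : mR * mR * mR -> \bar R) : measurable_fun setT h ->
  (forall p, (0 <= h p)%E) ->
  (\int[@leb3 R]_p h (p.1, (- p.2)%R) = \int[@leb3 R]_p h p)%E.
Proof.
move=> mh h0; have mh' := measurable_opp3 mh.
rewrite (tonelli_leb3_line mh' (fun p => h0 _)) (tonelli_leb3_line mh h0).
apply: eq_integral => q _ /=; apply: (ge0_integral_opp (f := fun c => h (q, c))) => //.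
exact: (measurableT_comp mh (measurable_pair1 q)).
Qed.

Lemma integral_leb3_opp (h : mR * mR * mR -> \bar R) : measurable_fun setT h ->
  (\int[@leb3 R]_p h (p.1, (- p.2)%R) = \int[@leb3 R]_p h p)%E.
Proof.
move=> mh; rewrite integralE [RHS]integralE; congr (_ - _)%E.
- rewrite -(ge0_integral_leb3_opp (h := funepos h) (measurable_funepos mh) (fun p => funepos_ge0 _ p)).
  by apply: eq_integral => p _; rewrite !funeposE.
- rewrite -(ge0_integral_leb3_opp (h := funeneg h) (measurable_funeneg mh) (fun p => funeneg_ge0 _ p)).
  by apply: eq_integral => p _; rewrite !funenegE.
Qed.

Lemma ge0_integral_leb2_rev (a : R) (h : mR * mR -> \bar R) : measurable_fun setT h ->
  (forall p, (0 <= h p)%E) ->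
  (\int[@leb2 R]_p h ((a - p.1)%R, p.2) = \int[@leb2 R]_p h p)%E.
Proof.
move=> mh h0.
have mr : measurable_fun setT (fun p : mR * mR => ((a - p.1)%R, p.2) : mR * mR).
  apply/measurable_fun_pairP; split => /=; last exact: measurable_snd.
  exact: (measurable_funB (measurable_cst a) (@measurable_fst _ _ mR mR)).
have mh' := measurableT_comp mh mr.
rewrite (tonelli_leb2 mh' (fun p => h0 _)) (tonelli_leb2 mh h0).
apply: eq_integral => b _ /=.
have mhb : measurable_fun setT (fun x : mR => h (x, b)) by exact: (measurableT_comp mh (measurable_pair2 b)).
have mhb' : measurable_fun setT (fun x : mR => h ((a + x)%R, b)).
  have ma : measurable_fun setT (fun x : mR => (a + x)%R : mR) by exact: (measurable_funD (measurable_cst a) (@measurable_id _ mR setT)).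
  exact: (measurableT_comp mhb ma).
rewrite (ge0_integral_opp (f := fun x => h ((a + x)%R, b)) mhb' (fun x => h0 _)).
have := ge0_integral_shift a (f := fun x => h (x, b)) mhb (fun x => h0 _).
by under eq_integral do rewrite addrC.
Qed.

Lemma integral_leb2_rev (a : R) (h : mR * mR -> \bar R) : measurable_fun setT h ->
  (\int[@leb2 R]_p h ((a - p.1)%R, p.2) = \int[@leb2 R]_p h p)%E.
Proof.
move=> mh; rewrite integralE [RHS]integralE; congr (_ - _)%E.
- rewrite -(ge0_integral_leb2_rev a (h := funepos h) (measurable_funepos mh) (fun p => funepos_ge0 _ p)).
  by apply: eq_integral => p _; rewrite !funeposE.
- rewrite -(ge0_integral_leb2_rev a (h := funeneg h) (measurable_funeneg mh) (fun p => funeneg_ge0 _ p)).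
  by apply: eq_integral => p _; rewrite !funenegE.
Qed.

Lemma barE (y : vec) : [/\ bar y 0 i1 = y 0 i1, bar y 0 i2 = y 0 i2 & bar y 0 i3 = - y 0 i3].
Proof. by rewrite /bar !vec3E. Qed.

Lemma barK (y : vec) : bar (bar y) = y.
Proof. by have [e1 e2 e3] := barE y; rewrite {1}/bar e1 e2 e3 opprK vec3_eta. Qed.

Lemma bar_vec3 (a b c : R) : bar (vec3 a b c) = vec3 a b (- c).
Proof. by rewrite /bar !vec3E. Qed.

Lemma barB (y x : vec) : bar (y - x) = bar y - bar x.
Proof. by apply: vec_eqP; rewrite /bar !mxE//= opprD. Qed.

Lemma enorm_bar (y : vec) : enorm (bar y) = enorm y.
Proof.
have [e1 e2 e3] := barE y.
by apply/eqP; rewrite -(@eqrXn2 _ 2)// ?enorm_ge0// !enorm_sqr e1 e2 e3 sqrrN.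
Qed.

Lemma bar_scale (a : R) (y : vec) : bar (a *: y) = a *: bar y.
Proof. by apply: vec_eqP; rewrite /bar !mxE//= mulrN. Qed.

Lemma dist_bar (x y : vec) : enorm (bar y - bar x) = enorm (y - x).
Proof. by rewrite -barB enorm_bar. Qed.

Lemma omega_bar (x y : vec) : omega (bar x) (bar y) = bar (omega x y).
Proof. by rewrite /omega dist_bar bar_scale barB. Qed.

Lemma sphere_param_bar (x : vec) (r : R) (q : R * R) :
  bar (sphere_param x r q) = sphere_param (bar x) r (pi - q.1, q.2).
Proof.
rewrite !sphere_paramE bar_vec3 /=; have [e1 e2 e3] := barE x; rewrite e1 e2 e3.
have cpi : cos (pi - q.1) = - cos q.1 by rewrite cosB cospi sinpi mulN1r mul0r addr0.
have spi : sin (pi - q.1) = sin q.1 by rewrite sinB cospi sinpi mul0r sub0r mulN1r opprK.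
by rewrite cpi spi mulrN opprD.
Qed.

Lemma rect_rev (q : mR * mR) : rect ((pi - q.1)%R : mR, q.2) <-> rect q.
Proof.
by split=> -[]; rewrite /= !in_itv/= => /andP[h1 h2] h3; split; rewrite /= ?in_itv//=; apply/andP; split; lra.
Qed.

Section Off.
Variables (c : vec) (t M : R) (F : vec -> R).
Hypotheses (t0 : 0 < t) (c3 : c 0 i3 != 0) (M0 : 0 <= M).
Hypothesis cF : forall y : vec, y != c -> {for y, continuous F}.

Lemma integrable_ball_off : (forall y : vec, 0 < enorm (y - c) <= t -> `|F y| <= M / enorm (y - c) ^+ 2) ->
  (@leb3 R).-integrable setT (EFin \o (fun p : mR * mR * mR =>
    let y := vec3 p.1.1 p.1.2 p.2 in uind y * ((0 < enorm (y - c) < t)%R%:R * F y))).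
Proof.
move=> FM.
pose A n (p : mR * mR * mR) : R := uind (vec3 p.1.1 p.1.2 p.2) *
  (cutoff t n (enorm (vec3 p.1.1 p.1.2 p.2 - c) ^+ 2) * F (vec3 p.1.1 p.1.2 p.2)).
have mA n : measurable_fun setT (A n).
  apply: measurable_funM; first exact: measurable_uind.
  apply: (@measurable_vec3_cont _ (fun y => cutoff t n (enorm (y - c) ^+ 2) * F y)).
  by apply: (@continuous_cut _ c (cutoff t) n F) => //; [exact: (@continuous_cutoff _ t n)|move=> q /(@cutoff_lo _ t)[]].
have cA p : A n p @[n --> \oo] --> (let y := vec3 p.1.1 p.1.2 p.2 in uind y * ((0 < enorm (y - c) < t)%R%:R * F y)).
  rewrite /A /=; apply: cvgM; first exact: cvg_cst.
  by rewrite (dist_sqr_lt c t0); apply: cvgM; [exact: cutoff_cvg|exact: cvg_cst].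
have mf : measurable_fun setT (fun p : mR * mR * mR =>
    let y := vec3 p.1.1 p.1.2 p.2 in uind y * ((0 < enorm (y - c) < t)%R%:R * F y)).
  by apply: (@measurable_fun_cvg _ _ _ _ A) => // p _; exact: cA.
have := integrableZl measurableT M (integrable_inv_dist2 c t0).
apply: le_integrable => //; first exact/measurable_EFinP.
move=> p _; rewrite /= lee_fin; set y := vec3 _ _ _.
have rhs0 : 0 <= M * inv_dist2 c t y by rewrite mulr_ge0// inv_dist2_ge0.
rewrite (ger0_norm rhs0) /inv_dist2.
have [h|h] := boolP (0 < enorm (y - c) < t); last by rewrite mul0r mulr0 normr0 mul0r mulr0.
have h' : 0 < enorm (y - c) <= t by have /andP[-> /ltW] := h.
rewrite !mul1r normrM ger0_norm ?uind_ge0//; apply: le_trans (FM y h').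
by rewrite ler_piMl// uind_le1.
Qed.

Lemma integrable_plane_off : (forall y : vec, 0 < enorm (y - c) <= t -> `|F y| <= M) ->
  (@leb2 R).-integrable setT (EFin \o (fun p : mR * mR =>
    let y := vec3 p.1 p.2 0 in (enorm (y - c) < t)%R%:R * F y)).
Proof.
move=> FM; pose L := enorm c + t.
have yc (a b : R) : vec3 a b 0 != c by apply: contra_neq c3 => <-; rewrite vec3E.
have mF : measurable_fun setT (fun p : mR * mR => F (vec3 p.1 p.2 0)).
  apply: (@measurable_fun_caratheodory _ _ mR (fun a b => F (vec3 a b 0))).
    by move=> v u; apply: (@continuous_comp _ _ _ (fun a => vec3 a v 0) F); [exact: continuous_line1|exact: cF].
  move=> u; apply: continuous_measurable_fun => v.
  by apply: (@continuous_comp _ _ _ (fun b => vec3 u b 0) F); [exact: continuous_line2|exact: cF].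
(* The indicator of the disc is obtained from [uind] at an auxiliary point whose third coordinate is
   t - |y - c|. *)
have md : measurable_fun setT (fun p : mR * mR => uind (vec3 0 0 (t - enorm (vec3 p.1 p.2 0 - c)))).
  apply: measurable_uind_comp; under eq_fun do rewrite vec3E.
  apply: (@measurable_vec3_plane_cont _ 0 (fun y => t - enorm (y - c))) => y.
  by apply: (@continuousB _ _ _ (cst t : vec -> R) (fun y : vec => enorm (y - c))); [exact: cst_continuous|exact: continuous_dist].
have mf := measurable_funM md mF.
have fE (p : mR * mR) : uind (vec3 0 0 (t - enorm (vec3 p.1 p.2 0 - c))) * F (vec3 p.1 p.2 0) =
    (enorm (vec3 p.1 p.2 0 - c) < t)%R%:R * F (vec3 p.1 p.2 0).
  by rewrite /uind vec3E subr_gt0.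
pose square : set (mR * mR) := `[- L, L] `*` `[- L, L].
have mS : measurable square by exact: measurableX.
have ib : (@leb2 R).-integrable square (EFin \o (fun p : mR * mR =>
    uind (vec3 0 0 (t - enorm (vec3 p.1 p.2 0 - c))) * F (vec3 p.1 p.2 0))).
  apply: (@integrable_bounded _ _ _ _ _ _ M) => //.
  - exact: leb2_square.
  - by apply: measurable_funS mf.
  - move=> p _; rewrite fE; case: ltP => h; last by rewrite mul0r normr0.
    by rewrite mul1r; apply: FM; rewrite dist_gt0 yc ltW.
have := (integrable_mkcond (EFin \o (fun p : mR * mR =>
    uind (vec3 0 0 (t - enorm (vec3 p.1 p.2 0 - c))) * F (vec3 p.1 p.2 0))) mS).1 ib.
apply: eq_integrable => // p _; rewrite patchE; case: ifPn => [_|]; first by rewrite /= fE.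
rewrite notin_setE => h; rewrite /=; case: ltP => hr; last by rewrite mul0r.
exfalso; apply: h.
have h1 k : `|vec3 p.1 p.2 0 0 k| <= L.
  have := le_coord_enorm (vec3 p.1 p.2 0 - c) k; have := le_coord_enorm c k.
  by rewrite !mxE /L !ler_norml => ? ?; apply/andP; split; lra.
split => /=; rewrite in_itv/= -ler_norml.
  by have := h1 i1; rewrite vec3E.
by have := h1 i2; rewrite vec3E.
Qed.

End Off.

Lemma Rintegral_eq_on d (T : measurableType d) (m : {measure set T -> \bar R}) (A D : set T) (f g : T -> R) :
  (forall x, A x -> D x -> f x = g x) -> (forall x, A x -> ~ D x -> f x = 0) -> (forall x, ~ A x -> D x -> g x = 0) ->
  \int[m]_(x in A) f x = \int[m]_(x in D) g x.
Proof.
move=> h1 h2 h3; rewrite /Rintegral; congr fine.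
rewrite integral_mkcond [RHS]integral_mkcond; apply: eq_integral => x _; rewrite !patchE.
case: ifPn; case: ifPn; rewrite ?inE ?notin_setE => // a b.
- by rewrite h1.
- by rewrite h2.
- by rewrite h3.
Qed.

End Reflections.

(** * From the integrals of the formula to integrals over the half space *)

Section Conversions.
Context {R : realType}.
Notation vec := 'rV[R]_3.
Notation mR := (measurableTypeR R).
Variables (x : vec) (t : R).
Hypotheses (t0 : 0 < t) (x3 : 0 < x 0 i3).

Definition ball_int (c : vec) (F : vec -> R) : R :=
  \int[@leb3 R]_p (let y := vec3 p.1.1 p.1.2 p.2 in uind y * ((0 < enorm (y - c) < t)%R%:R * F y)).

Definition disc_int (c : vec) (F : vec -> R) : R :=
  \int[@leb2 R]_p (let y := vec3 p.1 p.2 0 in (enorm (y - c) < t)%R%:R * F y).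

Definition ball_integrable (c : vec) (F : vec -> R) : Prop :=
  (@leb3 R).-integrable setT (EFin \o (fun p : mR * mR * mR =>
    let y := vec3 p.1.1 p.1.2 p.2 in uind y * ((0 < enorm (y - c) < t)%R%:R * F y))).

Definition disc_integrable (c : vec) (F : vec -> R) : Prop :=
  (@leb2 R).-integrable setT (EFin \o (fun p : mR * mR =>
    let y := vec3 p.1 p.2 0 in (enorm (y - c) < t)%R%:R * F y)).

Definition sphere_integrable (c : vec) (Q : vec -> R) : Prop :=
  (@leb2 R).-integrable rect (EFin \o (fun q : mR * mR =>
    uind (sphere_param c t q) * Q (sphere_param c t q) * sin q.1)).

Lemma smeanZ c k Q : sphere_integrable c Q -> smean c (fun y => k * Q y) t = k * smean c Q t.
Proof.
move=> iQ; rewrite /smean -RintegralZl//; last exact: measurable_rect.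
by apply: eq_Rintegral => q _; rewrite mulrCA !mulrA.
Qed.

Lemma ball_intZ c k F : ball_integrable c F -> ball_int c (fun y => k * F y) = k * ball_int c F.
Proof.
move=> iF; rewrite /ball_int -RintegralZl//; by apply: eq_Rintegral => p _; rewrite [in RHS]mulrCA; congr (_ * _); rewrite mulrCA.
Qed.

Lemma disc_intZ c k F : disc_integrable c F -> disc_int c (fun y => k * F y) = k * disc_int c F.
Proof.
by move=> iF; rewrite /disc_int -RintegralZl//; apply: eq_Rintegral => p _; rewrite mulrCA.
Qed.

Lemma uind_bar (y : vec) : uind (bar y) = (y 0 i3 < 0)%R%:R.
Proof. by have [_ _ e] := barE y; rewrite /uind e oppr_gt0. Qed.

(** The hypothesis moves the factor t^2 of the surface element, absent from [smean], into the
    integrand. *)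
Lemma int_sphere_upper (h Q : vec -> R) : (forall y : vec, 0 < y 0 i3 -> enorm (y - x) = t -> h y * t ^+ 2 = Q y) ->
  int_sphere x t (@upper R) h = smean x Q t.
Proof.
move=> hQ; rewrite /int_sphere /smean.
apply: Rintegral_eq_on => [q [rq /= y3] _|q [rq uq] h1|q h1 rq] /=.
- by rewrite /uind y3 mul1r -hQ// ?enorm_sphere ?ltW// mulrA.
- by [].
- have n : ~ 0 < sphere_param x t q 0 i3 by move=> y3; apply: h1.
  by rewrite /uind (negbTE (introN idP n)) !mul0r.
Qed.

Lemma smean_bar Q : sphere_integrable (bar x) Q ->
  smean (bar x) Q t = \int[@leb2 R]_(q in rect)
    (uind (bar (sphere_param x t q)) * Q (bar (sphere_param x t q)) * sin q.1).
Proof.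
move=> iQ; rewrite /smean /Rintegral; congr fine.
rewrite integral_mkcond [RHS]integral_mkcond.
have mr := @measurable_rect R.
have := (integrable_mkcond _ mr).1 iQ => /measurable_int mQ.
rewrite -(integral_leb2_rev pi mQ); apply: eq_integral => q _; rewrite !patchE.
have e : ((pi - q.1, q.2) \in (rect : set (mR * mR))) = (q \in (rect : set (mR * mR))).
  by apply/idP/idP; rewrite !inE => /rect_rev.
rewrite e; case: ifP => // _; rewrite /= -sphere_param_bar.
by rewrite sinB cospi sinpi mul0r sub0r mulN1r opprK.
Qed.

Lemma int_sphere_lower (h Q : vec -> R) : sphere_integrable (bar x) Q ->
  (forall y : vec, 0 < y 0 i3 -> enorm (y - bar x) = t -> h (bar y) * t ^+ 2 = Q y) ->
  int_sphere x t (@lower R) h = smean (bar x) Q t.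
Proof.
move=> iQ hQ; rewrite (smean_bar iQ) /int_sphere.
apply: Rintegral_eq_on => [q [rq /= y3] _|q [rq uq] h1|q h1 rq] /=.
- have [_ _ e] := barE (sphere_param x t q).
  rewrite uind_bar y3 mul1r -hQ ?barK ?mulrA// ?e ?oppr_gt0//.
  by rewrite dist_bar enorm_sphere// ltW.
- by [].
- have n : ~ sphere_param x t q 0 i3 < 0 by move=> y3; apply: h1.
  by rewrite uind_bar (negbTE (introN idP n)) !mul0r.
Qed.

(** [ball_int] leaves out the centre while the ball of the formula contains it; the value 0 of [h]
    there reconciles the two. *)
Lemma int_ball_upper (h F : vec -> R) : (forall y : vec, 0 < y 0 i3 -> 0 < enorm (y - x) < t -> h y = F y) -> h x = 0 ->
  int_space (eball x t `&` @upper R) h = ball_int x F.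
Proof.
move=> hF hx; rewrite /int_space /ball_int.
apply: Rintegral_eq_on => [p [/= r1 y3] _|p _ []//|p h1 _] /=.
- rewrite /eball /= enormB in r1; rewrite /uind y3 mul1r r1 andbT.
  have [r0|] := boolP (0 < enorm (vec3 p.1.1 p.1.2 p.2 - x)).
    by rewrite mul1r hF// r0.
  by rewrite dist_gt0 negbK => /eqP ->; rewrite mul0r.
- rewrite /uind; case: ltP => y3; last by rewrite mul0r.
  case: (boolP (_ < _ < _)) => [/andP[_ r1]|]; last by rewrite mul0r mulr0.
  by exfalso; apply: h1; split => //; rewrite /eball /= enormB.
Qed.

Lemma int_ball_lower (h F : vec -> R) : ball_integrable (bar x) F ->
  (forall y : vec, 0 < y 0 i3 -> 0 < enorm (y - bar x) < t -> h (bar y) = F y) ->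
  int_space (eball x t `&` @lower R) h = ball_int (bar x) F.
Proof.
move=> iF hF.
have -> : ball_int (bar x) F = \int[@leb3 R]_p (let y := vec3 p.1.1 p.1.2 p.2 in
    uind (bar y) * ((0 < enorm (y - x) < t)%R%:R * F (bar y))).
  rewrite /ball_int /Rintegral -(integral_leb3_opp (measurable_int _ iF)).
  by congr fine; apply: eq_integral => p _; rewrite /= -bar_vec3 dist_bar.
rewrite /int_space.
apply: Rintegral_eq_on => [p [/= r1 y3] _|p _ []//|p h1 _] /=.
- set y := vec3 _ _ _ in r1 y3 *; have r1' : enorm (y - x) < t by rewrite enormB.
  have y3' : y 0 i3 < 0 by exact: y3.
  have r0 : 0 < enorm (y - x) by rewrite dist_gt0; apply: contraTneq y3' => ->; rewrite -leNgt ltW.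
  have [_ _ e] := barE y.
  by rewrite uind_bar y3' r0 r1' !mul1r -[in LHS](barK y) hF ?e ?oppr_gt0// dist_bar r0 r1'.
- set y := vec3 _ _ _ in h1 *; rewrite uind_bar; case: (ltP (y 0 i3)) => y3; last by rewrite mul0r.
  case: (boolP (_ < _ < _)) => [/andP[_ r1]|]; last by rewrite mul0r mulr0.
  by exfalso; apply: h1; split => //; rewrite /eball /= enormB.
Qed.

Lemma plane_dist_bar (y : vec) : y 0 i3 = 0 -> enorm (y - bar x) = enorm (y - x).
Proof.
move=> y0; rewrite -(dist_bar x y); congr (enorm (_ - _)).
by have [e1 e2 e3] := barE y; apply: vec_eqP; rewrite ?e1 ?e2// e3 y0 oppr0.
Qed.

Lemma plane_bar (y : vec) : y 0 i3 = 0 -> bar y = y.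
Proof. by move=> y0; have [e1 e2 e3] := barE y; apply: vec_eqP; rewrite ?e1 ?e2// e3 y0 oppr0. Qed.

(** A centre and its mirror image are equidistant from every point of the plane, so both give the
    same disc. *)
Lemma int_plane_disc c (h F : vec -> R) : c = x \/ c = bar x ->
  (forall y : vec, y 0 i3 = 0 -> enorm (y - c) < t -> h y = F y) ->
  int_plane (eball x t) h = disc_int c F.
Proof.
move=> hc hF; rewrite /int_plane /disc_int.
have e (p : mR * mR) : enorm (vec3 p.1 p.2 0 - x) = enorm (vec3 p.1 p.2 0 - c).
  by case: hc => ->//; rewrite plane_dist_bar// vec3E.
apply: Rintegral_eq_on => [p /= r1 _|p _ []//|p h1 _] /=.
- rewrite /eball /= enormB e in r1; by rewrite r1 mul1r hF// vec3E.
- case: ltP => r1; last by rewrite mul0r.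
  by exfalso; apply: h1; rewrite /eball /= enormB e.
Qed.

(** No domination is assumed: if the positive or the negative part has an infinite integral, both
    sides are 0 by the convention on [fine]. Signs can thus be pulled out of any velocity
    integral. *)
Lemma vintN (P : vec -> R) : vint (fun v => - P v) = - vint P.
Proof.
rewrite /vint /Rintegral integralE [in RHS]integralE.
pose G : mR * mR * mR -> \bar R := fun p => (P (vec3 p.1.1 p.1.2 p.2))%:E.
have e1 : (fun p : mR * mR * mR => ((- P (vec3 p.1.1 p.1.2 p.2))%:E)%E) = (fun p => - G p)%E by [].
rewrite e1 -/G funeposN funenegN.
have h1 : (0 <= \int[@leb3 R]_p (G^\+)%E p)%E by apply: integral_ge0 => p _; exact: funepos_ge0.
have h2 : (0 <= \int[@leb3 R]_p (G^\-)%E p)%E by apply: integral_ge0 => p _; exact: funeneg_ge0.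
move: h1 h2; case: (\int[@leb3 R]_p (G^\+)%E p)%E => [a| |]; case: (\int[@leb3 R]_p (G^\-)%E p)%E => [b| |] //=.
- by rewrite opprB.
- by rewrite oppr0.
- by rewrite oppr0.
- by rewrite oppr0.
Qed.

Lemma vint_iota (i : 'I_3) (P : vec -> R) : vint (fun v => iota_sign R i * P v) = iota_sign R i * vint P.
Proof.
rewrite /iota_sign; case: ifP => _.
- by rewrite mulN1r -vintN; apply: vint_ext => v; rewrite mulN1r.
- by rewrite mul1r; apply: vint_ext => v; rewrite mul1r.
Qed.

End Conversions.

Section Centre.
Context {R : realType}.
Notation vec := 'rV[R]_3.
Notation mR := (measurableTypeR R).
Variables (T gr : R) (f : R -> vec -> vec -> R) (E B : R -> vec -> vec) (E0 B0 : vec -> vec).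
Hypotheses (T0 : 0 < T) (sol : RVM_solution T gr f E B E0 B0).
Variables (t : R) (c : vec) (i : 'I_3).
Hypotheses (t0 : 0 < t) (tT : t <= T) (c3 : c 0 i3 != 0).

Local Notation fe := (fe T f).
Local Notation vret := (vret t c).
Local Notation ret := (ret t c).
Local Notation dpart := (data_part T E t c i).
Local Notation rpart := (density_part T f t c i).
Local Notation acc := (accel T gr f E B t c i).
Local Notation kin := (kint T f t c i).
Local Notation flx := (flux T f E t c i).

Let q0 : 0 <= 37 :> R. Proof. by []. Qed.
Let p4 : 4 * (pi : R) != 0. Proof. by rewrite mulf_neq0// gt_eqF// pi_gt0. Qed.

Lemma sphere_integrable_data : sphere_integrable t c dpart.
Proof.
have [M M0 h] := data_part_le T0 sol t c i.
apply: (@integrable_sphere_integrand _ c dpart t M) => //; last by rewrite t0 lexx.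
by move=> y _; exact: (continuous_data_part T0 sol).
Qed.

Lemma sphere_integrable_density : sphere_integrable t c rpart.
Proof.
have [M M0 h] := density_part_le T0 sol c i t0.
apply: (@integrable_sphere_integrand _ c rpart t (t * M)) => //; last by rewrite t0 lexx.
  by move=> y yc; exact: (continuous_density_part T0 sol).
move=> y hy; apply: (le_trans (h y hy)); rewrite ler_wpM2r//; by have /andP[] := hy.
Qed.

Lemma smean_radial : smean c (radial_flux c flx) t = smean c dpart t - 4 * pi * smean c rpart t.
Proof.
have i1' := sphere_integrable_data; have i2' := sphere_integrable_density.
have mr := @measurable_rect R.
rewrite /smean -RintegralZl// -RintegralB//; last exact: (integrableZl mr (4 * pi) i2').
apply: eq_Rintegral => q _; rewrite radial_fluxE; last exact: sphere_param_neq.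
by rewrite mulrBr mulrBl; congr (_ - _); rewrite mulrCA -!mulrA.
Qed.

Lemma ball_integrable_kint : ball_integrable t c kin.
Proof.
have [M M0 h] := kint_le T0 sol c i t0.
by apply: (@integrable_ball_off _ c t M) => // y yc; exact: (continuous_kint T0 sol).
Qed.

Let flux_accel (p : mR * mR * mR) : let y := vec3 p.1.1 p.1.2 p.2 in
  uind y * ((0 < enorm (y - c) < t)%R%:R * ((enorm (y - c))^-1 * acc y)) =
  (4 * pi)^-1 * (uind y * ((0 < enorm (y - c) < t)%R%:R * \sum_j dflux T f E t c i j y))
  + uind y * ((0 < enorm (y - c) < t)%R%:R * kin y).
Proof.
rewrite /=; set y := vec3 _ _ _; rewrite /uind.
case: (ltP 0 (y 0 i3)) => y3; last by rewrite !mul0r mulr0 addr0.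
case: (boolP (0 < enorm (y - c) < t)) => hr; last by rewrite !mul0r !mulr0 addr0.
rewrite (sum_dflux T0 sol i tT y3 hr) !mul1r mulKf//.
by rewrite subrK.
Qed.

(** Integrability is read off from the divergence identity: up to a factor, the acceleration density
    is the divergence of the flux plus the kernel density, both already integrable. *)
Lemma ball_integrable_accel : ball_integrable t c (fun y => (enorm (y - c))^-1 * acc y).
Proof.
have [i1' _ _] := retarded_representation T0 sol i t0 tT c3.
have h := integrableD measurableT (integrableZl measurableT (4 * pi)^-1 i1') ball_integrable_kint.
apply: eq_integrable h => // p _ /=; rewrite -EFinM -EFinD; congr EFin.
by rewrite -flux_accel.
Qed.

Lemma disc_integrable_flux : disc_integrable t c (flx i3).
Proof. by have [_ h _] := retarded_representation T0 sol i t0 tT c3. Qed.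

Lemma ball_int_flux : ball_int t c (fun y => \sum_j dflux T f E t c i j y) =
  4 * pi * (ball_int t c (fun y => (enorm (y - c))^-1 * acc y) - ball_int t c kin).
Proof.
rewrite /ball_int -RintegralB//; [|exact: ball_integrable_accel|exact: ball_integrable_kint].
rewrite -RintegralZl//; last exact: (integrableB measurableT ball_integrable_accel ball_integrable_kint).
apply: eq_Rintegral => p _ /=; have /= -> := flux_accel p.
by rewrite addrK mulVKf.
Qed.

Lemma centre_representation :
  smean c dpart t - 4 * pi * smean c rpart t - uind c * fieldE T E i t c * (4 * pi) =
  4 * pi * (ball_int t c (fun y => (enorm (y - c))^-1 * acc y) - ball_int t c kin) + disc_int t c (flx i3).
Proof.
have [_ _ h] := retarded_representation T0 sol i t0 tT c3.
by rewrite -smean_radial h -ball_int_flux.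
Qed.

Let kvd k m (y : vec) : kernel c k 37 2 m -> y != c -> exists C, vdom C (fun v => k y v * ret fe y v).
Proof.
move=> hk yc; have [C hC] := decays_fe T0 sol 5 (enorm y); exists (37 * C / enorm (y - c) ^+ m).
exact: (kernel_vdom _ q0 hk (cont3_fe T0 sol) hC yc (box_enorm (lexx _))).
Qed.

Lemma kintE (y : vec) : y != c -> kin y = vint (fun v =>
  (enorm (vhat v) ^+ 2 - 1) * (vhat v 0 i + omega c y 0 i)
    / (enorm (y - c) ^+ 2 * (1 + dot (vhat v) (omega c y)) ^+ 2) * ret fe y v).
Proof.
move=> yc.
have [C1 d1] := kvd (kernel_dkap c i i1) yc; have [C2 d2] := kvd (kernel_dkap c i i2) yc.
have [C3 d3] := kvd (kernel_dkap c i i3) yc.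
rewrite /kint /vret -(vintD d1 d2) -(vintD (vdomD d1 d2) d3); apply: vint_ext => v.
by rewrite -sum_dkap// big3E !mulrDl.
Qed.

Lemma density_partE (y : vec) : y != c -> rpart y = enorm (y - c) * vint (fun v =>
  (\sum_j omega c y 0 j * (delta R i j - (omega c y 0 i + vhat v 0 i) * vhat v 0 j / (1 + dot (vhat v) (omega c y))))
  * ret fe y v).
Proof.
move=> yc.
have [C1 d1] := kvd (kernel_kap c i i1) yc; have [C2 d2] := kvd (kernel_kap c i i2) yc.
have [C3 d3] := kvd (kernel_kap c i i3) yc.
have z1 := vdomZ ((y - c) 0 i1) d1; have z2 := vdomZ ((y - c) 0 i2) d2; have z3 := vdomZ ((y - c) 0 i3) d3.
rewrite /density_part /vret -(vintZ _ d1) -(vintZ _ d2) -(vintZ _ d3) -(vintD z1 z2) -(vintD (vdomD z1 z2) z3).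
congr (_ * _); apply: vint_ext => v.
by rewrite sum_kap big3E !mulrDl !mulrA.
Qed.

Lemma vret_kapE j (y : vec) : y != c -> vret (kap c i j) fe y = vint (fun v =>
  (delta R i j - (omega c y 0 i + vhat v 0 i) * vhat v 0 j / (1 + dot (vhat v) (omega c y))) * ret fe y v)
  / enorm (y - c).
Proof.
move=> yc; have r0 : 0 < enorm (y - c) by rewrite dist_gt0.
have [C d] := kvd (kernel_kap c i j) yc.
have e : vret (kap c i j) fe y = (enorm (y - c))^-1 * (enorm (y - c) * vret (kap c i j) fe y).
  by rewrite mulKf// gt_eqF.
rewrite e mulrC; congr (_ * _); rewrite /vret -(vintZ _ d); apply: vint_ext => v.
by rewrite mulrA; congr (_ * _); rewrite /kap /qk [dot (omega c y) _]dotC mulrCA divff ?gt_eqF// mulr1 mulrAC.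
Qed.

Let ret_id (X : Type) (u : R -> vec -> X) (y : vec) : 0 <= y 0 i3 -> enorm (y - c) <= t ->
  ret (ext T u) y = u (t - enorm (y - c)) y.
Proof.
move=> y3 rt; apply: ext_id => //; rewrite subr_ge0 rt/= lerBlDr (le_trans tT)// lerDl enorm_ge0//.
Qed.

Lemma ret_feE (y v : vec) : 0 <= y 0 i3 -> enorm (y - c) <= t -> ret fe y v = f (t - enorm (y - c)) y v.
Proof. by move=> y3 rt; rewrite /fe ret_id. Qed.

Lemma forceEE (y v : vec) : 0 <= y 0 i3 -> enorm (y - c) <= t ->
  forceE T gr E B t c y v = force gr E B (t - enorm (y - c)) y v.
Proof. by move=> y3 rt; rewrite /forceE ret_id. Qed.

(** [integrable_plane_off] wants a bound on the whole punctured ball, where this function grows like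
    1/r. The factor min(1, r/|c_3|) tames it at the centre and equals 1 on the plane. *)
Lemma disc_integrable_kap : disc_integrable t c (vret (kap c i i3) fe).
Proof.
have [M M0 h] := kap_bound T0 sol c i t0.
have c30 : 0 < `|c 0 i3| by rewrite normr_gt0.
pose w (y : vec) : R := Num.min 1 (enorm (y - c) / `|c 0 i3|).
pose F (y : vec) := vret (kap c i i3) fe y * w y.
have w0 y : 0 <= w y by rewrite /w le_min ler01 divr_ge0 ?enorm_ge0// ltW.
have hF : disc_integrable t c F.
  apply: (@integrable_plane_off _ c t (M / `|c 0 i3|)) => //.
  - by rewrite divr_ge0// ltW.
  - move=> y yc; apply: (@continuousM _ _ (vret (kap c i i3) fe) w).
      exact: (continuous_vret (t := t) q0 (kernel_kap c i i3) (cont3_fe T0 sol) (decays_fe T0 sol) yc).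
    apply: (@continuous_min _ _ (fun _ : vec => 1 : R) (fun y : vec => enorm (y - c) / `|c 0 i3|)); first exact: cst_continuous.
    apply: (@continuousM _ _ (fun y : vec => enorm (y - c)) (fun _ => `|c 0 i3|^-1)); last exact: cst_continuous.
    exact: continuous_dist.
  - move=> y hy; have /andP[r0 _] := hy.
    rewrite /F normrM (ger0_norm (w0 y)).
    have hw : w y <= enorm (y - c) / `|c 0 i3| by rewrite /w ge_min lexx orbT.
    apply: (le_trans (ler_pM (normr_ge0 _) (w0 y) (h i3 y hy) hw)).
    by rewrite mulrA divfK// gt_eqF.
apply: eq_integrable hF => // p _ /=; congr (EFin (_ * _)).
have e : w (vec3 p.1 p.2 0) = 1.
  rewrite /w min_l// ler_pdivlMr// mul1r.
  by have := le_coord_enorm (vec3 p.1 p.2 0 - c) i3; rewrite !mxE/= sub0r normrN.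
by rewrite /F e mulr1.
Qed.

End Centre.

Section Linearity.
Context {R : realType}.
Notation vec := 'rV[R]_3.
Variables (t : R) (c : vec).

Lemma sphere_integrableZ k (Q : vec -> R) : sphere_integrable t c Q -> sphere_integrable t c (fun y => k * Q y).
Proof.
move=> iQ; have := integrableZl (@measurable_rect R) k iQ.
by apply: eq_integrable => [|q _]; [exact: measurable_rect|rewrite /= -EFinM; congr EFin; ring].
Qed.

Lemma ball_integrableZ k (F : vec -> R) : ball_integrable t c F -> ball_integrable t c (fun y => k * F y).
Proof.
move=> iF; have := integrableZl measurableT k iF.
by apply: eq_integrable => // p _; rewrite /= -EFinM; congr EFin; ring.
Qed.

Lemma disc_integrable_lin k (F G : vec -> R) : disc_integrable t c F -> disc_integrable t c G ->
  disc_integrable t c (fun y => F y + k * G y).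
Proof.
move=> iF iG; have := integrableD measurableT iF (integrableZl measurableT k iG).
by apply: eq_integrable => // p _; rewrite /= -EFinM -EFinD; congr EFin; ring.
Qed.

Lemma disc_int_lin k (F G : vec -> R) : disc_integrable t c F -> disc_integrable t c G ->
  disc_int t c (fun y => F y + k * G y) = disc_int t c F + k * disc_int t c G.
Proof.
move=> iF iG; rewrite /disc_int -RintegralZl// -RintegralD//; last exact: (integrableZl measurableT k iG).
by apply: eq_Rintegral => p _; rewrite mulrDr; congr (_ + _); rewrite mulrCA.
Qed.

Lemma disc_int_eq (F G : vec -> R) : (forall y : vec, y 0 i3 = 0 -> enorm (y - c) < t -> F y = G y) ->
  disc_int t c F = disc_int t c G.
Proof.
move=> FG; apply: eq_Rintegral => p _ /=; case: ltP => h; last by rewrite !mul0r.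
by rewrite FG// vec3E.
Qed.

End Linearity.

(** * Initial data and boundary terms for the two centres *)

Section Reflected.
Context {R : realType}.
Notation vec := 'rV[R]_3.
Variables (T gr : R) (f : R -> vec -> vec -> R) (E B : R -> vec -> vec) (E0 B0 : vec -> vec).
Hypotheses (T0 : 0 < T) (sol : RVM_solution T gr f E B E0 B0).
Variables (t : R) (x : vec) (i : 'I_3).
Hypotheses (t0 : 0 < t) (tT : t <= T) (x3 : 0 < x 0 i3).

Let p4 : 4 * (pi : R) != 0. Proof. by rewrite mulf_neq0// gt_eqF// pi_gt0. Qed.
Let c3x : x 0 i3 != 0. Proof. by rewrite gt_eqF. Qed.
Let c3b : bar x 0 i3 != 0. Proof. by have [_ _ ->] := barE x; rewrite oppr_eq0 gt_eqF. Qed.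

Let data_alg (z1 z2 z3 g1 g2 g3 e et s : R) :
  z1 * g1 + z2 * g2 + z3 * g3 + (e + s * et) = s * et + e + (g1 * z1 + g2 * z2 + g3 * z3).
Proof. by ring. Qed.

(** On the sphere the retarded time is 0, and Ampère's law at time 0 identifies d_t E with [dtE0].
    The derivatives of the initial data are taken within the closed half space, so agreement there
    suffices. *)
Lemma data_partE (c y : vec) : 0 < y 0 i3 -> enorm (y - c) = t ->
  data_part T E t c i y = t * dtE0 f B0 y 0 i + E0 y 0 i + dot (gradx (fun z => E0 z 0 i) y) (y - c).
Proof.
move=> y3 yt.
have yO : Omega_bar y by exact: ltW.
have t00 : 0 <= (0 : R) <= T by rewrite lexx ltW.
have rE (X : Type) (u : R -> vec -> X) : ret t c (ext T u) y = u 0 y.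
  by rewrite /ret yt subrr ext_id.
have gE j : gradx (fun z => E0 z 0 i) y 0 j = Dx j (comp E i) 0 y.
  rewrite mxE /dx; apply: derive_within_eq => // z zO.
  by rewrite /comp (RVM_initE sol zO).
have eE : comp E i 0 y = E0 y 0 i by rewrite /comp (RVM_initE sol yO).
have eT : Dt T (comp E i) 0 y = dtE0 f B0 y 0 i.
  have h := RVM_ampere sol (in_itvP t00) y3.
  have hc : curlx B0 y = curlx (B 0) y.
    rewrite /curlx; have d j k : dx j (fun z => B0 z 0 k) y = dx j (fun z => B 0 z 0 k) y.
      by apply: derive_within_eq => // z zO; rewrite (RVM_initB sol zO).
    by rewrite !d.
  have h2 : dtE0 f B0 y = dt_field T E 0 y by rewrite /dtE0 hc h addrAC subrr add0r.
  by rewrite h2 mxE.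
rewrite dotE !gE -eE -eT /data_part yt; set z := y - c.
rewrite /fieldE /fieldEt /fieldEx 5!rE; exact: data_alg.
Qed.

Lemma vdom_density s (y : vec) : exists C, vdom C (fun v => fe T f s y v).
Proof.
have [C hC] := decays_fe T0 sol 3 (enorm y).
exists C; split; first exact: (cont3_v (cont3_fe T0 sol)).
move=> v; rewrite /weight ler_pdivlMr ?exprn_gt0 ?gamma2_gt0// mulrC.
by apply: hC; exact: box_enorm.
Qed.

Let Lh (y : vec) : R := vint (fun v => 2 * f (t - enorm (y - x)) y v / enorm (y - x)).

(** The difference of the two fluxes with their density kernels added back: only the boundary traces
    of E_i, d_t E_i and d_3 E_i remain. *)
Let H (y : vec) : R :=
  (flux T f E t x i i3 y + (- iota_sign R i) * flux T f E t (bar x) i i3 y)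
  + 4 * pi * (vret t x (kap x i i3) (fe T f) y + (- iota_sign R i) * vret t (bar x) (kap (bar x) i i3) (fe T f) y).

Let plane_alg (ex e et w r p k1 k2 s : R) :
  (ex / r + w * e / r ^+ 2 + w * et / r - p * k1 + (- s) * (ex / r + (- w) * e / r ^+ 2 + (- w) * et / r - p * k2))
   + p * (k1 + (- s) * k2) = (1 - s) * (ex / r) + (1 + s) * (w * e / r ^+ 2 + w * et / r).
Proof. by ring. Qed.

Let zero_alg (ex w r L p : R) : (1 - 1) * ex + (1 + 1) * (w * 0 / r ^+ 2 + w * 0 / r) = p * (0 * L).
Proof. by ring. Qed.

(* The signs: on the plane omega_3 changes sign between the two centres, and the
   retarded time does not. *)
Let plane_H (y : vec) : y 0 i3 = 0 -> enorm (y - x) < t -> H y = 4 * pi * (delta R i i3 * Lh y).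
Proof.
move=> y0 rt.
have yx : y != x by apply: contra_neq c3x => <-.
have r0 : 0 < enorm (y - x) by rewrite dist_gt0.
have rb := plane_dist_bar x y0.
have hs : 0 < t - enorm (y - x) < T by rewrite subr_gt0 rt/= ltrBlDr (le_lt_trans tT)// ltrDl.
have hs' : 0 <= t - enorm (y - x) <= T by have /andP[/ltW -> /ltW ->] := hs.
have yO : Omega_bar y by rewrite /Omega_bar /= y0.
have w : omega (bar x) y 0 i3 = - omega x y 0 i3.
  have [_ _ e] := barE x.
  have dE (u : vec) : (y - u) 0 i3 = - u 0 i3 by rewrite !mxE y0 sub0r.
  by rewrite !omegaE rb !dE e opprK mulNr opprK.
rewrite /H /flux w rb /ret rb plane_alg /iota_sign /delta.
case: eqP => [->|/eqP i3'].
  rewrite (boundary_E3 sol hs y0) subrr mul0r addr0 opprK mul1r.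
  have [C hC] := vdom_density (t - enorm (y - x)) y.
  have -> : Lh y = 2 / enorm (y - x) * vint (fe T f (t - enorm (y - x)) y).
    rewrite /Lh -(vintZ _ hC); apply: vint_ext => v.
    by rewrite /fe ext_id// mulrAC.
  by ring.
have [e1 e2] := boundary_E sol hs y0 i3'.
by rewrite e1 e2; exact: zero_alg.
Qed.

Let disc_integrable_bar (F : vec -> R) : disc_integrable t (bar x) F -> disc_integrable t x F.
Proof.
by apply: eq_integrable => // p _; rewrite /= plane_dist_bar// vec3E.
Qed.

Let disc_int_bar (F : vec -> R) : disc_int t (bar x) F = disc_int t x F.
Proof. by apply: eq_Rintegral => p _; rewrite /= plane_dist_bar// vec3E. Qed.

Let terms_alg (a b k l s p : R) : a - s * b = - p * (k - s * l) + (a + - s * b + p * (k + - s * l)).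
Proof. by ring. Qed.

(** Integrating [H] over the disc splits off the kernel integrals that appear in the formula and
    leaves the surviving boundary source. *)
Lemma plane_terms :
  disc_int t x (flux T f E t x i i3) - iota_sign R i * disc_int t (bar x) (flux T f E t (bar x) i i3)
  = - (4 * pi) * (disc_int t x (vret t x (kap x i i3) (fe T f))
      - iota_sign R i * disc_int t (bar x) (vret t (bar x) (kap (bar x) i i3) (fe T f)))
    + 4 * pi * (delta R i i3 * int_plane (eball x t) (fun y =>
        int_space setT (fun v => 2 * f (t - enorm (y - x)) y v / enorm (y - x)))).
Proof.
have iF1 := disc_integrable_flux T0 sol i t0 tT c3x.
have iF2 := disc_integrable_bar (disc_integrable_flux T0 sol i t0 tT c3b).
have iK1 := disc_integrable_kap T0 sol i t0 c3x.
have iK2 := disc_integrable_bar (disc_integrable_kap T0 sol i t0 c3b).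
have iF := disc_integrable_lin (- iota_sign R i) iF1 iF2.
have iK := disc_integrable_lin (- iota_sign R i) iK1 iK2.
have iH : disc_integrable t x H := disc_integrable_lin (4 * pi) iF iK.
have HL : disc_int t x H = 4 * pi * (delta R i i3 * int_plane (eball x t) (fun y =>
        int_space setT (fun v => 2 * f (t - enorm (y - x)) y v / enorm (y - x)))).
  rewrite (int_plane_disc (F := Lh) (or_introl erefl))//.
  have [e|/negbTE e] := eqVneq i i3; rewrite /delta e ?eqxx.
    (* On the disc [Lh] equals [H] divided by 4 pi, and [H] is known to be integrable, which
       justifies pulling the scalar out. *)
    rewrite mul1r (_ : disc_int t x Lh = disc_int t x (fun y => (4 * pi)^-1 * H y)).
      by rewrite disc_intZ// mulVKf.
    by apply: disc_int_eq => y y0 rt; rewrite plane_H// /delta e eqxx mul1r mulKf.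
  (* For a tangential component [H] vanishes on the disc, so its integral is 0 times itself. *)
  rewrite mul0r mulr0 (_ : disc_int t x H = disc_int t x (fun y => 0 * H y)).
    by rewrite disc_intZ// mul0r.
  by apply: disc_int_eq => y y0 rt; rewrite mul0r plane_H// /delta e mul0r mulr0.
rewrite !disc_int_bar -HL /H (disc_int_lin (4 * pi) iF iK) (disc_int_lin (- iota_sign R i) iF1 iF2).
by rewrite (disc_int_lin (- iota_sign R i) iK1 iK2); exact: terms_alg.
Qed.

End Reflected.

(** * The two centres combined *)

Section Assembly.
Context {R : realType}.
Notation vec := 'rV[R]_3.
Variables (T gr : R) (f : R -> vec -> vec -> R) (E B : R -> vec -> vec) (E0 B0 : vec -> vec).
Hypotheses (T0 : 0 < T) (sol : RVM_solution T gr f E B E0 B0).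
Variables (t : R) (x : vec) (i : 'I_3).
Hypotheses (t0 : 0 < t) (tT : t <= T) (x3 : 0 < x 0 i3).

Let p4 : 4 * (pi : R) != 0. Proof. by rewrite mulf_neq0// gt_eqF// pi_gt0. Qed.
Let t2 : t ^+ 2 != 0. Proof. by rewrite expf_neq0// gt_eqF. Qed.
Let c3x : x 0 i3 != 0. Proof. by rewrite gt_eqF. Qed.
Let c3b : bar x 0 i3 != 0. Proof. by have [_ _ ->] := barE x; rewrite oppr_eq0 gt_eqF. Qed.

Let factor (p k s a : R) : p != 0 -> s != 0 -> (p * s)^-1 * ((s * k) * a) = k * (p^-1 * a).
Proof. by move=> p0 s0; field; rewrite p0 s0. Qed.

Let dist_barC (y : vec) : enorm (bar y - x) = enorm (y - bar x).
Proof. by rewrite -(dist_bar (bar x) y) barK. Qed.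

Let omega_barC (y : vec) : bar (omega x (bar y)) = omega (bar x) y.
Proof. by rewrite -omega_bar barK. Qed.

Let in_upper (y c : vec) : 0 < y 0 i3 -> 0 < enorm (y - c) < t -> [/\ y != c, 0 <= y 0 i3 & enorm (y - c) <= t].
Proof. by move=> y3 /andP[r0 /ltW rt]; split => //; [rewrite -dist_gt0|exact: ltW]. Qed.

Lemma data_upperE :
  (4 * pi * t ^+ 2)^-1 * int_sphere x t (@upper R) (fun y =>
    t * dtE0 f B0 y 0 i + E0 y 0 i + dot (gradx (fun z => E0 z 0 i) y) (y - x))
  = (4 * pi)^-1 * smean x (data_part T E t x i) t.
Proof.
(* The trivial factor 1 stands where the reflected term has minus the sign iota, so that [factor]
   normalises both. *)
rewrite (@int_sphere_upper _ x t _ _ (fun y => (t ^+ 2 * 1) * data_part T E t x i y)) ?ltW//.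
  by rewrite smeanZ ?factor ?mul1r//; exact: (sphere_integrable_data T0 sol).
by move=> y y3 yt; rewrite (data_partE T0 sol i y3 yt) mulr1 mulrC.
Qed.

Lemma data_lowerE :
  (4 * pi * t ^+ 2)^-1 * int_sphere x t (@lower R) (fun y => iota_sign R i *
     (- (t * dtE0 f B0 (bar y) 0 i) - E0 (bar y) 0 i
      - dot (gradx (fun z => E0 z 0 i) (bar y)) (bar y - bar x)))
  = - iota_sign R i * ((4 * pi)^-1 * smean (bar x) (data_part T E t (bar x) i) t).
Proof.
have iD := sphere_integrable_data T0 sol (bar x) i t0.
rewrite (@int_sphere_lower _ x t _ _ (fun y => (t ^+ 2 * - iota_sign R i) * data_part T E t (bar x) i y)) ?ltW//.
- by rewrite smeanZ// factor.
- exact: sphere_integrableZ.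
- by move=> y y3 yt; rewrite barK (data_partE T0 sol i y3 yt); ring.
Qed.

Lemma kernel_upperE :
  int_space (eball x t `&` @upper R) (fun y => int_space setT (fun v =>
    (enorm (vhat v) ^+ 2 - 1) * (vhat v 0 i + omega x y 0 i)
      / (enorm (y - x) ^+ 2 * (1 + dot (vhat v) (omega x y)) ^+ 2) * f (t - enorm (y - x)) y v))
  = ball_int t x (kint T f t x i).
Proof.
apply: int_ball_upper.
  move=> y y3 hr; have [yx y3' rt] := in_upper y3 hr.
  by rewrite vintE (kintE T0 sol t i yx); apply: vint_ext => v; rewrite ret_feE.
(* At the centre the distance is 0 and the inverse of 0 is 0, so the integrand vanishes for every
   v. *)
rewrite vintE -[RHS](_ : vint (fun _ : vec => 0 : R) = 0); last by rewrite /vint /Rintegral integral0.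
apply: vint_ext => v; rewrite subrr (eqP (_ : enorm (0 : vec) == 0)) ?enorm_eq0//.
by rewrite expr0n /= mul0r invr0 mulr0 mul0r.
Qed.

Lemma kernel_lowerE :
  int_space (eball x t `&` @lower R) (fun y => int_space setT (fun v => iota_sign R i *
    ((enorm (vhat v) ^+ 2 - 1) * (vhat v 0 i + bar (omega x y) 0 i)
      / (enorm (y - x) ^+ 2 * (1 + dot (vhat v) (bar (omega x y))) ^+ 2)) * f (t - enorm (y - x)) (bar y) v))
  = iota_sign R i * ball_int t (bar x) (kint T f t (bar x) i).
Proof.
have iK := ball_integrable_kint T0 sol (bar x) i t0.
rewrite -ball_intZ//; apply: int_ball_lower => //; first exact: ball_integrableZ.
move=> y y3 hr; have [yx y3' rt] := in_upper y3 hr.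
rewrite vintE (kintE T0 sol t i yx) -vint_iota; apply: vint_ext => v.
by rewrite (ret_feE f tT v y3' rt) dist_barC omega_barC barK -[LHS]mulrA.
Qed.

Lemma force_upperE :
  int_space (eball x t `&` @upper R) (fun y => int_space setT (fun v =>
    dot (aE i v (omega x y)) (f (t - enorm (y - x)) y v *: force gr E B (t - enorm (y - x)) y v)) / enorm (y - x))
  = ball_int t x (fun y => (enorm (y - x))^-1 * accel T gr f E B t x i y).
Proof.
apply: int_ball_upper; last by rewrite subrr (eqP (_ : enorm (0 : vec) == 0)) ?enorm_eq0// invr0 mulr0.
move=> y y3 hr; have [yx y3' rt] := in_upper y3 hr.
rewrite vintE mulrC; congr (_ * _); apply: vint_ext => v.
by rewrite ret_feE// forceEE.
Qed.

Lemma force_lowerE :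
  int_space (eball x t `&` @lower R) (fun y => int_space setT (fun v => iota_sign R i *
    dot (aE i v (bar (omega x y)))
      (f (t - enorm (y - x)) (bar y) v *: force gr E B (t - enorm (y - x)) (bar y) v)) / enorm (y - x))
  = iota_sign R i * ball_int t (bar x) (fun y => (enorm (y - bar x))^-1 * accel T gr f E B t (bar x) i y).
Proof.
have iA := ball_integrable_accel T0 sol i t0 tT c3b.
rewrite -ball_intZ//; apply: int_ball_lower => //; first exact: ball_integrableZ.
move=> y y3 hr; have [yx y3' rt] := in_upper y3 hr.
rewrite vintE vint_iota dist_barC -mulrA; congr (_ * _); rewrite mulrC; congr (_ * _); apply: vint_ext => v.
by rewrite ret_feE// forceEE// omega_barC barK.
Qed.

Let plane_neq (y c : vec) : c 0 i3 != 0 -> y 0 i3 = 0 -> y != c.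
Proof. by move=> c3 y0; apply: contra_neq c3 => <-. Qed.

Lemma plane_directE :
  int_plane (eball x t) (fun y => int_space setT (fun v =>
    (delta R i i3 - (omega x y 0 i + vhat v 0 i) * vhat v 0 i3 / (1 + dot (vhat v) (omega x y)))
      * f (t - enorm (y - x)) y v) / enorm (y - x))
  = disc_int t x (vret t x (kap x i i3) (fe T f)).
Proof.
apply: int_plane_disc; first by left.
move=> y y0 rt; rewrite vintE (vret_kapE T0 sol t i i3 (plane_neq c3x y0)); congr (_ / _).
by apply: vint_ext => v; rewrite ret_feE ?y0// ltW.
Qed.

Lemma plane_reflectedE :
  int_plane (eball x t) (fun y => int_space setT (fun v => iota_sign R i *
    (delta R i i3 - (bar (omega x y) 0 i * vhat v 0 i3 + vhat v 0 i * vhat v 0 i3)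
        / (1 + dot (vhat v) (bar (omega x y)))) * f (t - enorm (y - x)) y v) / enorm (y - x))
  = iota_sign R i * disc_int t (bar x) (vret t (bar x) (kap (bar x) i i3) (fe T f)).
Proof.
rewrite -disc_intZ; last exact: (disc_integrable_kap T0 sol i t0 c3b).
apply: int_plane_disc; first by right.
move=> y y0 rt; rewrite vintE (vret_kapE T0 sol t i i3 (plane_neq c3b y0)).
rewrite -(plane_dist_bar x y0) mulrA -vint_iota; congr (_ / _); apply: vint_ext => v.
have e : bar (omega x y) = omega (bar x) y by rewrite -{1}(plane_bar y0) omega_barC.
have y0' : 0 <= y 0 i3 by rewrite y0.
by rewrite e (ret_feE f tT v y0' (ltW rt)) -(mulrDl (omega (bar x) y 0 i)) -[LHS]mulrA.
Qed.

Let on_sphere (y c : vec) : enorm (y - c) = t -> y != c.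
Proof. by move=> e; rewrite -dist_gt0 e. Qed.

Let ret_sphere (y c v : vec) : 0 < y 0 i3 -> enorm (y - c) = t -> ret t c (fe T f) y v = f 0 y v.
Proof.
move=> y3 yt; have rt : enorm (y - c) <= t by rewrite yt.
by rewrite (ret_feE f tT v (ltW y3) rt) yt subrr.
Qed.

Lemma density_upperE :
  int_sphere x t (@upper R) (fun y => int_space setT (fun v =>
    (\sum_(j < 3) omega x y 0 j *
      (delta R i j - (omega x y 0 i + vhat v 0 i) * vhat v 0 j / (1 + dot (vhat v) (omega x y)))) * f 0 y v)
    / enorm (y - x))
  = smean x (density_part T f t x i) t.
Proof.
apply: int_sphere_upper; rewrite ?ltW// => y y3 yt.
rewrite vintE (density_partE T0 sol t i (on_sphere yt)) yt mulrAC -mulrA expr2 mulfK ?gt_eqF// mulrC.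
by congr (_ * _); apply: vint_ext => v; rewrite (ret_sphere v y3 yt).
Qed.

Lemma density_lowerE :
  int_sphere x t (@lower R) (fun y => int_space setT (fun v => iota_sign R i *
    (\sum_(j < 3) bar (omega x y) 0 j *
      (delta R i j - (bar (omega x y) 0 i * vhat v 0 j + vhat v 0 i * vhat v 0 j)
        / (1 + dot (vhat v) (bar (omega x y))))) * f 0 (bar y) v) / enorm (y - x))
  = iota_sign R i * smean (bar x) (density_part T f t (bar x) i) t.
Proof.
have iS := sphere_integrable_density T0 sol (bar x) i t0.
rewrite -smeanZ//; apply: int_sphere_lower; rewrite ?ltW//; first exact: sphere_integrableZ.
move=> y y3 yt.
rewrite vintE dist_barC (density_partE T0 sol t i (on_sphere yt)) yt mulrAC -mulrA expr2 mulfK ?gt_eqF//.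
rewrite [in RHS]mulrCA -vint_iota mulrC; congr (_ * _); apply: vint_ext => v.
rewrite (ret_sphere v y3 yt) omega_barC barK -[LHS]mulrA.
by congr (_ * (_ * _)); apply: eq_bigr => j _; rewrite -mulrDl.
Qed.

End Assembly.

(** The first identity minus s times the second, divided by 4 pi. The letters stand for data (d),
    density on the sphere (r), acceleration (a), kernel (k), flux through the plane (f) and its
    density part (n), each for the centres x and bar x; e is the field, s the sign iota_i and l the
    surviving boundary term. The third hypothesis eliminates the fluxes. *)
Lemma representation_algebra {R : realType} (e dx db rx rb ax ab kx kb fx fb nx nb l s : R) :
  dx - 4 * pi * rx - e * (4 * pi) = 4 * pi * (ax - kx) + fx ->
  db - 4 * pi * rb = 4 * pi * (ab - kb) + fb ->
  fx - s * fb = - (4 * pi) * (nx - s * nb) + 4 * pi * l ->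
  e = (4 * pi)^-1 * dx + - s * ((4 * pi)^-1 * db) + kx - s * kb - ax + s * ab + nx - s * nb - rx + s * rb - l.
Proof.
have p4 : 4 * (pi : R) != 0 by rewrite mulf_neq0// gt_eqF// pi_gt0.
move: p4; move: (4 * pi) => p p0 h1 h2 h3.
have hd : dx = p * (rx + e + ax - kx) + fx by rewrite -[fx](addKr (p * (ax - kx))) -h1; ring.
have hb : db = p * (rb + ab - kb) + fb by rewrite -[fb](addKr (p * (ab - kb))) -h2; ring.
have hf : fx = s * fb + (- p * (nx - s * nb) + p * l) by rewrite -h3; ring.
by rewrite hd hb hf; field.
Qed.

Theorem proposition1 (R : realType) (T g : R) (T_gt0 : 0 < T)
    (f : R -> 'rV[R]_3 -> 'rV[R]_3 -> R)
    (E B : R -> 'rV[R]_3 -> 'rV[R]_3) (E0 B0 : 'rV[R]_3 -> 'rV[R]_3)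
    (sol : RVM_solution T g f E B E0 B0)
    (i : 'I_3) (t : R) (t_gt0 : 0 < t) (t_leT : t <= T)
    (x : 'rV[R]_3) (Omega_x : Omega x) :
  E t x 0 i =
    (4 * pi * t ^+ 2)^-1 *
      int_sphere x t (@upper R) (fun y =>
        t * dtE0 f B0 y 0 i + E0 y 0 i
          + dot (gradx (fun z => E0 z 0 i) y) (y - x))
  + (4 * pi * t ^+ 2)^-1 *
      int_sphere x t (@lower R) (fun y =>
        iota_sign R i *
          (- (t * dtE0 f B0 (bar y) 0 i) - E0 (bar y) 0 i
             - dot (gradx (fun z => E0 z 0 i) (bar y)) (bar y - bar x)))
  + int_space (eball x t `&` @upper R) (fun y =>
      int_space setT (fun v =>
        (enorm (vhat v) ^+ 2 - 1) * (vhat v 0 i + omega x y 0 i)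
          / (enorm (y - x) ^+ 2 * (1 + dot (vhat v) (omega x y)) ^+ 2)
          * f (t - enorm (y - x)) y v))
  - int_space (eball x t `&` @lower R) (fun y =>
      int_space setT (fun v =>
        iota_sign R i *
        ((enorm (vhat v) ^+ 2 - 1) * (vhat v 0 i + bar (omega x y) 0 i)
          / (enorm (y - x) ^+ 2 * (1 + dot (vhat v) (bar (omega x y))) ^+ 2))
          * f (t - enorm (y - x)) (bar y) v))
  - int_space (eball x t `&` @upper R) (fun y =>
      int_space setT (fun v =>
        dot (aE i v (omega x y))
          (f (t - enorm (y - x)) y v *: force g E B (t - enorm (y - x)) y v))
      / enorm (y - x))
  + int_space (eball x t `&` @lower R) (fun y =>
      int_space setT (fun v =>
        iota_sign R i *
        dot (aE i v (bar (omega x y)))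
          (f (t - enorm (y - x)) (bar y) v
             *: force g E B (t - enorm (y - x)) (bar y) v))
      / enorm (y - x))
  + int_plane (eball x t) (fun y =>
      int_space setT (fun v =>
        (delta R i i3 - (omega x y 0 i + vhat v 0 i) * vhat v 0 i3
                          / (1 + dot (vhat v) (omega x y)))
          * f (t - enorm (y - x)) y v)
      / enorm (y - x))
  - int_plane (eball x t) (fun y =>
      int_space setT (fun v =>
        iota_sign R i *
        (delta R i i3 - (bar (omega x y) 0 i * vhat v 0 i3
                           + vhat v 0 i * vhat v 0 i3)
                          / (1 + dot (vhat v) (bar (omega x y))))
          * f (t - enorm (y - x)) y v)
      / enorm (y - x))
  - int_sphere x t (@upper R) (fun y =>
      int_space setT (fun v =>
        (\sum_(j < 3) omega x y 0 j *
          (delta R i j - (omega x y 0 i + vhat v 0 i) * vhat v 0 j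
                           / (1 + dot (vhat v) (omega x y))))
          * f 0 y v)
      / enorm (y - x))
  + int_sphere x t (@lower R) (fun y =>
      int_space setT (fun v =>
        iota_sign R i *
        (\sum_(j < 3) bar (omega x y) 0 j *
          (delta R i j - (bar (omega x y) 0 i * vhat v 0 j
                            + vhat v 0 i * vhat v 0 j)
                           / (1 + dot (vhat v) (bar (omega x y)))))
          * f 0 (bar y) v)
      / enorm (y - x))
  - delta R i i3 *
      int_plane (eball x t) (fun y =>
        int_space setT (fun v =>
          2 * f (t - enorm (y - x)) y v / enorm (y - x))).

Proof.
have x3 : 0 < x 0 i3 := Omega_x.
have c3x : x 0 i3 != 0 by rewrite gt_eqF.
have [_ _ b3] := barE x.
have c3b : bar x 0 i3 != 0 by rewrite b3 oppr_eq0.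
rewrite (data_upperE T_gt0 sol) // (data_lowerE T_gt0 sol) // (kernel_upperE T_gt0 sol) // (kernel_lowerE T_gt0 sol) //.
rewrite (@force_upperE R T g f E B t x i t_leT) // (force_lowerE T_gt0 sol) // (plane_directE T_gt0 sol) // (plane_reflectedE T_gt0 sol) //.
rewrite (density_upperE T_gt0 sol) // (density_lowerE T_gt0 sol) //.
have hx := centre_representation T_gt0 sol i t_gt0 t_leT c3x.
have hb := centre_representation T_gt0 sol i t_gt0 t_leT c3b.
have hp := plane_terms T_gt0 sol i t_gt0 t_leT x3.
have ux : uind x = 1 by rewrite /uind x3.
have ub : uind (bar x) = 0 by rewrite /uind b3 oppr_gt0 ltNge ltW.
have eE : fieldE T E i t x = E t x 0 i.
  by rewrite /fieldE ext_id ?(ltW t_gt0)// /Omega_bar /= ltW.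
rewrite ux eE mul1r in hx; rewrite ub !mul0r subr0 in hb.
exact: (representation_algebra hx hb hp).
Qed.
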